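(* As a $\mathcal{J}_0$-module, $$J^w_{2*, \begin{pmatrix} 2* & 2* + 1 \\ 2* + 1 & 2* \end{pmatrix}} = \bigoplus_{\substack{a, b, c \in \mathbb{N}_0 \\ b < \min(a, c)}} \bigoplus_{k \in 2 \mathbb{Z}} J_{k, \begin{pmatrix} 2a & 2b + 1 \\ 2b + 1 & 2c \end{pmatrix}}^w$$ is spanned by the forms $\Phi_{-2, \begin{pmatrix} 2 & 1 \\ 1 & 2 \end{pmatrix}}$ and $\Phi_{0, \begin{pmatrix} 2 & 1 \\ 1 & 2 \end{pmatrix}}$.
   Context: $J^w_{k,M}$ denotes the space of weak Jacobi forms $f(\tau,z,w)$ ($\tau\in\mathbb{H}$, $z,w\in\mathbb{C}$) of weight $k$ and index the lattice $\mathbb{Z}^2$ with Gram matrix $M$ (holomorphic, transforming like Jacobi forms under $\mathrm{SL}_2(\mathbb{Z})$ and under translations by $\mathbb{Z}^2\tau+\mathbb{Z}^2$ with respect to the quadratic form $x^TMx/2$, with Fourier expansion supported on nonnegative powers of $q=e^{2\pi i\tau}$). $\mathcal{J}_0$ is the graded ring $\bigoplus_{a,b,c\in\mathbb{N}_0,\, b\le\min(a,c)}\bigoplus_{k\in2\mathbb{Z}} J^w_{k,\begin{pmatrix} 2a&2b\\2b&2c\end{pmatrix}}$. Let $\vartheta(\tau,z)=q^{1/8}\zeta^{1/2}\sum_{n\in\mathbb{Z}}q^{n(n+1)/2}(-\zeta)^n$, $\zeta=e^{2\pi iz}$, $\eta$ the Dedekind eta function, and $'$ the derivative in the elliptic variable.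 Define $\Phi_{-3, \begin{pmatrix} 2 & 1 \\ 1 & 2 \end{pmatrix}}=\vartheta(\tau,z)\vartheta(\tau,w)\vartheta(\tau,z+w)/\eta^9(\tau)$, $\Phi_{-2, \begin{pmatrix} 2 & 1 \\ 1 & 2 \end{pmatrix}}=\Big(\frac{\vartheta'(\tau,z)}{\vartheta(\tau,z)}+\frac{\vartheta'(\tau,w)}{\vartheta(\tau,w)}-\frac{\vartheta'(\tau,z+w)}{\vartheta(\tau,z+w)}\Big)\Phi_{-3, \begin{pmatrix} 2 & 1 \\ 1 & 2 \end{pmatrix}}$ (weight $-2$, $q^0$-term $\zeta^{-1}\omega^{-1}+\zeta^{-1}+\omega^{-1}-6+\zeta+\omega+\zeta\omega$, $\omega=e^{2\pi iw}$) and $\Phi_{0, \begin{pmatrix} 2 & 1 \\ 1 & 2 \end{pmatrix}}=-12\,\mathcal{S}\big(\Phi_{-2, \begin{pmatrix} 2 & 1 \\ 1 & 2 \end{pmatrix}}\big)$ (weight $0$, $q^0$-term $\zeta^{-1}\omega^{-1}+\zeta^{-1}+\omega^{-1}+18+\zeta+\omega+\zeta\omega$), both weak Jacobi forms of index $\begin{pmatrix} 2&1\\1&2\end{pmatrix}$. Here $\mathcal{S}f=\mathcal{H}f-\frac{3}{\pi^2}(\frac{k}{12}-\frac{2}{24})G_2f$ is the Serre derivative, $\mathcal{H}$ the heat operator acting on $c(n,r)q^n\zeta^r$ by multiplication with $n-r^TM^{-1}r/2$, and $G_2(\tau)=\frac{\pi^2}{3}(1-24\sum\sigma_1(n)q^n)$.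 *)

(* Defs.v *)
From HB Require Import structures.
From mathcomp Require Import all_boot all_order all_algebra.
From mathcomp Require Import complex finmap.
From mathcomp Require Import all_classical all_reals all_analysis.
From mathcomp Require Import summability.
From mathcomp Require Import ring.

Set Implicit Arguments.
Unset Strict Implicit.
Unset Printing Implicit Defensive.

Import Order.TTheory GRing.Theory Num.Theory.
Import numFieldNormedType.Exports.

Local Open Scope classical_set_scope.
Local Open Scope complex_scope.
Local Open Scope ring_scope.

(* The topology of R[i] as a normed module over itself, so that [derive1] and
   [differentiable] below are complex differentiability. *)
#[warnings="-redundant-canonical-projection"]
HB.instance Definition _ (R : rcfType) := NormedModule.copy R[i] R[i]^o.

Fact log_derivE (F : fieldType) (x y s x' y' s' : F) :
  x != 0 -> y != 0 -> s != 0 ->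
  (x' / x + y' / y - s' / s) * (x * y * s) =
  x' * y * s + x * y' * s - x * y * s'.
Proof. by move=> hx hy hs; field; rewrite hx hy hs. Qed.

Section JacobiForms.
Variable R : realType.
Local Notation C := R[i].

Definition cexp (z : C) : C :=
  (expR (complex.Re z))%:C * (cos (complex.Im z) +i* sin (complex.Im z)).

(* e(z) = exp(2 pi i z); thus q^s = e(s tau), zeta^s = e(s z). *)
Definition ce (z : C) : C := cexp ((2 * pi : R)%:C * 'i%C * z).

Definition uhp := {t : C | 0 < complex.Im t}.

(* Sums and products of forms below are the pointwise ones of the library. *)
Definition jform := uhp -> C -> C -> C.

Definition vec2 (x y : C) : 'cV[C]_2 := \col_i [:: x; y]`_i.
Definition bilf (S : 'M[C]_2) (x y : 'cV[C]_2) : C := (x^T *m S *m y) 0 0.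
Definition quadf (S : 'M[C]_2) (x : 'cV[C]_2) : C := bilf S x x / 2.
Definition toC (M : 'M[int]_2) : 'M[C]_2 := map_mx intr M.

(* Joint (Frechet) complex differentiability on the open set H x C x C; the
   default value of [insubd], used for p.1.1 outside H, is irrelevant since
   differentiability at a point of H only depends on nearby values. *)
Definition holomorphic (f : jform) : Prop :=
  forall (t : uhp) (z w : C),
    differentiable (fun p : C * C * C => f (insubd t p.1.1) p.1.2 p.2)
      (val t, z, w).

(* Fourier exponents (n, (r1, r2)) of q^n zeta^r1 omega^r2. *)
Definition fexp := (nat * (int * int))%type.

Definition fmonom (m : fexp) (t : uhp) (z w : C) : C :=
  ce (m.1%:R * val t + m.2.1%:~R * z + m.2.2%:~R * w).

(* f = sum c(n, r) q^n zeta^r1 omega^r2, n >= 0: convergence along the net of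
   finite sets of exponents, that is, absolute convergence. *)
Definition fourier_expansion (f : jform) (c : fexp -> C) : Prop :=
  forall (t : uhp) (z w : C),
    partial_sum (fun m => c m * fmonom m t z w) @ totally --> f t z w.

(* Both factors of automorphy use Q(x) = x^T M x / 2. The point t' is A.t, the
   image of t under the Moebius action of A. *)
Record weak_jacobi_form (k : int) (M : 'M[int]_2) (f : jform) : Prop := {
  wjf_holomorphic : holomorphic f ;
  wjf_modular : forall (A : 'M[int]_2) (t t' : uhp) (z w : C),
    \det A = 1 ->
    let j := (A 1 0)%:~R * val t + (A 1 1)%:~R in
    val t' = ((A 0 0)%:~R * val t + (A 0 1)%:~R) / j ->
    f t' (z / j) (w / j) =
      j ^ k * ce ((A 1 0)%:~R * quadf (toC M) (vec2 z w) / j) * f t z w ;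
  wjf_elliptic : forall (t : uhp) (z w : C) (l1 l2 m1 m2 : int),
    let l := vec2 l1%:~R l2%:~R in
    f t (z + l1%:~R * val t + m1%:~R) (w + l2%:~R * val t + m2%:~R) =
      ce (- (quadf (toC M) l * val t + bilf (toC M) l (vec2 z w))) * f t z w ;
  wjf_fourier : exists c : fexp -> C, fourier_expansion f c
}.

Definition fourier_coef (f : jform) : fexp -> C :=
  xget (fun=> 0) [set c | fourier_expansion f c].

Definition heat (M : 'M[int]_2) (f : jform) : jform := fun t z w =>
  summability.sum (fun m : fexp =>
    (m.1%:R - quadf (invmx (toC M)) (vec2 m.2.1%:~R m.2.2%:~R)) *
    fourier_coef f m * fmonom m t z w).

Definition sigma1 (n : nat) : nat := (\sum_(d <- divisors n) d)%N.

Definition G2 (t : C) : C :=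
  (pi ^+ 2 / 3 : R)%:C *
  (1 - 24 * summability.sum (fun n : nat =>
              (sigma1 n.+1)%:R * ce (n.+1%:R * t))).

Definition serre (k : int) (M : 'M[int]_2) (f : jform) : jform := fun t z w =>
  heat M f t z w -
  (3 / pi ^+ 2 : R)%:C * (k%:~R / 12 - 2 / 24) * G2 (val t) * f t z w.

Definition theta (t z : C) : C :=
  ce (t / 8 + z / 2) *
  summability.sum (fun n : int =>
    (-1) ^ n * ce (n%:~R * (n%:~R + 1) / 2 * t + n%:~R * z)).

Definition theta' (t z : C) : C := derive1 (theta t) z.

Definition eta (t : C) : C :=
  ce (t / 24) *
  limn (fun N : nat => \prod_(1 <= n < N.+1) (1 - ce (n%:R * t))).

Definition Phi_m3 : jform := fun t z w =>
  theta (val t) z * theta (val t) w * theta (val t) (z + w) / eta (val t) ^+ 9.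

(* The product (theta'/theta(z) + theta'/theta(w) - theta'/theta(z+w)) Phi_m3
   is multiplied out, so that the formula is also right at the (removable)
   zeros of the theta factors, where MathComp's x / 0 = 0 would give a wrong
   value; see Phi_m2E. Here ' is d/dz, for which the q^0-term is pi i times
   zeta^-1 omega^-1 + zeta^-1 + omega^-1 - 6 + zeta + omega + zeta omega. *)
Definition Phi_m2 : jform := fun t z w =>
  (theta' (val t) z * theta (val t) w * theta (val t) (z + w)
   + theta (val t) z * theta' (val t) w * theta (val t) (z + w)
   - theta (val t) z * theta (val t) w * theta' (val t) (z + w))
  / eta (val t) ^+ 9.

Lemma Phi_m2E (t : uhp) (z w : C) :
  theta (val t) z != 0 -> theta (val t) w != 0 ->
  theta (val t) (z + w) != 0 ->
  Phi_m2 t z w =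
    (theta' (val t) z / theta (val t) z + theta' (val t) w / theta (val t) w
     - theta' (val t) (z + w) / theta (val t) (z + w)) * Phi_m3 t z w.
Proof. by move=> hz hw hzw; rewrite mulrA log_derivE. Qed.

Definition gram (p s r : int) : 'M[int]_2 :=
  \matrix_(i, j) if i != j then s else if i == 0 then p else r.

Definition gramA2 : 'M[int]_2 := gram 2 1 2.

Definition Phi_0 : jform := fun t z w => - 12 * serre (- 2) gramA2 Phi_m2 t z w.

(* Weight and Gram matrix of the index. *)
Definition degree := (int * 'M[int]_2)%type.

(* The external direct sum of the spaces of weak Jacobi forms of degree in D:
   families of forms, indexed by the degree, with finite support in D. *)
Definition gform := degree -> jform.

Definition graded_sum (D : set degree) : set gform := [set F |
  [/\ finite_set [set d | F d <> 0],
      (forall d, D d -> weak_jacobi_form d.1 d.2 (F d)) &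
      (forall d, ~ D d -> F d = 0)]].

Definition homog (d : degree) (f : jform) : gform :=
  fun e => if e == d then f else 0.

(* Product of the graded ring (convolution of families); it is not the
   pointwise product that the library puts on functions. *)
Definition gmul (F G : gform) : gform :=
  fun d => \sum_(e \in [set: degree]) (F e * G (d - e)).

Definition gspan (A S : set gform) : set gform := [set F |
  exists (n : nat) (a s : 'I_n -> gform),
    [/\ forall i, A (a i), forall i, S (s i) & F = \sum_i gmul (a i) (s i)]].

Definition J0 : set gform := graded_sum [set d | exists (k : int) (a b c : nat),
  (b <= minn a c)%N /\
  d = (2 * k, gram (2 * a%:Z) (2 * b%:Z) (2 * c%:Z))].

Definition Jodd : set gform := graded_sum [set d | exists (k : int) (a b c : nat),
  (b < minn a c)%N /\
  d = (2 * k, gram (2 * a%:Z) (2 * b%:Z + 1) (2 * c%:Z))].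

End JacobiForms.

Arguments J0 R : clear implicits.
Arguments Jodd R : clear implicits.
Arguments Phi_m2 R : clear implicits.
Arguments Phi_0 R : clear implicits.

(* Main.v *)
(* Write x(w) and y(w) for the values at z = 0 of the forms Phi_{-2} and Phi_0.
   With theta_[z,w](h) = theta(z + h) theta(w + h) theta(z + w - h), Phi_{-2} and
   Phi_0 are, up to constants, the h-coefficient and a corrected h^3-coefficient of
   theta_[z,w] divided by eta^9; this gives their transformation laws and their
   invariance under the symmetric group of {z, w, - z - w}. The transformation law
   of theta itself holds because the quotient of its two sides is an elliptic
   function without poles.

   Let f have even weight and index al z^2 + ga w^2 + be (z + w)^2 plus the A2 form.
   Its restriction to z = 0 is A x + B y for one-variable forms A and B, which lift
   to the index al z^2 + ga w^2 + be (z + w)^2; subtract the corresponding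
   combination of Phi_{-2} and Phi_0. The z-derivative at z = 0 is then a form of odd
   weight in w, hence a multiple of psi, the z-derivative of y(w) Phi_{-2} - x(w) Phi_0,
   and can be removed too. What remains vanishes to second order at z = 0, so it
   is divisible by x(z), with a quotient of index smaller by z^2: by induction,
   choosing z so that al is positive, one is left with the index (0, 1; 1, 2), for
   which there is no nonzero form. *)
From HB Require Import structures.
From mathcomp Require Import all_boot all_order all_algebra.
From mathcomp Require Import complex finmap.
From mathcomp Require Import all_classical all_reals all_analysis.
From mathcomp Require Import summability.
From mathcomp Require Import ring lra zify.
Require Import Defs.

Set Implicit Arguments.
Unset Strict Implicit.
Unset Printing Implicit Defensive.

Import Order.TTheory GRing.Theory Num.Theory.
Import numFieldNormedType.Exports.

Local Open Scope classical_set_scope.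
Local Open Scope complex_scope.
Local Open Scope ring_scope.

(** The condition on the index drives the induction: for b < min(a, c) the Gram matrix (2a, 2b+1;
    2b+1, 2c) is the A2 form plus al z^2 + ga w^2 + be (z + w)^2, where al = a - 1 - b, ga = c - 1 -
    b and be = b are nonnegative. The main obstacle is division by x(z). A weak Jacobi form needs a
    Fourier expansion over n >= 0 that converges for all z, while 1 / theta^2 can be expanded only
    in the strip |Im z| < Im t. The quotient is therefore expanded in the strip, and its
    ellipticity, read as a relation between coefficients, carries the convergence to all z.
    Convergence means absolute summability over arbitrary index types, and local arguments use
    polynomial jets. The rigidity of theta rests on the maximum principle on a period parallelogram.
    It leaves an undetermined constant in the transformation law of theta, which cancels in Phi_{-2}
    and Phi_0 because eta^9 is a multiple of theta'(0)^3. The correction of the h^3-coefficient is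
    theta'''(0) / theta'(0), which enters through the G2 of the Serre derivative. *)

(** * The modulus on [R[i]] with values in [R] *)

Section ComplexModulus.
Variable R : realType.
Implicit Types x y : R[i].

(** The norm of [R[i]] takes its values in [R[i]], where the order is partial; a modulus in [R] lets
    estimates go through real arithmetic. *)
Definition cabs x : R := ComplexField.Normc.normc x.

Lemma normr_cabs x : `|x| = (cabs x)%:C.
Proof. by []. Qed.

Lemma cabs_ge0 x : 0 <= cabs x.
Proof. by rewrite -ler0c -normr_cabs. Qed.

Lemma cabs0 : cabs 0 = 0.
Proof. exact: ComplexField.Normc.normc0. Qed.

Lemma cabs1 : cabs 1 = 1.
Proof. exact: ComplexField.Normc.normc1. Qed.

Lemma cabs_eq0 x : (cabs x == 0) = (x == 0).
Proof. by apply/eqP/eqP => [/ComplexField.Normc.eq0_normc|->] //; exact: cabs0. Qed.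

Lemma cabsM x y : cabs (x * y) = cabs x * cabs y.
Proof. exact: ComplexField.Normc.normcM. Qed.

Lemma cabsN x : cabs (- x) = cabs x.
Proof. exact: normcN. Qed.

Lemma cabsV x : cabs x^-1 = (cabs x)^-1.
Proof. exact: ComplexField.Normc.normcV. Qed.

Lemma cabsX x n : cabs (x ^+ n) = cabs x ^+ n.
Proof. by elim: n => [|n IH]; rewrite ?expr0 ?cabs1 // !exprS cabsM IH. Qed.

Lemma cabsD x y : cabs (x + y) <= cabs x + cabs y.
Proof. exact: le_normcD. Qed.

Lemma cabsB x y : cabs (x - y) = cabs (y - x).
Proof. by rewrite -cabsN opprB. Qed.

Lemma cabsR (r : R) : cabs r%:C = `|r|.
Proof. by rewrite /cabs /= expr0n /= addr0 sqrtr_sqr. Qed.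

Lemma cabs_nat n : cabs n%:R = n%:R.
Proof. by rewrite -(rmorph_nat (real_complex R)) cabsR ger0_norm. Qed.

Lemma cabs_sum (I : Type) (s : seq I) (P : pred I) (f : I -> R[i]) :
  cabs (\sum_(i <- s | P i) f i) <= \sum_(i <- s | P i) cabs (f i).
Proof.
elim/big_rec2: _ => [|i y1 y2 _ h]; first by rewrite cabs0.
exact: le_trans (cabsD _ _) (lerD (lexx _) h).
Qed.

Lemma cabs_dist x y : cabs x - cabs y <= cabs (x - y).
Proof. by rewrite lerBlDr -{1}(subrK y x) cabsD. Qed.

Lemma Re_le_cabs x : `|complex.Re x| <= cabs x.
Proof.
case: x => a b; rewrite /cabs /= -sqrtr_sqr ler_sqrt ?lerDl ?sqr_ge0 //.
by rewrite addr_ge0 // sqr_ge0.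
Qed.

Lemma Im_le_cabs x : `|complex.Im x| <= cabs x.
Proof.
case: x => a b; rewrite /cabs /= -(sqrtr_sqr b) ler_sqrt ?lerDr ?sqr_ge0 //.
by rewrite addr_ge0 // sqr_ge0.
Qed.

Lemma cabs_le_ReIm x : cabs x <= `|complex.Re x| + `|complex.Im x|.
Proof.
rewrite {1}[x]complexE; apply: le_trans (cabsD _ _) _.
by rewrite cabsM !cabsR /cabs /= expr0n expr1n add0r sqrtr1 mul1r.
Qed.

Lemma cabs_small x : (forall e : R, 0 < e -> cabs x <= e) -> x = 0.
Proof.
move=> h; apply/eqP; rewrite -cabs_eq0; apply: contraT => nz.
have p : 0 < cabs x by rewrite lt0r nz cabs_ge0.
have := h (cabs x / 2) (divr_gt0 p (ltr0n _ 2)); lra.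
Qed.

Lemma Re_sum (I : Type) (s : seq I) (f : I -> R[i]) :
  complex.Re (\sum_(i <- s) f i) = \sum_(i <- s) complex.Re (f i).
Proof. by apply: (big_morph (@complex.Re R)) => [[a b] [c d]|]. Qed.

Lemma Im_sum (I : Type) (s : seq I) (f : I -> R[i]) :
  complex.Im (\sum_(i <- s) f i) = \sum_(i <- s) complex.Im (f i).
Proof. by apply: (big_morph (@complex.Im R)) => [[a b] [c d]|]. Qed.

End ComplexModulus.

#[local] Existing Instance totally_filter.

(** * Absolutely summable families over arbitrary index types *)

Section Summation.
Variable R : realType.
Local Notation C := R[i].

(** Duplicate-free sequences stand for finite subsets. The bound is kept explicit because double
    series need bounds of their rows that can themselves be summed. *)
Definition sumbnd (I : choiceType) (f : I -> C) (B : R) :=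
  forall s : seq I, uniq s -> \sum_(i <- s) cabs (f i) <= B.

Definition asum (I : choiceType) (f : I -> C) := exists B, sumbnd f B.

Definition hassum (I : choiceType) (f : I -> C) (l : C) :=
  forall e : R, 0 < e -> exists s0 : seq I, forall s, uniq s ->
    {subset s0 <= s} -> cabs (\sum_(i <- s) f i - l) <= e.

Lemma hassum_cvg (I : choiceType) (f : I -> C) l :
  hassum f l <-> partial_sum f @ totally --> l.
Proof.
split=> [h|h].
  apply/cvgrPdist_le => e; rewrite ltcE => /andP[/eqP ie re].
  have [s0 hs0] := h _ re.
  exists [fset x in s0]%fset => // A /= sA.
  rewrite /partial_sum -(big_seq_fsetE _ A xpredT f) /= normr_cabs.
  rewrite lecE ie eqxx /= cabsB; apply: hs0; first exact: fset_uniq.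
  by move=> x xs; apply: (fsubsetP sA); rewrite !inE.
move=> e e0; move/cvgrPdist_le: h => /(_ e%:C); rewrite ltcR => /(_ e0).
case=> A _ hA; exists A => s us sA.
have := hA [fset x in s]%fset.
rewrite /partial_sum -(big_seq_fsetE _ [fset x in s]%fset xpredT f) /=.
rewrite normr_cabs lecR cabsB.
have /(perm_big s) -> : perm_eq [fset x in s]%fset s.
  by rewrite uniq_perm ?fset_uniq // => x; rewrite !inE.
by apply; apply/fsubsetP => x xA; rewrite !inE; exact: sA.
Qed.

Definition csum (I : choiceType) (f : I -> C) : C := summability.sum f.

Lemma hassum_csum (I : choiceType) (f : I -> C) l : hassum f l -> csum f = l.
Proof.
move/hassum_cvg => h; rewrite /csum /summability.sum.
by apply: cvg_lim => //; exact: norm_hausdorff.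
Qed.

Lemma sumbnd_le (I : choiceType) (f g : I -> C) B :
  (forall i, cabs (f i) <= cabs (g i)) -> sumbnd g B -> sumbnd f B.
Proof. by move=> h hg s us; apply: le_trans (hg s us); apply: ler_sum. Qed.

Lemma asum_le (I : choiceType) (f g : I -> C) :
  (forall i, cabs (f i) <= cabs (g i)) -> asum g -> asum f.
Proof. by move=> h [B hB]; exists B; exact: sumbnd_le hB. Qed.

Lemma big_subset_le (I : choiceType) (u : I -> R) (s t : seq I) :
  (forall i, 0 <= u i) -> uniq s -> uniq t -> {subset s <= t} ->
  \sum_(i <- s) u i <= \sum_(i <- t) u i.
Proof.
move=> u0 us ut st.
rewrite [X in _ <= X](bigID (mem s)) /= -[X in _ <= X + _]big_filter.
suff /(perm_big s) -> : perm_eq [seq i <- t | i \in s] s by rewrite lerDl sumr_ge0.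
rewrite uniq_perm ?filter_uniq // => x; rewrite mem_filter /=.
by case: (boolP (x \in s)) => // /st ->.
Qed.

Lemma nneg_hassum (I : choiceType) (u : I -> R) (B : R) :
  (forall i, 0 <= u i) -> (forall s, uniq s -> \sum_(i <- s) u i <= B) ->
  exists l : R, hassum (fun i => (u i)%:C) l%:C.
Proof.
move=> u0 hB; pose S := [set x | exists2 s : seq I, uniq s & x = \sum_(i <- s) u i].
have hS : has_sup S.
  split; first by exists 0, nil; rewrite ?big_nil.
  by exists B => x [s us ->]; exact: hB.
exists (sup S) => e e0.
have [_ [s us ->] hs] := sup_adherent e0 hS.
exists s => t ut st; rewrite -rmorph_sum -rmorphB cabsR.
have h1 : \sum_(i <- t) u i <= sup S by apply: ub_le_sup; [case: hS | exists t].
have h2 := big_subset_le u0 us ut st.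
rewrite ler_norml; lra.
Qed.

Lemma hassumD (I : choiceType) (f g : I -> C) l m :
  hassum f l -> hassum g m -> hassum (fun i => f i + g i) (l + m).
Proof.
move=> h h' e e0; have e2 : 0 < e / 2 by lra.
have [s hs] := h _ e2; have [s' hs'] := h' _ e2.
exists (s ++ s') => t ut st; rewrite big_split /=.
have t1 : {subset s <= t} by move=> x xs; rewrite st // mem_cat xs.
have t2 : {subset s' <= t} by move=> x xs; rewrite st // mem_cat xs orbT.
rewrite opprD addrACA; apply: le_trans (cabsD _ _) _.
by have := hs t ut t1; have := hs' t ut t2; lra.
Qed.

Lemma hassumZ (I : choiceType) (f : I -> C) l (k : C) :
  hassum f l -> hassum (fun i => k * f i) (k * l).
Proof.
move=> h e e0.
have p : 0 < cabs k + 1 by rewrite ltr_wpDl // cabs_ge0.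
have [s hs] := h _ (divr_gt0 e0 p).
exists s => t ut st; rewrite -mulr_sumr -mulrBr cabsM.
apply: le_trans (ler_wpM2l (cabs_ge0 _) (hs t ut st)) _.
rewrite mulrA ler_pdivrMr // mulrC ler_wpM2l ?lerDl //; lra.
Qed.

(** A supremum of partial sums is available only for nonnegative real families, hence the splitting
    into positive and negative parts of the real and imaginary parts. *)
Lemma asum_hassum (I : choiceType) (f : I -> C) :
  asum f -> hassum f (csum f).
Proof.
move=> [B hB].
have key (g : C -> R) : (forall x, 0 <= g x <= cabs x) ->
    exists l : R, hassum (fun i => (g (f i))%:C) l%:C.
  move=> hg; apply: (@nneg_hassum _ _ B) => [i|s us].
    by case/andP: (hg (f i)).
  by apply: le_trans (hB s us); apply: ler_sum => i _; case/andP: (hg (f i)).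
have aux (r : R) x : `|r| <= cabs x -> 0 <= Num.max r 0 <= cabs x.
  move=> h; rewrite le_max lexx orbT /= ge_max cabs_ge0 andbT.
  exact: le_trans (ler_norm _) h.
have auxN (r : R) x : `|r| <= cabs x -> 0 <= Num.max (- r) 0 <= cabs x.
  by rewrite -normrN; exact: aux.
have [a ha] := key _ (fun x => aux _ _ (Re_le_cabs x)).
have [b hb] := key _ (fun x => auxN _ _ (Re_le_cabs x)).
have [c hc] := key _ (fun x => aux _ _ (Im_le_cabs x)).
have [d hd] := key _ (fun x => auxN _ _ (Im_le_cabs x)).
have h := hassumD (hassumD ha (hassumZ (-1) hb))
  (hassumD (hassumZ 'i%C hc) (hassumZ (- 'i%C) hd)).
have E : (fun i => f i) = (fun i => (Num.max (complex.Re (f i)) 0)%:C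
    + -1 * (Num.max (- complex.Re (f i)) 0)%:C
    + ('i%C * (Num.max (complex.Im (f i)) 0)%:C
    + - 'i%C * (Num.max (- complex.Im (f i)) 0)%:C)).
  apply/funext => i; rewrite {1}[f i]complexE.
  have p (r : R) : r = Num.max r 0 - Num.max (- r) 0.
    by case: (lerP r 0) => h1; case: (lerP (- r) 0) => h2; lra.
  by rewrite {1}(p (complex.Re (f i))) {1}(p (complex.Im (f i))) !rmorphB /=; ring.
by rewrite -E in h; rewrite (hassum_csum h).
Qed.

(** Outside [t0] every finite sum has modulus at most 2. Taken over the indices where the real part
    has a fixed sign, this bounds the sum of the absolute real parts by 4; the imaginary parts add
    another 4. This turns [fourier_expansion], a convergence along finite sets, into absolute
    convergence. *)
Lemma hassum_asum (I : choiceType) (f : I -> C) l : hassum f l -> asum f.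
Proof.
move=> h; have [s0 hs0] := h 1 ltr01.
pose t0 := undup s0.
have tail s : uniq s -> {in s, forall x, x \notin t0} -> cabs (\sum_(i <- s) f i) <= 2.
  move=> us hs.
  have u : uniq (t0 ++ s).
    rewrite cat_uniq undup_uniq us andbT /=; apply/hasPn => x xs; exact: hs.
  have h1 := hs0 _ u _; have h2 := hs0 _ (undup_uniq s0) _.
  rewrite big_cat /= in h1.
  have -> : \sum_(i <- s) f i = (\sum_(i <- t0) f i + \sum_(i <- s) f i - l)
     - (\sum_(i <- t0) f i - l) by ring.
  apply: le_trans (cabsD _ _) _; rewrite cabsN (natrD _ 1 1) lerD //.
    by apply: h1 => x xs; rewrite mem_cat mem_undup xs.
  by apply: h2 => x xs; rewrite mem_undup.
have part (g : C -> R) s : (forall x, `|g x| <= cabs x) ->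
    (forall s, g (\sum_(i <- s) f i) = \sum_(i <- s) g (f i)) ->
    uniq s -> {in s, forall x, x \notin t0} -> \sum_(i <- s) `|g (f i)| <= 4.
  move=> hg gs us hs; rewrite (bigID (fun i => 0 <= g (f i))) /=.
  rewrite (natrD _ 2 2); apply: lerD.
    rewrite (eq_bigr (fun i => g (f i))); last by move=> i; exact: ger0_norm.
    rewrite -big_filter -gs; apply: le_trans (ler_norm _) (le_trans (hg _) _).
    by apply: tail; [exact: filter_uniq | move=> x; rewrite mem_filter => /andP[_ /hs]].
  rewrite (eq_bigr (fun i => - g (f i))); last first.
    by move=> i; rewrite -ltNge; exact: ltr0_norm.
  rewrite sumrN -big_filter -gs; apply: le_trans (ler_norm _) _.
  rewrite normrN; apply: le_trans (hg _) _.
  by apply: tail; [exact: filter_uniq | move=> x; rewrite mem_filter => /andP[_ /hs]].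
exists (\sum_(i <- t0) cabs (f i) + 8) => s us.
rewrite (bigID (fun i => i \in t0)) /=; apply: lerD.
  rewrite -big_filter; apply: big_subset_le; rewrite ?undup_uniq ?filter_uniq //.
    by move=> i; exact: cabs_ge0.
  by move=> x; rewrite mem_filter => /andP[].
rewrite -big_filter; set s' := [seq i <- s | _].
have us' : uniq s' by exact: filter_uniq.
have hs' : {in s', forall x, x \notin t0} by move=> x; rewrite mem_filter => /andP[].
apply: (@le_trans _ _ (\sum_(i <- s') (`|complex.Re (f i)| + `|complex.Im (f i)|))).
  by apply: ler_sum => i _; exact: cabs_le_ReIm.
rewrite big_split /= (natrD _ 4 4) lerD //.
  exact: part (@Re_le_cabs R) (fun s => Re_sum s f) us' hs'.
exact: part (@Im_le_cabs R) (fun s => Im_sum s f) us' hs'.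
Qed.

Lemma asumD (I : choiceType) (f g : I -> C) :
  asum f -> asum g -> asum (fun i => f i + g i).
Proof.
move=> [B hB] [B' hB']; exists (B + B') => s us.
apply: le_trans (lerD (hB s us) (hB' s us)).
by rewrite -big_split /=; apply: ler_sum => i _; exact: cabsD.
Qed.

Lemma asumZ (I : choiceType) (k : C) (f : I -> C) :
  asum f -> asum (fun i => k * f i).
Proof.
move=> [B hB]; exists (cabs k * B) => s us.
under eq_bigr do rewrite cabsM.
by rewrite -mulr_sumr ler_wpM2l ?cabs_ge0 // hB.
Qed.

Lemma csumD (I : choiceType) (f g : I -> C) :
  asum f -> asum g -> csum (fun i => f i + g i) = csum f + csum g.
Proof.
by move=> hf hg; apply/hassum_csum/hassumD; exact: asum_hassum.
Qed.

Lemma csumZ (I : choiceType) (k : C) (f : I -> C) :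
  asum f -> csum (fun i => k * f i) = k * csum f.
Proof. by move=> hf; apply/hassum_csum/hassumZ; exact: asum_hassum. Qed.

Lemma asumN (I : choiceType) (f : I -> C) :
  asum f -> asum (fun i => - f i).
Proof. by apply: asum_le => i; rewrite cabsN. Qed.

Lemma csumB (I : choiceType) (f g : I -> C) :
  asum f -> asum g -> csum (fun i => f i - g i) = csum f - csum g.
Proof.
move=> hf hg; rewrite csumD //; last exact: asumN.
congr (_ + _); rewrite -mulN1r -csumZ //.
by congr csum; apply/funext => i; rewrite mulN1r.
Qed.

Lemma csum_bnd (I : choiceType) (f : I -> C) B : sumbnd f B -> cabs (csum f) <= B.
Proof.
move=> hB; have /asum_hassum h : asum f by exists B.
rewrite leNgt; apply/negP => lt.
have e0 : 0 < (cabs (csum f) - B) / 2 by rewrite divr_gt0 // subr_gt0.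
have [s0 hs] := h _ e0.
have sub : {subset s0 <= undup s0} by move=> x; rewrite mem_undup.
have := hs _ (undup_uniq s0) sub; rewrite cabsB.
have : cabs (\sum_(i <- undup s0) f i) <= B.
  exact: le_trans (cabs_sum _ _ _) (hB _ (undup_uniq _)).
have := cabs_dist (csum f) (\sum_(i <- undup s0) f i); lra.
Qed.

Lemma asum_tail (I : choiceType) (f : I -> C) (e : R) : asum f -> 0 < e ->
  exists s0 : seq I, forall s : seq I, uniq s -> {in s, forall x, x \notin s0} ->
    \sum_(i <- s) cabs (f i) <= e.
Proof.
move=> [B hB] e0.
have [l hl] : exists l : R, hassum (fun i => (cabs (f i))%:C) l%:C.
  by apply: nneg_hassum hB => i; exact: cabs_ge0.
have e2 : 0 < e / 2 by lra.
have [s0 hs0] := hl _ e2; exists (undup s0) => s us hs.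
have u : uniq (undup s0 ++ s).
  rewrite cat_uniq undup_uniq us andbT /=; apply/hasPn => x xs; exact: hs.
have h1 : cabs (\sum_(i <- undup s0 ++ s) (cabs (f i))%:C - l%:C) <= e / 2.
  by apply: hs0 => // x xs; rewrite mem_cat mem_undup xs.
have h2 : cabs (\sum_(i <- undup s0) (cabs (f i))%:C - l%:C) <= e / 2.
  by apply: hs0 => [|x xs]; rewrite ?undup_uniq ?mem_undup.
move: h1 h2; rewrite big_cat /= -!rmorph_sum -rmorphD -!rmorphB !cabsR.
rewrite !ler_norml; lra.
Qed.

Lemma sumbnd_restrict (I : choiceType) (f : I -> C) (P : pred I) B :
  sumbnd f B -> sumbnd (fun i => if P i then f i else 0) B.
Proof.
by apply: sumbnd_le => i; case: ifP => // _; rewrite cabs0 cabs_ge0.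
Qed.

Lemma asum_restrict (I : choiceType) (f : I -> C) (P : pred I) :
  asum f -> asum (fun i => if P i then f i else 0).
Proof. by move=> [B hB]; exists B; exact: sumbnd_restrict. Qed.

Lemma eq_csum (I : choiceType) (f g : I -> C) : f =1 g -> csum f = csum g.
Proof. by move=> /funext ->. Qed.

Lemma eq_asum (I : choiceType) (f g : I -> C) : f =1 g -> asum f -> asum g.
Proof. by move=> /funext ->. Qed.

Lemma asum_sum (I : choiceType) (J : Type) (s : seq J) (f : J -> I -> C) :
  (forall j, asum (f j)) -> asum (fun i => \sum_(j <- s) f j i).
Proof.
move=> h; elim: s => [|j s IH].
  by exists 0 => t _; rewrite big1 // => i _; rewrite big_nil cabs0.
apply: eq_asum (asumD (h j) IH) => i; by rewrite big_cons.
Qed.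

Lemma csum_sum (I : choiceType) (J : Type) (s : seq J) (f : J -> I -> C) :
  (forall j, asum (f j)) ->
  csum (fun i => \sum_(j <- s) f j i) = \sum_(j <- s) csum (f j).
Proof.
move=> h; elim: s => [|j s IH].
  rewrite big_nil; apply: hassum_csum => e e0; exists nil => t _ _.
  rewrite big1 ?subr0 ?cabs0 ?ltW // => i _; exact: big_nil.
rewrite big_cons -IH -csumD //; last exact: asum_sum.
by apply: eq_csum => i; rewrite big_cons.
Qed.

Lemma asum_finsupp (I : choiceType) (f : I -> C) (s : seq I) :
  (forall i, i \notin s -> f i = 0) -> asum f.
Proof.
move=> h; exists (\sum_(i <- undup s) cabs (f i)) => t ut.
rewrite (bigID (mem s)) /= [X in _ + X]big1 ?addr0; last first.
  by move=> i /h ->; rewrite cabs0.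
rewrite -big_filter; apply: big_subset_le; rewrite ?undup_uniq ?filter_uniq //.
  by move=> i; exact: cabs_ge0.
by move=> x; rewrite mem_filter mem_undup => /andP[].
Qed.

Lemma csum_finsupp (I : choiceType) (f : I -> C) (s : seq I) :
  uniq s -> (forall i, i \notin s -> f i = 0) -> csum f = \sum_(i <- s) f i.
Proof.
move=> us h; apply: hassum_csum => e e0; exists s => t ut st.
rewrite (bigID (mem s)) /= [X in _ + X - _]big1 ?addr0; last by move=> i /h.
rewrite -big_filter; suff /(perm_big s) -> : perm_eq [seq i <- t | i \in s] s.
  by rewrite subrr cabs0 ltW.
rewrite uniq_perm ?filter_uniq // => x; rewrite mem_filter /=.
by case: (boolP (x \in s)) => // /st ->.
Qed.

Lemma csum1 (I : choiceType) (f : I -> C) (i0 : I) :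
  (forall i, i != i0 -> f i = 0) -> csum f = f i0.
Proof.
move=> h; rewrite (@csum_finsupp _ f [:: i0]) ?big_seq1 // => i.
by rewrite inE; exact: h.
Qed.

Lemma csum0 (I : choiceType) : csum (fun _ : I => 0) = 0.
Proof. by rewrite (@csum_finsupp _ _ nil) ?big_nil. Qed.

Section Push.
Variables (I J : choiceType) (h : I -> J).

(** Sum over the fibre of [h]. Cauchy products, substitutions in exponents and iterated sums are all
    treated as pushforwards, so that [csum_push] is the one rearrangement theorem. *)
Definition push (f : I -> C) (j : J) : C :=
  csum (fun i => if h i == j then f i else 0).

Lemma sum_push (f : I -> C) (t : seq J) : asum f -> uniq t ->
  \sum_(j <- t) push f j = csum (fun i => if h i \in t then f i else 0).
Proof.
move=> hf ut; rewrite -csum_sum; last by move=> j; exact: asum_restrict.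
apply: eq_csum => i; case: ifP => hi.
  rewrite (bigD1_seq (h i)) //= eqxx big1 ?addr0 // => j.
  by rewrite eq_sym => /negbTE ->.
rewrite big_seq big1 // => j jt; case: eqP => // e.
by rewrite e jt in hi.
Qed.

(** The modulus of a fibre sum is at most the fibre sum of the moduli, and the latter, added over
    finitely many fibres, is a restriction of the family of moduli. *)
Lemma sumbnd_push (f : I -> C) B : sumbnd f B -> sumbnd (push f) B.
Proof.
move=> hB t ut.
have hf : asum f by exists B.
have ha : sumbnd (fun i => (cabs (f i))%:C) B.
  by move=> s us; under eq_bigr do rewrite cabsR ger0_norm ?cabs_ge0 //; exact: hB.
have haa : asum (fun i => (cabs (f i))%:C) by exists B.
pose g (i : I) : C := (cabs (f i))%:C.
suff key j : cabs (push f j) <= complex.Re (push g j).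
  apply: le_trans (ler_sum _ (fun j _ => key j)) _.
  rewrite -Re_sum sum_push //; apply: le_trans (ler_norm _) _.
  by apply: le_trans (Re_le_cabs _) _; apply: csum_bnd; exact: sumbnd_restrict.
have hg : hassum (fun i => if h i == j then g i else 0) (push g j).
  exact/asum_hassum/asum_restrict.
apply: csum_bnd => s us; rewrite leNgt; apply/negP => lt.
set S := \sum_(i <- s) _ in lt.
have e0 : 0 < (S - complex.Re (push g j)) / 2 by rewrite divr_gt0 // subr_gt0.
have [s0 hs0] := hg _ e0.
have := hs0 (undup (s ++ s0)) (undup_uniq _) _.
have sub : {subset s0 <= undup (s ++ s0)}.
  by move=> x xs; rewrite mem_undup mem_cat xs orbT.
move=> /(_ sub) h1.
have h2 := le_trans (le_trans (ler_norm _) (Re_le_cabs _)) h1.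
have h3 : S <= complex.Re (\sum_(i <- undup (s ++ s0)) (if h i == j then g i else 0)).
  rewrite Re_sum (eq_bigr (fun i => cabs (if h i == j then f i else 0))); last first.
    by move=> i _; case: ifP => _; [by []|rewrite cabs0].
  apply: big_subset_le; rewrite ?undup_uniq //.
    by move=> i; exact: cabs_ge0.
  by move=> x xs; rewrite mem_undup mem_cat xs.
move: h2; set T := \sum_(i <- undup _) _ in h3 *.
have -> : complex.Re (T - push g j) = complex.Re T - complex.Re (push g j).
  by case: (T) (push g j) => a b [c d].
lra.
Qed.

Lemma asum_push (f : I -> C) : asum f -> asum (push f).
Proof. by move=> [B hB]; exists B; exact: sumbnd_push. Qed.

Lemma csum_push (f : I -> C) : asum f -> csum (push f) = csum f.
Proof.
move=> hf; apply: hassum_csum => e e0.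
have [s0 hs0] := asum_tail hf e0.
exists (map h s0) => t ut st; rewrite sum_push //.
rewrite cabsB -csumB //; last exact: asum_restrict.
apply: csum_bnd => s us.
rewrite (bigID (fun i => h i \in t)) /= [X in X + _]big1 ?add0r; last first.
  by move=> i ->; rewrite subrr cabs0.
rewrite (eq_bigr (fun i => cabs (f i))); last first.
  by move=> i /negbTE ->; rewrite subr0.
rewrite -big_filter; apply: hs0; first exact: filter_uniq.
move=> x; rewrite mem_filter => /andP[hx _].
by apply: contra hx => xs; apply: st; exact: map_f.
Qed.

End Push.

Section Reindex.
Variables (I J : choiceType) (h : J -> I).
Hypothesis h_inj : injective h.

Lemma sumbnd_inj (f : I -> C) B : sumbnd f B -> sumbnd (f \o h) B.
Proof.
move=> hB s us; rewrite -(big_map h xpredT (fun i => cabs (f i))).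
by apply: hB; rewrite map_inj_uniq.
Qed.

Lemma asum_inj (f : I -> C) : asum f -> asum (f \o h).
Proof. by move=> [B hB]; exists B; exact: sumbnd_inj. Qed.

Lemma csum_inj (f : I -> C) : asum f ->
  (forall i, (forall j, h j <> i) -> f i = 0) -> csum (f \o h) = csum f.
Proof.
move=> hf f0; rewrite -(csum_push h (asum_inj hf)); apply: eq_csum => i.
have [[j e]|ne] := pselect (exists j, h j = i).
  rewrite /push (@csum1 _ _ j) ?e ?eqxx //=; first by rewrite e.
  move=> j' ne; case: eqP => // e'; case/eqP: ne; apply: h_inj; by rewrite e.
have ne' j : h j <> i by move=> e; apply: ne; exists j.
rewrite f0 // -[RHS](csum0 J); apply: eq_csum => j.
by case: eqP => // /ne'.
Qed.

End Reindex.

Lemma asum_can (I J : choiceType) (h : J -> I) (g : I -> J) (f : I -> C) :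
  cancel g h -> asum (f \o h) -> asum f.
Proof.
move=> gh H; have := asum_inj (can_inj gh) H; apply: eq_asum => i /=.
by rewrite gh.
Qed.

Lemma csum_bij (I J : choiceType) (h : J -> I) (f : I -> C) :
  bijective h -> asum f -> csum (f \o h) = csum f.
Proof.
move=> [g hg gh] hf; apply: csum_inj => //; first exact: can_inj hg.
by move=> i ni; case: (ni (g i)).
Qed.

Section Pairs.
Variables (I J : choiceType).

Lemma asum_pair_sum (f : I * J -> C) :
  asum f -> asum (fun i => csum (fun j => f (i, j))).
Proof.
move=> hf; apply: eq_asum (asum_push fst hf) => i.
rewrite /push -[LHS](@csum_inj _ _ (fun j => (i, j))) /=.
- by apply: eq_csum => j /=; rewrite eqxx.
- by move=> j j' [].
- exact: asum_restrict.
- by move=> [i' j'] /= h; case: eqP => // e; case: (h j'); rewrite e.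
Qed.

Lemma csum_pair (f : I * J -> C) :
  asum f -> csum f = csum (fun i => csum (fun j => f (i, j))).
Proof.
move=> hf; rewrite -(csum_push fst hf); apply: eq_csum => i.
rewrite /push -[LHS](@csum_inj _ _ (fun j => (i, j))) /=.
- by apply: eq_csum => j /=; rewrite eqxx.
- by move=> j j' [].
- exact: asum_restrict.
- by move=> [i' j'] /= h; case: eqP => // e; case: (h j'); rewrite e.
Qed.

(** Tonelli's criterion: a finite set of pairs is enclosed in the product of its two projections. *)
Lemma asum_pairI (f : I * J -> C) (b : I -> R) :
  (forall i, sumbnd (fun j => f (i, j)) (b i)) -> asum (fun i => (b i)%:C) ->
  asum f.
Proof.
move=> hf [B hB]; exists B => s us.
pose s1 := undup (map fst s); pose s2 := undup (map snd s).
apply: (@le_trans _ _ (\sum_(p <- [seq (i, j) | i <- s1, j <- s2]) cabs (f p))).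
  apply: big_subset_le => //; first by move=> i; exact: cabs_ge0.
    by apply: allpairs_uniq; rewrite ?undup_uniq // => -[? ?] [? ?].
  move=> [i j] ij; apply/allpairsP; exists (i, j) => /=.
  by rewrite !mem_undup; split=> //; apply/mapP; exists (i, j).
rewrite big_allpairs /=; apply: le_trans (hB s1 (undup_uniq _)).
apply: ler_sum => i _; apply: le_trans (hf i s2 (undup_uniq _)) _.
by rewrite cabsR ler_norm.
Qed.

Lemma asumM (f : I -> C) (g : J -> C) :
  asum f -> asum g -> asum (fun p => f p.1 * g p.2).
Proof.
move=> hf [B hB]; apply: (@asum_pairI _ (fun i => cabs (f i) * B)).
  move=> i s us /=; under eq_bigr do rewrite cabsM.
  by rewrite -mulr_sumr ler_wpM2l ?cabs_ge0 // hB.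
apply: asum_le (asumZ B%:C hf) => i.
by rewrite rmorphM mulrC !cabsM !cabsR (ger0_norm (cabs_ge0 _)).
Qed.

Lemma csumM (f : I -> C) (g : J -> C) : asum f -> asum g ->
  csum (fun p => f p.1 * g p.2) = csum f * csum g.
Proof.
move=> hf hg; rewrite csum_pair; last exact: asumM.
rewrite mulrC -csumZ //; apply: eq_csum => i /=.
by rewrite csumZ // mulrC.
Qed.

End Pairs.

Lemma csum_swap (I J : choiceType) (f : I * J -> C) : asum f ->
  csum (fun i => csum (fun j => f (i, j))) = csum (fun j => csum (fun i => f (i, j))).
Proof.
move=> hf; rewrite -csum_pair //.
pose sw (p : J * I) := (p.2, p.1).
have bsw : bijective sw by exists (fun p => (p.2, p.1)) => -[].
by rewrite -(csum_bij bsw hf) csum_pair //; apply: asum_inj => // -[? ?] [? ?] [-> ->].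
Qed.

Definition seqlim (u : nat -> C) (l : C) :=
  forall e : R, 0 < e -> exists N, forall n, (N <= n)%N -> cabs (u n - l) <= e.

Lemma seqlim_unique u l l' : seqlim u l -> seqlim u l' -> l = l'.
Proof.
move=> h h'; apply/eqP; rewrite -subr_eq0; apply/eqP/cabs_small => e e0.
have e2 : 0 < e / 2 by lra.
have [N hN] := h _ e2; have [N' hN'] := h' _ e2.
have := hN _ (leq_maxl N N'); have := hN' _ (leq_maxr N N').
set S := u _ => a b.
rewrite (_ : l - l' = (l - S) + (S - l')); last by ring.
apply: le_trans (cabsD _ _) _; rewrite cabsB; lra.
Qed.

(** Dominated convergence. One third of [e] is spent on a finite set, where convergence is uniform,
    and two thirds on twice the tail of the dominating family. *)
Lemma csum_dominated (I : choiceType) (u : nat -> I -> C) (f b : I -> C) :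
  asum b -> (forall n i, cabs (u n i) <= cabs (b i)) ->
  (forall i, seqlim (u ^~ i) (f i)) -> asum f /\ seqlim (fun n => csum (u n)) (csum f).
Proof.
move=> hb hu hl.
have fb i : cabs (f i) <= cabs (b i).
  rewrite leNgt; apply/negP => lt.
  have e0 : 0 < (cabs (f i) - cabs (b i)) / 2 by rewrite divr_gt0 // subr_gt0.
  have [N hN] := hl i _ e0; have := hN N (leqnn _); rewrite cabsB => h1.
  have := cabs_dist (f i) (u N i); have := hu N i; lra.
have hf : asum f by exact: asum_le hb.
split=> // e e0.
have e3 : 0 < e / 3 by lra.
have [s0 hs0] := asum_tail hb e3.
pose t := undup s0.
have e4 : 0 < e / 3 / (size t).+1%:R by rewrite divr_gt0.
have [N hN] : exists N, forall n, (N <= n)%N -> forall i, i \in t ->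
    cabs (u n i - f i) <= e / 3 / (size t).+1%:R.
  move: (e / 3 / _) e4 => d e4.
  elim: (t) => [|i t' [N IH]]; first by exists 0%N.
  have [N' hN'] := hl i _ e4; exists (maxn N N') => n.
  rewrite geq_max => /andP[h1 h2] j; rewrite inE => /orP[/eqP ->|]; first exact: hN'.
  exact: IH.
exists N => n hn; rewrite -csumB //; last by apply: asum_le hb; exact: hu.
apply: csum_bnd => s us; rewrite (bigID (fun i => i \in t)) /=.
have -> : e = e / 3 + (e / 3 + e / 3) by lra.
apply: lerD; last first.
  apply: (@le_trans _ _ (\sum_(i <- s | i \notin t) (cabs (b i) + cabs (b i)))).
    apply: ler_sum => i _; apply: le_trans (cabsD _ _) _.
    by rewrite cabsN lerD.
  by rewrite -big_filter big_split /= lerD //; apply: hs0; rewrite ?filter_uniq //;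
    move=> x; rewrite mem_filter mem_undup => /andP[].
rewrite -big_filter; apply: (@le_trans _ _ (\sum_(i <- t) cabs (u n i - f i))).
  apply: big_subset_le; rewrite ?undup_uniq ?filter_uniq //.
    by move=> i; exact: cabs_ge0.
  by move=> x; rewrite mem_filter => /andP[].
apply: (@le_trans _ _ (\sum_(i <- t) (e / 3 / (size t).+1%:R))).
  by rewrite big_seq [X in _ <= X]big_seq; apply: ler_sum => i it; exact: hN.
rewrite big_const_seq count_predT iter_addr_0 -[X in X <= _]mulr_natr.
by rewrite mulrAC ler_pdivrMr // ler_wpM2l ?ler_nat // ltW.
Qed.

End Summation.

(** * Series over the naturals and the integers, and limits of sequences *)

Section NatSums.
Variable R : realType.
Local Notation C := R[i].

Lemma sumbnd_nat (f : nat -> C) B :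
  (forall n, \sum_(k < n) cabs (f k) <= B) -> sumbnd f B.
Proof.
move=> h s us; apply: le_trans (h (\max_(i <- s) i).+1).
rewrite -(big_mkord xpredT (fun k => cabs (f k))).
apply: big_subset_le; rewrite ?iota_uniq //; first by move=> i; exact: cabs_ge0.
by move=> x xs; rewrite mem_index_iota /= ltnS leq_bigmax_seq.
Qed.

Lemma asum_seqlim (f : nat -> C) :
  asum f -> seqlim (fun n => \sum_(k < n) f k) (csum f).
Proof.
move=> /asum_hassum h e e0; have [s0 hs0] := h _ e0.
exists (\max_(i <- s0) i).+1 => n hn.
rewrite -(big_mkord xpredT f); apply: hs0; first exact: iota_uniq.
move=> x xs; rewrite mem_index_iota /=; apply: leq_trans hn.
by rewrite ltnS leq_bigmax_seq.
Qed.

Lemma asum_int (f : int -> C) :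
  asum (fun n : nat => f n) -> asum (fun n : nat => f (Negz n)) -> asum f.
Proof.
move=> [B hB] [B' hB']; exists (B + B') => s us.
rewrite (bigID (fun n : int => 0 <= n)) /=; apply: lerD; rewrite -big_filter.
  set t := [seq i <- s | _].
  have e : t = map Posz (map absz t).
    rewrite -map_comp; symmetry; apply: map_id_in => x /=.
    by rewrite mem_filter => /andP[h _]; rewrite gez0_abs.
  rewrite e big_map; apply: hB.
  by rewrite -(map_inj_uniq (can_inj (fun n => erefl : absz (Posz n) = n))) -e filter_uniq.
set t := [seq i <- s | _].
have e : t = map Negz (map (fun n => (absz n).-1) t).
  rewrite -map_comp; symmetry; apply: map_id_in => x /=.
  rewrite mem_filter => /andP[h _]; move: h; case: x => // n _ /=.
rewrite e big_map; apply: hB'.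
have inj : injective Negz by move=> a b [].
by rewrite -(map_inj_uniq inj) -e filter_uniq.
Qed.

Lemma sum_geom_real (r : R) n : (1 - r) * \sum_(k < n) r ^+ k = 1 - r ^+ n.
Proof. by rewrite -[LHS]opprK -mulNr opprB -subrX1 opprB. Qed.

Lemma sumbnd_geom (x : C) : cabs x < 1 -> sumbnd (fun n => x ^+ n) (1 - cabs x)^-1.
Proof.
move=> h; apply: sumbnd_nat => n.
have p : 0 < 1 - cabs x by rewrite subr_gt0.
under eq_bigr do rewrite cabsX.
by rewrite -(ler_pM2l p) sum_geom_real divff ?gt_eqF // gerBl exprn_ge0 ?cabs_ge0.
Qed.

Lemma asum_geom (x : C) : cabs x < 1 -> asum (fun n => x ^+ n).
Proof. by move=> /sumbnd_geom h; eexists; exact: h. Qed.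

Lemma csum_shift (f : nat -> C) K : asum f ->
  csum f = \sum_(k < K) f k + csum (fun k => f (k + K)%N).
Proof.
move=> hf.
have e : f =1 (fun k => (if (k < K)%N then f k else 0) + (if (K <= k)%N then f k else 0)).
  by move=> k; case: (ltnP k K); rewrite ?addr0 ?add0r.
rewrite (eq_csum e) csumD; try exact: asum_restrict.
congr (_ + _).
  rewrite (@csum_finsupp _ _ _ (iota 0 K)) ?iota_uniq //; last first.
    by move=> k; rewrite mem_iota /= add0n => /negbTE ->.
  rewrite -(big_mkord xpredT f) /index_iota subn0.
  by rewrite big_seq [RHS]big_seq; apply: eq_bigr => k; rewrite mem_iota /= add0n => ->.
rewrite -(@csum_inj _ _ _ (fun k => (k + K)%N)).
- by apply: eq_csum => k /=; rewrite leq_addl.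
- by move=> a b /eqP; rewrite eqn_add2r => /eqP.
- exact: asum_restrict.
- move=> k hk; case: ifP => // Kk; case: (hk (k - K)%N); exact: subnK.
Qed.

Lemma csum_geom (x : C) : cabs x < 1 -> csum (fun n => x ^+ n) = (1 - x)^-1.
Proof.
move=> h; have ha := asum_geom h.
have e := csum_shift 1 ha; rewrite big_ord1 expr0 in e.
have e2 : csum (fun k => x ^+ (k + 1)) = x * csum (fun n => x ^+ n).
  by rewrite -csumZ //; apply: eq_csum => k; rewrite addn1 exprS.
have nz : 1 - x != 0.
  by apply: contraTneq h => /subr0_eq <-; rewrite cabs1 ltxx.
apply: (mulfI nz); rewrite divff // mulrBl mul1r -e2 {1}e addrK //.
Qed.

Lemma seqlim_real (u : nat -> R) (l : R) :
  u @ \oo --> l -> seqlim (fun n => (u n)%:C) l%:C.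
Proof.
move=> /cvgrPdist_le h e e0; have [N _ hN] := h e e0.
exists N => n hn; rewrite -rmorphB cabsR distrC; exact: hN.
Qed.

Lemma seqlimD (u v : nat -> C) l m :
  seqlim u l -> seqlim v m -> seqlim (fun n => u n + v n) (l + m).
Proof.
move=> hu hv e e0; have e2 : 0 < e / 2 by lra.
have [N hN] := hu _ e2; have [N' hN'] := hv _ e2.
exists (maxn N N') => n; rewrite geq_max => /andP[h1 h2].
rewrite opprD addrACA; apply: le_trans (cabsD _ _) _.
have := hN n h1; have := hN' n h2; lra.
Qed.

Lemma seqlimZ (u : nat -> C) l (k : C) :
  seqlim u l -> seqlim (fun n => k * u n) (k * l).
Proof.
move=> h e e0.
have p : 0 < cabs k + 1 by rewrite ltr_wpDl // cabs_ge0.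
have [N hN] := h _ (divr_gt0 e0 p).
exists N => n hn; rewrite -mulrBr cabsM.
apply: le_trans (ler_wpM2l (cabs_ge0 _) (hN n hn)) _.
rewrite mulrA ler_pdivrMr // mulrC ler_wpM2l ?lerDl //; lra.
Qed.

End NatSums.

(** * The complex exponential and [ce] *)

Section ComplexExponential.
Variable R : realType.
Local Notation C := R[i].

(** [cexp] is given by the real exponential, cosine and sine. It is identified with this power
    series on the two axes and then everywhere by additivity, which gives its functional equation
    and its Taylor remainder. *)
Let ex (z : C) := csum (fun k => z ^+ k / k`!%:R).

Lemma exp_term_le (x : R) n : 0 <= x -> \sum_(k < n) x ^+ k / k`!%:R <= expR x.
Proof.
move=> x0; have -> : \sum_(k < n) x ^+ k / k`!%:R = series (exp_coeff x) n.
  by rewrite /series /= big_mkord.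
apply: (nondecreasing_cvgn_le _ (is_cvg_series_exp_coeff x)).
by apply/nondecreasing_seqP => m; rewrite /series /= big_nat_recr //= lerDl exp_coeff_ge0.
Qed.

Lemma pow_le_exp (x : R) n : 0 <= x -> x ^+ n <= n`!%:R * expR x.
Proof.
move=> x0; rewrite mulrC -ler_pdivrMr ?ltr0n ?fact_gt0 //.
apply: le_trans (exp_term_le n.+1 x0); rewrite big_ord_recr /= lerDr.
by apply: sumr_ge0 => k _; rewrite divr_ge0 ?exprn_ge0.
Qed.

Lemma sumbnd_exp (z : C) : sumbnd (fun k => z ^+ k / k`!%:R) (expR (cabs z)).
Proof.
apply: sumbnd_nat => n; under eq_bigr do rewrite cabsM cabsX cabsV cabs_nat.
exact/exp_term_le/cabs_ge0.
Qed.

Lemma asum_exp (z : C) : asum (fun k => z ^+ k / k`!%:R).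
Proof. by eexists; exact: sumbnd_exp. Qed.

Let exD (x y : C) : ex (x + y) = ex x * ex y.
Proof.
have hx := asum_exp x; have hy := asum_exp y.
rewrite /ex -csumM // -(csum_push (fun p : nat * nat => (p.1 + p.2)%N) (asumM hx hy)).
apply: eq_csum => n; rewrite /push.
rewrite (@csum_finsupp _ _ _ [seq (i, (n - i)%N) | i <- iota 0 n.+1]).
- rewrite big_map -[iota 0 n.+1]/(index_iota 0 n.+1) big_mkord addrC exprDn mulr_suml.
  apply: eq_bigr => i _ /=; rewrite subnKC -1?ltnS // eqxx.
  have ni : (i <= n)%N by rewrite -ltnS.
  have := bin_fact ni => /(congr1 (fun m => m%:R : C)); rewrite !natrM => e.
  have f0 (m : nat) : (m`!%:R : C) != 0 by rewrite pnatr_eq0 -lt0n fact_gt0.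
  rewrite -e -mulr_natr; move: (f0 i) (f0 (n - i)%N) (f0 n); rewrite -e.
  move=> h1 h2; rewrite !mulf_eq0 => /norP[h3 _].
  by field; rewrite h1 h2 h3.
- by rewrite map_inj_uniq ?iota_uniq // => a b [].
- move=> [a b] /negP h /=; case: eqP => // e; case: h; apply/mapP.
  exists a; last by rewrite -e addKn.
  by rewrite mem_iota /= add0n -e ltnS leq_addr.
Qed.

Let ex_real (x : R) : ex x%:C = (expR x)%:C.
Proof.
apply: (seqlim_unique (asum_seqlim (asum_exp x%:C))).
have := seqlim_real (is_cvg_series_exp_coeff x).
rewrite -/(expR x); congr seqlim; apply/funext => n.
rewrite /series /= big_mkord rmorph_sum; apply: eq_bigr => k _.
by rewrite /exp_coeff /= rmorphM rmorphXn fmorphV rmorph_nat.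
Qed.

Let i_pow (k : nat) : ('i%C : C) ^+ k =
  ((~~ odd k)%:R * (-1) ^+ k./2) + 'i%C * ((odd k)%:R * (-1) ^+ k.-1./2).
Proof.
have e (m : nat) : ('i%C : C) ^+ m.*2 = (-1) ^+ m by rewrite -mul2n exprM sqr_i.
rewrite -{1}(odd_double_half k); case: (boolP (odd k)) => ok /=.
  rewrite add1n exprS e mul0r add0r mul1r.
  have -> : k.-1./2 = k./2 by rewrite -{1}(odd_double_half k) ok /= doubleK.
  by [].
by rewrite add0n e mul1r mul0r mulr0 addr0.
Qed.

Let ex_imag (y : R) : ex ('i%C * y%:C) = cos y +i* sin y.
Proof.
apply: (seqlim_unique (asum_seqlim (asum_exp ('i%C * y%:C)))).
have hc : seqlim (fun n => (series (cos_coeff y) n)%:C) (cos y)%:C.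
  rewrite unlock; apply: seqlim_real; exact: is_cvg_series_cos_coeff.
have hs : seqlim (fun n => (series (sin_coeff y) n)%:C) (sin y)%:C.
  rewrite unlock; apply: seqlim_real; exact: is_cvg_series_sin_coeff.
have -> : cos y +i* sin y = (cos y)%:C + 'i%C * (sin y)%:C by rewrite [LHS]complexE.
have := seqlimD hc (seqlimZ 'i%C hs).
congr seqlim; apply/funext => n.
rewrite /series /= !big_mkord !rmorph_sum mulr_sumr -big_split /=.
apply: eq_bigr => k _; rewrite /cos_coeff /sin_coeff /= exprMn i_pow.
rewrite -exprnP !rmorphM !fmorphV !rmorph_nat !rmorphXn !rmorphN1.
ring.
Qed.

Lemma cexpE (z : C) : cexp z = csum (fun k => z ^+ k / k`!%:R).
Proof. by rewrite -/(ex z) [in RHS](complexE z) exD ex_real ex_imag. Qed.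

Lemma cexpD (x y : C) : cexp (x + y) = cexp x * cexp y.
Proof. by rewrite !cexpE; exact: exD. Qed.

Lemma cexp0 : cexp 0 = 1 :> C.
Proof. by rewrite /cexp /= expR0 cos0 sin0 mul1r. Qed.

Lemma cabs_cexp (z : C) : cabs (cexp z) = expR (complex.Re z).
Proof.
rewrite /cexp cabsM cabsR ger0_norm ?expR_ge0 // /cabs /= cos2Dsin2 sqrtr1.
by rewrite mulr1.
Qed.

(** The tail is [z ^+ K] times a series dominated by the exponential one, because k! <= (k + K)!. *)
Lemma cexp_taylor (z : C) K :
  cabs (cexp z - \sum_(k < K) z ^+ k / k`!%:R) <= cabs z ^+ K * expR (cabs z).
Proof.
rewrite cexpE (csum_shift K (asum_exp z)) addrC addKr.
apply: csum_bnd; apply: (@sumbnd_le _ _ _ (fun k => z ^+ K * (z ^+ k / k`!%:R))).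
  move=> k; rewrite addnC exprD -mulrA !cabsM; apply: ler_wpM2l; first exact: cabs_ge0.
  apply: ler_wpM2l; first exact: cabs_ge0.
  rewrite !cabsV !cabs_nat lef_pV2 ?posrE ?ltr0n ?fact_gt0 // ler_nat.
  elim: K => //= K IH; rewrite addSn factS; apply: leq_trans IH _; exact: leq_pmull.
move=> s us; under eq_bigr do rewrite cabsM.
by rewrite -mulr_sumr cabsX ler_wpM2l ?exprn_ge0 ?cabs_ge0 // sumbnd_exp.
Qed.

Lemma ceE (x : C) : ce x = cexp ((2 * pi : R)%:C * 'i%C * x).
Proof. by []. Qed.

Lemma ceD (x y : C) : ce (x + y) = ce x * ce y.
Proof. by rewrite /ce mulrDr cexpD. Qed.

Lemma ce0 : ce 0 = 1 :> C.
Proof. by rewrite /ce mulr0 cexp0. Qed.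

Lemma ceNr (x : C) : ce x * ce (- x) = 1.
Proof. by rewrite -ceD subrr ce0. Qed.

Lemma ce_neq0 (x : C) : ce x != 0.
Proof. by apply/eqP => h; have := ceNr x; rewrite h mul0r => /esym/eqP; rewrite oner_eq0. Qed.

Lemma ceN (x : C) : ce (- x) = (ce x)^-1.
Proof. by apply: (mulfI (ce_neq0 x)); rewrite ceNr divff ?ce_neq0. Qed.

Lemma ceMn (x : C) n : ce (n%:R * x) = ce x ^+ n.
Proof. by elim: n => [|n IH]; rewrite ?mul0r ?ce0 // -natr1 mulrDl mul1r ceD IH exprSr. Qed.

Lemma ceMz (x : C) (n : int) : ce (n%:~R * x) = ce x ^ n.
Proof.
case: n => n; first exact: ceMn.
by rewrite NegzE -exprnN mulrNz mulNr ceN; congr (_^-1); exact: ceMn.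
Qed.

Lemma cabs_ce (x : C) : cabs (ce x) = expR (- (2 * pi * complex.Im x)).
Proof.
rewrite /ce cabs_cexp; congr expR; case: x => a b /=; ring.
Qed.

Lemma ce1 : ce 1 = 1 :> C.
Proof.
rewrite /ce /cexp mulr1 /= !(mul0r, mulr0, mulr1, subr0, add0r, addr0, sub0r).
have -> : 2 * pi = pi *+ 2 :> R by rewrite mulr_natl.
by rewrite oppr0 expR0 cos2pi sin_mulr2n sinpi mulr0 mul0rn mul1r.
Qed.

Lemma ce_half : ce 2^-1 = -1 :> C.
Proof.
have -> : 2^-1 = (2^-1 : R)%:C by rewrite fmorphV rmorph_nat.
rewrite /ce /cexp /= !(mul0r, mulr0, mulr1, subr0, add0r, addr0, sub0r).
have -> : 2 * pi / 2 = pi :> R by rewrite mulrC mulKf.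
rewrite oppr0 mul0r expR0 cospi sinpi mul1r.
by apply/eqP; rewrite eq_complex /= oppr0 !eqxx.
Qed.

Lemma ce_int (n : int) : ce n%:~R = 1 :> C.
Proof. by rewrite -[n%:~R]mulr1 ceMz ce1 exp1rz. Qed.

Lemma ceDint (x : C) (n : int) : ce (x + n%:~R) = ce x.
Proof. by rewrite ceD ce_int mulr1. Qed.

(** The modulus forces [x] to be real. If r is its fractional part, cos (2 pi r) = 1 makes sin (pi
    r) vanish, which is impossible for 0 < r < 1. *)
Lemma ce_eq1 (x : C) : ce x = 1 -> exists n : int, x = n%:~R.
Proof.
move=> h.
have im : complex.Im x = 0.
  have := cabs_ce x; rewrite h cabs1 => /esym e.
  have /eqP := expR_inj (etrans e (esym (expR0 R))).
  by rewrite oppr_eq0 !mulf_eq0 pnatr_eq0 (gt_eqF (pi_gt0 R)) => /eqP.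
have [n hn] : exists n : int, n%:~R <= complex.Re x < (n + 1)%:~R.
  by exists (Num.floor (complex.Re x)); rewrite floor_itv ?num_real.
exists n; pose y := x - n%:~R; apply/eqP; rewrite -subr_eq0 -/y; apply/eqP.
have hy : ce y = 1 by rewrite /y -mulrNz ceDint.
pose r := complex.Re x - n%:~R.
have r0 : 0 <= r < 1.
  by case/andP: hn; rewrite rmorphD /= /r => a b; apply/andP; split; lra.
have ey : y = r%:C.
  rewrite /y {1}[x]complexE im mulr0 addr0 /r rmorphB; congr (_ - _).
  by rewrite rmorph_int.
rewrite ey; have [r00|r1] : r = 0 \/ 0 < r by case/andP: r0; rewrite le_eqVlt => /orP[/eqP <-|]; [left|right].
  by rewrite r00.
have : 0 < sin (pi * r).
  by apply: sin_gt0_pi; rewrite mulr_gt0 ?pi_gt0 //= gtr_pMr ?pi_gt0 //; case/andP: r0.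
have : cos (2 * pi * r) = 1.
  have := congr1 (@complex.Re R) hy; rewrite ey /ce /cexp /=.
  by rewrite !(mul0r, mulr0, mulr1, subr0, add0r, addr0, sub0r, oppr0) expR0 mul1r.
have -> : 2 * pi * r = (pi * r) *+ 2 by ring.
rewrite cos_mulr2n => h1 h2; exfalso.
have := cos2Dsin2 (pi * r); move: h1 h2; set c := cos _; set s := sin _.
rewrite mulr2n => h1 h2 h3; have h4 : 0 < s ^+ 2 by exact: exprn_gt0.
by clear -h1 h3 h4; lra.
Qed.

End ComplexExponential.

(** * Polynomial approximation to a given order at 0 *)

Section Jets.
Variable R : realType.
Local Notation C := R[i].

(** F = p + O(h^n). The coefficients of [p] below [n] are determined ([jet_unique]), and [p] may
    have any degree, so that products are formed without truncation. *)
Definition jet (n : nat) (F : C -> C) (p : {poly C}) :=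
  exists B d : R, 0 < d /\
    forall h, cabs h < d -> cabs (F h - p.[h]) <= B * cabs h ^+ n.

Lemma poly_bounded (p : {poly C}) :
  exists M : R, 0 <= M /\ forall h, cabs h <= 1 -> cabs p.[h] <= M.
Proof.
elim/poly_ind: p => [|p c [M [M0 hM]]].
  by exists 0; split=> // h _; rewrite horner0 cabs0.
exists (M + cabs c); split=> [|h h1]; first by rewrite addr_ge0 ?cabs_ge0.
rewrite !hornerE; apply: le_trans (cabsD _ _) (lerD _ (lexx _)).
by rewrite cabsM -[M]mulr1 ler_pM ?cabs_ge0 ?hM.
Qed.

Lemma cabs_lim0 (x : C) (M d : R) : 0 < d ->
  (forall h : C, 0 < cabs h < d -> cabs x <= M * cabs h) -> x = 0.
Proof.
move=> d0 h; apply: cabs_small => e e0.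
pose r := Num.min (d / 2) (e / (`|M| + 1)).
have M1 : 0 < `|M| + 1 by rewrite ltr_wpDl.
have r0 : 0 < r by rewrite lt_min !divr_gt0.
have rd : r < d.
  by apply: (@le_lt_trans _ _ (d / 2)); [rewrite ge_min lexx|lra].
have := h r%:C; rewrite cabsR gtr0_norm // r0 rd => /(_ isT) h1.
apply: le_trans h1 _; apply: (@le_trans _ _ ((`|M| + 1) * r)).
  by rewrite ler_wpM2r ?(ltW r0) //; have := ler_norm M; lra.
by rewrite mulrC -ler_pdivlMr // ge_min lexx orbT.
Qed.

(** The constant term tends to 0 with h; then one factor h is divided out. *)
Lemma jet_poly0 n (d : {poly C}) (B e : R) : 0 < e ->
  (forall h, 0 < cabs h < e -> cabs d.[h] <= B * cabs h ^+ n) ->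
  forall k, (k < n)%N -> d`_k = 0.
Proof.
elim: n d => // n IH d e0 hd k kn.
elim/poly_ind: d hd => [|p c _] hd; first by rewrite coef0.
have [M [M0 hM]] := poly_bounded p.
have c0 : c = 0.
  pose e' := Num.min e 1.
  have e'0 : 0 < e' by rewrite lt_min e0 ltr01.
  apply: (@cabs_lim0 _ (`|B| + M) e' e'0) => h /andP[h0].
  rewrite lt_min => /andP[he h1].
  have := hd h; rewrite h0 he => /(_ isT); rewrite !hornerE => h2.
  have -> : c = (p.[h] * h + c) - p.[h] * h by ring.
  apply: le_trans (cabsD _ _) _; rewrite cabsN mulrDl; apply: lerD.
    apply: le_trans h2 _; apply: (@le_trans _ _ (`|B| * cabs h ^+ n.+1)).
      by rewrite ler_wpM2r ?exprn_ge0 ?cabs_ge0 ?ler_norm.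
    rewrite ler_wpM2l // exprS ler_piMr ?cabs_ge0 // exprn_ile1 ?cabs_ge0 //.
    exact: ltW.
  by rewrite cabsM ler_wpM2r ?cabs_ge0 // hM // ltW.
rewrite c0 addr0 coefMX; case: k kn => //= k kn.
apply: (IH p e0) => // h he; have := hd h he; rewrite c0 addr0 !hornerE cabsM.
by case/andP: he => h0 _; rewrite exprSr mulrA ler_pM2r.
Qed.

Lemma jet_unique n F p q : jet n F p -> jet n F q ->
  forall k, (k < n)%N -> p`_k = q`_k.
Proof.
move=> [B [d [d0 h]]] [B' [d' [d'0 h']]] k kn; apply/eqP; rewrite -subr_eq0 -coefB.
have m0 : 0 < Num.min d d' by rewrite lt_min d0 d'0.
apply/eqP; apply: (@jet_poly0 n _ (B + B') _ m0) => // x /andP[_].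
rewrite lt_min => /andP[xd xd']; rewrite hornerD hornerN.
have -> : p.[x] - q.[x] = (F x - q.[x]) - (F x - p.[x]) by ring.
apply: le_trans (cabsD _ _) _; rewrite cabsN mulrDl addrC.
by apply: lerD; [exact: h|exact: h'].
Qed.

Lemma jet_eq n F G p e : 0 < e -> (forall h, cabs h < e -> F h = G h) ->
  jet n F p -> jet n G p.
Proof.
move=> e0 FG [B [d [d0 h]]]; exists B, (Num.min d e).
split=> [|x]; first by rewrite lt_min d0 e0.
by rewrite lt_min => /andP[xd xe]; rewrite -FG //; exact: h.
Qed.

Lemma jet_ext n F G p : F =1 G -> jet n F p -> jet n G p.
Proof. by move=> /funext ->. Qed.

Lemma jet_horner n p : jet n (horner p) p.
Proof. by exists 0, 1; split=> // h _; rewrite subrr cabs0 mul0r. Qed.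

Lemma jetD n F G p q : jet n F p -> jet n G q -> jet n (fun h => F h + G h) (p + q).
Proof.
move=> [B [d [d0 h]]] [B' [d' [d'0 h']]]; exists (B + B'), (Num.min d d').
split=> [|x]; first by rewrite lt_min d0 d'0.
rewrite lt_min => /andP[xd xd']; rewrite hornerD opprD addrACA mulrDl.
by apply: le_trans (cabsD _ _) (lerD _ _); [exact: h|exact: h'].
Qed.

Lemma jetM n F G p q : jet n F p -> jet n G q -> jet n (fun h => F h * G h) (p * q).
Proof.
move=> [B [d [d0 h]]] [B' [d' [d'0 h']]].
have [M [M0 hM]] := poly_bounded p; have [M' [M'0 hM']] := poly_bounded q.
exists (B * (B' + M') + M * B'), (Num.min 1 (Num.min d d')).
split=> [|x]; first by rewrite !lt_min ltr01 d0 d'0.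
rewrite !lt_min => /and3P[x1 xd xd']; rewrite hornerM.
have hB := h x xd; have hB' := h' x xd'.
have x0 := cabs_ge0 x.
have xn : cabs x ^+ n <= 1 by rewrite exprn_ile1 // ltW.
have xn0 : 0 <= cabs x ^+ n by exact: exprn_ge0.
have B'0 : 0 <= B' * cabs x ^+ n by apply: le_trans hB'; exact: cabs_ge0.
have B0 : 0 <= B * cabs x ^+ n by apply: le_trans hB; exact: cabs_ge0.
have mp := hM x (ltW x1); have mq := hM' x (ltW x1).
have -> : F x * G x - p.[x] * q.[x] =
  (F x - p.[x]) * ((G x - q.[x]) + q.[x]) + p.[x] * (G x - q.[x]) by ring.
have b' : B' * cabs x ^+ n <= `|B'|.
  apply: (@le_trans _ _ (`|B'| * cabs x ^+ n)); last by rewrite ler_piMr.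
  by rewrite ler_wpM2r ?ler_norm.
(* The signs of [B] and [B'] can be inferred only where [cabs x ^+ n] is positive. *)
have [xe|xp] : cabs x ^+ n = 0 \/ 0 < cabs x ^+ n.
  by move: xn0; rewrite le_eqVlt => /orP[/eqP <-|]; [left|right].
  rewrite xe !mulr0 in hB hB' *.
  have -> : F x - p.[x] = 0 by apply/eqP; rewrite -cabs_eq0 eq_le hB cabs_ge0.
  have -> : G x - q.[x] = 0 by apply/eqP; rewrite -cabs_eq0 eq_le hB' cabs_ge0.
  by rewrite mul0r mulr0 addr0 cabs0.
have B'p : 0 <= B' by move: B'0; rewrite pmulr_lge0.
have Bp : 0 <= B by move: B0; rewrite pmulr_lge0.
apply: le_trans (cabsD _ _) _; rewrite !cabsM mulrDl; apply: lerD; last first.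
  by rewrite -mulrA ler_pM ?cabs_ge0.
rewrite mulrAC ler_pM ?cabs_ge0 //.
apply: le_trans (cabsD _ _) (lerD (le_trans hB' _) mq).
by rewrite ler_piMr.
Qed.

Lemma jetZ n F p (k : C) : jet n F p -> jet n (fun h => k * F h) (k%:P * p).
Proof.
by move=> h; apply: jet_ext (jetM (jet_horner n k%:P) h) => x; rewrite hornerC.
Qed.

Lemma jet_scale n F p (k : C) : jet n F p ->
  jet n (fun h => F (k * h)) (\poly_(i < size p) (k ^+ i * p`_i)).
Proof.
move=> [B [d [d0 h]]].
have k1 : 0 < cabs k + 1 by rewrite ltr_wpDl ?cabs_ge0.
exists (B * cabs k ^+ n), (d / (cabs k + 1)); split=> [|x hx].
  exact: divr_gt0.
have -> : (\poly_(i < size p) (k ^+ i * p`_i)).[x] = p.[k * x].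
  rewrite horner_poly horner_coef; apply: eq_bigr => i _.
  by rewrite exprMn; ring.
rewrite -mulrA -exprMn -cabsM; apply: h; rewrite cabsM.
have := cabs_ge0 x; have := cabs_ge0 k; move: hx; rewrite ltr_pdivlMr //; nra.
Qed.

Lemma jet_weak n m F p : (m <= n)%N -> jet n F p -> jet m F p.
Proof.
move=> mn [B [d [d0 h]]]; exists `|B|, (Num.min 1 d).
split=> [|x]; first by rewrite lt_min ltr01 d0.
rewrite lt_min => /andP[x1 xd]; apply: le_trans (h x xd) _.
apply: (@le_trans _ _ (`|B| * cabs x ^+ n)).
  by rewrite ler_wpM2r ?exprn_ge0 ?cabs_ge0 ?ler_norm.
by rewrite ler_wpM2l // ler_wiXn2l ?cabs_ge0 // ltW.
Qed.

Lemma jet_cexp2 (a : C) : jet 4 (fun h => cexp (a * h ^+ 2)) (1 + a%:P * 'X^2).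
Proof.
exists (cabs a ^+ 2 * expR (cabs a)), 1; split=> // h h1.
have := cexp_taylor (a * h ^+ 2) 2; rewrite big_ord_recl big_ord1 /= !fact0 expr0 expr1.
have -> : (1 + a%:P * 'X^2).[h] = 1 + a * h ^+ 2.
  by rewrite hornerD hornerM hornerXn !hornerC.
rewrite !divr1 => e; apply: le_trans e _.
rewrite cabsM cabsX (_ : (cabs a * cabs h ^+ 2) ^+ 2 = cabs a ^+ 2 * cabs h ^+ 4); last by ring.
rewrite [X in _ <= X]mulrAC ler_wpM2l //.
  by rewrite mulr_ge0 ?exprn_ge0 ?cabs_ge0.
by rewrite ler_expR ler_piMr ?cabs_ge0 // exprn_ile1 ?cabs_ge0 // ltW.
Qed.

(** Lets identities that hold away from isolated points pass to these points. *)
Lemma jet_continuous n F p : jet n.+1 F p ->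
  (exists2 d : R, 0 < d & forall h, 0 < cabs h < d -> F h = 0) -> p`_0 = 0.
Proof.
move=> [B [d [d0 h]]] [e e0 he].
have m0 : 0 < Num.min d e by rewrite lt_min d0 e0.
apply: (@jet_poly0 n.+1 _ B _ m0) => // y /andP[y0]; rewrite lt_min => /andP[yd ye].
by have := h y yd; rewrite he ?y0 // sub0r cabsN.
Qed.

End Jets.

(** * Fourier series in three variables and their Taylor expansions *)

Section FourierSeries.
Variable R : realType.
Local Notation C := R[i].

Definition qmon (m : fexp) (T z w : C) : C :=
  ce (m.1%:R * T + m.2.1%:~R * z + m.2.2%:~R * w).

Definition fam (c : fexp -> C) (T z w : C) : fexp -> C := fun m => c m * qmon m T z w.

(** The domain is a parameter because the inverse of theta has an expansion only in parts of the
    strip |Im z| < Im t, and products have to be formed there. *)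
Definition isFSon (D : uhp R -> C -> C -> Prop) (c : fexp -> C) (f : jform R) :=
  forall t z w, D t z w ->
    asum (fam c (val t) z w) /\ f t z w = csum (fam c (val t) z w).

Definition everywhere : uhp R -> C -> C -> Prop := fun _ _ _ => True.

Notation isFS := (isFSon everywhere).

Lemma isFS_fourier c f : isFS c f <-> fourier_expansion f c.
Proof.
split=> [h t z w|h t z w _].
  have [ha ->] := h t z w I.
  exact/hassum_cvg/(asum_hassum ha).
have /hassum_cvg hs := h t z w.
by split; [exact: hassum_asum hs|rewrite -(hassum_csum hs)].
Qed.

Lemma qmon_neq0 m T z w : qmon m T z w != 0.
Proof. exact: ce_neq0. Qed.

Lemma qmonM m m' T z w : qmon m T z w * qmon m' T z w =
  qmon ((m.1 + m'.1)%N, (m.2.1 + m'.2.1, m.2.2 + m'.2.2)) T z w.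
Proof. by rewrite /qmon -ceD /= natrD !rmorphD /=; congr ce; ring. Qed.

Lemma cabs_qmon m T z w : cabs (qmon m T z w) =
  expR (- (2 * pi * (m.1%:R * complex.Im T + m.2.1%:~R * complex.Im z
    + m.2.2%:~R * complex.Im w))).
Proof.
rewrite /qmon cabs_ce; congr (expR (- (_ * _))).
have imM (r : R) (x : C) : complex.Im (r%:C * x) = r * complex.Im x.
  by case: x => a b /=; rewrite mul0r addr0.
have imD (x y : C) : complex.Im (x + y) = complex.Im x + complex.Im y.
  by case: x y => a b [c d].
rewrite !imD -(rmorph_nat (real_complex R)) -!(rmorph_int (real_complex R)).
by rewrite !imM.
Qed.

Section Pushforward.
Variables (I : choiceType) (a : I -> C) (h : I -> fexp).

Lemma push_qmon T z w m : asum (fun i => a i * qmon (h i) T z w) ->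
  push h a m * qmon m T z w = push h (fun i => a i * qmon (h i) T z w) m.
Proof.
move=> ha; rewrite /push mulrC -csumZ.
  by apply: eq_csum => i; case: eqP => [->|]; rewrite ?mulr0 // mulrC.
have := asumZ (qmon m T z w)^-1 (asum_restrict (fun i => h i == m) ha).
apply: eq_asum => i; case: eqP => [->|]; rewrite ?mulr0 //.
by rewrite mulrC mulfK ?qmon_neq0.
Qed.

Lemma isFSon_push (D : uhp R -> C -> C -> Prop) (f : jform R) :
  (forall t z w, D t z w -> asum (fun i => a i * qmon (h i) (val t) z w) /\
     f t z w = csum (fun i => a i * qmon (h i) (val t) z w)) ->
  isFSon D (push h a) f.
Proof.
move=> H t z w Dt; have [ha ->] := H t z w Dt.
have e : fam (push h a) (val t) z w = push h (fun i => a i * qmon (h i) (val t) z w).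
  by apply/funext => m; exact: push_qmon.
by rewrite e csum_push //; split=> //; exact: asum_push.
Qed.

Lemma csum_push_weight (l : fexp -> C) T z w :
  asum (fun i => a i * qmon (h i) T z w) ->
  asum (fun i => l (h i) * a i * qmon (h i) T z w) ->
  asum (fun m => l m * push h a m * qmon m T z w) /\
  csum (fun m => l m * push h a m * qmon m T z w) =
  csum (fun i => l (h i) * a i * qmon (h i) T z w).
Proof.
move=> ha hl.
have e : (fun m => l m * push h a m * qmon m T z w) =
    push h (fun i => l (h i) * a i * qmon (h i) T z w).
  apply/funext => m; rewrite -mulrA push_qmon // /push -csumZ; last exact: asum_restrict.
  by apply: eq_csum => i; case: eqP => [<-|]; rewrite ?mulr0 // mulrA.
by rewrite e csum_push //; split=> //; exact: asum_push.
Qed.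

End Pushforward.

Lemma isFSonD D c d f g : isFSon D c f -> isFSon D d g ->
  isFSon D (fun m => c m + d m) (fun t z w => f t z w + g t z w).
Proof.
move=> hf hg t z w Dt; have [a ->] := hf t z w Dt; have [b ->] := hg t z w Dt.
have e : fam (fun m => c m + d m) (val t) z w =
    (fun m => fam c (val t) z w m + fam d (val t) z w m).
  by apply/funext => m; rewrite /fam mulrDl.
by rewrite e csumD //; split=> //; exact: asumD.
Qed.

Definition conv (c d : fexp -> C) : fexp -> C :=
  push (fun p : fexp * fexp => ((p.1.1 + p.2.1)%N,
          (p.1.2.1 + p.2.2.1, p.1.2.2 + p.2.2.2)) : fexp)
       (fun p => c p.1 * d p.2).

Lemma isFSonM D c d f g : isFSon D c f -> isFSon D d g ->
  isFSon D (conv c d) (fun t z w => f t z w * g t z w).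
Proof.
move=> hf hg; apply: isFSon_push => t z w Dt.
have [a ->] := hf t z w Dt; have [b ->] := hg t z w Dt.
have e : (fun p : fexp * fexp => c p.1 * d p.2 *
   qmon ((p.1.1 + p.2.1)%N, (p.1.2.1 + p.2.2.1, p.1.2.2 + p.2.2.2)) (val t) z w) =
   (fun p => fam c (val t) z w p.1 * fam d (val t) z w p.2).
  by apply/funext => p; rewrite -qmonM /fam mulrACA.
by rewrite e csumM //; split=> //; exact: asumM.
Qed.

Lemma isFSonZ D (k : C) c f : isFSon D c f ->
  isFSon D (fun m => k * c m) (fun t z w => k * f t z w).
Proof.
move=> hf t z w Dt; have [a ->] := hf t z w Dt.
have e : fam (fun m => k * c m) (val t) z w = (fun m => k * fam c (val t) z w m).
  by apply/funext => m; rewrite /fam mulrA.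
by rewrite e csumZ //; split=> //; exact: asumZ.
Qed.

Lemma isFSon_monom D (m0 : fexp) :
  isFSon D (fun m => (m == m0)%:R) (fun t z w => qmon m0 (val t) z w).
Proof.
move=> t z w _; split.
  by apply: (@asum_finsupp _ _ _ [:: m0]) => m; rewrite inE /fam => /negbTE ->; rewrite mul0r.
rewrite (@csum1 _ _ _ m0) /fam ?eqxx ?mul1r // => m /negbTE ->.
by rewrite mul0r.
Qed.

Lemma isFSon_sub (D E : uhp R -> C -> C -> Prop) c f :
  (forall t z w, E t z w -> D t z w) -> isFSon D c f -> isFSon E c f.
Proof. by move=> ED hf t z w /ED; exact: hf. Qed.

Lemma isFSon_ext D c (f g : jform R) : (forall t z w, D t z w -> f t z w = g t z w) ->
  isFSon D c f -> isFSon D c g.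
Proof. by move=> fg hf t z w Dt; rewrite -fg //; exact: hf. Qed.

Lemma isFS_subst (u11 u12 u21 u22 : int) c f : isFS c f ->
  isFS (push (fun m : fexp => (m.1, (u11 * m.2.1 + u21 * m.2.2,
                                     u12 * m.2.1 + u22 * m.2.2)) : fexp) c)
    (fun t z w => f t (u11%:~R * z + u12%:~R * w) (u21%:~R * z + u22%:~R * w)).
Proof.
move=> hf; apply: isFSon_push => t z w _.
have [a ->] := hf t (u11%:~R * z + u12%:~R * w) (u21%:~R * z + u22%:~R * w) I.
suff e : (fun i : fexp => c i * qmon (i.1, (u11 * i.2.1 + u21 * i.2.2,
    u12 * i.2.1 + u22 * i.2.2)) (val t) z w) =
  fam c (val t) (u11%:~R * z + u12%:~R * w) (u21%:~R * z + u22%:~R * w).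
  by rewrite e.
apply/funext => m; rewrite /fam /qmon /=; congr (_ * ce _).
by rewrite !rmorphD !rmorphM /=; ring.
Qed.

Definition fweight (m : fexp) : R := m.1%:R + `|m.2.1%:~R| + `|m.2.2%:~R|.

Lemma fweight_ge0 m : 0 <= fweight m.
Proof. by rewrite !addr_ge0. Qed.

(** Lowering Im T by d and moving Im z and Im w by d against the signs of r1 and r2 multiplies the
    modulus of a term by exp (2 pi d (n + |r1| + |r2|)). The result is a term of one of four
    convergent series, so convergence everywhere improves to exponential decay. *)
Lemma fam_weight (c : fexp -> C) (T z w : C) :
  (forall T z w, 0 < complex.Im T -> asum (fam c T z w)) -> 0 < complex.Im T ->
  exists2 e : R, 0 < e & asum (fun m => fam c T z w m * (expR (e * fweight m))%:C).
Proof.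
move=> hc T0; pose d := complex.Im T / 2; have d0 : 0 < d by rewrite divr_gt0.
exists (2 * pi * d); first by rewrite !mulr_gt0 ?pi_gt0.
pose sh (x : C) (r : R) : C := x + 'i%C * r%:C.
have imsh x r : complex.Im (sh x r) = complex.Im x + r.
  by case: x => a b; rewrite /sh /=; ring.
pose F (b1 b2 : bool) := fam c (sh T (- d)) (sh z (if b1 then d else - d))
                               (sh w (if b2 then d else - d)).
have hF b1 b2 : asum (fun m => (cabs (F b1 b2 m))%:C).
  apply: (@asum_le _ _ _ (F b1 b2)) => [m|].
    by rewrite cabsR ger0_norm ?cabs_ge0.
  by apply: hc; rewrite imsh /d; lra.
have := asumD (asumD (hF false false) (hF false true)) (asumD (hF true false) (hF true true)).
apply: asum_le => m; rewrite -!rmorphD cabsR ger0_norm; last by rewrite !addr_ge0 ?cabs_ge0.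
have key : cabs (fam c T z w m * (expR (2 * pi * d * fweight m))%:C) =
    cabs (F (m.2.1%:~R < 0 :> R) (m.2.2%:~R < 0 :> R) m).
  rewrite /F /fam cabsM 2!(cabsM (c m)) -mulrA; congr (_ * _).
  rewrite !cabs_qmon cabsR ger0_norm ?expR_ge0 // -expRD; congr expR.
  rewrite !imsh /fweight.
  have ab (x : R) : x * (if x < 0 then d else - d) = - (d * `|x|).
    by case: (ltrP x 0) => [/ltr0_norm|/ger0_norm] ->; ring.
  rewrite !mulrDr !ab; ring.
rewrite key; have q := (fun b1 b2 => cabs_ge0 (F b1 b2 m)).
have := q false false; have := q false true; have := q true false; have := q true true.
by case: (_ < _); case: (_ < _); lra.
Qed.

Lemma asum_weight_le (g y : fexp -> C) (e B : R) :
  asum (fun m => g m * (expR (e * fweight m))%:C) ->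
  (forall m, cabs (y m) <= B * expR (e * fweight m)) -> asum (fun m => g m * y m).
Proof.
move=> hg hy; apply: asum_le (asumZ B%:C hg) => m.
rewrite !cabsM !cabsR mulrCA; apply: ler_wpM2l; first exact: cabs_ge0.
apply: le_trans (hy m) _; rewrite (ger0_norm (expR_ge0 _)).
by rewrite ler_wpM2r ?expR_ge0 ?ler_norm.
Qed.

Lemma csum_weight_bnd (g : fexp -> C) (e : R) :
  asum (fun m => g m * (expR (e * fweight m))%:C) ->
  exists2 S : R, 0 <= S & forall (y : fexp -> C) (B : R), 0 <= B ->
    (forall m, cabs (y m) <= B * expR (e * fweight m)) ->
    cabs (csum (fun m => g m * y m)) <= B * S.
Proof.
move=> [S hS]; exists S => [|y B B0 hy]; first by have := hS nil isT; rewrite big_nil.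
apply: csum_bnd => s us; apply: le_trans (ler_wpM2l B0 (hS s us)).
rewrite mulr_sumr; apply: ler_sum => m _; rewrite !cabsM cabsR mulrCA.
rewrite ler_wpM2l ?cabs_ge0 //; apply: le_trans (hy m) _.
by rewrite ler_wpM2l // ler_norm.
Qed.

Definition lin_exp (m : fexp) (h1 h2 h3 : C) : C :=
  (2 * pi : R)%:C * 'i%C * (m.1%:R * h1 + m.2.1%:~R * h2 + m.2.2%:~R * h3).

Lemma qmonD m T z w h1 h2 h3 : qmon m (T + h1) (z + h2) (w + h3) =
  qmon m T z w * cexp (lin_exp m h1 h2 h3).
Proof. by rewrite /lin_exp -ceE /qmon -ceD; congr ce; ring. Qed.

Lemma cabs_lin_exp m h1 h2 h3 (r : R) :
  cabs h1 <= r -> cabs h2 <= r -> cabs h3 <= r ->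
  cabs (lin_exp m h1 h2 h3) <= 2 * pi * r * fweight m.
Proof.
move=> a1 a2 a3; have p0 : 0 <= 2 * pi :> R by rewrite mulr_ge0 ?pi_ge0.
have ci : cabs ('i%C : C) = 1 by rewrite /cabs /= expr0n expr1n add0r sqrtr1.
rewrite /lin_exp !cabsM cabsR ci mulr1 ger0_norm // -[X in _ <= X]mulrA; apply: ler_wpM2l => //.
have cz (n : int) : cabs (n%:~R : C) = `|n%:~R|.
  by rewrite -(rmorph_int (real_complex R)) cabsR.
apply: le_trans (cabsD _ _) _; apply: le_trans (lerD (cabsD _ _) (lexx _)) _.
rewrite /fweight !mulrDr !cabsM !cz cabs_nat.
by rewrite [r * _]mulrC [r * `|_|]mulrC [r * `|m.2.2%:~R|]mulrC !lerD ?ler_wpM2l.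
Qed.

(** One [e] and one [S] serve all orders [K] and all small displacements: order 2 gives
    differentiability, the higher orders give jets, and the summability clause covers polynomial
    weights in the exponents. *)
Lemma fam_taylor (c : fexp -> C) (T z w : C) :
  (forall T z w, 0 < complex.Im T -> asum (fam c T z w)) -> 0 < complex.Im T ->
  exists e S : R, [/\ 0 < e,
   (forall K h1 h2 h3, asum (fun m => fam c T z w m * lin_exp m h1 h2 h3 ^+ K)) &
   forall K (r : R) h1 h2 h3, 0 <= r <= e ->
     cabs h1 <= r -> cabs h2 <= r -> cabs h3 <= r ->
     cabs (csum (fam c (T + h1) (z + h2) (w + h3)) - \sum_(k < K)
        csum (fun m => fam c T z w m * lin_exp m h1 h2 h3 ^+ k) / k`!%:R)
     <= S * K`!%:R / e ^+ K * r ^+ K].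
Proof.
move=> hc T0; have [e e0 he] := fam_weight z w hc T0.
have [S S0 hS] := csum_weight_bnd he.
have p0 : 0 < 2 * pi :> R by rewrite mulr_gt0 ?pi_gt0.
(* Within this radius the exponent of a displacement stays below half the available weight; the
   other half absorbs the power [K] through x^K <= K! e^x. *)
pose e1 := e / (2 * pi) / 2; have e10 : 0 < e1 by rewrite !divr_gt0.
have e1E : 2 * pi * e1 = e / 2 by rewrite /e1 mulrC mulrAC divfK ?gt_eqF.
clearbody e1.
have W0 := fweight_ge0.
have pn : (pi : R) != 0 by rewrite gt_eqF ?pi_gt0.
have en : e != 0 by rewrite gt_eqF.
have hpow K h1 h2 h3 : asum (fun m => fam c T z w m * lin_exp m h1 h2 h3 ^+ K).
  pose r := cabs h1 + cabs h2 + cabs h3.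
  have [q1 q2 q3] : [/\ cabs h1 <= r, cabs h2 <= r & cabs h3 <= r].
    by have := cabs_ge0 h1; have := cabs_ge0 h2; have := cabs_ge0 h3; rewrite /r; split; lra.
  have r0 : 0 <= r by apply: le_trans q1; exact: cabs_ge0.
  apply: (asum_weight_le (B := (2 * pi * r / e) ^+ K * K`!%:R) he) => m.
  rewrite cabsX; have := cabs_lin_exp m q1 q2 q3 => q.
  have -> : (2 * pi * r / e) ^+ K * K`!%:R * expR (e * fweight m) =
            (2 * pi * r / e) ^+ K * (K`!%:R * expR (e * fweight m)) by ring.
  apply: le_trans (ler_wpM2l _ (pow_le_exp K (_ : 0 <= e * fweight m))).
  - rewrite -exprMn; apply: lerXn2r; rewrite ?nnegrE ?cabs_ge0 //.
      by rewrite mulr_ge0 ?(mulr_ge0 _ (W0 m)) ?divr_ge0 ?mulr_ge0 ?pi_ge0 // ltW.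
    apply: le_trans q _; rewrite le_eqVlt; apply/orP; left; apply/eqP.
    by field; rewrite gt_eqF.
  - by rewrite exprn_ge0 // divr_ge0 ?mulr_ge0 ?pi_ge0 // ltW.
  - by rewrite mulr_ge0 // ltW.
exists e1, S; split=> // K r h1 h2 h3 /andP[r0 re] q1 q2 q3.
have hb m : cabs (lin_exp m h1 h2 h3) <= e * fweight m / 2.
  apply: le_trans (cabs_lin_exp m q1 q2 q3) _.
  have -> : e * fweight m / 2 = 2 * pi * e1 * fweight m.
    by rewrite e1E; ring.
  by rewrite ler_wpM2r // ler_wpM2l // ltW.
have hs : (fam c (T + h1) (z + h2) (w + h3)) =1
    (fun m => fam c T z w m * cexp (lin_exp m h1 h2 h3)).
  by move=> m; rewrite /fam qmonD mulrA.
have half m : e * fweight m / 2 <= e * fweight m.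
  by have := mulr_ge0 (ltW e0) (W0 m); lra.
have ha : asum (fun m => fam c T z w m * cexp (lin_exp m h1 h2 h3)).
  apply: (asum_weight_le (B := 1) he) => m; rewrite mul1r cabs_cexp ler_expR.
  by apply: le_trans (ler_norm _) (le_trans (Re_le_cabs _) (le_trans (hb m) (half m))).
rewrite (eq_csum hs).
have -> : \sum_(k < K) csum (fun m => fam c T z w m * lin_exp m h1 h2 h3 ^+ k) / k`!%:R =
   csum (fun m => fam c T z w m * \sum_(k < K) (lin_exp m h1 h2 h3 ^+ k / k`!%:R)).
  rewrite (eq_csum (g := fun m => \sum_(k < K) (k`!%:R^-1 *
     (fam c T z w m * lin_exp m h1 h2 h3 ^+ k)))); last first.
    by move=> m; rewrite mulr_sumr; apply: eq_bigr => k _; rewrite mulrA mulrC.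
  rewrite csum_sum; last by move=> k; apply: asumZ.
  by apply: eq_bigr => k _; rewrite csumZ // mulrC.
have hb2 : asum (fun m => fam c T z w m * \sum_(k < K) (lin_exp m h1 h2 h3 ^+ k / k`!%:R)).
  apply: (@eq_asum _ _ (fun m => \sum_(k < K) (k`!%:R^-1 *
     (fam c T z w m * lin_exp m h1 h2 h3 ^+ k)))); last by apply: asum_sum => k; exact: asumZ.
  by move=> m; rewrite mulr_sumr; apply: eq_bigr => k _; rewrite [RHS]mulrA mulrC.
rewrite -csumB //.
rewrite (eq_csum (g := fun m => fam c T z w m * (cexp (lin_exp m h1 h2 h3) -
   \sum_(k < K) (lin_exp m h1 h2 h3 ^+ k / k`!%:R)))); last by move=> m; rewrite mulrBr.
have -> : S * K`!%:R / e1 ^+ K * r ^+ K = K`!%:R * (r / e1) ^+ K * S.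
  have aux (s f a b : R) : s * f * b * a = f * (a * b) * s by ring.
  by rewrite exprMn exprVn; exact: aux.
apply: hS => [|m]; first by rewrite mulr_ge0 ?exprn_ge0 ?divr_ge0 // ltW.
apply: le_trans (cexp_taylor _ K) _.
apply: (@le_trans _ _ ((r / e1) ^+ K * (e * fweight m / 2) ^+ K * expR (e * fweight m / 2))).
  apply: ler_pM; rewrite ?exprn_ge0 ?cabs_ge0 ?expR_ge0 ?ler_expR //.
  rewrite -exprMn; apply: lerXn2r; rewrite ?nnegrE ?cabs_ge0 //.
    by rewrite mulr_ge0 ?divr_ge0 ?mulr_ge0 // ltW.
  apply: le_trans (cabs_lin_exp m q1 q2 q3) _.
  rewrite le_eqVlt; apply/orP; left; apply/eqP.
  have -> : e * fweight m / 2 = 2 * pi * e1 * fweight m by rewrite e1E; ring.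
  by field; rewrite gt_eqF.
have x0 : 0 <= e * fweight m / 2 by rewrite divr_ge0 ?mulr_ge0 // ltW.
rewrite -mulrA [K`!%:R * _]mulrC -[X in _ <= X]mulrA; apply: ler_wpM2l.
  by rewrite exprn_ge0 // divr_ge0 // ltW.
set x := e * fweight m / 2 in x0 *.
have -> : e * fweight m = x + x by rewrite /x; field.
rewrite expRD mulrA ler_wpM2r ?expR_ge0 //.
exact: pow_le_exp.
Qed.

Lemma fam_jet (c : fexp -> C) (T z w u v : C) K :
  (forall T z w, 0 < complex.Im T -> asum (fam c T z w)) -> 0 < complex.Im T ->
  (forall k, asum (fun m => fam c T z w m * lin_exp m 0 u v ^+ k)) /\
  jet K (fun h => csum (fam c T (z + h * u) (w + h * v)))
    (\poly_(k < K) (csum (fun m => fam c T z w m * lin_exp m 0 u v ^+ k) / k`!%:R)).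
Proof.
move=> hc T0; have [e [S [e0 hp hT]]] := fam_taylor z w hc T0; split=> [k|].
  exact: hp.
pose M := cabs u + cabs v + 1.
have M0 : 0 < M by rewrite /M; have := cabs_ge0 u; have := cabs_ge0 v; lra.
exists (S * K`!%:R / e ^+ K * M ^+ K), (e / M); split=> [|h hh]; first exact: divr_gt0.
have hM (x : C) : cabs x <= M -> cabs (h * x) <= cabs h * M.
  by move=> xM; rewrite cabsM ler_wpM2l ?cabs_ge0.
have re : 0 <= cabs h * M <= e.
  by apply/andP; split; [rewrite mulr_ge0 ?cabs_ge0 // ltW|rewrite -ler_pdivlMr // ltW].
have := hT K (cabs h * M) 0 (h * u) (h * v) re.
rewrite cabs0 addr0 exprMn mulrA mulrAC => /(_ _ _ _) H.
apply: le_trans (H _ _ _).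
- rewrite le_eqVlt; apply/orP; left; apply/eqP; congr (cabs (_ - _)).
  rewrite horner_poly; apply: eq_bigr => k _.
  rewrite mulrAC; congr (_ / _); rewrite mulrC -csumZ //; apply: eq_csum => m.
  rewrite mulrCA -exprMn; congr (_ * _ ^+ _); rewrite /lin_exp; ring.
- by case/andP: re.
- by apply: hM; rewrite /M; have := cabs_ge0 u; have := cabs_ge0 v; lra.
- by apply: hM; rewrite /M; have := cabs_ge0 u; have := cabs_ge0 v; lra.
Qed.

End FourierSeries.
Notation isFS := (isFSon (@everywhere _)).

(** * Uniqueness of Fourier coefficients *)

Section FourierUniqueness.
Variable R : realType.
Local Notation C := R[i].

(** Averages over the (N+1)-st roots of unity replace integrals over the circle: the value is 1 at d
    = 0 and 0 for 0 < |d| <= N. *)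
Let chi (N : nat) (d : int) : C :=
  (N.+1%:R)^-1 * \sum_(k < N.+1) ce (d%:~R * (k%:R / N.+1%:R)).

Let chi_le1 N d : cabs (chi N d) <= 1.
Proof.
rewrite /chi cabsM cabsV cabs_nat mulrC ler_pdivrMr ?ltr0n // mul1r.
apply: le_trans (cabs_sum _ _ _) _.
rewrite (eq_bigr (fun=> 1)) ?sumr_const ?card_ord // => k _.
rewrite cabs_ce (_ : complex.Im _ = 0) ?mulr0 ?oppr0 ?expR0 //.
have -> : d%:~R * (k%:R / N.+1%:R) = (d%:~R * (k%:R / N.+1%:R))%:C :> C.
  by rewrite !rmorphM fmorphV !rmorph_nat rmorph_int.
by [].
Qed.

Let chi0 N : chi N 0 = 1.
Proof.
rewrite /chi (eq_bigr (fun=> 1)) => [|k _]; last by rewrite mul0r ce0.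
by rewrite sumr_const card_ord mulVf // pnatr_eq0.
Qed.

Let chi_eq0 N (d : int) : d != 0 -> (`|d| <= N)%N -> chi N d = 0.
Proof.
move=> d0 dN; have N0 : (N.+1%:R : C) != 0 by rewrite pnatr_eq0.
pose r := ce (d%:~R / N.+1%:R : C).
have r1 : r - 1 != 0.
  rewrite subr_eq0; apply/eqP => /ce_eq1[n /(canRL (divfK N0))].
  rewrite -[N.+1%:R]/(N.+1%:~R) -intrM => /eqP; rewrite eqr_int => /eqP e.
  have n0 : n != 0 by apply: contraNneq d0 => n0; rewrite e n0 mul0r.
  move: dN; rewrite e abszM /=; have : (0 < `|n|)%N by rewrite absz_gt0.
  by move=> h; rewrite leqNgt => /negP; apply; exact: leq_pmull.
rewrite /chi (eq_bigr (fun k : 'I_N.+1 => r ^+ k)) => [|k _]; last first.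
  by rewrite /r -ceMn mulrCA.
apply/eqP; rewrite mulf_eq0 invr_eq0 (negbTE N0) /=.
by rewrite -(mulrI_eq0 _ (lregP r1)) -subrX1 /r -ceMn mulrCA divff // mulr1 ce_int subrr.
Qed.

(** Averaging the vanishing sums against a character gives the family weighted by [chi N (h i - n)];
    as N grows, dominated convergence leaves the fibre over [n]. *)
Lemma char_unique (I : choiceType) (h : I -> int) (c : I -> C) : asum c ->
  (forall x : R, csum (fun i => c i * ce ((h i)%:~R * x%:C)) = 0) ->
  forall n, csum (fun i => if h i == n then c i else 0) = 0.
Proof.
move=> hc hx n.
have cabs1' i (x : R) : cabs (c i * ce ((h i)%:~R * x%:C)) = cabs (c i).
  rewrite cabsM cabs_ce (_ : complex.Im _ = 0) ?mulr0 ?oppr0 ?expR0 ?mulr1 //.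
  by have -> : (h i)%:~R * x%:C = ((h i)%:~R * x)%:C :> C by rewrite rmorphM rmorph_int.
have hcx (x : R) : asum (fun i => c i * ce ((h i)%:~R * x%:C)).
  by apply: asum_le hc => i; rewrite cabs1'.
have av N : csum (fun i => c i * chi N (h i - n)) = 0.
  pose x (k : nat) : R := k%:R / N.+1%:R.
  have xE k : (x k)%:C = k%:R / N.+1%:R :> C by rewrite rmorphM fmorphV !rmorph_nat.
  rewrite (eq_csum (g := fun i => \sum_(k < N.+1) ((N.+1%:R)^-1 * ce (- n%:~R * (x k)%:C)) *
      (c i * ce ((h i)%:~R * (x k)%:C)))); last first.
    move=> i; rewrite /chi mulr_sumr mulr_sumr; apply: eq_bigr => k _; rewrite xE.
    have -> : (h i - n)%:~R * (k%:R / N.+1%:R) =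
        - n%:~R * (k%:R / N.+1%:R) + (h i)%:~R * (k%:R / N.+1%:R) :> C.
      by rewrite rmorphB /=; ring.
    by rewrite ceD; move: (ce _) (ce _) => a b; ring.
  rewrite csum_sum; last by move=> k; exact: asumZ.
  by rewrite big1 // => k _; rewrite csumZ // hx mulr0.
have {av} : seqlim (fun=> 0) (csum (fun i => if h i == n then c i else 0)).
  have -> : (fun=> 0) = (fun N => csum (fun i => c i * chi N (h i - n))).
    by apply/funext => N; rewrite av.
  apply: (csum_dominated hc _ _).2 => [N i|i].
    by rewrite cabsM ler_piMr ?cabs_ge0 ?chi_le1.
  move=> e e0; exists `|h i - n|%N => N hN; case: eqP => [->|/eqP ne].
    by rewrite subrr chi0 mulr1 subrr cabs0 ltW.
  by rewrite chi_eq0 ?subr_eq0 // mulr0 subrr cabs0 ltW.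
move=> h0; apply: (seqlim_unique h0) => e e0; exists 0%N => m _.
by rewrite subrr cabs0 ltW.
Qed.

Lemma torus_unique (I : choiceType) (h1 h2 h3 : I -> int) (c : I -> C) : asum c ->
  (forall x1 x2 x3 : R, csum (fun i => c i *
     ce ((h1 i)%:~R * x1%:C + (h2 i)%:~R * x2%:C + (h3 i)%:~R * x3%:C)) = 0) ->
  forall n1 n2 n3, csum (fun i =>
    if [&& h1 i == n1, h2 i == n2 & h3 i == n3] then c i else 0) = 0.
Proof.
move=> hc hx n1 n2 n3.
have im0 (r : R) : cabs (ce r%:C) = 1 by rewrite cabs_ce /= mulr0 oppr0 expR0.
have reT (k : int) (x : R) : k%:~R * x%:C = (k%:~R * x)%:C :> C by rewrite rmorphM rmorph_int.
have s1 x2 x3 : csum (fun i => if h1 i == n1 then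
    c i * ce ((h2 i)%:~R * x2%:C + (h3 i)%:~R * x3%:C) else 0) = 0.
  apply: char_unique => [|x1].
    by apply: asum_le hc => i; rewrite cabsM !reT -rmorphD im0 mulr1.
  rewrite -[RHS](hx x1 x2 x3); apply: eq_csum => i.
  by rewrite -mulrA -ceD; congr (_ * ce _); ring.
pose c1 i := if h1 i == n1 then c i else 0.
have hc1 : asum c1 by exact: asum_restrict.
have s2 x3 : csum (fun i => if h2 i == n2 then c1 i * ce ((h3 i)%:~R * x3%:C) else 0) = 0.
  apply: char_unique => [|x2].
    by apply: asum_le hc1 => i; rewrite cabsM reT im0 mulr1.
  rewrite -[RHS](s1 x2 x3); apply: eq_csum => i; rewrite /c1.
  by case: ifP => _; rewrite ?mul0r // -mulrA -ceD addrC.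
pose c2 i := if h2 i == n2 then c1 i else 0.
have hc2 : asum c2 by exact: asum_restrict.
have := @char_unique _ h3 c2 hc2 _ n3.
have -> : (fun i => if h3 i == n3 then c2 i else 0) = (fun i =>
    if [&& h1 i == n1, h2 i == n2 & h3 i == n3] then c i else 0).
  by apply/funext => i; rewrite /c2 /c1; do 3 case: (_ == _).
apply=> x3; rewrite -[RHS](s2 x3); apply: eq_csum => i; rewrite /c2.
by case: ifP => _; rewrite ?mul0r.
Qed.

Lemma qmon_real m (T z w : C) (x1 x2 x3 : R) :
  qmon m (T + x1%:C) (z + x2%:C) (w + x3%:C) = qmon m T z w *
  ce ((Posz m.1)%:~R * x1%:C + m.2.1%:~R * x2%:C + m.2.2%:~R * x3%:C).
Proof. by rewrite /qmon -ceD; congr ce; rewrite -[(Posz _)%:~R]/(_%:R); ring. Qed.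

Lemma fam_unique (c : fexp -> C) (T z w : C) : asum (fam c T z w) ->
  (forall x1 x2 x3 : R, csum (fam c (T + x1%:C) (z + x2%:C) (w + x3%:C)) = 0) ->
  forall m, c m = 0.
Proof.
move=> hc hx m.
have := @torus_unique _ (fun m => Posz m.1) (fun m => m.2.1) (fun m => m.2.2) _ hc.
move=> /(_ _ (Posz m.1) m.2.1 m.2.2) H.
have : fam c T z w m = 0.
  rewrite -[RHS]H => [|x1 x2 x3].
    rewrite (@csum1 _ _ _ m) ?eqxx // => -[n [r s]] ne /=.
    case: ifP => // /and3P[/eqP[e1] /eqP e2 /eqP e3].
    by case/negP: ne; rewrite e1 e2 e3; case: (m) => [? []].
  rewrite -[RHS](hx x1 x2 x3); apply: eq_csum => i.
  by rewrite /fam qmon_real mulrA.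
by rewrite /fam => /eqP; rewrite mulf_eq0 (negbTE (qmon_neq0 _ _ _ _)) orbF => /eqP.
Qed.

Lemma Im_real (T : C) (x : R) : complex.Im (T + x%:C) = complex.Im T.
Proof. by case: T => a b /=; rewrite addr0. Qed.

Definition uhpi : uhp R := exist _ ('i%C : C) (ltr01 : 0 < complex.Im ('i%C : C)).

Definition uhp_shift (t : uhp R) (x : R) : uhp R :=
  exist _ (val t + x%:C) (eq_ind_r (fun u => is_true (0 < u)) (valP t) (Im_real (val t) x)).

(** Real translates of a single point suffice, so that uniqueness also holds on a strip. *)
Lemma isFSon_unique (D : uhp R -> C -> C -> Prop) c d f t z w :
  (forall x1 x2 x3 : R, D (uhp_shift t x1) (z + x2%:C) (w + x3%:C)) ->
  isFSon D c f -> isFSon D d f -> c = d.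
Proof.
move=> hD hc hd; apply/funext => m; apply/eqP; rewrite -subr_eq0; apply/eqP.
have hh x1 x2 x3 : asum (fam (fun m => c m - d m) (val t + x1%:C) (z + x2%:C) (w + x3%:C)) /\
    csum (fam (fun m => c m - d m) (val t + x1%:C) (z + x2%:C) (w + x3%:C)) = 0.
  have [a ea] := hc _ _ _ (hD x1 x2 x3); have [b eb] := hd _ _ _ (hD x1 x2 x3).
  have -> : fam (fun m => c m - d m) (val t + x1%:C) (z + x2%:C) (w + x3%:C) =
     (fun m => fam c (val t + x1%:C) (z + x2%:C) (w + x3%:C) m -
               fam d (val t + x1%:C) (z + x2%:C) (w + x3%:C) m).
    by apply/funext => k; rewrite /fam mulrBl.
  split; first by apply: asumD => //; exact: asumN.
  by rewrite csumB // -ea -eb subrr.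
apply: (@fam_unique (fun m => c m - d m) (val t) z w) => [|x1 x2 x3].
  by have [] := hh 0 0 0; rewrite !addr0.
by have [] := hh x1 x2 x3.
Qed.

Lemma isFS_unique (c d : fexp -> C) (f : jform R) : isFS c f -> isFS d f -> c = d.
Proof. exact: (@isFSon_unique _ _ _ _ uhpi 0 0). Qed.

Lemma fourier_coefE (c : fexp -> C) (f : jform R) : isFS c f -> fourier_coef f = c.
Proof.
move=> hc; rewrite /fourier_coef; case: xgetP => [d _ hd|/(_ c) []].
  by apply: isFS_unique hc; exact/isFS_fourier.
exact/isFS_fourier.
Qed.

Lemma isFS_asum (c : fexp -> C) (f : jform R) : isFS c f ->
  forall T z w, 0 < complex.Im T -> asum (fam c T z w).
Proof. by move=> hf T z w T0; have [] := hf (exist _ T T0) z w I. Qed.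

End FourierUniqueness.

(** * Complex differentiability of Fourier series *)

Section FourierHolomorphic.
Variable R : realType.
Local Notation C := R[i].

Definition linform3 (a1 a2 a3 : C) (p : C * C * C) : C :=
  a1 * p.1.1 + a2 * p.1.2 + a3 * p.2.

Lemma linform3_linear a1 a2 a3 : linear (linform3 a1 a2 a3).
Proof. by move=> k [[x1 x2] x3] [[y1 y2] y3]; rewrite /linform3 /= /GRing.scale /=; ring. Qed.

HB.instance Definition _ a1 a2 a3 :=
  GRing.isLinear.Build C (C * C * C)%type C _ (linform3 a1 a2 a3) (linform3_linear a1 a2 a3).

Lemma linform3_continuous a1 a2 a3 : continuous (linform3 a1 a2 a3).
Proof.
move=> p; apply: cvgD; first apply: cvgD.
- by apply: cvgM; [exact: cvg_cst|apply: cvg_comp; [exact: cvg_fst|exact: cvg_fst]].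
- by apply: cvgM; [exact: cvg_cst|apply: cvg_comp; [exact: cvg_fst|exact: cvg_snd]].
- by apply: cvgM; [exact: cvg_cst|exact: cvg_snd].
Qed.

(** The Taylor estimate of order 2 exhibits the differential, whose linearity is that of [lin_exp]
    in the displacement. *)
Lemma isFS_holomorphic (c : fexp -> C) (f : jform R) : isFS c f -> holomorphic f.
Proof.
move=> hf t z w; have T0 := valP t.
have [e [S [e0 hp hT]]] := fam_taylor z w (isFS_asum hf) T0.
pose L h1 h2 h3 := csum (fun m => fam c (val t) z w m * lin_exp m h1 h2 h3).
have LE h1 h2 h3 : L h1 h2 h3 = linform3 (L 1 0 0) (L 0 1 0) (L 0 0 1) (h1, h2, h3).
  have hp1 a1 a2 a3 : asum (fun m => fam c (val t) z w m * lin_exp m a1 a2 a3).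
    by apply: eq_asum (hp 1%N a1 a2 a3) => m; rewrite expr1.
  rewrite /linform3 /= ![_ * h1]mulrC ![_ * h2]mulrC ![_ * h3]mulrC /L -!csumZ //.
  rewrite -!csumD; do ?[exact: asumZ|apply: asumD].
  by apply: eq_csum => m; rewrite /lin_exp; ring.
pose V : normedModType C := (C * C * C)%type; pose W : normedModType C := C.
pose df : {linear V -> W} := linform3 (L 1 0 0) (L 0 1 0) (L 0 0 1).
pose F : V -> W := fun p => f (insubd t p.1.1) p.1.2 p.2.
pose x0 : V := (val t, z, w).
have cdf : continuous df by exact: linform3_continuous.
have expn : F \o shift x0 = cst (F x0) + df +o_ (0 : V) id.
  apply/eqaddoP => eps eps0.
  have [E E0 epsE] : exists2 E : R, 0 < E & eps = E%:C.
    move: eps0; rewrite ltcE => /andP[/eqP i0 r0]; exists (complex.Re eps) => //.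
    have {}i0 : complex.Im eps = 0 by rewrite i0.
    by rewrite [LHS]complexE i0 mulr0 addr0.
  pose B := `|S * 2`!%:R / e ^+ 2| + 1.
  have B0 : 0 < B by rewrite ltr_wpDl.
  (* The bound by Im t keeps t + h1 in the upper half-plane, where [insubd] returns its argument and
     not the default. *)
  pose d := Num.min (Num.min e (complex.Im (val t))) (E / B).
  have d0 : 0 < d by rewrite !lt_min e0 T0 divr_gt0.
  have nb : \forall h \near (0 : V), `|h| < d%:C.
    by apply/nbhs_norm0P; exists d%:C => //=; rewrite ltcR.
  apply: filterS nb => h hd.
  pose r := complex.Re `|h|.
  have rE : `|h| = r%:C by rewrite /r RRe_real // normr_real.
  have r0 : 0 <= r by rewrite -ler0c -rE normr_ge0.
  have maxl (x y : C) : 0 <= x -> 0 <= y -> (x <= Num.max x y) /\ (y <= Num.max x y).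
    move=> xx0 yy0; rewrite maxElt; case: ifP => [/ltW->//|/negbT].
    by rewrite -real_leNgt ?ger0_real // => ->.
  have [n1 n2] := maxl `|h.1| `|h.2| (normr_ge0 _) (normr_ge0 _).
  have [n3 n4] := maxl `|h.1.1| `|h.1.2| (normr_ge0 _) (normr_ge0 _).
  rewrite -prod_normE rE in n1 n2; rewrite -prod_normE in n3 n4.
  have m1 := le_trans n3 n1; have m2 := le_trans n4 n1.
  rewrite !normr_cabs !lecR in m1 m2 n2.
  have : r < d by rewrite -ltcR -rE.
  rewrite !lt_min => /andP[/andP[re rt] rE'].
  case: h hd r rE r0 n1 n2 n3 n4 m1 m2 re rt rE' => [[h1 h2] h3] /= _ r rE r0 _ n2 _ _ m1 m2 re rt rE'.
  have i0 : 0 < complex.Im (val t + h1).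
    have := le_trans (Im_le_cabs h1) m1; rewrite ler_norml.
    have -> : complex.Im (val t + h1) = complex.Im (val t) + complex.Im h1.
      by case: (val t) (h1) => a b [? ?].
    lra.
  have r01 : 0 <= r <= e by rewrite r0 ltW.
  have := hT 2 r h1 h2 h3 r01 m1 m2 n2.
  rewrite big_ord_recl big_ord1 /= !divr1.
  have -> : csum (fun m => fam c (val t) z w m * lin_exp m h1 h2 h3 ^+ 0) = f t z w.
    have [_ ->] := hf t z w I; by apply: eq_csum => m; rewrite expr0 mulr1.
  have -> : csum (fun m => fam c (val t) z w m * lin_exp m h1 h2 h3 ^+ bump 0 0) =
      df (h1, h2, h3).
    by rewrite -[RHS]LE; apply: eq_csum => m; rewrite /bump expr1.
  have -> : csum (fam c (val t + h1) (z + h2) (w + h3)) =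
      F ((h1, h2, h3) + x0).
    rewrite /F /=.
    have [_ ->] := hf (insubd t (h1 + val t)) (h2 + z) (h3 + w) I.
    rewrite insubdK; last by rewrite addrC; exact: i0.
    by rewrite addrC [z + _]addrC [w + _]addrC.
  have -> : f t z w = F x0 by rewrite /F /= valKd.
  move=> hh; rewrite rE epsE -rmorphM normr_cabs lecR.
  apply: (le_trans hh); rewrite exprS expr1 mulrA ler_wpM2r //.
  apply: (@le_trans _ _ (B * r)).
    by rewrite ler_wpM2r // /B; have := ler_norm (S * 2`!%:R / e ^+ 2); lra.
  by rewrite mulrC -ler_pdivlMr // ltW.
apply/diff_locallyP; rewrite (diff_unique cdf expn); split=> //.
Qed.

End FourierHolomorphic.

(** * Sums of exponentials and Gaussian bounds *)

Section ExpSums.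
Variable R : realType.
Local Notation C := R[i].

Lemma expsum_pow (I : choiceType) (a al : I -> C) (e : R) : 0 < e ->
  asum (fun i => a i * (expR (e * cabs (al i)))%:C) ->
  forall k, asum (fun i => a i * al i ^+ k).
Proof.
move=> e0 ha k; have f0 : 0 < k`!%:R :> R by rewrite ltr0n fact_gt0.
apply: asum_le (asumZ (k`!%:R / e ^+ k)%:C ha) => i.
rewrite cabsM 2!cabsM !cabsR cabsX mulrCA ler_wpM2l ?cabs_ge0 //.
have ek : 0 < e ^+ k by rewrite exprn_gt0.
rewrite !ger0_norm ?expR_ge0 ?divr_ge0 ?(ltW ek) ?(ltW f0) //.
rewrite mulrAC ler_pdivlMr // -exprMn [_ * e]mulrC.
by apply: pow_le_exp; rewrite mulr_ge0 ?cabs_ge0 // ltW.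
Qed.

(** Theta and the product of three thetas have this shape in the displacement [h], with [al] affine
    in the summation index. *)
Lemma expsum_jet (I : choiceType) (a al : I -> C) (e : R) K : 0 < e ->
  asum (fun i => a i * (expR (e * cabs (al i)))%:C) ->
  jet K (fun h => csum (fun i => a i * cexp (al i * h)))
    (\poly_(k < K) (csum (fun i => a i * al i ^+ k) / k`!%:R)).
Proof.
move=> e0 ha; have hpow := expsum_pow e0 ha; have [S hS] := ha.
have S0 : 0 <= S by have := hS nil isT; rewrite big_nil.
pose d := e / 2; have d0 : 0 < d by rewrite divr_gt0.
have hK : 0 < K`!%:R :> R by rewrite ltr0n fact_gt0.
exists (K`!%:R / d ^+ K * S), d; split=> // h hh.
have y0 i : 0 <= d * cabs (al i) by rewrite mulr_ge0 ?cabs_ge0 // ltW.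
have xl i : cabs (al i * h) <= d * cabs (al i).
  by rewrite cabsM mulrC ler_wpM2r ?cabs_ge0 // ltW.
have dle i : d * cabs (al i) <= e * cabs (al i).
  by rewrite ler_wpM2r ?cabs_ge0 // /d; lra.
have h1 : asum (fun i => a i * cexp (al i * h)).
  apply: asum_le ha => i; rewrite 2!(cabsM (a i)) ler_wpM2l ?cabs_ge0 // cabs_cexp cabsR.
  rewrite ger0_norm ?expR_ge0 // ler_expR.
  by apply: le_trans (ler_norm _) (le_trans (Re_le_cabs _) (le_trans (xl i) (dle i))).
have e2 i : a i * (\sum_(k < K) (al i * h) ^+ k / k`!%:R) =
    \sum_(k < K) (h ^+ k / k`!%:R) * (a i * al i ^+ k).
  by rewrite mulr_sumr; apply: eq_bigr => k _; rewrite exprMn; ring.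
have h2 : asum (fun i => a i * (\sum_(k < K) (al i * h) ^+ k / k`!%:R)).
  by apply: eq_asum (fun i => esym (e2 i)) _; apply: asum_sum => k; exact: asumZ.
have -> : (\poly_(k < K) (csum (fun i => a i * al i ^+ k) / k`!%:R)).[h] =
    csum (fun i => a i * (\sum_(k < K) (al i * h) ^+ k / k`!%:R)).
  rewrite (eq_csum e2) csum_sum; last by move=> k; exact: asumZ.
  by rewrite horner_poly; apply: eq_bigr => k _; rewrite csumZ //; ring.
rewrite -csumB //.
apply: csum_bnd => s us.
have -> : K`!%:R / d ^+ K * S * cabs h ^+ K = (K`!%:R / d ^+ K * cabs h ^+ K) * S by ring.
have q0 : 0 <= K`!%:R / d ^+ K * cabs h ^+ K.
  by rewrite mulr_ge0 ?divr_ge0 ?exprn_ge0 ?cabs_ge0 // ltW.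
apply: le_trans (ler_wpM2l q0 (hS s us)).
rewrite mulr_sumr; apply: ler_sum => i _.
rewrite -mulrBr (cabsM (a i)) (cabsM (a i)) mulrCA ler_wpM2l ?cabs_ge0 // cabsR.
rewrite (ger0_norm (expR_ge0 _)); apply: le_trans (cexp_taylor _ K) _.
apply: (@le_trans _ _ ((cabs h / d) ^+ K * (d * cabs (al i)) ^+ K * expR (d * cabs (al i)))).
  apply: ler_pM; rewrite ?exprn_ge0 ?cabs_ge0 ?expR_ge0 ?ler_expR //.
  rewrite -exprMn cabsM; apply: lerXn2r; rewrite ?nnegrE ?mulr_ge0 ?cabs_ge0 ?invr_ge0 //.
  - exact: ltW.
  - exact: ltW.
  - by rewrite mulrA divfK ?gt_eqF // mulrC.
have -> : e * cabs (al i) = d * cabs (al i) + d * cabs (al i) by rewrite /d; field.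
rewrite expRD exprMn exprVn.
have -> : K`!%:R / d ^+ K * cabs h ^+ K * (expR (d * cabs (al i)) * expR (d * cabs (al i)))
  = cabs h ^+ K / d ^+ K * (K`!%:R * expR (d * cabs (al i))) * expR (d * cabs (al i)).
  by move: (d ^+ K)^-1 (expR _) => u v; ring.
rewrite ler_wpM2r ?expR_ge0 // ler_wpM2l //; first by rewrite divr_ge0 ?exprn_ge0 ?cabs_ge0 // ltW.
exact: pow_le_exp.
Qed.

Lemma gauss_nat (a b : R) : 0 < a ->
  asum (fun n : nat => (expR (- a * n%:R ^+ 2 + b * n%:R))%:C : C).
Proof.
(* The maximum of - a x^2 + (|b| + 1) x; the added 1 leaves a factor e^(-n), hence a geometric
   series. *)
move=> a0; pose c := (`|b| + 1) ^+ 2 / (4 * a).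
have r1 : cabs ((expR (-1))%:C : C) < 1.
  by rewrite cabsR ger0_norm ?expR_ge0 // -[X in _ < X](expR0 R) ltr_expR; lra.
apply: asum_le (asumZ (expR c)%:C (asum_geom r1)) => n.
rewrite cabsM cabsX !cabsR !ger0_norm ?expR_ge0 // -expRM_natl -expRD ler_expR.
have n0 : 0 <= n%:R :> R by [].
have : b * n%:R <= `|b| * n%:R by rewrite ler_wpM2r // ler_norm.
suff : - a * n%:R ^+ 2 + (`|b| + 1) * n%:R <= c.
  by move: (n%:R : R) (`|b|) => x y h1 h2; rewrite mulrN1; lra.
rewrite /c ler_pdivlMr; last by rewrite mulr_gt0.
rewrite -subr_ge0; set y := `|b| + 1; set x := n%:R.
have -> : y ^+ 2 - (- a * x ^+ 2 + y * x) * (4 * a) = (y - 2 * a * x) ^+ 2 by ring.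
exact: sqr_ge0.
Qed.

Lemma gauss_int (a b : R) : 0 < a ->
  asum (fun n : int => (expR (- a * n%:~R ^+ 2 + b * n%:~R))%:C : C).
Proof.
move=> a0; apply: asum_int; first exact: gauss_nat.
have inj : injective S by exact: succn_inj.
have := asum_inj inj (gauss_nat (- b) a0); apply: eq_asum => n /=.
by rewrite NegzE mulrNz sqrrN; congr (expR _)%:C; rewrite -[(Posz _)%:~R]/(_%:R); ring.
Qed.

(* absolute value signs are absorbed by adding the two Gaussian sums with opposite tilt *)
Lemma gauss_int_abs (a b e : R) : 0 < a ->
  asum (fun n : int => (expR (- a * n%:~R ^+ 2 + b * n%:~R + e * `|n%:~R|))%:C : C).
Proof.
move=> a0; have := asumD (gauss_int (b + e) a0) (gauss_int (b - e) a0).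
apply: asum_le => n; rewrite -rmorphD 2!cabsR (ger0_norm (expR_ge0 _)).
rewrite (@ger0_norm _ (_ + _)) ?addr_ge0 ?expR_ge0 //.
case: ler0P => _.
  rewrite -[X in X <= _]add0r; apply: lerD; rewrite ?expR_ge0 // ler_expR.
  by move: (n%:~R : R) => x; lra.
rewrite -[X in X <= _]addr0; apply: lerD; rewrite ?expR_ge0 // ler_expR.
by move: (n%:~R : R) => x; lra.
Qed.

Lemma seqlim_bounded (u : nat -> C) l : seqlim u l ->
  exists2 B : R, 0 <= B & exists N, forall n, (N <= n)%N -> cabs (u n) <= B.
Proof.
move=> h; have [N hN] := h 1 ltr01; exists (cabs l + 1).
  by rewrite addr_ge0 ?cabs_ge0.
exists N => n /hN; have := cabs_dist (u n) l; lra.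
Qed.

Lemma seqlimM (u v : nat -> C) l m :
  seqlim u l -> seqlim v m -> seqlim (fun n => u n * v n) (l * m).
Proof.
move=> hu hv; have [B B0 [N0 hB]] := seqlim_bounded hv.
have c0 := cabs_ge0 l.
have p : 0 < B + cabs l + 1 by lra.
move=> e e0; have e1 : 0 < e / (B + cabs l + 1) by rewrite divr_gt0.
have [N hN] := hu _ e1; have [N' hN'] := hv _ e1.
exists (maxn N0 (maxn N N')) => n; rewrite !geq_max => /and3P[n0 n1 n2].
have -> : u n * v n - l * m = (u n - l) * v n + l * (v n - m) by ring.
apply: le_trans (cabsD _ _) _; rewrite 2!cabsM.
have h1 := ler_pM (cabs_ge0 _) (cabs_ge0 _) (hN n n1) (hB n n0).
have h2 := ler_wpM2l c0 (hN' n n2).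
apply: le_trans (lerD h1 h2) _.
rewrite [cabs l * _]mulrC -mulrDr mulrAC ler_pdivrMr // ler_wpM2l ?(ltW e0) //; lra.
Qed.

Lemma seqlim_cst (l : C) : seqlim (fun=> l) l.
Proof. by move=> e e0; exists 0%N => n _; rewrite subrr cabs0 ltW. Qed.

Lemma seqlim_pow (x : C) : cabs x < 1 -> seqlim (fun n => x ^+ n) 0.
Proof.
move=> h e e0.
have [N hN] := asum_tail (asum_geom h) e0.
exists (\max_(i <- N) i).+1 => n hn; rewrite subr0.
have := hN [:: n] isT; rewrite big_seq1; apply => y; rewrite inE => /eqP ->.
by apply/negP => nN; have := leq_bigmax_seq (F := id) _ nN isT; rewrite leqNgt hn.
Qed.

End ExpSums.

(* Otherwise unification unfolds them into products of real exponentials. *)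
Opaque ce cexp.

(** * Euler's series and the Jacobi triple product *)

Section QProducts.
Variable R : realType.
Local Notation C := R[i].
Local Notation Im := complex.Im.

Lemma ImD (x y : C) : Im (x + y) = Im x + Im y.
Proof. by case: x y => a b [c d]. Qed.

Lemma ImN (x : C) : Im (- x) = - Im x.
Proof. by case: x. Qed.

Lemma ImMr (r : R) (x : C) : Im (r%:C * x) = r * Im x.
Proof. by case: x => a b /=; rewrite mul0r addr0. Qed.

Lemma ImMn (n : nat) (x : C) : Im (n%:R * x) = n%:R * Im x.
Proof. by rewrite -(rmorph_nat (real_complex R)) ImMr. Qed.

Lemma ImMz (n : int) (x : C) : Im (n%:~R * x) = n%:~R * Im x.
Proof. by rewrite -(rmorph_int (real_complex R)) ImMr. Qed.

Variable t : C.
Hypothesis t0 : 0 < Im t.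

Definition qpoch (n : nat) : C := \prod_(i < n) (1 - ce (i.+1%:R * t)).

Let r := expR (- (2 * pi * Im t)) : R.

Let r0 : 0 < r. Proof. exact: expR_gt0. Qed.

Let twopi_gt0 : 0 < 2 * pi :> R. Proof. by rewrite mulr_gt0 ?pi_gt0. Qed.

Lemma cabs_ce_lt1 (z : C) : 0 < Im z -> cabs (ce z) < 1.
Proof.
move=> z0; rewrite cabs_ce -[X in _ < X](expR0 R) ltr_expR oppr_lt0.
by rewrite mulr_gt0.
Qed.

Let r1 : r < 1. Proof. by rewrite /r -cabs_ce cabs_ce_lt1. Qed.

Lemma ce_pow_neq1 n : 1 - ce (n.+1%:R * t) != 0.
Proof.
rewrite subr_eq0; apply/eqP => e.
have : cabs (ce (n.+1%:R * t)) < 1 by apply: cabs_ce_lt1; rewrite ImMn mulr_gt0.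
by rewrite -e cabs1 ltxx.
Qed.

Lemma qpoch_neq0 n : qpoch n != 0.
Proof. by rewrite /qpoch; apply/prodf_neq0 => i _; exact: ce_pow_neq1. Qed.

Lemma qpoch0 : qpoch 0 = 1.
Proof. by rewrite /qpoch big_ord0. Qed.

Lemma qpochS n : qpoch n.+1 = qpoch n * (1 - ce (n.+1%:R * t)).
Proof. by rewrite /qpoch big_ord_recr. Qed.

(** From 1 / (1 - x) <= exp (x / (1 - x)) at x = r^(i+1), together with 1 - x >= 1 - r: the
    exponents are dominated by r^i / (1 - r), whose sum is (1 - r)^-2. *)
Definition qbound : R := expR ((1 - r) ^- 2).

Lemma rpoch_le n : \prod_(i < n) (1 - r ^+ i.+1)^-1 <= qbound.
Proof.
have p : 0 < 1 - r by rewrite subr_gt0.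
apply: (@le_trans _ _ (\prod_(i < n) expR (r ^+ i / (1 - r)))).
  apply: ler_prod => i _.
  have ri : r ^+ i.+1 <= r.
    by rewrite exprS ler_piMr ?(ltW r0) // exprn_ile1 // ltW.
  have q : 0 < 1 - r ^+ i.+1 by lra.
  rewrite invr_ge0 ltW //=.
  have -> : (1 - r ^+ i.+1)^-1 = 1 + r ^+ i.+1 / (1 - r ^+ i.+1).
    by field; rewrite gt_eqF.
  apply: le_trans (expR_ge1Dx _) _; rewrite ler_expR.
  apply: ler_pM; rewrite ?invr_ge0 ?exprn_ge0 ?(ltW q) ?(ltW r0) //.
    by rewrite exprS ler_piMl ?exprn_ge0 ?(ltW r0) // ltW.
  by rewrite lef_pV2 ?posrE //; lra.
rewrite -(big_morph expR (@expRD R) (@expR0 R)) ler_expR -mulr_suml.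
rewrite exprS expr1 invfM ler_wpM2r ?invr_ge0 ?(ltW p) //.
rewrite -(ler_pM2l p) sum_geom_real divff ?gt_eqF // gerBl exprn_ge0 //.
exact: ltW.
Qed.

Lemma cabs_ce_pow n : cabs (ce (n%:R * t)) = r ^+ n.
Proof. by rewrite ceMn cabsX cabs_ce. Qed.

Lemma qpoch_bound n : cabs (qpoch n)^-1 <= \prod_(i < n) (1 - r ^+ i.+1)^-1.
Proof.
rewrite /qpoch -prodfV; elim: n => [|n IH]; first by rewrite !big_ord0 cabs1.
rewrite !big_ord_recr /= cabsM; apply: ler_pM; rewrite ?cabs_ge0 //.
have q : 0 < 1 - r ^+ n.+1 by rewrite subr_gt0 exprn_ilt1 // ltW.
rewrite cabsV lef_pV2 ?posrE //; last first.
  by rewrite lt0r cabs_ge0 cabs_eq0 ce_pow_neq1.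
by have := cabs_dist 1 (ce (n.+1%:R * t)); rewrite cabs1 cabs_ce_pow.
Qed.

Lemma qpoch_le n : cabs (qpoch n)^-1 <= qbound.
Proof. exact: le_trans (qpoch_bound n) (rpoch_le n). Qed.

(* [eulerE z] is the inverse of the product of the [1 - q^n zeta], [n > 0], and [eulerF z] is
   that product (Euler); only the former needs [|q zeta| < 1]. *)
Definition eulerE (z : C) : C := csum (fun k => ce (k%:R * (t + z)) / qpoch k).

Definition eulerF (z : C) : C := csum (fun k : nat =>
  (-1) ^+ k * ce (k%:R * (k%:R + 1) / 2 * t + k%:R * z) / qpoch k).

Lemma asum_eulerE z : 0 < Im (t + z) -> asum (fun k => ce (k%:R * (t + z)) / qpoch k).
Proof.
move=> h; apply: asum_le (asumZ qbound%:C (asum_geom (cabs_ce_lt1 h))) => k.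
rewrite 2!cabsM ceMn mulrC ler_wpM2r ?cabs_ge0 //.
by apply: le_trans (qpoch_le k) _; rewrite cabsR ler_norm.
Qed.

Lemma asum_gauss_qpoch (z : C) : asum (fun k : nat =>
  (-1) ^+ k * ce (k%:R * (k%:R + 1) / 2 * t + k%:R * z)).
Proof.
have a0 : 0 < pi * Im t by rewrite mulr_gt0 ?pi_gt0.
apply: asum_le (gauss_nat (- (pi * Im t) - 2 * pi * Im z) a0) => k.
rewrite cabsM cabsX cabsN cabs1 expr1n mul1r cabs_ce cabsR ger0_norm ?expR_ge0 //.
rewrite ler_expR le_eqVlt; apply/orP; left; apply/eqP.
have -> : k%:R * (k%:R + 1) / 2 = (k%:R * (k%:R + 1) / 2 : R)%:C :> C.
  by rewrite !rmorphM rmorphD fmorphV !rmorph_nat rmorph1.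
by rewrite ImD ImMr ImMn; field.
Qed.

Lemma asum_eulerF z : asum (fun k : nat =>
  (-1) ^+ k * ce (k%:R * (k%:R + 1) / 2 * t + k%:R * z) / qpoch k).
Proof.
apply: asum_le (asumZ qbound%:C (asum_gauss_qpoch z)) => k.
rewrite [leLHS]cabsM [leRHS]cabsM mulrC ler_wpM2r ?cabs_ge0 //.
by apply: le_trans (qpoch_le k) _; rewrite cabsR ler_norm.
Qed.

(** Taken coefficientwise, the factor 1 - q^k of the difference cancels the last factor of
    [qpoch k], and the index moves by one. *)
Lemma eulerE_rec z : 0 < Im (t + z) -> eulerE z * (1 - ce (t + z)) = eulerE (z + t).
Proof.
move=> h; have ha := asum_eulerE h.
have h' : 0 < Im (t + (z + t)) by rewrite addrA ImD addr_gt0.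
have hb := asum_eulerE h'.
suff e : eulerE z - eulerE (z + t) = ce (t + z) * eulerE z.
  by rewrite mulrBr mulr1 [_ * ce _]mulrC -e; ring.
rewrite /eulerE -csumB // (csum_shift 1); last by apply: asumD => //; exact: asumN.
rewrite big_ord1 !mul0r !ce0 subrr add0r -csumZ //; apply: eq_csum => k.
rewrite addn1 -mulrBl qpochS invfM.
have -> : ce (k.+1%:R * (t + (z + t))) = ce (t + z) * ce (k%:R * (t + z)) * ce (k.+1%:R * t).
  by rewrite -!ceD; congr ce; rewrite -natr1; ring.
have -> : ce (k.+1%:R * (t + z)) = ce (t + z) * ce (k%:R * (t + z)).
  by rewrite -!ceD; congr ce; rewrite -natr1; ring.
have n1 := ce_pow_neq1 k; have n2 := qpoch_neq0 k.
by move: (ce _) (ce _) (ce _) n1 (qpoch k) n2 => a b c n1 d n2; field; rewrite n2 n1.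
Qed.

Lemma eulerF_rec z : eulerF z = (1 - ce (t + z)) * eulerF (z + t).
Proof.
have ha := asum_eulerF z; have hb := asum_eulerF (z + t).
suff e : eulerF z - eulerF (z + t) = - ce (t + z) * eulerF (z + t).
  by rewrite mulrBl mul1r -mulNr -e; ring.
rewrite /eulerF -csumB // (csum_shift 1); last by apply: asumD => //; exact: asumN.
rewrite big_ord1 !mul0r !addr0 ce0 subrr add0r -csumZ //; apply: eq_csum => k.
rewrite addn1 -mulrBl qpochS invfM exprS.
set X := k%:R * (k%:R + 1) / 2 * t + k%:R * (z + t).
have -> : ce (k.+1%:R * (k.+1%:R + 1) / 2 * t + k.+1%:R * z) = ce (t + z) * ce X.
  by rewrite -ceD; congr ce; rewrite /X -natr1; field.
have -> : ce (k.+1%:R * (k.+1%:R + 1) / 2 * t + k.+1%:R * (z + t)) =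
   ce (t + z) * ce X * ce (k.+1%:R * t).
  by rewrite -2!ceD; congr ce; rewrite /X -natr1; field.
have n1 := ce_pow_neq1 k; have n2 := qpoch_neq0 k.
move: (ce (t + z)) (ce X) (ce _) n1 (qpoch k) n2 ((-1) ^+ k) => a b c n1 d n2 s.
by field; rewrite n2 n1.
Qed.

(** Every term with k > 0 is damped by q^(k n). *)
Lemma seqlim_ce_pow (f : nat -> C) : asum f ->
  seqlim (fun n => csum (fun k => f k * ce (k%:R * (n%:R * t)))) (f 0%N).
Proof.
move=> hf.
have -> : f 0%N = csum (fun k => if k == 0%N then f k else 0).
  by rewrite (@csum1 _ _ _ 0%N) // => k /negbTE ->.
apply: (csum_dominated hf _ _).2 => [n k|k].
  rewrite (cabsM (f k)) ler_piMr ?cabs_ge0 // !ceMn !cabsX cabs_ce -/r.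
  by rewrite !exprn_ile1 ?exprn_ge0 // ltW.
case: eqP => [->|/eqP k0].
  have -> : (fun n => f 0%N * ce (0%:R * (n%:R * t))) = (fun=> f 0%N).
    by apply/funext => n; rewrite mul0r ce0 mulr1.
  exact: seqlim_cst.
rewrite -[X in seqlim _ X](mulr0 (f k)); apply: seqlimZ.
have -> : (fun n => ce (k%:R * (n%:R * t))) = (fun n => ce (k%:R * t) ^+ n).
  by apply/funext => n; rewrite -ceMn mulrCA.
apply: seqlim_pow; apply: cabs_ce_lt1; rewrite ImMn mulr_gt0 // ltr0n lt0n //.
Qed.

Lemma eulerE_lim z : 0 < Im (t + z) -> seqlim (fun n => eulerE (z + n%:R * t)) 1.
Proof.
move=> h; have := seqlim_ce_pow (asum_eulerE h).
rewrite mul0r ce0 qpoch0 divr1; congr seqlim; apply/funext => n.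
apply: eq_csum => k; rewrite mulrAC; congr (_ / _).
by rewrite -ceD; congr ce; ring.
Qed.

Lemma eulerF_lim z : seqlim (fun n => eulerF (z + n%:R * t)) 1.
Proof.
have := seqlim_ce_pow (asum_eulerF z).
rewrite !mul0r addr0 ce0 qpoch0 divr1 mulr1; congr seqlim; apply/funext => n.
apply: eq_csum => k; rewrite mulrAC; congr (_ / _); rewrite -[LHS]mulrA; congr (_ * _).
by rewrite -ceD; congr ce; ring.
Qed.

(** By the two recursions the product is unchanged under z -> z + t, and along these translates both
    factors tend to 1. *)
Lemma eulerEF z : 0 < Im (t + z) -> eulerE z * eulerF z = 1.
Proof.
move=> h.
have hn n : 0 < Im (t + (z + n%:R * t)).
  by rewrite addrA ImD ImMn ltr_pwDl // mulr_ge0 // ltW.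
have step n : eulerE (z + n%:R * t) * eulerF (z + n%:R * t) = eulerE z * eulerF z.
  elim: n => [|n <-]; first by rewrite mul0r addr0.
  have -> : z + n.+1%:R * t = z + n%:R * t + t by rewrite -natr1; ring.
  by rewrite [eulerF (z + n%:R * t)]eulerF_rec mulrA eulerE_rec.
have := seqlimM (eulerE_lim h) (eulerF_lim z); rewrite mulr1 => h1.
apply: (seqlim_unique _ h1).
have -> : (fun n => eulerE (z + n%:R * t) * eulerF (z + n%:R * t)) =
  (fun=> eulerE z * eulerF z) by apply/funext => n; exact: step.
exact: seqlim_cst.
Qed.

Lemma eulerF_nat n : eulerF (n%:R * t) = eulerF 0 / qpoch n.
Proof.
elim: n => [|n IH]; first by rewrite mul0r /qpoch big_ord0 divr1.
have e := eulerF_rec (n%:R * t); rewrite IH in e.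
have -> : n.+1%:R * t = n%:R * t + t by rewrite -natr1; ring.
have n1 := ce_pow_neq1 n; have n2 := qpoch_neq0 n.
have e2 : t + n%:R * t = n.+1%:R * t by rewrite -natr1; ring.
rewrite e2 in e; apply: (mulfI n1); rewrite -e qpochS invfM.
by move: (ce _) n1 (qpoch n) n2 (eulerF 0) => a n1 b n2 c; field; rewrite n2 n1.
Qed.

Lemma eulerF_neg n : eulerF (- n.+1%:R * t) = 0.
Proof.
elim: n => [|n IH]; rewrite eulerF_rec.
  by rewrite mulN1r subrr ce0 subrr mul0r.
have -> : - n.+2%:R * t + t = - n.+1%:R * t by rewrite -[n.+2]addn1 natrD; ring.
by rewrite IH mulr0.
Qed.

(** [qpoch n] is [eulerF 0] times [eulerE] at n t, and the latter tends to 1. *)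
Lemma qpoch_lim : seqlim qpoch (eulerF 0).
Proof.
have E0 : 0 < Im (t + 0) by rewrite addr0.
have := seqlimM (seqlim_cst (eulerF 0)) (eulerE_lim E0); rewrite mulr1.
congr seqlim; apply/funext => n.
have h : 0 < Im (t + n%:R * t) by rewrite ImD ImMn ltr_pwDl // mulr_ge0 // ltW.
have := eulerEF h; rewrite eulerF_nat add0r => e.
by apply: (mulIf (invr_neq0 (qpoch_neq0 n))); rewrite divff ?qpoch_neq0 // -[RHS]e; ring.
Qed.

Definition jacobiJ (z : C) : C := csum (fun n : int =>
  (-1) ^ n * ce (n%:~R * (n%:~R + 1) / 2 * t + n%:~R * z)).

Lemma cabs_signz (n : int) : cabs ((-1) ^ n : C) = 1.
Proof.
case: n => n; first by rewrite -exprnP cabsX cabsN cabs1 expr1n.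
by rewrite NegzE -exprnN cabsV cabsX cabsN cabs1 expr1n invr1.
Qed.

Lemma cabs_theta_term (n : int) (z : C) :
  cabs ((-1) ^ n * ce (n%:~R * (n%:~R + 1) / 2 * t + n%:~R * z)) =
  expR (- (pi * Im t) * n%:~R ^+ 2 + (- (pi * Im t) - 2 * pi * Im z) * n%:~R).
Proof.
rewrite cabsM cabs_signz mul1r cabs_ce.
have -> : n%:~R * (n%:~R + 1) / 2 = (n%:~R * (n%:~R + 1) / 2 : R)%:C :> C.
  by rewrite !rmorphM rmorphD fmorphV !rmorph_int rmorph1 rmorph_nat.
by rewrite ImD ImMr ImMz; congr expR; field.
Qed.

Lemma asum_jacobiJ z : asum (fun n : int =>
  (-1) ^ n * ce (n%:~R * (n%:~R + 1) / 2 * t + n%:~R * z)).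
Proof.
have a0 : 0 < pi * Im t by rewrite mulr_gt0 ?pi_gt0.
apply: asum_le (gauss_int (- (pi * Im t) - 2 * pi * Im z) a0) => n.
by rewrite cabs_theta_term cabsR ger0_norm ?expR_ge0.
Qed.

Lemma signzD (m n : int) : (-1) ^ (m + n) = (-1) ^ m * (-1) ^ n :> C.
Proof. by rewrite expfzDr // oppr_eq0 oner_eq0. Qed.

Lemma signzN (m : int) : (-1) ^ (- m) = (-1) ^ m :> C.
Proof. by rewrite -exprz_inv invrN invr1. Qed.

(* Andrews' proof: collect the double series of the left-hand side by powers of zeta. *)
Lemma triple_product_E z : 0 < Im (t + z) ->
  eulerE z * jacobiJ z = (1 - ce (- z)) * eulerF (- z) * eulerF 0.
Proof.
move=> h; have hE := asum_eulerE h.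
pose c (n : int) := (-1) ^ n * ce (n%:~R * (n%:~R - 1) / 2 * t - n%:~R * z) : C.
have optz : injective (fun n : int => - n) by exact: oppr_inj.
have cE n : c n = (-1) ^ (- n) * ce ((- n)%:~R * ((- n)%:~R + 1) / 2 * t + (- n)%:~R * z).
  by rewrite /c signzN mulrNz; congr (_ * ce _); ring.
have hc : asum c.
  by apply: eq_asum (asum_inj optz (asum_jacobiJ z)) => n /=; rewrite cE.
have Jc : jacobiJ z = csum c.
  have bN : bijective (fun n : int => - n) by exists (fun n : int => - n) => n; rewrite opprK.
  by rewrite /jacobiJ -(csum_bij bN (asum_jacobiJ z)); apply: eq_csum => n /=; rewrite cE.
pose a (p : int * nat) := c p.1 * (ce (p.2%:R * (t + z)) / qpoch p.2).
have ha : asum a by exact: (asumM hc hE).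
have -> : eulerE z * jacobiJ z = csum a by rewrite Jc mulrC -csumM.
(* The shear n -> n + m separates the exponents, so that the sum over m becomes [eulerF] at n t. *)
pose sh (p : int * nat) : int * nat := (p.1 + p.2%:Z, p.2).
have bsh : bijective sh.
  by exists (fun p : int * nat => (p.1 - p.2%:Z, p.2)) => -[n m]; rewrite /sh /= ?addrK ?subrK.
rewrite -(csum_bij bsh ha) csum_pair; last by apply: asum_inj => //; exact: bij_inj bsh.
have inner n : csum (fun m => (a \o sh) (n, m)) = c n * eulerF (n%:~R * t).
  rewrite /eulerF -csumZ; last exact: asum_eulerF.
  apply: eq_csum => m /=; rewrite /a /sh /= /c signzD -exprnP.
  have -> : (n + m)%:~R * ((n + m)%:~R - 1) / 2 * t - (n + m)%:~R * z =
     (n%:~R * (n%:~R - 1) / 2 * t - n%:~R * z)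
     + (m%:R * (m%:R + 1) / 2 * t + m%:R * (n%:~R * t)) - m%:R * (t + z) :> C.
    by rewrite !rmorphD /= -[m%:~R]/(m%:R); field.
  rewrite 2!ceD.
  have := ceNr (m%:R * (t + z)).
  move: (ce _) (ce _) (ce _) (ce _) ((-1) ^ n) ((-1) ^+ m) (qpoch m)^-1.
  move=> A B D E s1 s2 Q DE; have -> : s1 * s2 * (B * A * D) * (E * Q) =
     s1 * s2 * A * B * Q * (E * D) by ring.
  by rewrite DE; ring.
rewrite (eq_csum inner).
have hsum : asum (fun n : int => c n * eulerF (n%:~R * t)).
  apply: eq_asum inner _; apply: asum_pair_sum.
  by apply: asum_inj => //; exact: bij_inj bsh.
have pinj : injective Posz by move=> x y [].
(* [eulerF] vanishes at the negative multiples of t, which cuts the sum over the integers down to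
   the naturals. *)
rewrite -(csum_inj pinj hsum); last first.
  case=> [n|n] hn; first by case: (hn n).
  by rewrite NegzE mulrNz -[(Posz _)%:~R]/(_%:R) eulerF_neg mulr0.
have -> : (1 - ce (- z)) * eulerF (- z) = eulerF (- z - t).
  by rewrite [RHS]eulerF_rec subrK addrCA subrr addr0.
rewrite mulrC [eulerF (- z - t)]/eulerF -csumZ; last exact: asum_eulerF.
apply: eq_csum => n /=; rewrite -[(Posz n)%:~R]/(n%:R) eulerF_nat /c -exprnP.
have -> : (Posz n)%:~R * ((Posz n)%:~R - 1) / 2 * t - (Posz n)%:~R * z =
  n%:R * (n%:R + 1) / 2 * t + n%:R * (- z - t) :> C.
  by rewrite -[(Posz n)%:~R]/(n%:R); field.
by move: (ce _) (qpoch n)^-1 (eulerF 0) ((-1) ^+ n) => *; ring.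
Qed.

Lemma triple_product z : - Im t < Im z < Im t ->
  jacobiJ z * eulerE z * eulerE (- z) * eulerE 0 = 1 - ce (- z).
Proof.
move=> /andP[h1 h2].
have p1 : 0 < Im (t + z) by rewrite ImD; lra.
have p2 : 0 < Im (t - z) by rewrite ImD ImN; lra.
have p3 : 0 < Im (t + 0) by rewrite addr0.
rewrite [jacobiJ z * _]mulrC triple_product_E //.
have := eulerEF p2; have := eulerEF p3.
move: (eulerE _) (eulerE _) (eulerF _) (eulerF _) (ce _) => A B D E F h h'.
rewrite -[RHS]mulr1 -h -[RHS]mulr1 -h'; ring.
Qed.

End QProducts.

(** * The derivative [derive1] read off from a jet *)

Section JetDerivative.
Variable R : realType.
Local Notation C := R[i].

Lemma jet_derive1 (F : C -> C) (z : C) p :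
  jet 2 (fun h => F (z + h)) p -> derive1 F z = p`_1.
Proof.
move=> [B [d [d0 h]]].
rewrite /derive1; apply: cvg_lim; first exact: norm_hausdorff.
apply/cvgrPdist_le => eps eps0.
have [E E0 epsE] : exists2 E : R, 0 < E & eps = E%:C.
  move: eps0; rewrite ltcE => /andP[/eqP i0 r0]; exists (complex.Re eps) => //.
  have {}i0 : complex.Im eps = 0 by rewrite i0.
  by rewrite [LHS]complexE i0 mulr0 addr0.
have q0 : p`_0 = F z.
  have := h 0; rewrite addr0 cabs0 expr0n mulr0 => /(_ d0) h0.
  have /eqP : F z - p.[0] = 0 by apply/eqP; rewrite -cabs_eq0 eq_le h0 cabs_ge0.
  by rewrite subr_eq0 horner_coef0 => /eqP.
pose q := \poly_(i < size p) p`_i.+2.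
have [M [M0 hM]] := poly_bounded q.
have pE x : p.[x] = p`_0 + p`_1 * x + q.[x] * x ^+ 2.
  have pp : p = (p`_0)%:P + p`_1 *: 'X + q * 'X^2.
    apply/polyP => i; rewrite !coefD coefC coefZ coefX coefMXn.
    case: i => [|[|i]]; rewrite /= ?mulr0 ?mulr1 ?addr0 ?add0r //.
    rewrite subn2 /= coef_poly; case: ltnP => // hi.
    by rewrite nth_default // (leq_trans hi) // -addn2 leq_addr.
  by rewrite {1}pp hornerD hornerD hornerM hornerXn hornerZ hornerX hornerC.
pose B' := `|B| + M + 1; have B'0 : 0 < B' by rewrite /B'; have := normr_ge0 B; lra.
have nb : \forall x \near (0 : C)^', x != 0 /\ cabs x < Num.min (Num.min 1 d) (E / B').
  apply/nbhs_ballP; exists (Num.min (Num.min 1 d) (E / B'))%:C => /=.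
    by rewrite ltcR !lt_min ltr01 d0 divr_gt0.
  move=> x; rewrite -ball_normE /= sub0r normrN normr_cabs ltcR => hx x0.
  by split.
apply: filterS nb => x [x0]; rewrite !lt_min => /andP[/andP[x1 xd] xE].
rewrite normr_cabs epsE lecR /GRing.scale /= [x + z]addrC.
have -> : p`_1 - x^-1 * (F (z + x) - F z) = - (x^-1 * (F (z + x) - p.[x])) - q.[x] * x.
  by rewrite pE q0; field.
apply: le_trans (cabsD _ _) _; rewrite !cabsN 2!cabsM cabsV.
have xp : 0 < cabs x by rewrite lt0r cabs_eq0 x0 cabs_ge0.
have k1 : (cabs x)^-1 * cabs (F (z + x) - p.[x]) <= `|B| * cabs x.
  rewrite mulrC ler_pdivrMr // -mulrA -expr2; apply: le_trans (h x xd) _.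
  by rewrite ler_wpM2r ?exprn_ge0 ?cabs_ge0 ?ler_norm.
have k2 : cabs q.[x] * cabs x <= M * cabs x by rewrite ler_wpM2r ?cabs_ge0 ?hM // ltW.
apply: le_trans (lerD k1 k2) _; rewrite -mulrDl.
have : B' * cabs x <= E by rewrite mulrC -ler_pdivlMr // ltW.
by rewrite /B'; move: (cabs x) xp => c c0; lra.
Qed.

End JetDerivative.

(** * Cauchy products, and a second-order estimate for finite products *)

Section PushAdd.
Variable R : realType.
Local Notation C := R[i].

Lemma push_addn (f g : nat -> C) n :
  push (fun p : nat * nat => (p.1 + p.2)%N) (fun p => f p.1 * g p.2) n =
  \sum_(i < n.+1) f i * g (n - i)%N.
Proof.
rewrite /push (@csum_finsupp _ _ _ [seq (i, (n - i)%N) | i <- iota 0 n.+1]).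
- rewrite big_map -[iota 0 n.+1]/(index_iota 0 n.+1) big_mkord.
  by apply: eq_bigr => i _ /=; rewrite subnKC -1?ltnS // eqxx.
- by rewrite map_inj_uniq ?iota_uniq // => a b [].
- move=> [a b] /negP h /=; case: eqP => // e; case: h; apply/mapP.
  exists a; last by rewrite -e addKn.
  by rewrite mem_iota /= add0n -e ltnS leq_addr.
Qed.

Lemma deriv_geom (x : C) : cabs x < 1 ->
  asum (fun k => k.+1%:R * x ^+ k) /\ csum (fun k => k.+1%:R * x ^+ k) = (1 - x) ^- 2.
Proof.
move=> hx; have ha := asum_geom hx; have hm := asumM ha ha.
have e : push (fun p : nat * nat => (p.1 + p.2)%N) (fun p => x ^+ p.1 * x ^+ p.2) =1
    (fun k => k.+1%:R * x ^+ k).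
  move=> k; rewrite push_addn (eq_bigr (fun=> x ^+ k)) => [|i _].
    by rewrite sumr_const card_ord mulr_natl.
  by rewrite -exprD subnKC // -ltnS.
split; first exact: eq_asum e (asum_push _ hm).
by rewrite -(eq_csum e) csum_push // csumM // csum_geom // expr2 invfM.
Qed.

Lemma deriv_geom_bnd (x : C) : cabs x < 1 ->
  sumbnd (fun k => k.+1%:R * x ^+ k) ((1 - cabs x) ^- 2).
Proof.
move=> hx; have hy : cabs (cabs x)%:C < 1 by rewrite cabsR ger0_norm ?cabs_ge0.
have [ha es] := deriv_geom hy.
move=> s us; rewrite leNgt; apply/negP => lt.
have p0 : 0 < (\sum_(k <- s) cabs (k.+1%:R * x ^+ k) - (1 - cabs x) ^- 2) / 2.
  by rewrite divr_gt0 // subr_gt0.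
have [s0 hs0] := asum_hassum ha p0.
have := hs0 (undup (s ++ s0)) (undup_uniq _).
have sub : {subset s0 <= undup (s ++ s0)}.
  by move=> y ys; rewrite mem_undup mem_cat ys orbT.
move=> /(_ sub); rewrite es.
have -> : (1 - (cabs x)%:C) ^- 2 = ((1 - cabs x) ^- 2)%:C.
  by rewrite fmorphV rmorphXn rmorphB rmorph1.
have -> : \sum_(i <- undup (s ++ s0)) i.+1%:R * (cabs x)%:C ^+ i =
   (\sum_(i <- undup (s ++ s0)) cabs (i.+1%:R * x ^+ i))%:C.
  rewrite rmorph_sum; apply: eq_bigr => i _.
  by rewrite cabsM cabs_nat cabsX rmorphM rmorph_nat rmorphXn.
rewrite -rmorphB cabsR => h1; have := le_trans (ler_norm _) h1.
have : \sum_(k <- s) cabs (k.+1%:R * x ^+ k) <=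
   \sum_(i <- undup (s ++ s0)) cabs (i.+1%:R * x ^+ i).
  apply: big_subset_le; rewrite ?undup_uniq //; first by move=> i; exact: cabs_ge0.
  by move=> y ys; rewrite mem_undup mem_cat ys.
lra.
Qed.

(** The second-order error is fed by the first-order error, and that one by the size of the product;
    hence a simultaneous induction on the three bounds. *)
Lemma prod_taylor (x : nat -> C) n : let s := \sum_(i < n) cabs (x i) in
  cabs (\prod_(i < n) (1 - x i) - 1 + \sum_(i < n) x i) <= s ^+ 2 * expR s.
Proof.
have H m : let s := \sum_(i < m) cabs (x i) in
   [/\ 0 <= s, cabs (\prod_(i < m) (1 - x i)) <= expR s,
     cabs (\prod_(i < m) (1 - x i) - 1) <= s * expR s &
     cabs (\prod_(i < m) (1 - x i) - 1 + \sum_(i < m) x i) <= s ^+ 2 * expR s].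
  elim: m => [|m]; first by rewrite /= !big_ord0 expR0 subrr addr0 cabs0 cabs1 expr0n !mul0r.
  rewrite !big_ord_recr /=.
  set P := \prod_(i < m) _; set S := \sum_(i < m) x i; set s := \sum_(i < m) cabs _.
  set y := x m; set c := cabs y; have c0 : 0 <= c by exact: cabs_ge0.
  have cE : cabs y = c by [].
  case=> s0 h1 h2 h3.
  have e0 : 0 < expR s by exact: expR_gt0.
  have e1 : 1 <= expR c by have := expR_ge1Dx c; lra.
  have e2 : 1 + c <= expR c by exact: expR_ge1Dx.
  have yP : cabs (P * y) <= c * expR s by rewrite cabsM cE mulrC ler_wpM2l.
  have mono (u : R) : 0 <= u -> u * expR s <= u * (expR s * expR c).
    by move=> u0; rewrite ler_wpM2l // ler_pMr.
  rewrite expRD; split.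
  - by rewrite addr_ge0.
  - rewrite cabsM ler_pM ?cabs_ge0 //; apply: le_trans (cabsD _ _) _.
    by rewrite cabsN cabs1 cE.
  - have -> : P * (1 - y) - 1 = (P - 1) - P * y by ring.
    apply: le_trans (cabsD _ _) _; rewrite cabsN; apply: le_trans (lerD h2 yP) _.
    by rewrite -mulrDl mono // addr_ge0.
  - have -> : P * (1 - y) - 1 + (S + y) = (P - 1 + S) - y * (P - 1) by ring.
    apply: le_trans (cabsD _ _) _; rewrite cabsN cabsM cE.
    apply: le_trans (lerD h3 (ler_wpM2l c0 h2)) _.
    rewrite [c * (s * _)]mulrA -mulrDl; apply: (@le_trans _ _ ((s + c) ^+ 2 * expR s)).
      rewrite ler_wpM2r ?(ltW e0) //.
      have := sqr_ge0 c; have := mulr_ge0 s0 c0; move=> a b; nra.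
    by rewrite mono // sqr_ge0.
by have [] := H n.
Qed.

End PushAdd.

(** * The theta function: translations, zeros, product formula *)

Section Theta.
Variable R : realType.
Local Notation C := R[i].
Local Notation Im := complex.Im.
Local Notation tpi := ((2 * pi : R)%:C * 'i%C).

Definition half (n : int) : C := n%:~R + 2^-1.

(** Completing the square absorbs the prefactor q^(1/8) zeta^(1/2), so that translations act by
    reindexing and derivatives by powers of n + 1/2. *)
Definition theta_term (t z : C) (n : int) : C :=
  (-1) ^ n * ce (half n ^+ 2 / 2 * t + half n * z).

Lemma theta_termE t z n : theta_term t z n =
  ce (t / 8 + z / 2) * ((-1) ^ n * ce (n%:~R * (n%:~R + 1) / 2 * t + n%:~R * z)).
Proof.
by rewrite /theta_term [RHS]mulrCA -ceD; congr (_ * ce _); rewrite /half; field.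
Qed.

Lemma tpi_neq0 : tpi != 0.
Proof.
rewrite mulf_neq0 //; last by rewrite eq_complex /= oner_eq0 andbF.
by rewrite -[0]/((0 : R)%:C) (inj_eq (@complexI R)) mulf_neq0 ?pnatr_eq0 // gt_eqF ?pi_gt0.
Qed.

Lemma cabs_half n : cabs (half n) <= `|n%:~R| + 1.
Proof.
have -> : half n = (n%:~R + 2^-1)%:C by rewrite rmorphD fmorphV rmorph_int rmorph_nat.
by rewrite cabsR; apply: le_trans (ler_normD _ _) _; rewrite lerD2l ger0_norm; lra.
Qed.

Section FixedT.
Variable t : C.
Hypothesis t0 : 0 < Im t.

Lemma asum_theta_exp z (e : R) : 0 <= e ->
  asum (fun n => theta_term t z n * (expR (e * cabs (tpi * half n)))%:C).
Proof.
move=> e0; have a0 : 0 < pi * Im t by rewrite mulr_gt0 ?pi_gt0.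
pose k := e * cabs (tpi : C); have k0 : 0 <= k by rewrite mulr_ge0 ?cabs_ge0.
apply: asum_le (asumZ (ce (t / 8 + z / 2) * (expR k)%:C)
   (gauss_int_abs (- (pi * Im t) - 2 * pi * Im z) k a0)) => n.
rewrite theta_termE cabsM (cabsM (ce _)) cabs_theta_term // [X in _ <= X]cabsM (cabsM (ce _)).
rewrite -2!(mulrA (cabs (ce _))) ler_wpM2l ?cabs_ge0 // !cabsR !(ger0_norm (expR_ge0 _)) -!expRD ler_expR.
rewrite (cabsM tpi) mulrA -/k.
have := ler_wpM2l k0 (cabs_half n); rewrite mulrDr mulr1; lra.
Qed.

Lemma asum_theta z : asum (theta_term t z).
Proof.
apply: eq_asum (asum_theta_exp z (lexx 0)) => n.
by rewrite mul0r expR0 mulr1.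
Qed.

Lemma theta_sum z : theta t z = csum (theta_term t z).
Proof.
rewrite /theta -/(csum _) -csumZ; last exact: asum_jacobiJ.
by apply: eq_csum => n; rewrite theta_termE.
Qed.

Lemma theta_jacobi z : theta t z = ce (t / 8 + z / 2) * jacobiJ t z.
Proof. by []. Qed.

Definition Dtheta (k : nat) (z : C) : C :=
  csum (fun n => theta_term t z n * (tpi * half n) ^+ k).

Lemma theta_term_shift z h n :
  theta_term t (z + h) n = theta_term t z n * cexp (tpi * half n * h).
Proof.
rewrite /theta_term -[tpi * half n * h]mulrA -ceE -[RHS]mulrA -ceD.
by congr (_ * ce _); ring.
Qed.

Lemma theta_jet K z : jet K (fun h => theta t (z + h))
  (\poly_(k < K) (Dtheta k z / k`!%:R)).
Proof.
have := expsum_jet K ltr01 (asum_theta_exp z ler01).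
apply: jet_ext => h; rewrite theta_sum; apply: eq_csum => n.
by rewrite theta_term_shift.
Qed.

Lemma asum_Dtheta k z : asum (fun n => theta_term t z n * (tpi * half n) ^+ k).
Proof. exact: expsum_pow ltr01 (asum_theta_exp z ler01) k. Qed.

Lemma theta_shift z (l m : int) : theta t (z + l%:~R * t + m%:~R) =
  (-1) ^ (l + m) * ce (- (l%:~R ^+ 2 / 2 * t + l%:~R * z)) * theta t z.
Proof.
rewrite !theta_sum -csumZ; last exact: asum_theta.
have bl : bijective (fun n : int => n + l).
  by exists (fun n => n - l) => n; rewrite ?addrK ?subrK.
rewrite -[RHS](csum_bij bl); last exact/asumZ/asum_theta.
apply: eq_csum => n /=; rewrite /theta_term.
have hm : ce (half n * m%:~R) = (-1) ^ m :> C.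
  by rewrite /half mulrDl -intrM ceD ce_int mul1r mulrC ceMz ce_half.
have -> : half n ^+ 2 / 2 * t + half n * (z + l%:~R * t + m%:~R) =
   - (l%:~R ^+ 2 / 2 * t + l%:~R * z) +
   (half (n + l) ^+ 2 / 2 * t + half (n + l) * z) + half n * m%:~R.
  by rewrite /half rmorphD /=; field.
rewrite 2!ceD hm !signzD.
have := signzN R l; have ll : (-1) ^ l * (-1) ^ l = 1 :> C.
  by rewrite -{2}[l]opprK signzN -signzD subrr.
move=> _; move: (ce _) (ce _) ((-1) ^ n) ((-1) ^ m) => A B s1 s2.
have -> : (-1) ^ l * s2 * B * (s1 * (-1) ^ l * A) = ((-1) ^ l * (-1) ^ l) * s2 * A * s1 * B by ring.
by rewrite ll; ring.
Qed.

Lemma thetaN z : theta t (- z) = - theta t z.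
Proof.
rewrite !theta_sum -[RHS]mulN1r -csumZ; last exact: asum_theta.
have bl : bijective (fun n : int => - n - 1).
  by exists (fun n : int => - n - 1) => n; ring.
rewrite -[RHS](csum_bij bl); last exact/asumZ/asum_theta.
apply: eq_csum => n /=; rewrite /theta_term.
have -> : (-1) ^ (- n - 1) = - (-1) ^ n :> C.
  by rewrite -opprD signzN signzD expr1z mulrN1.
have -> : half (- n - 1) = - half n by rewrite /half rmorphB rmorphN /=; field.
rewrite [RHS]mulrA mulN1r opprK sqrrN; congr (_ * ce (_ + _)).
by rewrite mulrN mulNr.
Qed.

Lemma theta0 : theta t 0 = 0.
Proof.
have /eqP := thetaN 0; rewrite oppr0 -addr_eq0 -mulr2n mulrn_eq0 /=.
by move/eqP.
Qed.

Lemma theta_prod z : - Im t < Im z < Im t -> theta t z =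
  ce (t / 8) * (ce (z / 2) - ce (- (z / 2))) * (eulerF t z * eulerF t (- z)) * eulerF t 0.
Proof.
move=> hz; have := triple_product t0 hz; case/andP: hz => h1 h2.
have p1 : 0 < Im (t + z) by rewrite ImD; lra.
have p2 : 0 < Im (t - z) by rewrite ImD ImN; lra.
have p3 : 0 < Im (t + 0) by rewrite addr0.
have := eulerEF t0 p1; have := eulerEF t0 p2; have := eulerEF t0 p3.
rewrite theta_jacobi ceD.
have -> : ce (- (z / 2)) = ce (z / 2) * ce (- z).
  by rewrite -ceD; congr ce; field.
set E1 := eulerE t z; set E2 := eulerE t (- z); set E3 := eulerE t 0.
set F1 := eulerF t z; set F2 := eulerF t (- z); set F3 := eulerF t 0.
set J := jacobiJ t z; clearbody E1 E2 E3 F1 F2 F3 J; move=> h3' h2' h1' hJ.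
have -> : J = J * (E3 * F3) * (E2 * F2) * (E1 * F1) by rewrite h1' h2' h3' !mulr1.
have -> : J * (E3 * F3) * (E2 * F2) * (E1 * F1) = (J * E1 * E2 * E3) * F1 * F2 * F3 by ring.
by rewrite hJ; move: (ce _) (ce _) (ce _) => a b c; ring.
Qed.

(** When the theta series vanishes, the triple product reads 1 - ce (- z) = 0. *)
Lemma theta_eq0_strip z : - Im t < Im z < Im t -> theta t z = 0 ->
  exists m : int, z = m%:~R.
Proof.
move=> hz; have := triple_product t0 hz; rewrite theta_jacobi => e /eqP.
rewrite mulf_eq0 (negbTE (ce_neq0 _)) /= => /eqP J0.
move: e; rewrite J0 !mul0r => /esym/subr0_eq/esym/ce_eq1[m hm].
by exists (- m); rewrite mulrNz -hm opprK.
Qed.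

Lemma theta_eq0 z : theta t z = 0 -> exists l m : int, z = l%:~R * t + m%:~R.
Proof.
move=> h; pose l := Num.floor (Im z / Im t).
have := floor_itv (Im z / Im t); rewrite -/l => /andP[l1 l2].
pose z' := z + (- l)%:~R * t + 0%:~R.
have im : Im z' = Im z - l%:~R * Im t.
  by rewrite /z' addr0 ImD ImMz mulrNz mulNr.
have h1 : 0 <= Im z' by rewrite im subr_ge0 -ler_pdivlMr.
have h2 : Im z' < Im t.
  by rewrite im ltrBlDr -[X in X + _]mul1r -mulrDl -ltr_pdivrMr // addrC; rewrite rmorphD /= in l2.
have [m hm] : exists m : int, z' = m%:~R.
  apply: theta_eq0_strip; first by apply/andP; split; lra.
  by rewrite /z' theta_shift h mulr0.
exists l, m; rewrite -hm /z' addr0 mulrNz; ring.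
Qed.

(* [q zeta -> q zeta^-1] symmetric pairs of factors depend on [zeta] only through [sv z] *)
Definition sv (z : C) : C := (ce (z / 2) - ce (- (z / 2))) ^+ 2.

Lemma svE z : sv z = ce z + ce (- z) - 2.
Proof.
rewrite /sv; have := ceNr (z / 2).
have -> : ce z = ce (z / 2) ^+ 2 by rewrite expr2 -ceD; congr ce; field.
have -> : ce (- z) = ce (- (z / 2)) ^+ 2 by rewrite expr2 -ceD; congr ce; field.
move: (ce _) (ce _) => b a ab.
have -> : (a - b) ^+ 2 = a ^+ 2 + b ^+ 2 - 2 * (a * b) by ring.
by rewrite ab mulr1.
Qed.

(** With a = q^(n+1) one has (1 - a zeta)(1 - a / zeta) = (1 - a)^2 (1 - [sv z] [lam n]). *)
Definition lam (n : nat) : C := ce (n.+1%:R * t) / (1 - ce (n.+1%:R * t)) ^+ 2.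

Lemma eulerF_pair z n : eulerF t z * eulerF t (- z) =
  qpoch t n ^+ 2 * \prod_(i < n) (1 - sv z * lam i) *
  (eulerF t (z + n%:R * t) * eulerF t (- z + n%:R * t)).
Proof.
elim: n => [|n ->]; first by rewrite qpoch0 big_ord0 mul0r !addr0; ring.
rewrite (eulerF_rec t0 (z + n%:R * t)) (eulerF_rec t0 (- z + n%:R * t)).
have e x : x + n%:R * t + t = x + n.+1%:R * t by rewrite -natr1; ring.
rewrite !e qpochS big_ord_recr /= svE /lam.
have -> : ce (t + (z + n%:R * t)) = ce (n.+1%:R * t) * ce z.
  by rewrite -ceD; congr ce; rewrite -natr1; ring.
have -> : ce (t + (- z + n%:R * t)) = ce (n.+1%:R * t) * ce (- z).
  by rewrite -ceD; congr ce; rewrite -natr1; ring.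
have := ce_pow_neq1 t0 n; have := ceNr z.
set a := ce (n.+1%:R * t); set b := ce z; set c := ce (- z).
have key : b * c = 1 -> 1 - a != 0 ->
    (1 - a * b) * (1 - a * c) = (1 - a) ^+ 2 * (1 - (b + c - 2) * (a / (1 - a) ^+ 2)).
  move=> bc nz; have -> : (1 - a * b) * (1 - a * c) = 1 - a * b - a * c + a ^+ 2 * (b * c) by ring.
  by rewrite bc; field.
move=> /key h /h {h}; clearbody a b c.
move: (eulerF t (z + _)) (eulerF t (- z + _)) (qpoch _ _) (\prod_(i < n) _) => A B Q P h.
have -> : Q ^+ 2 * P * ((1 - a * b) * A * ((1 - a * c) * B)) =
  Q ^+ 2 * P * ((1 - a * b) * (1 - a * c)) * (A * B) by ring.
by rewrite h; ring.
Qed.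

Lemma lamE n : lam n = csum (fun k => k.+1%:R * ce (n.+1%:R * t) ^+ k.+1).
Proof.
have h : cabs (ce (n.+1%:R * t)) < 1 by apply: cabs_ce_lt1; rewrite ImMn mulr_gt0.
have [ha e] := deriv_geom h.
by rewrite /lam -e -csumZ //; apply: eq_csum => k; rewrite exprS; ring.
Qed.

Let q := ce t.
Let q1 : cabs q < 1. Proof. exact: cabs_ce_lt1. Qed.

Let dbl (p : nat * nat) : C := p.2.+1%:R * ce (p.1.+1%:R * t) ^+ p.2.+1.

Let asum_dbl : asum dbl.
Proof.
have p0 : 0 < 1 - cabs q by rewrite subr_gt0.
apply: (@asum_pairI _ _ _ _ (fun n => cabs (q ^+ n.+1) * (1 - cabs q) ^- 2)).
  move=> n s us.
  have h : cabs (ce (n.+1%:R * t)) < 1 by apply: cabs_ce_lt1; rewrite ImMn mulr_gt0.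
  apply: (@le_trans _ _ (cabs (q ^+ n.+1) *
     \sum_(k <- s) cabs (k.+1%:R * ce (n.+1%:R * t) ^+ k))).
    have -> : q ^+ n.+1 = ce (n.+1%:R * t) by rewrite /q -ceMn.
    rewrite mulr_sumr; apply: ler_sum => k _; rewrite /dbl /= exprS.
    by rewrite mulrCA (cabsM (ce (n.+1%:R * t))).
  rewrite ler_wpM2l ?cabs_ge0 //; apply: le_trans (deriv_geom_bnd h us) _.
  have p1 : 0 < 1 - cabs (ce (n.+1%:R * t)) by rewrite subr_gt0.
  rewrite lef_pV2 ?posrE ?exprn_gt0 // lerXn2r ?nnegrE ?(ltW p0) ?(ltW p1) //.
  rewrite lerD2l lerN2 ceMn cabsX -/q exprS ler_piMr ?cabs_ge0 //.
  by rewrite exprn_ile1 ?cabs_ge0 // ltW.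
apply: asum_le (asumZ ((1 - cabs q) ^- 2)%:C (asum_inj succn_inj (asum_geom q1))) => n.
by rewrite rmorphM mulrC 2!cabsM !cabsR (ger0_norm (cabs_ge0 _)).
Qed.

Definition lambert : C := csum (fun n : nat => (sigma1 n.+1)%:R * ce (n.+1%:R * t)).

Lemma asum_lam : asum lam.
Proof.
apply: eq_asum (asum_pair_sum asum_dbl) => n; by rewrite lamE.
Qed.

(** Expanding each [lam] gives the double series of k q^(n k); collecting the terms with n k = N
    leaves the divisor sum of N. *)
Lemma csum_lam : csum lam = lambert.
Proof.
rewrite (eq_csum lamE) -[LHS](csum_pair asum_dbl).
rewrite -(csum_push (fun p : nat * nat => (p.1.+1 * p.2.+1).-1) asum_dbl).
apply: eq_csum => N; rewrite /push.
pose s := [seq ((N.+1 %/ d).-1, d.-1) | d <- divisors N.+1].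
have N0 : (0 < N.+1)%N by [].
rewrite (@csum_finsupp _ _ _ s).
- rewrite big_map /sigma1 natr_sum mulr_suml big_seq [RHS]big_seq.
  apply: eq_bigr => d; rewrite -dvdn_divisors // => dN.
  have d0 : (0 < d)%N by exact: dvdn_gt0 dN.
  have e0 : (0 < N.+1 %/ d)%N by rewrite divn_gt0 // dvdn_leq.
  have e : (d * (N.+1 %/ d) = N.+1)%N by rewrite mulnC divnK.
  have e1 : ((N.+1 %/ d).-1.+1 * d.-1.+1).-1 = N by rewrite !prednK // divnK.
  rewrite /dbl [fst _]/= [snd _]/= e1 eqxx (prednK d0) (prednK e0).
  by rewrite -ceMn mulrA -natrM e.
- rewrite map_inj_in_uniq ?divisors_uniq // => a b.
  rewrite -!dvdn_divisors // => aN bN [_ h].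
  by rewrite -(prednK (dvdn_gt0 N0 aN)) -(prednK (dvdn_gt0 N0 bN)) h.
- move=> [n k] /negP h /=; case: eqP => // e; case: h; apply/mapP.
  have e1 : (n.+1 * k.+1 = N.+1)%N by rewrite mulSn addSn; congr _.+1.
  exists k.+1; first by rewrite -dvdn_divisors // -e1 dvdn_mull.
  by rewrite -e1 mulnK.
Qed.

Lemma G2E : G2 t = (pi ^+ 2 / 3 : R)%:C * (1 - 24 * lambert).
Proof. by []. Qed.

(** The bound of [prod_taylor] on the finite products does not depend on their length, hence
    survives in the limit. An error of order [sv ^+ 2], that is z^4, is what the third derivative of
    theta at 0 requires. *)
Lemma eulerF_pair_taylor : exists2 B : R, 0 <= B & forall z, cabs (sv z) <= 1 ->
  cabs (eulerF t z * eulerF t (- z) - eulerF t 0 ^+ 2 * (1 - sv z * lambert)) <=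
  B * cabs (sv z) ^+ 2.
Proof.
have [S hS] := asum_lam.
have S0 : 0 <= S by have := hS nil isT; rewrite big_nil.
exists (cabs (eulerF t 0) ^+ 2 * (S ^+ 2 * expR S)).
  by rewrite mulr_ge0 ?exprn_ge0 ?cabs_ge0 // mulr_ge0 ?exprn_ge0 ?expR_ge0.
move=> z z1; set v := sv z.
pose D (n : nat) := \prod_(i < n) (1 - v * lam i) - 1 + \sum_(i < n) (v * lam i).
have hD n : cabs (D n) <= cabs v ^+ 2 * (S ^+ 2 * expR S).
  have := prod_taylor (fun i => v * lam i) n; rewrite /= -/(D n) => pt.
  apply: le_trans pt _.
  have s0 : 0 <= \sum_(i < n) cabs (v * lam i) by apply: sumr_ge0 => i _; exact: cabs_ge0.
  have sv1 : \sum_(i < n) cabs (v * lam i) <= cabs v * S.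
    under eq_bigr do rewrite cabsM.
    rewrite -mulr_sumr ler_wpM2l ?cabs_ge0 //.
    rewrite -(big_mkord xpredT (fun i => cabs (lam i))); exact: hS (iota_uniq _ _).
  rewrite mulrA -exprMn ler_pM ?exprn_ge0 ?expR_ge0 //.
    by rewrite lerXn2r ?nnegrE // mulr_ge0 ?cabs_ge0.
  by rewrite ler_expR; apply: le_trans sv1 _; rewrite ler_piMl.
have lim : seqlim (fun n => qpoch t n ^+ 2 * (D n + 1 - \sum_(i < n) (v * lam i)) *
    (eulerF t (z + n%:R * t) * eulerF t (- z + n%:R * t))) (eulerF t z * eulerF t (- z)).
  have -> : (fun n => qpoch t n ^+ 2 * (D n + 1 - \sum_(i < n) (v * lam i)) *
    (eulerF t (z + n%:R * t) * eulerF t (- z + n%:R * t))) =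
    (fun=> eulerF t z * eulerF t (- z)).
    apply/funext => n; rewrite [RHS](eulerF_pair z n) /D -/v; congr (_ * _ * _); ring.
  exact: seqlim_cst.
have lS : seqlim (fun n => \sum_(i < n) (v * lam i)) (v * lambert).
  rewrite -csum_lam -csumZ; last exact: asum_lam.
  exact/asum_seqlim/asumZ/asum_lam.
have lQ : seqlim (fun n => qpoch t n ^+ 2) (eulerF t 0 ^+ 2).
  rewrite expr2; have := seqlimM (qpoch_lim t0) (qpoch_lim t0).
  by congr seqlim; apply/funext => n; rewrite expr2.
have lF : seqlim (fun n => eulerF t (z + n%:R * t) * eulerF t (- z + n%:R * t)) 1.
  by have := seqlimM (eulerF_lim t0 z) (eulerF_lim t0 (- z)); rewrite mulr1.
have l1 : seqlim (fun n => 1 - \sum_(i < n) (v * lam i)) (1 - v * lambert).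
  have := seqlimD (seqlim_cst 1) (seqlimZ (-1) lS).
  rewrite mulN1r; congr seqlim; apply/funext => n; by rewrite mulN1r.
have := seqlimM (seqlimM lQ l1) lF; rewrite mulr1 => lim2.
have := seqlimD lim (seqlimZ (-1) lim2); rewrite mulN1r => lim3.
have lDQ : seqlim (fun n => qpoch t n ^+ 2 * D n *
    (eulerF t (z + n%:R * t) * eulerF t (- z + n%:R * t)))
   (eulerF t z * eulerF t (- z) - eulerF t 0 ^+ 2 * (1 - v * lambert)).
  move: lim3; congr seqlim; apply/funext => n; ring.
rewrite leNgt; apply/negP => lt.
have lQF := seqlimM lQ lF; rewrite mulr1 in lQF.
set L := eulerF t z * _ - _ in lDQ lt.
pose K := S ^+ 2 * expR S.
have K0 : 0 <= K by rewrite mulr_ge0 ?exprn_ge0 ?expR_ge0.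
(* The excess of the limit over the claimed bound; each of the two approximations that follow may
   use up a third of it. *)
pose g := cabs L - cabs (eulerF t 0) ^+ 2 * K * cabs v ^+ 2.
have g0 : 0 < g by rewrite subr_gt0.
have [N1 h1] := lDQ _ (divr_gt0 g0 (ltr0n _ 3)).
have K1 : 0 < K + 1 by lra.
have [N2 h2] := lQF _ (divr_gt0 (divr_gt0 g0 (ltr0n _ 3)) K1).
pose n := maxn N1 N2.
have := h1 n (leq_maxl _ _); have := h2 n (leq_maxr _ _).
set QF := qpoch t n ^+ 2 * _.
have -> : qpoch t n ^+ 2 * D n * (eulerF t (z + n%:R * t) * eulerF t (- z + n%:R * t)) =
   QF * D n by rewrite /QF; ring.
move=> k2 k1.
have a1 := cabs_dist L (QF * D n); rewrite cabsB in a1.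
have a2 : cabs (QF * D n) <= (cabs (eulerF t 0) ^+ 2 + g / 3 / (K + 1)) * (cabs v ^+ 2 * K).
  rewrite cabsM ler_pM ?cabs_ge0 ?hD //.
  by have := cabs_dist QF (eulerF t 0 ^+ 2); rewrite cabsX; lra.
have v1 : cabs v ^+ 2 <= 1 by rewrite exprn_ile1 ?cabs_ge0.
have a3 : g / 3 / (K + 1) * (cabs v ^+ 2 * K) <= g / 3.
  rewrite -mulrA ler_piMr ?divr_ge0 ?(ltW g0) // mulrC ler_pdivrMr // mul1r.
  by apply: (@le_trans _ _ K); [rewrite ler_piMl|lra].
have a4 : cabs (eulerF t 0) ^+ 2 * (cabs v ^+ 2 * K) = cabs L - g by rewrite /g; ring.
move: a2; rewrite mulrDl a4; lra.
Qed.

End FixedT.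
End Theta.

(** * The eta function and the Taylor coefficients of theta at 0 *)

Section ThetaJets.
Variable R : realType.
Local Notation C := R[i].
Local Notation Im := complex.Im.
Local Notation tpi := ((2 * pi : R)%:C * 'i%C).

Lemma jet_close n F G p (B d : R) : 0 < d ->
  (forall h, cabs h < d -> cabs (F h - G h) <= B * cabs h ^+ n) -> jet n G p -> jet n F p.
Proof.
move=> d0 FG [B' [d' [d'0 h]]]; exists (B + B'), (Num.min d d').
split=> [|x]; first by rewrite lt_min d0 d'0.
rewrite lt_min => /andP[xd xd'].
have -> : F x - p.[x] = (F x - G x) + (G x - p.[x]) by ring.
rewrite mulrDl; apply: le_trans (cabsD _ _) (lerD _ _); [exact: FG|exact: h].
Qed.

Lemma jet_cexp (a : C) K :
  jet K (fun h => cexp (a * h)) (\poly_(k < K) (a ^+ k / k`!%:R)).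
Proof.
exists (cabs a ^+ K * expR (cabs a)), 1; split=> // h h1.
have -> : (\poly_(k < K) (a ^+ k / k`!%:R)).[h] = \sum_(k < K) (a * h) ^+ k / k`!%:R.
  by rewrite horner_poly; apply: eq_bigr => k _; rewrite exprMn; ring.
apply: le_trans (cexp_taylor _ _) _; rewrite cabsM exprMn mulrAC.
rewrite ler_wpM2r ?exprn_ge0 ?cabs_ge0 // ler_wpM2l ?exprn_ge0 ?cabs_ge0 //.
by rewrite ler_expR ler_piMr ?cabs_ge0 // ltW.
Qed.

Lemma seqlim_limn (u : nat -> C) l : seqlim u l -> limn u = l.
Proof.
move=> h; apply: cvg_lim; first exact: norm_hausdorff.
apply/cvgrPdist_le => e; rewrite ltcE => /andP[/eqP ie re].
have [N hN] := h _ re; exists N => // n /= Nn.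
by rewrite normr_cabs lecE ie eqxx /= cabsB hN.
Qed.

Lemma eta_eulerF (t : C) : 0 < Im t -> eta t = ce (t / 24) * eulerF t 0.
Proof.
move=> t0; rewrite /eta; congr (_ * _); apply: seqlim_limn.
have := qpoch_lim t0; congr seqlim; apply/funext => N.
by rewrite /qpoch big_add1 /= big_mkord.
Qed.

Lemma eta3 (t : C) : 0 < Im t -> eta t ^+ 3 = ce (t / 8) * eulerF t 0 ^+ 3.
Proof.
move=> t0; rewrite eta_eulerF // exprMn -ceMn; congr (ce _ * _).
by field.
Qed.

Lemma eulerF0_neq0 (t : C) : 0 < Im t -> eulerF t 0 != 0.
Proof.
move=> t0; have h : 0 < Im (t + 0) by rewrite addr0.
have e := eulerEF t0 h; apply/eqP => F0; move: e; rewrite F0 mulr0 => /esym/eqP.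
by rewrite oner_eq0.
Qed.

Lemma eta_neq0 (t : C) : 0 < Im t -> eta t != 0.
Proof. by move=> t0; rewrite eta_eulerF // mulf_neq0 ?ce_neq0 ?eulerF0_neq0. Qed.

Section FixedT.
Variable t : C.
Hypothesis t0 : 0 < Im t.

Lemma theta'E z : theta' t z = Dtheta t 1 z.
Proof.
rewrite /theta' (jet_derive1 (theta_jet t0 2 z)) coef_poly /=.
by rewrite divr1.
Qed.

Let S (h : C) := ce (h / 2) - ce (- (h / 2)).
(** Cubic Taylor polynomial of 2 i sin (pi h), the factor of theta that vanishes at 0. *)
Let pS : {poly C} := tpi%:P * 'X + (tpi ^+ 3 / 24)%:P * 'X^3.

Let SE h : S h = cexp (tpi / 2 * h) + (-1) * cexp (- (tpi / 2) * h).
Proof. by rewrite /S mulN1r !ceE; congr (cexp _ - cexp _); field. Qed.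

Let jet_S : jet 4 S pS.
Proof.
have := jetD (jet_cexp (tpi / 2) 4) (jetZ (-1) (jet_cexp (- (tpi / 2)) 4)).
set p := (X in jet 4 _ X).
have -> : p = pS.
  apply/polyP => i; rewrite /p /pS !coefD !coefCM !coef_poly coefX coefXn.
  case: i => [|[|[|[|i]]]] /=; rewrite ?mulr0 ?addr0 ?add0r ?mulr1 ?expr0 ?expr1 //=.
  - by rewrite divr1 mulN1r subrr.
  - by rewrite !divr1; field.
  - by rewrite (_ : 2`! = 2)%N //; field.
  - by rewrite (_ : 3`! = 6)%N //; field.
by apply: jet_ext => h; rewrite SE.
Qed.

Let S_small : exists2 B : R, 0 <= B & forall h, cabs h < 1 -> cabs (S h) <= B * cabs h.
Proof.
pose c := cabs (tpi / 2 : C); have c0 : 0 <= c by exact: cabs_ge0.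
exists (2 * (c * expR c)); first by rewrite mulr_ge0 // mulr_ge0 ?expR_ge0.
move=> h h1.
have k (a : C) : cabs a = c -> cabs (cexp (a * h) - 1) <= c * expR c * cabs h.
  move=> ac; have := cexp_taylor (a * h) 1; rewrite big_ord1 expr0 divr1 expr1 => e.
  apply: le_trans e _; rewrite cabsM ac mulrAC ler_wpM2r ?cabs_ge0 //.
  by rewrite ler_wpM2l // ler_expR ler_piMr // ltW.
rewrite SE (_ : _ + _ = (cexp (tpi / 2 * h) - 1) - (cexp (- (tpi / 2) * h) - 1)); last by ring.
apply: le_trans (cabsD _ _) _; rewrite cabsN.
by have := k _ (erefl : cabs (tpi / 2) = c); have := k _ (cabsN (tpi / 2)); lra.
Qed.

Let P := eulerF t 0.

Let jet_FF : jet 4 (fun h => eulerF t h * eulerF t (- h))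
  ((P ^+ 2)%:P * (1 - (lambert t)%:P * pS ^+ 2)).
Proof.
have [B B0 hB] := eulerF_pair_taylor t0; have [M M0 hM] := S_small.
pose d := Num.min 1 (M + 1)^-1.
have M1 : 0 < M + 1 by lra.
have d0 : 0 < d by rewrite lt_min ltr01 invr_gt0.
apply: (@jet_close 4 _ (fun h => P ^+ 2 * (1 - sv h * lambert t)) _ (B * M ^+ 4) d d0).
  move=> h; rewrite lt_min => /andP[h1 h2].
  have Sh := hM h h1.
  have hd : M * cabs h <= 1.
    have := cabs_ge0 h; move: h2; rewrite -[X in _ < X]mul1r ltr_pdivlMr //; nra.
  have sS : cabs (S h) <= 1 by apply: le_trans hd.
  have sv1 : cabs (sv h) <= 1.
    by rewrite /sv cabsX exprn_ile1 ?cabs_ge0.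
  apply: le_trans (hB h sv1) _; rewrite -mulrA ler_wpM2l // /sv cabsX -exprM -exprMn.
  by rewrite lerXn2r ?nnegrE ?cabs_ge0 // mulr_ge0 ?cabs_ge0.
have := jetZ (P ^+ 2) (jetD (jet_horner 4 1) (jetZ (- lambert t) (jetM jet_S jet_S))).
rewrite polyCN mulNr -expr2; apply: jet_ext => h.
rewrite hornerC /sv -/(S h); ring.
Qed.

Lemma theta_jet0 : jet 4 (theta t) ((ce (t / 8) * P ^+ 3)%:P *
   (pS * (1 - (lambert t)%:P * pS ^+ 2))).
Proof.
have h := jetM (jetZ (ce (t / 8)) jet_S) (jetM jet_FF (jet_horner 4 P%:P)).
have -> : (ce (t / 8) * P ^+ 3)%:P * (pS * (1 - (lambert t)%:P * pS ^+ 2)) =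
  (ce (t / 8))%:P * pS * ((P ^+ 2)%:P * (1 - (lambert t)%:P * pS ^+ 2) * P%:P).
  by rewrite polyCM !polyC_exp; ring.
apply: jet_eq t0 _ h => h hh.
have := Im_le_cabs h; rewrite ler_norml => /andP[a b].
rewrite theta_prod //; last by apply/andP; split; lra.
by rewrite hornerC /S mulrA.
Qed.

Lemma Dtheta1_0 : Dtheta t 1 0 = tpi * eta t ^+ 3.
Proof.
have := jet_unique (jet_ext (fun h => congr1 (theta t) (add0r h)) (theta_jet t0 4 0)) theta_jet0.
move=> /(_ 1%N isT); rewrite coef_poly /= divr1 => ->.
rewrite eta3 // -/P coefCM; move: (ce _ * _) => k.
have -> : (pS * (1 - (lambert t)%:P * pS ^+ 2))`_1 = tpi.
  have -> : pS = (tpi%:P + (tpi ^+ 3 / 24)%:P * 'X^2) * 'X by rewrite /pS; ring.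
  rewrite -mulrA [_ * (1 - _)]mulrC mulrA coefMX /=.
  rewrite coef0M coefD coefC coefCM coefXn mulr0 addr0 /=.
  rewrite coefB coef1 coefCM /= expr2 mulrA coefMX /= mulr0 subr0 mulr1 //.
by rewrite mulrC.
Qed.

Lemma Dtheta1_neq0 : Dtheta t 1 0 != 0.
Proof. by rewrite Dtheta1_0 mulf_neq0 ?tpi_neq0 // expf_neq0 ?eta_neq0. Qed.

(** The cubic term of the sine gives 1/24, the Euler factors give the term in [lambert]. The ratio
    is (2 pi i)^2 / 4 times 1 - 24 [lambert t], a constant multiple of G2. *)
Lemma Dtheta3_0 : Dtheta t 3 0 = tpi ^+ 2 * (4^-1 - 6 * lambert t) * Dtheta t 1 0.
Proof.
have := jet_unique (jet_ext (fun h => congr1 (theta t) (add0r h)) (theta_jet t0 4 0)) theta_jet0.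
move=> /(_ 3 isT); rewrite coef_poly /= (_ : 3`! = 6)%N // => e.
have -> : Dtheta t 3 0 = 6 * (Dtheta t 3 0 / 6) by field.
rewrite e Dtheta1_0 eta3 // -/P coefCM.
have -> : (pS * (1 - (lambert t)%:P * pS ^+ 2))`_3 = tpi ^+ 3 / 24 - lambert t * tpi ^+ 3.
  have -> : pS * (1 - (lambert t)%:P * pS ^+ 2) =
    tpi%:P * 'X + (tpi ^+ 3 / 24 - lambert t * tpi ^+ 3)%:P * 'X^3
    + 'X^4 * (- (lambert t)%:P * 'X * (3 * tpi%:P ^+ 2 * (tpi ^+ 3 / 24)%:P
       + 3 * tpi%:P * (tpi ^+ 3 / 24)%:P ^+ 2 * 'X^2 + (tpi ^+ 3 / 24)%:P ^+ 3 * 'X^4)).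
    rewrite /pS polyCB (polyCM (lambert t)) polyC_exp; ring.
  rewrite !coefD coefXnM /= addr0 !coefCM coefX coefXn /= mulr0 add0r mulr1 //.
by move: (ce _) => k; field.
Qed.

End FixedT.
End ThetaJets.

(** * Entire functions as power series about each point *)

Section PowerSeries.
Variable R : realType.
Local Notation C := R[i].

Definition pser (F : C -> C) (z : C) (a : nat -> C) :=
  forall h, asum (fun k => a k * h ^+ k) /\ F (z + h) = csum (fun k => a k * h ^+ k).

Lemma pser0 F z a : pser F z a -> F z = a 0%N.
Proof.
move=> /(_ 0)[_]; rewrite addr0 => ->.
rewrite (@csum1 _ _ _ 0%N) ?expr0 ?mulr1 // => k k0.
by rewrite expr0n (negbTE k0) mulr0.
Qed.

Lemma pserD F G z a b : pser F z a -> pser G z b ->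
  pser (fun x => F x + G x) z (fun k => a k + b k).
Proof.
move=> ha hb h; have [a1 ->] := ha h; have [b1 ->] := hb h.
have e : (fun k => (a k + b k) * h ^+ k) = (fun k => a k * h ^+ k + b k * h ^+ k).
  by apply/funext => k; rewrite mulrDl.
by rewrite e csumD //; split=> //; exact: asumD.
Qed.

Lemma pserZ F z a (c : C) : pser F z a -> pser (fun x => c * F x) z (fun k => c * a k).
Proof.
move=> ha h; have [a1 ->] := ha h.
have e : (fun k => c * a k * h ^+ k) = (fun k => c * (a k * h ^+ k)).
  by apply/funext => k; rewrite mulrA.
by rewrite e csumZ //; split=> //; exact: asumZ.
Qed.

Lemma pserM F G z a b : pser F z a -> pser G z b ->
  pser (fun x => F x * G x) z (fun n => \sum_(i < n.+1) a i * b (n - i)%N).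
Proof.
move=> ha hb h; have [a1 ->] := ha h; have [b1 ->] := hb h.
have e : (fun n => (\sum_(i < n.+1) a i * b (n - i)%N) * h ^+ n) =
    push (fun p : nat * nat => (p.1 + p.2)%N)
      (fun p => (a p.1 * h ^+ p.1) * (b p.2 * h ^+ p.2)).
  apply/funext => n; rewrite (push_addn (fun i => a i * h ^+ i) (fun i => b i * h ^+ i)).
  rewrite mulr_suml; apply: eq_bigr => i _; rewrite mulrACA -exprD subnKC // -ltnS.
  by [].
rewrite e; split; first by apply: asum_push; exact: (asumM a1 b1).
by rewrite csum_push ?(csumM a1 b1) //; exact: (asumM a1 b1).
Qed.

Lemma pser_ext F G z a : F =1 G -> pser F z a -> pser G z a.
Proof. by move=> /funext ->. Qed.

Lemma pser_scale F z a (c : C) : pser F (c * z) a ->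
  pser (fun x => F (c * x)) z (fun k => a k * c ^+ k).
Proof.
move=> ha h; have [] := ha (c * h); rewrite mulrDr => a1 ->.
have e : (fun k => a k * c ^+ k * h ^+ k) = (fun k => a k * (c * h) ^+ k).
  by apply/funext => k; rewrite exprMn mulrA.
by rewrite e.
Qed.

Lemma pser_expsum (I : choiceType) (c al : I -> C) (F : C -> C) z :
  (forall r : R, 0 <= r -> asum (fun i => c i * (expR (r * cabs (al i)))%:C)) ->
  (forall h, F (z + h) = csum (fun i => c i * cexp (al i * h))) ->
  pser F z (fun k => csum (fun i => c i * (al i ^+ k / k`!%:R))).
Proof.
move=> hc hF h.
pose u (p : I * nat) := c p.1 * ((al p.1 * h) ^+ p.2 / p.2`!%:R).
have hu : asum u.
  apply: (@asum_pairI _ _ _ _ (fun i => cabs (c i) * expR (cabs h * cabs (al i)))).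
    move=> i s us; rewrite /u /=; under eq_bigr do rewrite (cabsM (c i)).
    rewrite -mulr_sumr ler_wpM2l ?cabs_ge0 //.
    by have := @sumbnd_exp _ (al i * h) s us; rewrite [X in expR X]cabsM [X in expR X]mulrC.
  apply: asum_le (hc (cabs h) (cabs_ge0 _)) => i.
  rewrite (cabsM (c i)) !cabsR ger0_norm ?mulr_ge0 ?expR_ge0 ?cabs_ge0 //.
  by rewrite ger0_norm ?expR_ge0.
have e : (fun k => csum (fun i => c i * (al i ^+ k / k`!%:R)) * h ^+ k) =
    (fun k => csum (fun i => u (i, k))).
  apply/funext => k; rewrite mulrC -csumZ; last first.
    have := asum_le _ (asumZ (k`!%:R)%:C (hc 1 ler01)); apply=> i.
    rewrite (cabsM (c i)) (cabsM (k`!%:R)%:C) (cabsM (c i) (expR _)%:C) mulrCA ler_wpM2l ?cabs_ge0 //.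
    rewrite !cabsR cabsM cabsX cabsV cabs_nat !ger0_norm ?expR_ge0 // mul1r.
    have f1 : 1 <= k`!%:R :> R by rewrite ler1n fact_gt0.
    have p1 := pow_le_exp k (cabs_ge0 (al i)).
    apply: le_trans p1; rewrite ler_pdivrMr ?(lt_le_trans ltr01 f1) //.
    by rewrite ler_peMr ?exprn_ge0 ?cabs_ge0.
  by apply: eq_csum => i; rewrite /u /= exprMn; move: (h ^+ k) (al i ^+ k) => x y; ring.
have hsw : asum (fun p : nat * I => u (p.2, p.1)).
  by apply: (asum_inj _ hu (h := fun p : nat * I => (p.2, p.1))) => -[? ?] [? ?] [-> ->].
rewrite e; split; first exact: (asum_pair_sum hsw).
rewrite hF -(csum_swap hu); apply: eq_csum => i.
by rewrite cexpE -csumZ //; exact: asum_exp.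
Qed.

(** At 0 the exponential series is spread over the even exponents; elsewhere al (z + h)^2 = al z^2 +
    2 al z h + al h^2 reduces to that case times an exponential. *)
Lemma pser_gauss (al z : C) : exists a, pser (fun x => cexp (al * x ^+ 2)) z a.
Proof.
have h2 : pser (fun x => cexp (al * x ^+ 2)) 0
    (fun k => if odd k then 0 else al ^+ k./2 / k./2`!%:R).
  move=> h; rewrite add0r cexpE.
  have ha := asum_exp (al * h ^+ 2).
  pose g (k : nat) : C := (if odd k then 0 else al ^+ k./2 / k./2`!%:R) * h ^+ k.
  have gE k : g k.*2 = (al * h ^+ 2) ^+ k / k`!%:R.
    by rewrite /g odd_double doubleK exprMn -exprM mul2n; ring.
  have dinj : injective double by exact: double_inj.
  have hg : asum g.
    case: ha => B hB; exists B => s us.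
    rewrite (bigID odd) /= big1 ?add0r => [|k ok]; last by rewrite /g ok mul0r cabs0.
    rewrite -big_filter; set s' := [seq k <- s | _].
    have es : s' = map double (map ssrnat.half s').
      rewrite -map_comp; symmetry; apply: map_id_in => k.
      by rewrite mem_filter /= => /andP[ok _]; rewrite -[RHS]odd_double_half (negbTE ok).
    rewrite es big_map (eq_bigr (fun k => cabs ((al * h ^+ 2) ^+ k / k`!%:R))); last first.
      by move=> k _; rewrite gE.
    by apply: hB; rewrite -(map_inj_uniq dinj) -es filter_uniq.
  split=> //; rewrite -(csum_inj dinj hg).
    by apply: eq_csum => k /=; rewrite gE.
  move=> k hk; rewrite /g; case: ifP; rewrite ?mul0r // => ok.
  by case: (hk k./2); rewrite -[RHS]odd_double_half ok.
have e1 (b : C) : pser (fun x => cexp (b * x)) 0 (fun k => b ^+ k / k`!%:R).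
  move=> h; rewrite add0r cexpE.
  have e : (fun k => b ^+ k / k`!%:R * h ^+ k) = (fun k => (b * h) ^+ k / k`!%:R).
    by apply/funext => k; rewrite exprMn; ring.
  by rewrite e; split=> //; exact: asum_exp.
have := pserZ (cexp (al * z ^+ 2)) (pserM (e1 (2 * al * z)) h2).
set a := (X in pser _ _ X) => H; exists a => h; have [ha e] := H h; split=> //.
rewrite -e add0r -2!cexpD; congr cexp; ring.
Qed.

Lemma pser_head F z a k : pser F z a -> (forall j, (j < k)%N -> a j = 0) ->
  exists B : R, forall h, cabs h < 1 ->
    cabs (F (z + h) - a k * h ^+ k) <= B * cabs h ^+ k.+1.
Proof.
move=> ha az; have [a1 _] := ha 1; have [S hS] := a1.
exists S => h h1; have [a2 ->] := ha h.
rewrite (csum_shift k.+1 a2) big_ord_recr /= big1 ?add0r; last first.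
  by move=> j _; rewrite az ?mul0r.
rewrite addrC addKr; apply: csum_bnd => s us.
apply: (@le_trans _ _ (\sum_(i <- s) cabs (a (i + k.+1)%N) * cabs h ^+ k.+1)).
  apply: ler_sum => i _; rewrite cabsM cabsX ler_wpM2l ?cabs_ge0 //.
  by rewrite exprD ler_piMl ?exprn_ge0 ?cabs_ge0 // exprn_ile1 ?cabs_ge0 // ltW.
rewrite -mulr_suml ler_wpM2r ?exprn_ge0 ?cabs_ge0 //.
have inj : injective (fun i => (i + k.+1)%N) by move=> x y /eqP; rewrite eqn_add2r => /eqP.
have := sumbnd_inj inj hS us; under eq_bigr do rewrite /= expr1n mulr1.
by [].
Qed.

Lemma pser_order F z a : pser F z a -> (forall x, F x = 0) \/
  exists k, a k != 0 /\ forall j, (j < k)%N -> a j = 0.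
Proof.
move=> ha; have [[k hk]|no] := pselect (exists k, a k != 0); last first.
  left=> x; have [_] := ha (x - z); rewrite addrC subrK => ->.
  rewrite -[RHS](csum0 R nat); apply: eq_csum => k.
  have [->|nk] := eqVneq (a k) 0; first by rewrite mul0r.
  by case: no; exists k.
right; have ex : exists k, a k != 0 by exists k.
case: (ex_minnP ex) => k0 hk0 min; exists k0; split=> // j jk.
by apply/eqP/negPn/negP => /min; rewrite leqNgt jk.
Qed.

(** For |h| < 1 / M half of the leading term dominates the remainder. This keeps denominators away
    from 0 on a punctured disc. *)
Lemma pser_lower F z a k : pser F z a -> a k != 0 ->
    (forall j, (j < k)%N -> a j = 0) ->
  exists d : R, [/\ 0 < d, d <= 1 & forall h, cabs h < d ->
    cabs (a k) / 2 * cabs h ^+ k <= cabs (F (z + h))].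
Proof.
move=> ha ak az; have [B hB] := pser_head ha az.
have a0 : 0 < cabs (a k) by rewrite lt_neqAle eq_sym cabs_eq0 ak cabs_ge0.
pose M := 1 + 2 * `|B| / cabs (a k).
have M1 : 1 <= M by rewrite /M lerDl divr_ge0 ?mulr_ge0 ?cabs_ge0.
have M0 : 0 < M := lt_le_trans ltr01 M1.
exists M^-1; split; rewrite ?invr_gt0 //; first by rewrite invf_le1.
move=> h hd; have h1 : cabs h < 1 by apply: lt_le_trans hd _; rewrite invf_le1.
have := cabs_dist (a k * h ^+ k) (F (z + h)); have := hB h h1.
rewrite cabsM cabsX => b1; rewrite -[cabs (_ - F _)]cabsN opprB => b2.
have x0 : 0 <= cabs h ^+ k by rewrite exprn_ge0 ?cabs_ge0.
have b3 : B * cabs h ^+ k.+1 <= cabs (a k) / 2 * cabs h ^+ k.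
  rewrite exprS mulrA ler_wpM2r //.
  have : cabs h * M < 1 by rewrite -ltr_pdivlMr // mul1r.
  rewrite /M mulrDr mulr1 => b4.
  have b5 : cabs h * (2 * `|B| / cabs (a k)) <= 1.
    by apply: ltW; apply: le_lt_trans b4; rewrite lerDr cabs_ge0.
  rewrite mulrA ler_pdivrMr // mul1r in b5.
  have := ler_norm B; have := cabs_ge0 h; nra.
move: b1 b2 b3 x0; rewrite exprS; nra.
Qed.

End PowerSeries.

Opaque theta.

(** * Rigidity of entire functions with the multipliers of theta *)

Section Liouville.
Variable R : realType.
Local Notation C := R[i].
Variables (G Th : C -> C) (t : C) (m1 mt : C -> C).
Hypothesis t0 : 0 < complex.Im t.
Hypothesis GS : forall z, exists a, pser G z a.
Hypothesis TS : forall z, exists a, pser Th z a.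
Hypothesis m1_neq0 : forall z, m1 z != 0.
Hypothesis mt_neq0 : forall z, mt z != 0.
Hypothesis G1 : forall z, G (z + 1) = m1 z * G z.
Hypothesis Th1 : forall z, Th (z + 1) = m1 z * Th z.
Hypothesis Gt : forall z, G (z + t) = mt z * G z.
Hypothesis Tht : forall z, Th (z + t) = mt z * Th z.
Hypothesis Th_simple : forall z b, pser Th z b -> Th z = 0 -> b 1%N != 0.
Hypothesis Th_zero : forall z, Th z = 0 -> G z = 0.

(** The value of G / Th at z by continuity, with a linear rate, so that the zeros of [Th] are
    treated like all other points. *)
Definition limval (z v : C) := exists L d : R, 0 < d /\
  forall h, h != 0 -> cabs h < d ->
    Th (z + h) != 0 /\ cabs (G (z + h) / Th (z + h) - v) <= L * cabs h.

Lemma Th_order z b : pser Th z b ->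
  exists2 k, b k != 0 & (forall j, (j < k)%N -> b j = 0) /\ (k <= 1)%N.
Proof.
move=> hb; have [b00|b0] := eqVneq (b 0%N) 0; last by exists 0%N.
by exists 1%N; [apply: (Th_simple hb); rewrite (pser0 hb)|split=> // -[]].
Qed.

Lemma limval_coef z a b k : pser G z a -> pser Th z b -> b k != 0 ->
    (forall j, (j < k)%N -> b j = 0) -> (forall j, (j < k)%N -> a j = 0) ->
  limval z (a k / b k).
Proof.
move=> ha hb bk bz az.
have [B1 hB1] := pser_head ha az; have [B2 hB2] := pser_head hb bz.
have [d [d0 d1 hd]] := pser_lower hb bk bz.
have c0 : 0 < cabs (b k) by rewrite lt_neqAle eq_sym cabs_eq0 bk cabs_ge0.
pose v := a k / b k.
exists ((B1 + cabs v * B2) * 2 / cabs (b k)), d; split=> // h h0 hh.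
have x0 : 0 < cabs h by rewrite lt_neqAle eq_sym cabs_eq0 h0 cabs_ge0.
have low := hd h hh; have xk : 0 < cabs h ^+ k by rewrite exprn_gt0.
have T0 : 0 < cabs (Th (z + h)).
  by apply: lt_le_trans low; rewrite mulr_gt0 // divr_gt0.
have Tn : Th (z + h) != 0 by rewrite -cabs_eq0 gt_eqF.
split=> //; rewrite -/v.
have -> : G (z + h) / Th (z + h) - v = (G (z + h) - v * Th (z + h)) / Th (z + h).
  by rewrite mulrBl mulfK.
rewrite cabsM cabsV ler_pdivrMr //.
have e : G (z + h) - v * Th (z + h) =
    (G (z + h) - a k * h ^+ k) - v * (Th (z + h) - b k * h ^+ k).
  have -> : a k = v * b k by rewrite /v divfK.
  by ring.
rewrite e; have h1 : cabs h < 1 by apply: lt_le_trans hh d1.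
have q1 := hB1 h h1; have q2 := hB2 h h1.
have q3 : cabs (G (z + h) - a k * h ^+ k - v * (Th (z + h) - b k * h ^+ k)) <=
   (B1 + cabs v * B2) * cabs h ^+ k.+1.
  apply: (le_trans (cabsD _ _)); rewrite mulrDl lerD // cabsN cabsM -mulrA.
  by rewrite ler_wpM2l ?cabs_ge0.
apply: (le_trans q3); have q4 : 0 <= B1 + cabs v * B2.
  have := le_trans (cabs_ge0 _) q3; rewrite pmulr_lge0 //; exact: exprn_gt0.
rewrite exprSr mulrA -[X in _ <= X]mulrA [cabs h * _]mulrC mulrA ler_wpM2r ?cabs_ge0 //.
rewrite -!mulrA ler_wpM2l // mulrA mulrC -ler_pdivrMr ?divr_gt0 //.
by rewrite invf_div mulrC.
Qed.

Lemma limval_ex z : exists v, limval z v.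
Proof.
have [a ha] := GS z; have [b hb] := TS z; have [k bk [bz k1]] := Th_order hb.
exists (a k / b k); apply: limval_coef => // j jk.
have j0 : j = 0%N by case: j jk (leq_trans jk k1).
by rewrite j0 -(pser0 ha) Th_zero // (pser0 hb) bz // -j0.
Qed.

Lemma limval_ratio z : Th z != 0 -> limval z (G z / Th z).
Proof.
move=> Tz; have [a ha] := GS z; have [b hb] := TS z.
by rewrite (pser0 ha) (pser0 hb); apply: limval_coef => //; rewrite -(pser0 hb).
Qed.

Lemma limval_unique z v v' : limval z v -> limval z v' -> v = v'.
Proof.
move=> [L [d [d0 hv]]] [L' [d' [d'0 hv']]]; apply/eqP; rewrite -subr_eq0; apply/eqP.
apply: (@cabs_lim0 _ _ (L + L') (Order.min d d')); first by rewrite lt_min d0 d'0.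
move=> h /andP[h0]; rewrite lt_min => /andP[hd hd'].
have hn : h != 0 by rewrite -cabs_eq0 gt_eqF.
have [_ q1] := hv h hn hd; have [_ q2] := hv' h hn hd'.
have -> : v - v' = (G (z + h) / Th (z + h) - v') - (G (z + h) / Th (z + h) - v) by ring.
by apply: (le_trans (cabsD _ _)); rewrite cabsN addrC mulrDl lerD.
Qed.

Definition quot z := xget 0 [set v | limval z v].

Lemma quotP z : limval z (quot z).
Proof. by have [v hv] := limval_ex z; exact: (@xgetPex _ _ [set v | limval z v] (ex_intro _ v hv)). Qed.

Lemma quotE z : Th z != 0 -> quot z = G z / Th z.
Proof. by move=> /limval_ratio; apply: limval_unique (quotP z). Qed.

Lemma quot_lip z : exists L d : R, 0 < d /\
  forall h, cabs h < d -> cabs (quot (z + h) - quot z) <= L * cabs h.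
Proof.
have [L [d [d0 hL]]] := quotP z; exists L, d; split=> // h hd.
have [->|h0] := eqVneq h 0; first by rewrite addr0 subrr cabs0 mulr0.
by have [Tn q] := hL h h0 hd; rewrite quotE.
Qed.

Lemma quot_per z p (m : C -> C) : (forall z, m z != 0) ->
  (forall z, G (z + p) = m z * G z) -> (forall z, Th (z + p) = m z * Th z) ->
  quot (z + p) = quot z.
Proof.
move=> m0 Gp Tp; apply: limval_unique (quotP _) _.
have [L [d [d0 hL]]] := quotP z; exists L, d; split=> // h h0 hd.
have [Tn q] := hL h h0 hd.
by rewrite addrAC Gp Tp mulf_neq0 // -mulf_div divff ?mul1r.
Qed.

Lemma quot_int z (k : int) : quot (z + k%:~R) = quot z.
Proof.
have n1 w : quot (w + 1) = quot w by exact: (quot_per _ m1_neq0 G1 Th1).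
elim/int_rec: k => [|n IH|n IH]; first by rewrite addr0.
  by rewrite -addn1 PoszD intrD addrA n1.
by rewrite -n1 -addrA -addn1 PoszD opprD intrD -addrA -[(-1)%:~R]/(-1) addNr addr0.
Qed.

Lemma quot_intt z (k : int) : quot (z + k%:~R * t) = quot z.
Proof.
have n1 w : quot (w + t) = quot w by exact: (quot_per _ mt_neq0 Gt Tht).
elim/int_rec: k => [|n IH|n IH]; first by rewrite mul0r addr0.
  by rewrite -addn1 PoszD intrD mulrDl mul1r addrA n1.
rewrite -n1 -addrA -addn1 PoszD opprD intrD -[(-1)%:~R]/(-1) mulrDl mulN1r.
by rewrite -addrA addNr addr0.
Qed.

(** The Lipschitz bound makes |quot| continuous in real coordinates on the compact unit square;
    periodicity under 1 and t covers the plane. *)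
Lemma quot_max : exists z0, forall z, cabs (quot z) <= cabs (quot z0).
Proof.
pose g (p : R * R) : R := cabs (quot (p.1%:C + p.2%:C * t)).
have gc : continuous g.
  move=> p; have [L [d [d0 hL]]] := quot_lip (p.1%:C + p.2%:C * t).
  apply/cvgrPdist_le => e e0.
  pose K := 1 + cabs t; have K1 : 1 <= K by rewrite lerDl cabs_ge0.
  pose r := Order.min (d / K) (e / ((1 + `|L|) * K)).
  have L1 : 0 < 1 + `|L| by rewrite ltr_pwDl.
  have r0 : 0 < r by rewrite lt_min !divr_gt0 ?mulr_gt0 //; lra.
  exists (ball p.1 r, ball p.2 r) => /=.
    by split; exact: nbhsx_ballx.
  move=> q [b1 b2].
  rewrite /ball /= in b1 b2.
  pose h : C := (q.1 - p.1)%:C + (q.2 - p.2)%:C * t.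
  have eh : q.1%:C + q.2%:C * t = p.1%:C + p.2%:C * t + h.
    by rewrite /h !rmorphB; ring.
  have hr : cabs h < r * K.
    apply: (le_lt_trans (cabsD _ _)); rewrite cabsM !cabsR distrC [X in _ + X * _]distrC.
    rewrite mulrDr mulr1 ltr_leD // ler_wpM2r ?cabs_ge0 //; exact: ltW.
  have K0 : 0 < K by lra.
  have q1 := hL h; rewrite /g eh.
  have hd : cabs h < d.
    apply: (lt_le_trans hr); by rewrite -ler_pdivlMr // ge_min lexx.
  have he : (1 + `|L|) * cabs h <= e.
    rewrite mulrC -ler_pdivlMr //; apply: ltW; apply: (lt_le_trans hr).
    by rewrite -ler_pdivlMr // -[e / _ / _]mulrA -invfM ge_min lexx orbT.
  have q2 : L * cabs h <= e.
    apply: le_trans he; rewrite ler_wpM2r ?cabs_ge0 //.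
    by have := ler_norm L; lra.
  rewrite ler_norml; apply/andP; split.
    rewrite lerNl opprB; apply: (le_trans (cabs_dist _ _)).
    by apply: le_trans q2; exact: q1.
  apply: (le_trans (cabs_dist _ _)); rewrite -cabsN opprB.
  by apply: le_trans q2; exact: q1.
have cK : compact (`[0 : R, 1] `*` `[0 : R, 1]).
  by apply: compact_setX; exact: segment_compact.
have [||p _ hp] := @compact_EVT_max _ _ g _ _ cK.
- by exists (0, 0); split; rewrite /= in_itv /= lexx ler01.
- exact: continuous_subspaceT.
exists (p.1%:C + p.2%:C * t) => z.
pose y := complex.Im z / complex.Im t; pose x := complex.Re (z - y%:C * t).
have ez : z = x%:C + y%:C * t.
  apply/eqP; rewrite -subr_eq; apply/eqP.
  have i0 : complex.Im (z - y%:C * t) = 0.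
    by rewrite ImD ImN ImMr /y divfK ?subrr // gt_eqF.
  by rewrite /x; case: (z - y%:C * t) i0 => a b /= ->.
have red : quot z = quot ((x - (Num.floor x)%:~R)%:C + (y - (Num.floor y)%:~R)%:C * t).
  rewrite ez -[RHS](quot_int _ (Num.floor x)) -[RHS](quot_intt _ (Num.floor y)); congr quot.
  by rewrite !rmorphB !rmorph_int; ring.
have fr (a : R) : 0 <= a - (Num.floor a)%:~R <= 1.
  have /andP[f1 f2] := floor_itv a; rewrite intrD in f2.
  by rewrite subr_ge0 f1 lerBlDl ltW.
rewrite red; apply: (hp (_, _)).
by rewrite inE; split; rewrite /= in_itv /=; exact: fr.
Qed.

(** Maximum principle at [z0]. If G - v Th is not zero, then quot = v + g h^p + O(h^(p+1)) near [z0]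
    with g nonzero, and along a direction in which g h^p points like v the modulus exceeds its
    maximum. *)
Lemma liouville : exists v, forall z, G z = v * Th z.
Proof.
have contra (a Q D X Y Z : R) :
  Q <= a -> a + X - Q <= D -> D <= Y -> Y <= Z -> Z < X -> False by lra.
have [z0 mx] := quot_max; set v := quot z0 in mx.
exists v.
have [a ha] := GS z0; have [b hb] := TS z0.
have hH : pser (fun z => G z + - v * Th z) z0 (fun k => a k + - v * b k).
  by apply: pserD ha _; exact: pserZ.
have [H0|[k [ck cz]]] := pser_order hH.
  by move=> z; apply/eqP; rewrite -subr_eq0 -mulNr H0.
exfalso.
have [k' bk [bz _]] := Th_order hb.
set c := a k + - v * b k in ck.
(* As [quot z0] is [v], the difference vanishes to higher order than [Th]: otherwise division by
   |h|^k would force its leading coefficient to be 0. *)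
have kk : (k' < k)%N.
  rewrite ltnNge; apply/negP => kk.
  have [L [d [d0 hL]]] := quotP z0.
  have [d1 [d10 d11 hl]] := pser_lower hH ck cz.
  have [B hB] := pser_head hb bz.
  have bb h : cabs h < 1 -> cabs (Th (z0 + h)) <= (`|B| + cabs (b k')) * cabs h ^+ k'.
    move=> h1; have -> : Th (z0 + h) = (Th (z0 + h) - b k' * h ^+ k') + b k' * h ^+ k' by ring.
    apply: (le_trans (cabsD _ _)); rewrite mulrDl cabsM cabsX lerD2r.
    apply: (le_trans (hB _ h1)); rewrite exprS mulrA ler_wpM2r ?exprn_ge0 ?cabs_ge0 //.
    apply: (le_trans (y := `|B| * cabs h)); first by rewrite ler_wpM2r ?cabs_ge0 ?ler_norm.
    by rewrite ler_piMr // ltW.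
  suff : c = 0 by move/eqP; rewrite (negbTE ck).
  apply: (@cabs_lim0 _ _ (2 * (`|L| * (`|B| + cabs (b k')))) (Order.min d d1)).
    by rewrite lt_min d0 d10.
  move=> h /andP[h0]; rewrite lt_min => /andP[hd hd1].
  have hn : h != 0 by rewrite -cabs_eq0 gt_eqF.
  have [Tn q] := hL h hn hd; have h1 := lt_le_trans hd1 d11.
  have eq : G (z0 + h) / Th (z0 + h) - v = (G (z0 + h) + - v * Th (z0 + h)) / Th (z0 + h).
    by rewrite mulrDl mulfK.
  rewrite -/v eq cabsM cabsV ler_pdivrMr in q; last by rewrite lt_neqAle eq_sym cabs_eq0 Tn cabs_ge0.
  have q1 := hl h hd1; have q2 := bb h h1; rewrite /= -/c in q1.
  have xk : 0 < cabs h ^+ k by rewrite exprn_gt0.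
  have q3 : cabs h ^+ k' <= cabs h ^+ k.
    by rewrite -(subnKC kk) exprD ler_piMr ?exprn_ge0 ?cabs_ge0 // exprn_ile1 ?cabs_ge0 // ltW.
  have q4 : cabs (G (z0 + h) + - v * Th (z0 + h)) <= `|L| * (`|B| + cabs (b k')) * cabs h * cabs h ^+ k.
    apply: (le_trans q); apply: (le_trans (y := `|L| * cabs h * cabs (Th (z0 + h)))).
      by rewrite ler_wpM2r ?cabs_ge0 // ler_wpM2r ?cabs_ge0 // ler_norm.
    rewrite -!mulrA ler_wpM2l // [X in _ <= X]mulrCA ler_wpM2l ?cabs_ge0 //; apply: (le_trans q2).
    by rewrite ler_wpM2l // addr_ge0 ?cabs_ge0.
  have := le_trans q1 q4; rewrite ler_pM2r // ler_pdivrMr // => q5.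
  by apply: (le_trans q5); rewrite mulrC !mulrA.
pose p := (k - k')%N; have p0 : (0 < p)%N by rewrite subn_gt0.
have kE : k = (p + k')%N by rewrite subnK // ltnW.
pose g := c / b k'; have g0 : g != 0 by rewrite mulf_neq0 ?invr_eq0.
have exp : exists B d : R, 0 < d /\ forall h, h != 0 -> cabs h < d ->
    cabs (quot (z0 + h) - (v + g * h ^+ p)) <= B * cabs h ^+ p.+1.
  have [B1 hB1] := pser_head hH cz; have [B2 hB2] := pser_head hb bz.
  have [d [d0 d1 hd]] := pser_lower hb bk bz.
  have c0 : 0 < cabs (b k') by rewrite lt_neqAle eq_sym cabs_eq0 bk cabs_ge0.
  exists ((`|B1| + cabs g * `|B2|) * 2 / cabs (b k')), d; split=> // h h0 hh.
  have x0 : 0 < cabs h by rewrite lt_neqAle eq_sym cabs_eq0 h0 cabs_ge0.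
  have low := hd h hh; have xk : 0 < cabs h ^+ k' by rewrite exprn_gt0.
  have T0 : 0 < cabs (Th (z0 + h)) by apply: lt_le_trans low; rewrite mulr_gt0 // divr_gt0.
  have Tn : Th (z0 + h) != 0 by rewrite -cabs_eq0 gt_eqF.
  rewrite quotE //.
  have -> : G (z0 + h) / Th (z0 + h) - (v + g * h ^+ p) =
     ((G (z0 + h) + - v * Th (z0 + h) - c * h ^+ k) -
       g * h ^+ p * (Th (z0 + h) - b k' * h ^+ k')) / Th (z0 + h).
    have -> : c = g * b k' by rewrite /g divfK.
    by rewrite kE exprD; move: (h ^+ p) (h ^+ k') => ? ?; field.
  rewrite cabsM cabsV ler_pdivrMr //.
  have h1 : cabs h < 1 by apply: lt_le_trans hh d1.
  have q1 := hB1 h h1; have q2 := hB2 h h1; rewrite /= -/c in q1.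
  have q3 : cabs (G (z0 + h) + - v * Th (z0 + h) - c * h ^+ k - g * h ^+ p * (Th (z0 + h) - b k' * h ^+ k'))
      <= (`|B1| + cabs g * `|B2|) * (cabs h ^+ p.+1 * cabs h ^+ k').
    apply: (le_trans (cabsD _ _)); rewrite [X in _ <= X]mulrDl lerD //.
      apply: (le_trans q1); rewrite -exprD addSn -kE.
      by rewrite ler_wpM2r ?exprn_ge0 ?cabs_ge0 // ler_norm.
    rewrite cabsN cabsM (cabsM g) cabsX -!mulrA ler_wpM2l ?cabs_ge0 //.
    rewrite exprSr -!mulrA mulrCA ler_wpM2l ?exprn_ge0 ?cabs_ge0 //.
    apply: (le_trans q2); rewrite -exprS.
    by rewrite ler_wpM2r ?exprn_ge0 ?cabs_ge0 // ler_norm.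
  apply: (le_trans q3).
  have q4 : 0 <= `|B1| + cabs g * `|B2| by rewrite addr_ge0 ?mulr_ge0 ?cabs_ge0.
  have q5 : cabs h ^+ k' <= 2 / cabs (b k') * cabs (Th (z0 + h)).
    by rewrite mulrAC ler_pdivrMr // in low; rewrite mulrAC ler_pdivlMr // mulrC [2 * _]mulrC.
  have -> : (`|B1| + cabs g * `|B2|) * 2 / cabs (b k') * cabs h ^+ p.+1 * cabs (Th (z0 + h)) =
    (`|B1| + cabs g * `|B2|) * (cabs h ^+ p.+1 * (2 / cabs (b k') * cabs (Th (z0 + h)))) by ring.
  by rewrite ler_wpM2l // ler_wpM2l // exprn_ge0 ?cabs_ge0.
have [B [d [d0 hB]]] := exp.
(* Unit vector in the direction of [v]; when [v] is 0, any direction increases the modulus. *)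
pose u : C := if v == 0 then 1 else v / (cabs v)%:C.
have uE : v = (cabs v)%:C * u.
  rewrite /u; case: eqVneq => [->|vn]; first by rewrite cabs0 mul0r.
  rewrite mulrC divfK //; apply/eqP => /(congr1 (@cabs R)); rewrite cabsR cabs0.
  by rewrite ger0_norm ?cabs_ge0 // => /eqP; rewrite cabs_eq0 (negbTE vn).
have cu : cabs u = 1.
  rewrite /u; case: eqVneq => [_|vn]; first by rewrite cabs1.
  rewrite cabsM cabsV cabsR ger0_norm ?cabs_ge0 // divff // cabs_eq0 //.
(* A solution of g rho^p = u, so that h = x rho with small x > 0 moves the quotient outwards along
   [u]. *)
pose rho : C := p.-root (u / g).
have rE : g * rho ^+ p = u by rewrite /rho rootCK // mulrCA divff // mulr1.
have un : u != 0 by rewrite -cabs_eq0 cu oner_eq0.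
have rho0 : rho != 0.
  by apply: contraNneq un => r0; rewrite -rE r0 expr0n (gtn_eqF p0) mulr0.
have cr : 0 < cabs rho by rewrite lt_neqAle eq_sym cabs_eq0 rho0 cabs_ge0.
pose M := `|B| * cabs rho ^+ p.+1.
have M0 : 0 <= M by rewrite mulr_ge0 ?exprn_ge0 ?cabs_ge0.
pose x := Order.min (d / (2 * cabs rho)) (1 + M)^-1.
have x0 : 0 < x by rewrite lt_min divr_gt0 ?invr_gt0 ?mulr_gt0 //; lra.
have xM : x * M < 1.
  have : x <= (1 + M)^-1 by rewrite ge_min lexx orbT.
  rewrite -[(1 + M)^-1]mul1r ler_pdivlMr ?mulrDr ?mulr1; lra.
pose h := x%:C * rho.
have ch : cabs h = x * cabs rho by rewrite cabsM cabsR gtr0_norm.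
have hn : h != 0 by rewrite -cabs_eq0 ch mulf_neq0 // gt_eqF.
have hd : cabs h < d.
  rewrite ch -ltr_pdivlMr //; apply: (le_lt_trans (y := d / (2 * cabs rho))); first by rewrite ge_min lexx.
  by rewrite ltr_pM2l // ltf_pV2 ?posrE ?mulr_gt0 //; lra.
have q := hB h hn hd.
have e1 : v + g * h ^+ p = (cabs v + x ^+ p)%:C * u.
  rewrite /h exprMn mulrCA rE {1}uE rmorphD rmorphXn /=.
  by move: (x%:C ^+ p) => y; ring.
rewrite e1 ch exprMn in q.
have := cabs_dist ((cabs v + x ^+ p)%:C * u) (quot (z0 + h)).
rewrite -[cabs (_ - quot _)]cabsN opprB cabsM cu mulr1 cabsR.
have xp : 0 < x ^+ p by rewrite exprn_gt0.
rewrite ger0_norm; last by rewrite addr_ge0 ?cabs_ge0 // ltW.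
have := mx (z0 + h).
have q5 : B * (x ^+ p.+1 * cabs rho ^+ p.+1) <= x ^+ p * (x * M).
  rewrite /M exprSr -!mulrA mulrCA ler_wpM2l ?(ltW xp) // mulrCA ler_wpM2l ?(ltW x0) //.
  by rewrite ler_wpM2r ?exprn_ge0 ?cabs_ge0 // ler_norm.
have q6 : x ^+ p * (x * M) < x ^+ p by rewrite gtr_pMr.
by move=> i1 i2; exact: (contra _ _ _ _ _ _ i1 i2 q q5 q6).
Qed.

End Liouville.

(** * The modular transformation of theta *)

Section ThetaModular.
Variable R : realType.
Local Notation C := R[i].
Local Notation tpi := ((2 * pi : R)%:C * 'i%C).

Lemma pser_unique (F : C -> C) z a b : pser F z a -> pser F z b -> a =1 b.
Proof.
move=> ha hb; have hD := pserD ha (pserZ (-1) hb).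
move=> k; apply/eqP; rewrite -subr_eq0; apply/negPn/negP.
elim/ltn_ind: k => k IH ak.
have hk j : (j < k)%N -> a j + -1 * b j = 0.
  by move=> jk; rewrite mulN1r; apply/eqP/negPn/negP; exact: IH.
have ak' : a k + -1 * b k != 0 by rewrite mulN1r.
have [d [d0 d1 hd]] := pser_lower hD ak' hk.
have := hd (d / 2)%:C; rewrite [X in _ <= cabs X](_ : _ = 0) ?cabs0 ?cabsR; last by ring.
rewrite gtr0_norm ?divr_gt0 //.
have /[swap] /[apply] : d / 2 < d by lra.
rewrite leNgt mulr_gt0 ?exprn_gt0 ?divr_gt0 //.
by rewrite lt_neqAle eq_sym cabs_eq0 ak' cabs_ge0.
Qed.

Lemma pser_theta (t : C) z : 0 < complex.Im t ->
  pser (theta t) z (fun k => csum (fun n => theta_term t z n * ((tpi * half R n) ^+ k / k`!%:R))).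
Proof.
move=> t0; apply: pser_expsum => [r r0|h]; first exact: asum_theta_exp.
rewrite theta_sum //; apply: eq_csum => n; exact: theta_term_shift.
Qed.

Lemma pser_cexp (b z : C) : exists2 e, pser (fun x => cexp (b * x)) z e & e 0%N = cexp (b * z).
Proof.
exists (fun k => cexp (b * z) * (b ^+ k / k`!%:R)) => [h|]; last by rewrite expr0 divr1 mulr1.
have e : (fun k => cexp (b * z) * (b ^+ k / k`!%:R) * h ^+ k) =
         (fun k => cexp (b * z) * ((b * h) ^+ k / k`!%:R)).
  by apply/funext => k; rewrite exprMn; ring.
rewrite e; split; first by apply: asumZ; exact: asum_exp.
by rewrite csumZ ?mulrDr ?cexpD ?[cexp (b * h)]cexpE //; exact: asum_exp.
Qed.

Lemma pser_shift (F : C -> C) z a : pser F z a -> pser (fun x => F (z + x)) 0 a.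
Proof. by move=> ha h; rewrite add0r. Qed.

Lemma sign2z (m : int) : (-1) ^ (2 * m) = 1 :> C.
Proof.
rewrite -exprz_exp; have -> : (-1 : C) ^ (2 : int) = 1; last exact: exp1rz.
by rewrite -[2 : int]/(Posz 2) -exprnP sqrrN expr1n.
Qed.

(** [theta_shift] carries the zero to 0, where the derivative is 2 pi i eta^3 and hence nonzero. *)
Lemma theta_simple (t : C) z b : 0 < complex.Im t ->
  pser (theta t) z b -> theta t z = 0 -> b 1%N != 0.
Proof.
move=> t0 hb tz; have [l [m zE]] := theta_eq0 t0 tz.
apply/negP => /eqP b1.
pose K : C := (-1) ^ (l + m) * ce (l%:~R ^+ 2 / 2 * t).
have Kn : K^-1 != 0.
  by rewrite invr_eq0 mulf_neq0 ?ce_neq0 // expfz_neq0 // oppr_eq0 oner_eq0.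
have e h : theta t h = (-1) ^ (l + m) * ce (l%:~R ^+ 2 / 2 * t) * (cexp (tpi * l%:~R * h) * theta t (z + h)).
  have -> : z + h = h + l%:~R * t + m%:~R by rewrite zE; ring.
  rewrite theta_shift // -mulrA -[tpi * _ * h]mulrA -ceE.
  have -> : (-1) ^ (l + m) * (ce (l%:~R ^+ 2 / 2 * t) * (ce (l%:~R * h) *
     ((-1) ^ (l + m) * ce (- (l%:~R ^+ 2 / 2 * t + l%:~R * h)) * theta t h))) =
     ((-1) ^ (l + m) * (-1) ^ (l + m)) * (ce (l%:~R ^+ 2 / 2 * t) * ce (l%:~R * h) *
      ce (- (l%:~R ^+ 2 / 2 * t + l%:~R * h))) * theta t h by ring.
  rewrite -2!ceD subrr ce0 mulr1 -expfzDr ?oppr_eq0 ?oner_eq0 // -mulr2n -mulr_natl sign2z.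
  by rewrite mul1r.
have [ee he e0] := pser_cexp (tpi * l%:~R) 0.
have H := pserZ ((-1) ^ (l + m) * ce (l%:~R ^+ 2 / 2 * t)) (pserM he (pser_shift hb)).
have H2 : pser (theta t) 0 _ := pser_ext (fun h => esym (e h)) H.
have := pser_unique H2 (pser_theta 0 t0) 1%N.
rewrite big_ord_recl big_ord1 /= subn0 b1 mulr0 add0r subnn -(pser0 hb) tz mulr0 mulr0.
move=> /esym; rewrite (eq_csum (g := fun n => theta_term t 0 n * (tpi * half R n) ^+ 1)); last first.
  by move=> n; rewrite /= divr1.
by move/eqP; rewrite (negbTE (Dtheta1_neq0 t0)).
Qed.

(** x - y - x y = (1 + x)(1 - y) - 1 is odd unless both integers are even. Determinant 1 excludes
    this for a column of the matrix, so the signs of the multipliers are the same for all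
    matrices. *)
Lemma sign_pair (x y : int) : (forall p r, ~ (x = 2 * p /\ y = 2 * r)) ->
  (-1) ^ (x - y) * ce (- (x%:~R * y%:~R) / 2) = -1 :> C.
Proof.
move=> nev.
have ceh (n : int) : ce (n%:~R / 2) = (-1) ^ n :> C.
  by rewrite ceMz ce_half.
have -> : - (x%:~R * y%:~R) / 2 = (- (x * y))%:~R / 2 :> C by rewrite rmorphN /= intrM.
rewrite ceh -expfzDr ?oppr_eq0 ?oner_eq0 //.
suff [m ->] : exists m, x - y - x * y = 2 * m + 1.
  by rewrite expfzDr ?oppr_eq0 ?oner_eq0 // sign2z mul1r.
have par (n : int) : exists p, n = 2 * p \/ n = 2 * p + 1.
  exists (n %/ 2)%Z; have := divz_eq n 2; have := modz_ge0 n (isT : 2 != 0 :> int).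
  have := ltz_pmod n (isT : 0 < 2 :> int); lia.
have [p [xE|xE]] := par x; have [r [yE|yE]] := par y.
- by case: (nev p r).
- by exists (p - r - 1 - p * (2 * r + 1)); rewrite xE yE; ring.
- by exists (p - r - 1 * r - 2 * p * r); rewrite xE yE; ring.
- by exists (p - r - 1 - p - r - 2 * p * r); rewrite xE yE; ring.
Qed.

Lemma multiplier_eq (A B E D s T : C) : A * B = E * D -> A * (s * B * T) = s * E * (D * T).
Proof.
move=> e; have -> : A * (s * B * T) = s * (A * B) * T by ring.
by rewrite e; ring.
Qed.

Lemma modular_exponent1 (c z j t : C) : j != 0 ->
  - (c * (z + 1) ^+ 2 / (2 * j)) + - ((- c) ^+ 2 / 2 * t + - c * (z / j)) =
  - ((1 / j - - c * t) * c) / 2 + - (c * z ^+ 2 / (2 * j)).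
Proof. by move=> j0; field. Qed.

Lemma modular_exponent2 (c d z j t s : C) : j != 0 -> d = j - c * t ->
  - (c * (z + t) ^+ 2 / (2 * j)) + - (d ^+ 2 / 2 * s + d * (z / j)) =
  - (d * (d * s - t / j)) / 2 + - (t / 2 + z) + - (c * z ^+ 2 / (2 * j)).
Proof. by move=> j0 ->; field. Qed.

(* The quotient of both sides (up to the constant) is an elliptic function without poles. *)
Lemma theta_modular (a b c d : int) (t t' : C) : 0 < complex.Im t -> 0 < complex.Im t' ->
  a * d - b * c = 1 ->
  let j := c%:~R * t + d%:~R in t' = (a%:~R * t + b%:~R) / j ->
  exists k : C, forall z, theta t' (z / j) = k * ce (c%:~R * z ^+ 2 / (2 * j)) * theta t z.
Proof.
move=> t0 t'0 det j t'E.
have detC : a%:~R * d%:~R - b%:~R * c%:~R = 1 :> C by rewrite -!intrM -intrB det.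
have j0 : j != 0.
  apply/eqP => j0; move: t'E t'0; rewrite j0 invr0 mulr0 => ->.
  by rewrite ltxx.
have tj : t' * j = a%:~R * t + b%:~R by rewrite t'E divfK.
have e1 : 1 / j = (- c)%:~R * t' + a%:~R.
  apply: (mulIf j0); rewrite divfK // mulrDl -mulrA tj rmorphN /= /j -[LHS]detC.
  by ring.
have e2 : t / j = d%:~R * t' + (- b)%:~R.
  apply: (mulIf j0); rewrite divfK // mulrDl -mulrA tj rmorphN /=.
  by rewrite -[LHS]mul1r -[X in X * t = _]detC /j; ring.
(* The Gaussian factor absorbs the quadratic exponent, so that [G] has the multipliers of [theta t]
   under z + 1 and z + t. *)
pose G z := ce (- (c%:~R * z ^+ 2 / (2 * j))) * theta t' (z / j).
have GS z : exists s, pser G z s.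
  have [s1 h1] := pser_gauss (tpi * - (c%:~R / (2 * j))) z.
  have h2 := pser_scale (pser_theta (j^-1 * z) t'0).
  have h3 := pserM h1 h2; eexists; apply: pser_ext h3 => x /=.
  by rewrite /G [x / j]mulrC ceE; congr (cexp _ * _); ring.
have tS z : exists s, pser (theta t) z s by eexists; exact: pser_theta.
have G1 z : G (z + 1) = -1 * G z.
  rewrite /G [(z + 1) / j]mulrDl e1 addrA theta_shift //.
  rewrite -[X in _ = X * _](@sign_pair a c); last first.
    move=> p r [aE cE]; have : 2 * (p * d - b * r) = 1 by rewrite -[RHS]det aE cE; ring.
    lia.
  rewrite [a - c]addrC; apply: multiplier_eq; rewrite -2!ceD; congr ce.
  have -> : a%:~R = 1 / j - (- c)%:~R * t' :> C by rewrite e1; ring.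
  rewrite rmorphN; exact: modular_exponent1.
have Gt z : G (z + t) = - ce (- (t / 2 + z)) * G z.
  rewrite /G [(z + t) / j]mulrDl e2 addrA theta_shift //.
  rewrite -[X in _ = X * _]mulN1r -[X in _ = X * _ * _](@sign_pair d b); last first.
    move=> p r [dE bE]; have : 2 * (a * p - r * c) = 1 by rewrite -[RHS]det dE bE; ring.
    lia.
  rewrite -[X in _ = X * _]mulrA; apply: multiplier_eq; rewrite -3!ceD; congr ce.
  have h1 : b%:~R = d%:~R * t' - t / j :> C by rewrite e2 rmorphN /=; ring.
  rewrite h1; have h2 : d%:~R = j - c%:~R * t by rewrite /j; ring.
  exact: modular_exponent2.
have th1 z : theta t (z + 1) = -1 * theta t z.
  have := theta_shift t0 z 0 1; rewrite mul0r addr0 add0r => ->.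
  by rewrite expr0n /= !mul0r addr0 oppr0 ce0 mulr1.
have tht z : theta t (z + t) = - ce (- (t / 2 + z)) * theta t z.
  have := theta_shift t0 z 1 0; rewrite addr0 mul1r addr0 => ->.
  have -> : 1%:~R ^+ 2 / 2 * t + 1%:~R * z = t / 2 + z :> C by ring.
  by rewrite -[(-1) ^ 1]/(-1) mulN1r.
have [||||v hv] := @liouville _ G (theta t) t (fun=> -1) (fun z => - ce (- (t / 2 + z))) t0 GS tS _ _ G1 th1 Gt tht.
- by move=> z; rewrite oppr_eq0 oner_eq0.
- by move=> z; rewrite oppr_eq0 ce_neq0.
- by move=> z s; exact: theta_simple.
- move=> z /(theta_eq0 t0)[l [m zE]]; rewrite /G.
  have -> : z / j = 0 + (l * d - m * c)%:~R * t' + (m * a - l * b)%:~R.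
    have -> : z / j = l%:~R * (t / j) + m%:~R * (1 / j) by rewrite zE; field.
    by rewrite e1 e2 !intrB !intrM !rmorphN /=; ring.
  by rewrite theta_shift // theta0 // !mulr0.
exists v => z; have := hv z; rewrite /G => /(congr1 (fun x => ce (c%:~R * z ^+ 2 / (2 * j)) * x)).
rewrite mulrA -ceD subrr ce0 mul1r => ->; ring.
Qed.

End ThetaModular.

(** * Fourier expansion of the inverse Euler products *)

Section PartitionSeries.
Variable R : realType.
Local Notation C := R[i].
Local Notation Im := complex.Im.

Lemma sumbndM (I J : choiceType) (f : I -> C) (g : J -> C) (A B : R) :
  sumbnd f A -> sumbnd g B -> sumbnd (fun p : I * J => f p.1 * g p.2) (A * B).
Proof.
move=> hf hg s us.
pose s1 := undup (map fst s); pose s2 := undup (map snd s).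
have A0 : 0 <= A by have := hf nil isT; rewrite big_nil.
have sub : {subset s <= [seq (i, j) | i <- s1, j <- s2]}.
  move=> p ps; apply/allpairsP; exists p; rewrite !mem_undup !map_f //.
  by case: p ps.
apply: (@le_trans _ _ (\sum_(p <- [seq (i, j) | i <- s1, j <- s2]) cabs (f p.1 * g p.2))).
  apply: big_subset_le => // [p|]; first exact: cabs_ge0.
  by apply: allpairs_uniq; rewrite ?undup_uniq // => -[? ?] [? ?].
rewrite big_allpairs_dep /=.
under eq_bigr do (under eq_bigr do rewrite cabsM); under eq_bigr do rewrite -mulr_sumr.
rewrite -mulr_suml ler_pM ?sumr_ge0 //; try by move=> *; exact: cabs_ge0.
- by apply: hf; exact: undup_uniq.
- by apply: hg; exact: undup_uniq.
Qed.

(* [partc k n] counts the partitions of [n] into parts at most [k]. *)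
Fixpoint partc (k n : nat) : C :=
  if k is k'.+1 then \sum_(i < n.+1) partc k' i * (k %| n - i)%N%:R else (n == 0%N)%:R.

(** Each step multiplies by the geometric series in q^(k+1). The bound is the same product at |q|,
    which [rpoch_le] controls for all k at once. *)
Lemma sumbnd_partc (t : C) k : 0 < Im t ->
  sumbnd (fun n => partc k n * ce (n%:R * t))
    (\prod_(i < k) (1 - cabs (ce t) ^+ i.+1)^-1) /\
  csum (fun n => partc k n * ce (n%:R * t)) = (qpoch t k)^-1.
Proof.
move=> t0; elim: k => [|k [IH1 IH2]].
  rewrite big_ord0 qpoch0 invr1; split=> [s us|].
    rewrite (bigID (pred1 0%N)) /= [X in _ + X]big1 ?addr0; last first.
      by move=> i /negbTE ->; rewrite mul0r cabs0.
    rewrite (eq_bigr (fun=> 1)); last by move=> i /eqP ->; rewrite /= mul1r mul0r ce0 cabs1.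
    rewrite -big_filter; have : (size [seq i <- s | i == 0%N] <= 1)%N.
      by rewrite size_filter (count_uniq_mem _ us); case: (_ \in _).
    case: [seq i <- s | _] => [|x [|]] // _; rewrite ?big_nil ?big_cons ?big_nil ?addr0 //.
  rewrite (@csum1 _ _ _ 0%N) ?eqxx ?mul0r ?ce0 ?mul1r //.
  by move=> i /negbTE /= ->; rewrite mul0r.
have x1 : cabs (ce (k.+1%:R * t)) < 1 by apply: cabs_ce_lt1; rewrite ImMn mulr_gt0.
pose g := push (fun m => (m * k.+1)%N) (fun m : nat => ce (k.+1%:R * t) ^+ m).
have gE n : g n = (k.+1 %| n)%N%:R * ce (n%:R * t).
  have [dv|ndv] := boolP (k.+1 %| n)%N; last first.
    rewrite mul0r /g /push -[RHS](csum0 R nat); apply: eq_csum => m.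
    by case: eqP => // e; move: ndv; rewrite -e dvdn_mull.
  rewrite mul1r /g /push (@csum1 _ _ _ (n %/ k.+1)%N) => [|m mn].
    by rewrite divnK // eqxx -ceMn mulrA -natrM divnK.
  by case: eqP => // e; move: mn; rewrite -e mulnK // eqxx.
have g1 : sumbnd g (1 - cabs (ce t) ^+ k.+1)^-1.
  apply: sumbnd_push; have := sumbnd_geom x1.
  by rewrite [X in (1 - cabs X)^-1]ceMn cabsX.
have g2 : csum g = (1 - ce (k.+1%:R * t))^-1.
  by rewrite /g csum_push ?csum_geom //; exact: asum_geom.
have e : (fun n => partc k.+1 n * ce (n%:R * t)) =
   push (fun p : nat * nat => (p.1 + p.2)%N)
     (fun p => (partc k p.1 * ce (p.1%:R * t)) * g p.2).
  apply/funext => n; rewrite (push_addn (fun n => partc k n * ce (n%:R * t)) g).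
  rewrite [partc k.+1 n]/= mulr_suml; apply: eq_bigr => i _; rewrite gE.
  have -> : n%:R * t = i%:R * t + (n - i)%:R * t.
    by rewrite -mulrDl -natrD subnKC // -ltnS.
  by rewrite ceD; move: (ce _) (ce _) => x y; ring.
rewrite e; split.
  by rewrite big_ord_recr; apply: sumbnd_push; exact: (sumbndM IH1 g1).
have a1 : asum (fun n => partc k n * ce (n%:R * t)) by eexists; exact: IH1.
have a2 : asum g by eexists; exact: g1.
rewrite csum_push; last exact: (asumM a1 a2).
by rewrite (csumM a1 a2) IH2 g2 qpochS invfM.
Qed.

(** [s] = 1 and [s] = -1 serve the factors in zeta and 1 / zeta of the inverse of theta, [s] = 0 the
    inverse powers of eta. *)
Lemma isFS_eulerE (s : int) : exists c,
  isFSon (fun (t : uhp R) (z _ : C) => 0 < Im (val t + s%:~R * z)) c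
    (fun t z _ => eulerE (val t) (s%:~R * z)) /\
  forall m, c m != 0 -> exists k : nat, m.2 = (s * k, 0).
Proof.
pose h (p : nat * nat) : fexp := ((p.1 + p.2)%N, (s * p.1, 0)).
exists (push h (fun p => partc p.1 p.2)); split; last first.
  move=> m hm; apply/not_existsP => no; move/negP: hm; apply; apply/eqP.
  rewrite /push -[RHS](csum0 R (nat * nat)%type); apply: eq_csum => p.
  by case: eqP => // e; case: (no p.1); rewrite -e.
apply: isFSon_push => t z w D; have t0 := valP t; rewrite /= in t0.
set u := val t + s%:~R * z in D.
have eu p : partc p.1 p.2 * qmon (h p) (val t) z 0 = ce (p.1%:R * u) * (partc p.1 p.2 * ce (p.2%:R * val t)).
  rewrite [RHS]mulrCA; congr (_ * _); rewrite -ceD /qmon /h /=; congr ce.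
  by rewrite /u /= natrD intrM -[(Posz p.1)%:~R]/(p.1%:R) mulr0 addr0; ring.
have r1 : cabs (ce (val t)) < 1 by exact: cabs_ce_lt1.
have au : asum (fun p : nat * nat => ce (p.1%:R * u) * (partc p.1 p.2 * ce (p.2%:R * val t))).
  apply: (@asum_pairI _ _ _ _ (fun k => cabs (ce u) ^+ k * qbound (val t))).
    move=> k; have [b1 _] := sumbnd_partc k t0 => l ul; rewrite /=.
    under eq_bigr do rewrite (cabsM (ce _)); rewrite -mulr_sumr ceMn cabsX.
    rewrite ler_wpM2l ?exprn_ge0 ?cabs_ge0 //; apply: (le_trans (b1 l ul)).
    have := rpoch_le t0 k; rewrite /= -[X in expR (- (2 * _ * X))]/(Im (val t)).
    by rewrite -cabs_ce.
  have : asum (fun k => (qbound (val t))%:C * (cabs (ce u))%:C ^+ k).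
    apply: asumZ; apply: asum_geom; rewrite cabsR ger0_norm ?cabs_ge0 //.
    exact: cabs_ce_lt1.
  by apply: eq_asum => k; rewrite rmorphM rmorphXn mulrC.
have e0 : (fun i => partc i.1 i.2 * qmon (h i) (val t) z w) =
     (fun p : nat * nat => ce (p.1%:R * u) * (partc p.1 p.2 * ce (p.2%:R * val t))).
  by apply/funext => p; rewrite -eu /qmon /= !mul0r.
rewrite e0; split=> //.
rewrite (csum_pair au) /eulerE; apply: eq_csum => k /=; have [b1 b2] := sumbnd_partc k t0.
by rewrite csumZ ?b2 //; eexists; exact: b1.
Qed.

End PartitionSeries.

(** * The product theta(z + h) theta(w + h) theta(z + w - h) and its derivatives in h *)

Section ThetaProduct.
Variable R : realType.
Local Notation C := R[i].
Local Notation Im := complex.Im.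
Local Notation tpi := ((2 * pi : R)%:C * 'i%C).
Local Notation half := (half R).
Variable t : C.
Hypothesis t0 : 0 < Im t.
Implicit Types (z w : C) (n : int * int * int).

Definition theta3 z w n : C :=
  theta_term t z n.1.1 * theta_term t w n.1.2 * theta_term t (z + w) n.2.
Definition dlt n : C := half n.1.1 + half n.1.2 - half n.2.
(** The k-th h-derivative of this product at h = 0, differentiated termwise: [dlt n] is the
    frequency in h of the term [n]. *)
Definition Gd (k : nat) z w : C := csum (fun n => theta3 z w n * (tpi * dlt n) ^+ k).

Lemma asum_theta3 z w (e : R) : 0 <= e ->
  asum (fun n => theta3 z w n * (expR (e * cabs (tpi * dlt n)))%:C).
Proof.
move=> e0; have a1 := asum_theta_exp t0 z e0; have a2 := asum_theta_exp t0 w e0.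
have a3 := asum_theta_exp t0 (z + w) e0.
have gen (a b c : C) (x y u v : R) : v <= x + y + u ->
    cabs (a * b * c * (expR v)%:C) <=
    cabs (a * (expR x)%:C * (b * (expR y)%:C) * (c * (expR u)%:C)).
  move=> le; rewrite [X in _ <= cabs X](_ : _ = a * b * c * (expR (x + y + u))%:C); last first.
    by rewrite !expRD !rmorphM /=; ring.
  rewrite !(cabsM (a * b * c)) ler_wpM2l ?cabs_ge0 // !cabsR !ger0_norm ?expR_ge0 //.
  by rewrite ler_expR.
apply: asum_le (asumM (asumM a1 a2) a3) => n; apply: gen; rewrite /=.
rewrite -!mulrDr ler_wpM2l // /dlt mulrBr mulrDr; apply: (le_trans (cabsD _ _)).
by rewrite cabsN lerD2r; exact: cabsD.
Qed.

Lemma asum_Gd k z w : asum (fun n => theta3 z w n * (tpi * dlt n) ^+ k).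
Proof. exact: (expsum_pow ltr01 (asum_theta3 z w ler01)). Qed.

Lemma theta3_sum z w h : csum (fun n => theta3 z w n * cexp (tpi * dlt n * h)) =
  theta t (z + h) * theta t (w + h) * theta t (z + w - h).
Proof.
have a1 := asum_theta t0 (z + h); have a2 := asum_theta t0 (w + h).
have a3 := asum_theta t0 (z + w - h).
rewrite !theta_sum // -(csumM a1 a2) -(csumM (asumM a1 a2) a3).
apply: eq_csum => n /=; rewrite (theta_term_shift t z h) (theta_term_shift t w h).
rewrite (theta_term_shift t (z + w) (- h)) /theta3 /dlt.
have -> : tpi * (half n.1.1 + half n.1.2 - half n.2) * h =
  tpi * half n.1.1 * h + tpi * half n.1.2 * h + tpi * half n.2 * - h by ring.
by rewrite !cexpD; move: (cexp _) (cexp _) (cexp _) => *; ring.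
Qed.

Lemma Gd_jet K z w : jet K (fun h => theta t (z + h) * theta t (w + h) * theta t (z + w - h))
  (\poly_(k < K) (Gd k z w / k`!%:R)).
Proof.
have := expsum_jet K ltr01 (asum_theta3 z w ler01).
by apply: jet_ext => h; exact: theta3_sum.
Qed.

(** A multiplier that is constant in h passes to every coefficient; the symmetries of [Gd] thus
    reduce to identities between products of three theta values. *)
Lemma Gd_ext (k : nat) z w z' w' (u : C) :
  (forall h, theta t (z' + h) * theta t (w' + h) * theta t (z' + w' - h) =
     u * (theta t (z + h) * theta t (w + h) * theta t (z + w - h))) ->
  Gd k z' w' = u * Gd k z w.
Proof.
move=> e; have j1 := jet_ext e (Gd_jet k.+1 z' w').
have := jet_unique j1 (jetZ u (Gd_jet k.+1 z w)) (ltnSn k).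
rewrite coefCM !coef_poly ltnSn mulrA => /(congr1 (fun x => x * k`!%:R)).
by rewrite !divfK // pnatr_eq0 -lt0n fact_gt0.
Qed.

Lemma Gd_swap k z w : Gd k w z = Gd k z w.
Proof. by rewrite -[RHS]mul1r; apply: Gd_ext => h; rewrite [w + z]addrC; ring. Qed.

Lemma Gd_reflect k z w : Gd k (- z - w) w = Gd k z w.
Proof.
rewrite -[RHS]mul1r; apply: Gd_ext => h.
have -> : - z - w + h = - (z + w - h) by ring.
have -> : - z - w + w - h = - (z + h) by ring.
by rewrite !thetaN //; ring.
Qed.

Lemma coef_scale (p : {poly C}) (k : C) j :
  (\poly_(i < size p) (k ^+ i * p`_i))`_j = k ^+ j * p`_j.
Proof.
by rewrite coef_poly; case: ltnP => // h; rewrite nth_default ?mulr0.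
Qed.

Lemma coef_mul3 (p q r : {poly C}) : (p * q * r)`_1 =
  p`_1 * q`_0 * r`_0 + p`_0 * q`_1 * r`_0 + p`_0 * q`_0 * r`_1.
Proof.
rewrite coefM big_ord_recl big_ord1 /= !coefM !big_ord_recl !big_ord0 /= /bump /=.
by rewrite ?subn0 ?subnn !addr0; ring.
Qed.

Lemma coef_cube (p q : {poly C}) : p`_0 = 0 -> p`_2 = 0 ->
  (forall j, q`_j = (-1) ^+ j * p`_j) -> (p * p * q)`_3 = - p`_1 ^+ 3.
Proof.
move=> p0 p2 hq; rewrite coefM !big_ord_recl big_ord0 /= !coefM !big_ord_recl !big_ord0 /=.
by rewrite /bump /= !hq !p0 !p2; ring.
Qed.

Section TaylorCoef.
Variable f : nat -> C.
Lemma taylor0 K : (\poly_(k < K.+1) (f k / k`!%:R))`_0 = f 0%N.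
Proof. by rewrite coef_poly divr1. Qed.
Lemma taylor1 K : (\poly_(k < K.+2) (f k / k`!%:R))`_1 = f 1%N.
Proof. by rewrite coef_poly divr1. Qed.
Lemma taylor2 K : (\poly_(k < K.+3) (f k / k`!%:R))`_2 = f 2%N / 2.
Proof. by rewrite coef_poly. Qed.
Lemma taylor3 K : (\poly_(k < K.+4) (f k / k`!%:R))`_3 = f 3%N / 6.
Proof. by rewrite coef_poly. Qed.
End TaylorCoef.

Lemma taylor_mul3 (f g k : nat -> C) (q : {poly C}) :
  (forall j, q`_j = (-1) ^+ j * (\poly_(i < 2) (k i / i`!%:R))`_j) ->
  (\poly_(i < 2) (f i / i`!%:R) * \poly_(i < 2) (g i / i`!%:R) * q)`_1 =
  f 1%N * g 0%N * k 0%N + f 0%N * g 1%N * k 0%N - f 0%N * g 0%N * k 1%N.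
Proof. by move=> hq; rewrite coef_mul3 !hq !taylor1 !taylor0; ring. Qed.

Lemma thetaB_jet K z : jet K (fun h => theta t (z - h))
  (\poly_(i < size (\poly_(k < K) (Dtheta t k z / k`!%:R)))
     ((-1) ^+ i * (\poly_(k < K) (Dtheta t k z / k`!%:R))`_i)).
Proof.
by apply: jet_ext (jet_scale (-1) (theta_jet t0 K z)) => h; rewrite mulN1r.
Qed.

Lemma Dtheta0 z : Dtheta t 0 z = theta t z.
Proof. by rewrite theta_sum //; apply: eq_csum => n; rewrite expr0 mulr1. Qed.

Lemma Gd1E z w : Gd 1 z w = Dtheta t 1 z * theta t w * theta t (z + w) +
  theta t z * Dtheta t 1 w * theta t (z + w) - theta t z * theta t w * Dtheta t 1 (z + w).
Proof.
have := jet_unique (Gd_jet 2 z w)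
  (jetM (jetM (theta_jet t0 2 z) (theta_jet t0 2 w)) (thetaB_jet 2 (z + w))) (ltnSn 1).
rewrite (taylor1 (fun k => Gd k z w)) => ->.
rewrite (@taylor_mul3 (fun k => Dtheta t k z) (fun k => Dtheta t k w) (fun k => Dtheta t k (z + w)));
  last by move=> j; exact: coef_scale.
by rewrite !Dtheta0.
Qed.

(** The contributions l1 h, l2 h and - (l1 + l2) h to the three multipliers cancel, which is the
    reason for the sign of h in the third factor. *)
Lemma Gd_shift k z w (l1 l2 m1 m2 : int) :
  Gd k (z + l1%:~R * t + m1%:~R) (w + l2%:~R * t + m2%:~R) =
  ce (- ((l1%:~R ^+ 2 + l1%:~R * l2%:~R + l2%:~R ^+ 2) * t +
     ((2 * l1%:~R + l2%:~R) * z + (l1%:~R + 2 * l2%:~R) * w))) * Gd k z w.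
Proof.
apply: Gd_ext => h.
have -> : z + l1%:~R * t + m1%:~R + h = (z + h) + l1%:~R * t + m1%:~R by ring.
have -> : w + l2%:~R * t + m2%:~R + h = (w + h) + l2%:~R * t + m2%:~R by ring.
have -> : z + l1%:~R * t + m1%:~R + (w + l2%:~R * t + m2%:~R) - h =
   (z + w - h) + (l1 + l2)%:~R * t + (m1 + m2)%:~R by rewrite !intrD; ring.
rewrite !theta_shift //.
have sg : (-1) ^ (l1 + m1) * (-1) ^ (l2 + m2) * (-1) ^ (l1 + l2 + (m1 + m2)) = 1 :> C.
  rewrite -!signzD; have -> : l1 + m1 + (l2 + m2) + (l1 + l2 + (m1 + m2)) = 2 * (l1 + l2 + m1 + m2) by ring.
  exact: sign2z.
have -> : - ((l1%:~R ^+ 2 + l1%:~R * l2%:~R + l2%:~R ^+ 2) * t +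
     ((2 * l1%:~R + l2%:~R) * z + (l1%:~R + 2 * l2%:~R) * w)) =
  - (l1%:~R ^+ 2 / 2 * t + l1%:~R * (z + h)) + - (l2%:~R ^+ 2 / 2 * t + l2%:~R * (w + h)) +
  - ((l1 + l2)%:~R ^+ 2 / 2 * t + (l1 + l2)%:~R * (z + w - h)) :> C.
  by rewrite intrD; field.
rewrite !ceD -[RHS]mul1r -[X in _ = X * _]sg.
move: (ce _) (ce _) (ce _) (theta _ _) (theta _ _) (theta _ _) => *.
by move: ((-1) ^ _) ((-1) ^ _) ((-1) ^ _) => *; ring.
Qed.

Lemma Gd_z0 w : Gd 1 0 w = Dtheta t 1 0 * theta t w ^+ 2.
Proof. by rewrite Gd1E theta0 // add0r; ring. Qed.

Lemma Gd1_00 : Gd 1 0 0 = 0.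
Proof. by rewrite Gd_z0 theta0 // expr0n mulr0. Qed.

Lemma Dtheta_even0 : Dtheta t 2 0 = 0.
Proof.
have j1 : jet 3 (fun h => theta t (0 + h)) _ := theta_jet t0 3 0.
have j2 := jetZ (-1) (thetaB_jet 3 0).
have e h : -1 * theta t (0 - h) = theta t (0 + h) by rewrite sub0r add0r thetaN // mulN1r opprK.
have := jet_unique (jet_ext e j2) j1 (ltnSn 2).
rewrite coefCM coef_scale coef_poly /= sqrrN expr1n mul1r mulN1r => /eqP.
rewrite eq_sym -subr_eq0 opprK -mulr2n mulrn_eq0 /= mulf_eq0 invr_eq0.
by rewrite pnatr_eq0 /= orbF => /eqP.
Qed.

(** At z = w = 0 the product is - theta(h)^3, and theta has no quadratic term at 0. *)
Lemma Gd3_00 : Gd 3 0 0 = - 6 * Dtheta t 1 0 ^+ 3.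
Proof.
have := jet_unique (Gd_jet 4 0 0)
  (jetM (jetM (theta_jet t0 4 0) (theta_jet t0 4 0)) (thetaB_jet 4 (0 + 0))) (ltnSn 3).
rewrite addr0 coef_cube; first last.
- by move=> j; exact: coef_scale.
- by rewrite (taylor2 (fun k => Dtheta t k 0)) Dtheta_even0 mul0r.
- by rewrite (taylor0 (fun k => Dtheta t k 0)) Dtheta0 theta0.
rewrite (taylor3 (fun k => Gd k 0 0)) (taylor1 (fun k => Dtheta t k 0)) => e.
have n6 : 6 != 0 :> C by rewrite pnatr_eq0.
by rewrite -[LHS](divfK n6) e; ring.
Qed.

End ThetaProduct.

(** * Weak Jacobi forms in scalar notation *)

Section WJ.
Variable R : realType.
Local Notation C := R[i].
Local Notation Im := complex.Im.
Implicit Types (f g : jform R) (k p s r : int).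

Lemma bilfE (S : 'M[C]_2) (a b c d : C) : bilf S (vec2 a b) (vec2 c d) =
  a * S 0 0 * c + b * S 1 0 * c + a * S 0 1 * d + b * S 1 1 * d.
Proof.
have e : lift ord0 ord0 = 1 :> 'I_2 by apply/val_inj.
rewrite /bilf !mxE !big_ord_recl !big_ord0 !mxE !big_ord_recl !big_ord0 !mxE !e /=.
by ring.
Qed.

Lemma quadf_gram p s r (z w : C) : quadf (toC R (gram p s r)) (vec2 z w) =
  (p%:~R * z ^+ 2 + 2 * s%:~R * z * w + r%:~R * w ^+ 2) / 2.
Proof. by rewrite /quadf bilfE !mxE /=; field. Qed.

Lemma bilf_gram p s r (a b z w : C) : bilf (toC R (gram p s r)) (vec2 a b) (vec2 z w) =
  (p%:~R * a + s%:~R * b) * z + (s%:~R * a + r%:~R * b) * w.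
Proof. by rewrite bilfE !mxE /=; ring. Qed.

Definition FS f := exists c, isFS c f.

(** The Gram matrix is given by its three integer entries, so that identities between indices become
    integer arithmetic. [WJP] restores the matrices and supplies holomorphy from the Fourier
    expansion. *)
Record WJ k p s r f : Prop := {
  WJ_mod : forall (a b c d : int) (t t' : uhp R) (z w : C), a * d - b * c = 1 ->
    let j := c%:~R * val t + d%:~R in
    val t' = (a%:~R * val t + b%:~R) / j ->
    f t' (z / j) (w / j) = j ^ k *
      ce (c%:~R * ((p%:~R * z ^+ 2 + 2 * s%:~R * z * w + r%:~R * w ^+ 2) / 2) / j) * f t z w ;
  WJ_ell : forall (t : uhp R) (z w : C) (l1 l2 m1 m2 : int),
    f t (z + l1%:~R * val t + m1%:~R) (w + l2%:~R * val t + m2%:~R) =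
    ce (- ((p%:~R * l1%:~R ^+ 2 + 2 * s%:~R * l1%:~R * l2%:~R + r%:~R * l2%:~R ^+ 2) / 2 * val t +
      ((p%:~R * l1%:~R + s%:~R * l2%:~R) * z + (s%:~R * l1%:~R + r%:~R * l2%:~R) * w))) * f t z w ;
  WJ_FS : FS f }.

Lemma det22 (A : 'M[int]_2) : \det A = A 0 0 * A 1 1 - A 0 1 * A 1 0.
Proof.
rewrite (expand_det_row _ 0) !big_ord_recl big_ord0 addr0 /cofactor !det_mx11 !mxE /=.
rewrite /bump /= expr0 mul1r expr1 mulN1r mulrN.
by congr (_ * A _ _ - A _ _ * A _ _); apply/val_inj.
Qed.

Lemma WJP k p s r f : weak_jacobi_form k (gram p s r) f <-> WJ k p s r f.
Proof.
split=> [[ho mo el fo]|[mo el [c fo]]].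
- split=> [a b c d t t' z w det j t'E|t z w l1 l2 m1 m2|].
  + pose A : 'M[int]_2 := \matrix_(i, i') if i == 0 then (if i' == 0 then a else b)
      else if i' == 0 then c else d.
    have := mo A t t' z w; rewrite det22 !mxE /= quadf_gram; exact.
  + by have := el t z w l1 l2 m1 m2; rewrite /= quadf_gram bilf_gram.
  + by have [c hc] := fo; exists c; apply/isFS_fourier.
- split.
  + exact: isFS_holomorphic fo.
  + move=> A t t' z w; rewrite det22 quadf_gram => det j t'E; exact: mo det t'E.
  + by move=> t z w l1 l2 m1 m2 l; rewrite quadf_gram bilf_gram; exact: el.
  + by exists c; apply/isFS_fourier.
Qed.

Lemma isFS_FS c f : isFS c f -> FS f.
Proof. by exists c. Qed.

Lemma FSM f g : FS f -> FS g -> FS (fun t z w => f t z w * g t z w).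
Proof. by move=> [c hc] [d hd]; exists (conv c d); exact: isFSonM. Qed.

Lemma FSD f g : FS f -> FS g -> FS (fun t z w => f t z w + g t z w).
Proof. by move=> [c hc] [d hd]; eexists; exact: isFSonD hc hd. Qed.

Lemma FSZ (x : C) f : FS f -> FS (fun t z w => x * f t z w).
Proof. by move=> [c hc]; eexists; exact: isFSonZ hc. Qed.

Lemma FS1 (x : C) : FS (fun _ _ _ => x).
Proof.
have := isFSonZ x (@isFSon_monom R (@everywhere R) (0%N, (0, 0))) => h; eexists.
apply: isFSon_ext h => t z w _; by rewrite /qmon /= !mul0r !addr0 ce0 mulr1.
Qed.

Lemma FSX f n : FS f -> FS (fun t z w => f t z w ^+ n).
Proof.
move=> hf; elim: n => [|n IH]; first exact: (FS1 1).
have -> : (fun t z w => f t z w ^+ n.+1) = (fun t z w => f t z w * f t z w ^+ n).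
  by do 3!apply/funext => ?; rewrite exprS.
exact: FSM.
Qed.

Lemma FS_ext f g : (forall t z w, f t z w = g t z w) -> FS f -> FS g.
Proof. by move=> e [c hc]; exists c; apply: isFSon_ext hc => t z w _. Qed.

End WJ.

(** * Fourier expansions of Phi_{-2} and Phi_0, and the heat operator *)

Section PhiFourier.
Variable R : realType.
Local Notation C := R[i].
Local Notation Im := complex.Im.
Local Notation tpi := ((2 * pi : R)%:C * 'i%C).
Local Notation half := (half R).

(** n (n + 1) / 2 as a natural number; for n = - (m + 1) it is m (m + 1) / 2 again. *)
Definition tri (n : int) : nat :=
  match n with Posz m => 'C(m.+1, 2) | Negz m => 'C(m.+1, 2) end.

Lemma triE n : (tri n)%:R = half n ^+ 2 / 2 - 8^-1 :> C.
Proof.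
have bE m : ('C(m.+1, 2))%:R = m%:R * (m%:R + 1) / 2 :> C.
  have /(congr1 (fun x => x%:R : C)) := bin2_sum m.+1; have := mul_bin_diag m.+1 1.
  rewrite bin1 /= => /(congr1 (fun x => x%:R : C)); rewrite !natrM => e _.
  apply: (@mulIf _ 2%:R); first by rewrite pnatr_eq0.
  by rewrite divfK ?pnatr_eq0 // mulrC -e -[m.+1]addn1 natrD; ring.
case: n => m; rewrite [tri _]/= bE /half.
  by rewrite -[(Posz m)%:~R]/(m%:R); field.
have -> : (Negz m)%:~R = - (m%:R + 1) :> C by rewrite NegzE mulrNz -pmulrn -natr1.
by field.
Qed.

Definition sgn3 (n : int * int * int) : C := (-1) ^ n.1.1 * (-1) ^ n.1.2 * (-1) ^ n.2.
Definition exp3 (n : int * int * int) : fexp :=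
  ((tri n.1.1 + tri n.1.2 + tri n.2)%N, (n.1.1 + n.2 + 1, n.1.2 + n.2 + 1)).

Lemma theta3E (t z w : C) n : theta3 t z w n = ce (3 / 8 * t) * (sgn3 n * qmon (exp3 n) t z w).
Proof.
have -> : qmon (exp3 n) t z w = ce (- (3 / 8 * t)) * (ce (half n.1.1 ^+ 2 / 2 * t + half n.1.1 * z) *
   ce (half n.1.2 ^+ 2 / 2 * t + half n.1.2 * w) * ce (half n.2 ^+ 2 / 2 * t + half n.2 * (z + w))).
  rewrite -!ceD /qmon /= !natrD !triE !intrD; congr ce; rewrite /half.
  by move: (n.1.1%:~R : C) (n.1.2%:~R : C) (n.2%:~R : C) => *; field.
rewrite /theta3 /theta_term /sgn3.
have := ceNr (3 / 8 * t); move: (ce (3 / 8 * t)) (ce (- (3 / 8 * t))) => x y xy.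
move: (ce _) (ce _) (ce _) => u v x'; move: ((-1) ^ _) ((-1) ^ _) ((-1) ^ _) => a b c.
by rewrite -[LHS]mul1r -[X in X * _ = _]xy; ring.
Qed.

Lemma Gd_fam k (t z w : C) n : sgn3 n * (tpi * dlt R n) ^+ k * qmon (exp3 n) t z w =
  ce (- (3 / 8 * t)) * (theta3 t z w n * (tpi * dlt R n) ^+ k).
Proof.
rewrite theta3E; have := ceNr (3 / 8 * t).
move: (ce (3 / 8 * t)) (ce (- (3 / 8 * t))) => x y xy.
move: (qmon _ _ _ _) (_ ^+ k) (sgn3 n) => u v a.
by rewrite -[LHS]mul1r -[X in X * _ = _]xy; ring.
Qed.

Lemma isFS_Gd k : isFS (push exp3 (fun n => sgn3 n * (tpi * dlt R n) ^+ k))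
  (fun t z w => ce (- (3 / 8 * val t)) * Gd (val t) k z w).
Proof.
apply: isFSon_push => t z w _; have t0 := valP t.
have e : (fun i => sgn3 i * (tpi * dlt R i) ^+ k * qmon (exp3 i) (val t) z w) =
   (fun n => ce (- (3 / 8 * val t)) * (theta3 (val t) z w n * (tpi * dlt R n) ^+ k)).
  by apply/funext => n; exact: Gd_fam.
have a := asum_Gd t0 k z w.
by rewrite e; split; [exact: asumZ|rewrite csumZ].
Qed.

Definition exp1 (n : int) : fexp := (tri n, (0, 0)).

Lemma Dtheta_fam k (t z w : C) n : (-1) ^ n * (tpi * half n) ^+ k * qmon (exp1 n) t z w =
  ce (- (t / 8)) * (theta_term t 0 n * (tpi * half n) ^+ k).
Proof.
have -> : qmon (exp1 n) t z w = ce (- (t / 8)) * ce (half n ^+ 2 / 2 * t + half n * 0).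
  by rewrite -ceD /qmon /= triE; congr ce; field.
by rewrite /theta_term; move: (ce _) (ce _) (_ ^+ k) ((-1) ^ n) => *; ring.
Qed.

Lemma isFS_Dtheta k : isFS (push exp1 (fun n => (-1) ^ n * (tpi * half n) ^+ k))
  (fun t z w => ce (- (val t / 8)) * Dtheta (val t) k 0).
Proof.
apply: isFSon_push => t z w _; have t0 := valP t.
have e : (fun i => (-1) ^ i * (tpi * half i) ^+ k * qmon (exp1 i) (val t) z w) =
   (fun n => ce (- (val t / 8)) * (theta_term (val t) 0 n * (tpi * half n) ^+ k)).
  by apply/funext => n; exact: Dtheta_fam.
have a := asum_Dtheta t0 k 0.
by rewrite e; split; [exact: asumZ|rewrite csumZ].
Qed.

Lemma FS_eulerE0 : FS (fun t _ _ => eulerE (val t) 0 : C).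
Proof.
have [c [hc _]] := @isFS_eulerE R 0; exists c => t z w _.
by have [] := hc t z w; rewrite ?mul0r ?addr0; [exact: valP t|].
Qed.

Lemma eta9 (t : uhp R) : (eta (val t) ^+ 9)^-1 = ce (- (3 / 8 * val t)) * eulerE (val t) 0 ^+ 9.
Proof.
have t0 := valP t; have EF : eulerE (val t) 0 * eulerF (val t) 0 = 1.
  by apply: eulerEF; rewrite ?addr0.
have -> : eta (val t) ^+ 9 = ce (3 / 8 * val t) * eulerF (val t) 0 ^+ 9.
  rewrite -[9%N]/(3 * 3)%N exprM eta3 // exprMn -exprM; congr (_ * _).
  by rewrite -ceMn; congr ce; ring.
rewrite invfM -ceN; congr (_ * _); rewrite -exprVn; congr (_ ^+ _).
by rewrite -[LHS]mul1r -EF mulfK // eulerF0_neq0.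
Qed.

(** Writing eta^9 through theta'(0) makes the constant of the theta transformation cancel between
    numerator and denominator. *)
Lemma eta9E (t : uhp R) : eta (val t) ^+ 9 = (Dtheta (val t) 1 0 / tpi) ^+ 3.
Proof.
by rewrite Dtheta1_0 ?(valP t) // mulrC mulKf ?tpi_neq0 // -exprM.
Qed.

Lemma FS_Gd_eta k : FS (fun t z w => Gd (val t) k z w / eta (val t) ^+ 9 : C).
Proof.
apply: FS_ext (FSM (isFS_FS (isFS_Gd k)) (FSX 9 FS_eulerE0)) => t z w.
by rewrite eta9; ring.
Qed.

Lemma Phi_m2_Gd (t : uhp R) z w : Phi_m2 R t z w = Gd (val t) 1 z w / eta (val t) ^+ 9.
Proof. by rewrite /Phi_m2 !theta'E ?Gd1E //; exact: valP t. Qed.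

Lemma FS_Phi_m2 : FS (Phi_m2 R).
Proof. by apply: FS_ext (FS_Gd_eta 1) => t z w; rewrite Phi_m2_Gd. Qed.

Definition lamA (m : fexp) : C :=
  m.1%:R - (m.2.1%:~R ^+ 2 - m.2.1%:~R * m.2.2%:~R + m.2.2%:~R ^+ 2) / 3.

Lemma lamAE (m : fexp) :
  m.1%:R - quadf (invmx (toC R gramA2)) (vec2 m.2.1%:~R m.2.2%:~R) = lamA m.
Proof.
pose B : 'M[C]_2 := \matrix_(i, j) if i == j then 2 / 3 else - 3^-1.
have AB : toC R gramA2 *m B = 1%:M.
  apply/matrixP => i j; rewrite !mxE !big_ord_recl big_ord0 !mxE /=.
  by case: i => -[|[|//]] ?; case: j => -[|[|//]] ? /=; field.
have -> : invmx (toC R gramA2) = B.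
  have [uA _] := mulmx1_unit AB.
  by rewrite -[LHS]mulmx1 -AB mulmxA mulVmx // mul1mx.
by rewrite /quadf bilfE !mxE /= /lamA; field.
Qed.

Lemma asum_lamA c (f : jform R) (t : uhp R) z w : isFS c f ->
  asum (fun m => lamA m * c m * qmon m (val t) z w).
Proof.
move=> hc; have ha := isFS_asum hc.
have [e [S [_ hS _]]] := fam_taylor z w ha (valP t).
have tn := tpi_neq0 R.
(* From - (r1^2 - r1 r2 + r2^2) / 3 = - (r1^2 + r2^2) / 2 + (r1 + r2)^2 / 6 the weight is a
   combination of powers of [lin_exp] in four directions. *)
have aD := asumD (asumD (asumZ tpi^-1 (hS 1%N 1 0 0)) (asumZ (- (2 * tpi ^+ 2)^-1) (asumD (hS 2%N 0 1 0) (hS 2%N 0 0 1))))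
  (asumZ ((6 * tpi ^+ 2)^-1) (hS 2%N 0 1 1)).
apply: eq_asum aD => m; rewrite /fam /lin_exp /lamA.
by move: (qmon _ _ _ _) tn => q; set T := tpi; clearbody T => tn; field.
Qed.

(** Leibniz rule for a weight that is additive on the exponents that occur. The heat eigenvalue is
    quadratic in r, but adding an exponent with r = 0 changes it by n alone, so the rule applies to
    factors depending only on t. *)
Lemma csum_conv_weight (c d : fexp -> C) (l nu : fexp -> C) T z w :
  (forall m m' : fexp, d m' != 0 ->
     l ((m.1 + m'.1)%N, (m.2.1 + m'.2.1, m.2.2 + m'.2.2)) = l m + nu m') ->
  asum (fam c T z w) -> asum (fam d T z w) ->
  asum (fun m => l m * c m * qmon m T z w) -> asum (fun m => nu m * d m * qmon m T z w) ->
  csum (fun m => l m * conv c d m * qmon m T z w) =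
  csum (fun m => l m * c m * qmon m T z w) * csum (fam d T z w) +
  csum (fam c T z w) * csum (fun m => nu m * d m * qmon m T z w).
Proof.
move=> hl a1 a2 b1 b2.
pose h (p : fexp * fexp) : fexp := ((p.1.1 + p.2.1)%N, (p.1.2.1 + p.2.2.1, p.1.2.2 + p.2.2.2)).
have A1 := asumM b1 a2; have A2 := asumM a1 b2; have A3 := asumM a1 a2.
have e p : l (h p) * (c p.1 * d p.2) * qmon (h p) T z w =
   (l p.1 * c p.1 * qmon p.1 T z w) * fam d T z w p.2 + fam c T z w p.1 * (nu p.2 * d p.2 * qmon p.2 T z w).
  rewrite -qmonM /fam; have [->|d0] := eqVneq (d p.2) 0; first by rewrite !(mulr0, mul0r) addr0.
  by rewrite /h hl //; move: (qmon _ _ _ _) (qmon _ _ _ _) => *; ring.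
have e3 p : c p.1 * d p.2 * qmon (h p) T z w = fam c T z w p.1 * fam d T z w p.2.
  by rewrite -qmonM /fam; move: (qmon _ _ _ _) (qmon _ _ _ _) => *; ring.
have [|| _ ->] := @csum_push_weight R _ (fun p : fexp * fexp => c p.1 * d p.2) h l T z w.
- by apply: eq_asum A3 => p; rewrite e3.
- by apply: eq_asum (asumD A1 A2) => p; rewrite e.
rewrite (eq_csum e) csumD // (csumM b1 a2) (csumM a1 b2); by [].
Qed.

Lemma push_supp (I : choiceType) (h : I -> fexp) (a : I -> C) m :
  push h a m != 0 -> exists i, h i = m.
Proof.
move=> hm; apply/not_existsP => no; move/negP: hm; apply; apply/eqP.
by rewrite /push -[RHS](csum0 R I); apply: eq_csum => i; case: eqP => // /no.
Qed.

(** The heat equation: since n is (half)^2 / 2 - 1/8, applying q d/dq to q^(-1/8) theta'(0) brings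
    in theta'''(0), which [Dtheta3_0] evaluates. *)
Lemma theta_weight (t : uhp R) z w : let d := push exp1 (fun n => (-1) ^ n * (tpi * half n) ^+ 1) in
  asum (fun m : fexp => m.1%:R * d m * qmon m (val t) z w) /\
  csum (fun m : fexp => m.1%:R * d m * qmon m (val t) z w) =
  - 3 * lambert (val t) * (ce (- (val t / 8)) * Dtheta (val t) 1 0).
Proof.
move=> d; have t0 := valP t; have tn := tpi_neq0 R.
have a1 := asum_Dtheta t0 1 0; have a3 := asum_Dtheta t0 3 0.
have e (n : int) : (exp1 n).1%:R * ((-1) ^ n * (tpi * half n) ^+ 1) * qmon (exp1 n) (val t) z w =
    ce (- (val t / 8)) * ((2 * tpi ^+ 2)^-1 * (theta_term (val t) 0 n * (tpi * half n) ^+ 3) +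
       - 8^-1 * (theta_term (val t) 0 n * (tpi * half n) ^+ 1)).
  rewrite -mulrA Dtheta_fam /= triE; set T := tpi in tn *; clearbody T.
  by move: (ce _) (theta_term _ _ _) => *; field.
have A : asum (fun n => ce (- (val t / 8)) * ((2 * tpi ^+ 2)^-1 * (theta_term (val t) 0 n * (tpi * half n) ^+ 3) +
       - 8^-1 * (theta_term (val t) 0 n * (tpi * half n) ^+ 1))).
  by apply: asumZ; apply: asumD; exact: asumZ.
have [||B ->] := @csum_push_weight R _ (fun n => (-1) ^ n * (tpi * half n) ^+ 1) exp1 (fun m => m.1%:R) (val t) z w.
- by apply: eq_asum (asumZ (ce (- (val t / 8))) a1) => n; rewrite Dtheta_fam.
- by apply: eq_asum A => n; rewrite e.
split=> //; rewrite (eq_csum e) csumZ; last by apply: asumD; exact: asumZ.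
rewrite csumD; [|exact: asumZ|exact: asumZ]; rewrite !csumZ //.
rewrite -[csum _]/(Dtheta (val t) 3 0) -[csum _]/(Dtheta (val t) 1 0) Dtheta3_0 //.
set T := tpi in tn *; clearbody T.
by move: (ce _) (Dtheta _ _ _) (lambert _) => *; field.
Qed.

(** Phi_{-2} has eta^9 in its denominator, but its product with the third power of q^(-1/8)
    theta'(0) is a multiple of the derivative of the theta product, on whose terms the weight is
    explicit. The Leibniz rule, applied three times, is then solved for the unknown [L]. *)
Lemma heat_Phi_m2 (t : uhp R) z w : heat gramA2 (Phi_m2 R) t z w =
  (Gd (val t) 3 z w / (6 * tpi ^+ 2) - 3 / 8 * Gd (val t) 1 z w) / eta (val t) ^+ 9 +
  9 * lambert (val t) * Phi_m2 R t z w.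
Proof.
have [c hc] := FS_Phi_m2; have t0 := valP t; have tn := tpi_neq0 R.
rewrite /heat (fourier_coefE hc).
rewrite -[summability.sum _]/(csum (fun m : fexp =>
   (m.1%:R - quadf (invmx (toC R gramA2)) (vec2 m.2.1%:~R m.2.2%:~R)) * c m * qmon m (val t) z w)).
rewrite (eq_csum (g := fun m => lamA m * c m * qmon m (val t) z w)); last by move=> m; rewrite lamAE.
set L := csum _.
pose d := push exp1 (fun n => (-1) ^ n * (tpi * half n) ^+ 1).
have hd : isFS d (fun t z w => ce (- (val t / 8)) * Dtheta (val t) 1 0) := isFS_Dtheta 1.
have ld (m m' : fexp) : d m' != 0 ->
   lamA ((m.1 + m'.1)%N, (m.2.1 + m'.2.1, m.2.2 + m'.2.2)) = lamA m + m'.1%:R.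
  by move=> /push_supp[n <-]; rewrite /lamA /= !addr0 natrD; ring.
have leib e (g : jform R) : isFS e g ->
  csum (fun m => lamA m * conv e d m * qmon m (val t) z w) =
  csum (fun m => lamA m * e m * qmon m (val t) z w) * (ce (- (val t / 8)) * Dtheta (val t) 1 0) +
  g t z w * (- 3 * lambert (val t) * (ce (- (val t / 8)) * Dtheta (val t) 1 0)).
  move=> he; have [b1 b2] := theta_weight t z w; have [a1 e1] := he t z w I; have [a2 e2] := hd t z w I.
  by rewrite (csum_conv_weight ld a1 a2 (asum_lamA t z w he) b1) b2 -e1 -e2.
have h1 := isFSonM hc hd; have h2 := isFSonM h1 hd; have h3 := isFSonM h2 hd.
have g1 := isFSonZ (tpi ^+ 3) (isFS_Gd 1).
have E1 (s : uhp R) : Dtheta (val s) 1 0 != 0 by apply: Dtheta1_neq0; exact: valP s.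
(* Uniqueness of Fourier coefficients turns the identity of functions into one of coefficient
   families. *)
have ec : conv (conv (conv c d) d) d = (fun m => tpi ^+ 3 * push exp3 (fun n => sgn3 n * (tpi * dlt R n) ^+ 1) m).
  apply: isFS_unique h3 _; apply: isFSon_ext g1 => s x y _.
  rewrite Phi_m2_Gd eta9E; have := E1 s; set T := tpi in tn *; clearbody T.
  have -> : ce (- (3 / 8 * val s)) = ce (- (val s / 8)) ^+ 3.
    by rewrite -ceMn; congr ce; field.
  by move: (ce _) (Dtheta _ _ _) (Gd _ _ _ _) => *; field; apply/andP.
have [||_ eG] := @csum_push_weight R _ (fun n => sgn3 n * (tpi * dlt R n) ^+ 1) exp3 lamA (val t) z w.
- by apply: eq_asum (asumZ (ce (- (3 / 8 * val t))) (asum_Gd t0 1 z w)) => n; rewrite Gd_fam.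
(* The vector of the three half-integers is split along (1, 1, -1). The orthogonal part is cancelled
   by the A2 form and the rest has square dlt^2 / 3, so the heat operator acts as a second
   derivative in h up to constants. *)
- have eA n : lamA (exp3 n) = dlt R n ^+ 2 / 6 - 3 / 8.
    rewrite /lamA /exp3 /= !natrD !triE !intrD /dlt /half.
    by move: (n.1.1%:~R : C) (n.1.2%:~R : C) (n.2%:~R : C) => *; field.
  have A := asumZ (ce (- (3 / 8 * val t))) (asumD (asumZ ((6 * tpi ^+ 2)^-1) (asum_Gd t0 3 z w)) (asumZ (- (3 / 8)) (asum_Gd t0 1 z w))).
  apply: eq_asum A => n; rewrite -[RHS]mulrA Gd_fam eA; set T := tpi in tn *; clearbody T.
  by move: (ce _) (theta3 _ _ _ _) (dlt _ _) => *; field.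
have eA n : lamA (exp3 n) = dlt R n ^+ 2 / 6 - 3 / 8.
  rewrite /lamA /exp3 /= !natrD !triE !intrD /dlt /half.
  by move: (n.1.1%:~R : C) (n.1.2%:~R : C) (n.2%:~R : C) => *; field.
have eR : csum (fun n => lamA (exp3 n) * (sgn3 n * (tpi * dlt R n) ^+ 1) * qmon (exp3 n) (val t) z w) =
    ce (- (3 / 8 * val t)) * (Gd (val t) 3 z w / (6 * tpi ^+ 2) - 3 / 8 * Gd (val t) 1 z w).
  rewrite (eq_csum (g := fun n => ce (- (3 / 8 * val t)) * ((6 * tpi ^+ 2)^-1 * (theta3 (val t) z w n * (tpi * dlt R n) ^+ 3) +
      - (3 / 8) * (theta3 (val t) z w n * (tpi * dlt R n) ^+ 1)))); last first.
    move=> n; rewrite -[LHS]mulrA Gd_fam eA; set T := tpi in tn *; clearbody T.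
    by move: (ce _) (theta3 _ _ _ _) (dlt _ _) => *; field.
  have b1 := asum_Gd t0 1 z w; have b3 := asum_Gd t0 3 z w.
  rewrite csumZ; last by apply: asumD; exact: asumZ.
  rewrite csumD; [|exact: asumZ|exact: asumZ]; rewrite !csumZ //.
  by rewrite -[csum _]/(Gd (val t) 3 z w) -[csum _]/(Gd (val t) 1 z w) mulNr [(6 * _)^-1 * _]mulrC.
have := leib _ _ h2; rewrite ec (leib _ _ h1) (leib _ _ hc) -/L.
have -> : (fun m => lamA m * (tpi ^+ 3 * push exp3 (fun n => sgn3 n * (tpi * dlt R n) ^+ 1) m) * qmon m (val t) z w) =
  (fun m => tpi ^+ 3 * (lamA m * push exp3 (fun n => sgn3 n * (tpi * dlt R n) ^+ 1) m * qmon m (val t) z w)).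
  by apply/funext => m; ring.
rewrite csumZ; last exact: asum_lamA (isFS_Gd 1).
rewrite eG eR eta9E Phi_m2_Gd eta9E.
have -> : ce (- (3 / 8 * val t)) = ce (- (val t / 8)) ^+ 3 by rewrite -ceMn; congr ce; field.
have := ce_neq0 (- (val t / 8)); have := E1 t; set T := tpi in tn *; clearbody T.
move: (ce _) (Dtheta _ _ _) (Gd _ _ _ _) (Gd _ _ _ _) (lambert _) L => q e1 G1 G3 S L e10 q0 E.
apply: (@mulIf _ ((q * e1) ^+ 3)); first by rewrite expf_neq0 // mulf_neq0.
have -> : L * (q * e1) ^+ 3 = T ^+ 3 * (q ^+ 3 * (G3 / (6 * T ^+ 2) - 3 / 8 * G1)) +
   9 * S * (G1 / (e1 / T) ^+ 3) * (q * e1) ^+ 3.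
  by rewrite E; ring.
by field; apply/andP.
Qed.

(** The G2 term of the Serre derivative and the [lambert] term of the heat operator merge into
    theta'''(0) / theta'(0). In this form the modular anomalies of the two summands cancel. *)
Lemma Phi_0_Gd (t : uhp R) z w : Phi_0 R t z w = - 2 / tpi ^+ 2 *
  (Gd (val t) 3 z w - 3 * (Dtheta (val t) 3 0 / Dtheta (val t) 1 0) * Gd (val t) 1 z w) / eta (val t) ^+ 9.
Proof.
have t0 := valP t; have tn := tpi_neq0 R; have e1 := Dtheta1_neq0 t0.
rewrite /Phi_0 /serre heat_Phi_m2 G2E Dtheta3_0 // mulfK // Phi_m2_Gd.
have -> : (3 / pi ^+ 2 : R)%:C * ((-2)%:~R / 12 - 2 / 24) * ((pi ^+ 2 / 3 : R)%:C * (1 - 24 * lambert (val t))) =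
   - 4^-1 * (1 - 24 * lambert (val t)) :> C.
  have -> : (3 / pi ^+ 2 : R)%:C * ((-2)%:~R / 12 - 2 / 24) * ((pi ^+ 2 / 3 : R)%:C * (1 - 24 * lambert (val t))) =
    ((3 / pi ^+ 2 : R)%:C * (pi ^+ 2 / 3 : R)%:C) * ((-2)%:~R / 12 - 2 / 24) * (1 - 24 * lambert (val t)) :> C by ring.
  rewrite -rmorphM /=; have -> : 3 / pi ^+ 2 * (pi ^+ 2 / 3) = 1 :> R.
    by rewrite mulrA divfK ?divff ?pnatr_eq0 // expf_neq0 // gt_eqF // pi_gt0.
  by rewrite -[(-2)%:~R]/(- 2 : C); field.
have en : eta (val t) ^+ 9 != 0 by rewrite expf_neq0 // eta_neq0.
set T := tpi in tn *; clearbody T.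
by move: (eta _ ^+ 9) (Gd _ _ _ _) (Gd _ _ _ _) (lambert _) en => *; field; apply/andP.
Qed.

(** Division by theta'(0) is multiplication by a power of [eulerE] at 0, which has a Fourier
    expansion. *)
Lemma FS_Phi_0 : FS (Phi_0 R).
Proof.
have h := FSM (FSM (isFS_FS (isFS_Dtheta 3)) (FSX 3 FS_eulerE0)) (FS_Gd_eta 1).
apply: FS_ext (FSZ (- 2 / tpi ^+ 2) (FSD (FS_Gd_eta 3) (FSZ (- 3 / tpi) h))) => t z w.
have t0 := valP t; have tn := tpi_neq0 R; have e1 := Dtheta1_neq0 t0.
have EF : eulerE (val t) 0 * eulerF (val t) 0 = 1 by apply: eulerEF; rewrite ?addr0.
rewrite Phi_0_Gd Dtheta1_0 // eta3 //.
have F0 := eulerF0_neq0 t0; have -> : eulerE (val t) 0 = (eulerF (val t) 0)^-1.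
  by rewrite -[RHS]mul1r -EF mulfK.
rewrite ceN; have q0 := ce_neq0 (val t / 8).
have en : eta (val t) ^+ 9 != 0 by rewrite expf_neq0 // eta_neq0.
set T := tpi in tn *; clearbody T.
move: (eta _ ^+ 9) (Gd _ _ _ _) (Gd _ _ _ _) (Dtheta _ _ _) (ce _) (eulerF _ _) en q0 F0 => *.
by field; apply/and4P.
Qed.

End PhiFourier.

(** * Modular transformation of the coefficients in h *)

Section PhiJacobi.
Variable R : realType.
Local Notation C := R[i].
Local Notation Im := complex.Im.
Local Notation tpi := ((2 * pi : R)%:C * 'i%C).

(** The Gaussian factor is even: it leaves the first coefficient alone and adds a multiple of it to
    the third. *)
Lemma taylor_gauss (F F' : C -> C) (f f' : nat -> C) (x K al : C) :
  jet 4 F (\poly_(k < 4) (f k / k`!%:R)) -> jet 4 F' (\poly_(k < 4) (f' k / k`!%:R)) ->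
  (forall h, F' (x * h) = K * (cexp (al * h ^+ 2) * F h)) ->
  x * f' 1%N = K * f 1%N /\ x ^+ 3 * f' 3%N = K * (f 3%N + 6 * al * f 1%N).
Proof.
move=> j j' e; have j1 := jet_ext e (jet_scale x j').
have := jet_unique j1 (jetZ K (jetM (jet_cexp2 al) j)) => u.
have c (p : {poly C}) n : ((1 + al%:P * 'X^2) * p)`_n = p`_n + al * (if (n < 2)%N then 0 else p`_(n - 2)).
  by rewrite mulrDl mul1r coefD -mulrA coefCM coefXnM.
have := u 1%N isT; rewrite coef_scale coefCM c !taylor1 /= mulr0 addr0 expr1 => e1.
have := u 3%N isT; rewrite coef_scale coefCM c !taylor3 /= taylor1 => e3.
split=> //; have n6 : 6 != 0 :> C by rewrite pnatr_eq0.
have -> : f' 3%N = f' 3%N / 6 * 6 by rewrite divfK.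
by rewrite mulrA e3; field.
Qed.

Variables (a b c d : int) (t t' : uhp R).
Hypothesis det : a * d - b * c = 1.
Let j : C := c%:~R * val t + d%:~R.
Hypothesis t'E : val t' = (a%:~R * val t + b%:~R) / j.

Lemma automorphy_neq0 : j != 0.
Proof.
apply/eqP => j0; have := valP t'; rewrite /= t'E j0 invr0 mulr0.
by rewrite ltxx.
Qed.

(** In (z + h)^2 + (w + h)^2 + (z + w - h)^2 the terms linear in h cancel and 3 h^2 remains. Hence
    the anomaly of the product has the factor 9, against 3 for a single theta. *)
Lemma theta_modularJ : exists K : C, [/\ K != 0,
  Dtheta (val t') 1 0 = j * K * Dtheta (val t) 1 0,
  Dtheta (val t') 3 0 = j ^+ 3 * K * (Dtheta (val t) 3 0 + 3 * (tpi * c%:~R / j) * Dtheta (val t) 1 0) &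
  forall z w, let Q := ce (c%:~R * ((2 * z ^+ 2 + 2 * 1 * z * w + 2 * w ^+ 2) / 2) / j) in
   Gd (val t') 1 (z / j) (w / j) = j * K ^+ 3 * Q * Gd (val t) 1 z w /\
   Gd (val t') 3 (z / j) (w / j) = j ^+ 3 * K ^+ 3 * Q *
     (Gd (val t) 3 z w + 9 * (tpi * c%:~R / j) * Gd (val t) 1 z w)].
Proof.
have [K hK] := theta_modular (valP t) (valP t') det t'E.
have j0 := automorphy_neq0; have n2 : 2 != 0 :> C by rewrite pnatr_eq0.
pose al : C := tpi * c%:~R / (2 * j).
have kE z : ce (c%:~R * z ^+ 2 / (2 * j)) = cexp (al * z ^+ 2).
  by rewrite ceE; congr cexp; rewrite /al; field.
have jt := theta_jet (valP t) 4 0; have jt' := theta_jet (valP t') 4 0.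
have [h|e1 e3] := taylor_gauss (x := j^-1) (K := K) (al := al) jt jt'.
  by rewrite !add0r mulrC hK kE mulrA.
have m0 (x y : C) : j^-1 * x = y -> x = j * y by move=> <-; rewrite mulVKf.
have m3 (x y : C) : (j^-1) ^+ 3 * x = y -> x = j ^+ 3 * y.
  by move=> <-; rewrite exprVn mulVKf // expf_neq0.
have E1 := m0 _ _ e1; have E3 := m3 _ _ e3.
exists K; split.
- have := Dtheta1_neq0 (valP t'); rewrite E1; apply: contraNneq => ->.
  by rewrite mul0r mulr0.
- by rewrite E1; ring.
- by rewrite E3 /al; field.
- move=> z w Q.
  have [h|g1 g3] := taylor_gauss (x := j^-1) (K := K ^+ 3 * Q) (al := 3 * al)
    (Gd_jet (valP t) 4 z w) (Gd_jet (valP t') 4 (z / j) (w / j)).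
    have -> : z / j + j^-1 * h = (z + h) / j by ring.
    have -> : w / j + j^-1 * h = (w + h) / j by ring.
    have -> : z / j + w / j - j^-1 * h = (z + w - h) / j by ring.
    rewrite !hK !kE.
    have -> : Q = cexp (al * (z ^+ 2 + w ^+ 2 + (z + w) ^+ 2)).
      by rewrite /Q ceE; congr cexp; rewrite /al; field.
    have e : cexp (al * (z + h) ^+ 2) * cexp (al * (w + h) ^+ 2) * cexp (al * (z + w - h) ^+ 2) =
       cexp (al * (z ^+ 2 + w ^+ 2 + (z + w) ^+ 2)) * cexp (3 * al * h ^+ 2).
      by rewrite -!cexpD; congr cexp; ring.
    rewrite [LHS](_ : _ = K ^+ 3 * (cexp (al * (z + h) ^+ 2) * cexp (al * (w + h) ^+ 2) * cexp (al * (z + w - h) ^+ 2)) *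
      (theta (val t) (z + h) * theta (val t) (w + h) * theta (val t) (z + w - h))).
      by rewrite e; move: (cexp _) (cexp _) (theta _ _) (theta _ _) (theta _ _) => *; ring.
    by move: (cexp _) (cexp _) (cexp _) (theta _ _) (theta _ _) (theta _ _) => *; ring.
  split; first by rewrite (m0 _ _ g1); ring.
  by rewrite (m3 _ _ g3) /al; field.
Qed.

End PhiJacobi.

(** * Phi_{-2} and Phi_0 as weak Jacobi forms; symmetries and special values *)

Section PhiWJ.
Variable R : realType.
Local Notation C := R[i].
Local Notation Im := complex.Im.
Local Notation tpi := ((2 * pi : R)%:C * 'i%C).

Lemma WJ_Phi_m2 : WJ (- 2) 2 1 2 (Phi_m2 R).
Proof.
split; last exact: FS_Phi_m2.
- move=> a b c d t t' z w det j t'E; have j0 := automorphy_neq0 t'E.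
  have [K [K0 E1 _ hG]] := theta_modularJ det t'E; have [g1 _] := hG z w.
  rewrite !Phi_m2_Gd g1 !eta9E E1 -/j.
  have -> : j ^ (- 2) = (j ^+ 2)^-1 by [].
  have e1 := Dtheta1_neq0 (valP t); have tn := tpi_neq0 R; rewrite -/j in j0.
  rewrite -[(2 : int)%:~R]/(2 : C) -[(1 : int)%:~R]/(1 : C).
  set T := tpi in tn *; clearbody T; move: (ce _) (Gd _ _ _ _) => *.
  by clearbody j; field; apply/and4P.
- move=> t z w l1 l2 m1 m2; rewrite !Phi_m2_Gd Gd_shift ?(valP t) // -mulrA; congr (ce _ * _).
  by rewrite -[(2 : int)%:~R]/(2 : C) -[(1 : int)%:~R]/(1 : C); field.
Qed.

Lemma WJ_Phi_0 : WJ 0 2 1 2 (Phi_0 R).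
Proof.
split; last exact: FS_Phi_0.
- move=> a b c d t t' z w det j t'E; have j0 := automorphy_neq0 t'E.
  have [K [K0 E1 E3 hG]] := theta_modularJ det t'E; have [g1 g3] := hG z w.
  rewrite !Phi_0_Gd g1 g3 !eta9E E1 E3 -/j expr0z.
  have e1 := Dtheta1_neq0 (valP t); have tn := tpi_neq0 R; rewrite -/j in j0.
  rewrite -[(2 : int)%:~R]/(2 : C) -[(1 : int)%:~R]/(1 : C).
  set T := tpi in tn *; clearbody T; move: (ce _) (Gd _ _ _ _) (Gd _ _ _ _) (Dtheta _ 3 _) => *.
  by clearbody j; field; apply/and4P.
- move=> t z w l1 l2 m1 m2; rewrite !Phi_0_Gd !Gd_shift ?(valP t) //.
  set e := ce _; set e' := ce _; have -> : e = e'.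
    by rewrite /e /e'; congr ce; rewrite -[(2 : int)%:~R]/(2 : C) -[(1 : int)%:~R]/(1 : C); field.
  clearbody e'; clear e; set T := tpi; clearbody T.
  by move: (Gd _ _ _ _) (Gd _ _ _ _) (Dtheta _ 3 _ / _) ((eta _ ^+ 9)^-1) => *; ring.
Qed.

Lemma Phi_m2_swap t z w : Phi_m2 R t w z = Phi_m2 R t z w.
Proof. by rewrite !Phi_m2_Gd (Gd_swap (valP t) 1 z w). Qed.
Lemma Phi_0_swap t z w : Phi_0 R t w z = Phi_0 R t z w.
Proof. by rewrite !Phi_0_Gd (Gd_swap (valP t) 1 z w) (Gd_swap (valP t) 3 z w). Qed.
Lemma Phi_m2_reflect t z w : Phi_m2 R t (- z - w) w = Phi_m2 R t z w.
Proof. by rewrite !Phi_m2_Gd (Gd_reflect (valP t) 1 z w). Qed.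
Lemma Phi_0_reflect t z w : Phi_0 R t (- z - w) w = Phi_0 R t z w.
Proof. by rewrite !Phi_0_Gd (Gd_reflect (valP t) 1 z w) (Gd_reflect (valP t) 3 z w). Qed.

(** Since theta(0) = 0, a single term survives, and it is a square in theta(w): this is the double
    zero by which forms will be divided. *)
Lemma Phi_m2_z0 t w : Phi_m2 R t 0 w = tpi ^+ 3 * theta (val t) w ^+ 2 / Dtheta (val t) 1 0 ^+ 2.
Proof.
have e1 := Dtheta1_neq0 (valP t); have tn := tpi_neq0 R.
rewrite Phi_m2_Gd Gd_z0 ?(valP t) // eta9E; set T := tpi in tn *; clearbody T.
by move: (theta _ _) => *; field; apply/andP.
Qed.

Lemma Phi_0_00 t : Phi_0 R t 0 0 = 12 * tpi.
Proof.
have e1 := Dtheta1_neq0 (valP t); have tn := tpi_neq0 R.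
rewrite Phi_0_Gd Gd3_00 ?(valP t) // Gd1_00 ?(valP t) // eta9E mulr0 subr0.
by set T := tpi in tn *; clearbody T; field; apply/andP.
Qed.

End PhiWJ.

(** * Arguments by continuity, and the z-derivative along z = 0 *)

Section Smooth.
Variable R : realType.
Local Notation C := R[i].
Local Notation tpi := ((2 * pi : R)%:C * 'i%C).
Implicit Types (F G : C -> C) (f g : jform R).

Lemma jet_value n F p : jet n.+1 F p -> p`_0 = F 0.
Proof.
move=> [B [d [d0 h]]]; have := h 0; rewrite cabs0 expr0n mulr0 horner_coef0 => /(_ d0).
by move=> l0; apply/eqP; rewrite eq_sym -subr_eq0 -cabs_eq0 eq_le l0 cabs_ge0.
Qed.

Definition smooth F := forall z, exists p, jet 2 (fun h => F (z + h)) p.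

Lemma smoothM F G : smooth F -> smooth G -> smooth (fun z => F z * G z).
Proof. by move=> hF hG z; have [p hp] := hF z; have [q hq] := hG z; exists (p * q); exact: jetM. Qed.

Lemma smoothZ k F : smooth F -> smooth (fun z => k * F z).
Proof. by move=> hF z; have [p hp] := hF z; exists (k%:P * p); exact: jetZ. Qed.

Lemma smooth_ce (a b c : C) : smooth (fun z => ce (a * z ^+ 2 + b * z + c)).
Proof.
move=> z; have j1 := jet_cexp (tpi * (2 * a * z + b)) 2.
have j2 := jet_weak (isT : (2 <= 4)%N) (jet_cexp2 (tpi * a)).
eexists; apply: jet_ext (jetZ (ce (a * z ^+ 2 + b * z + c)) (jetM j1 j2)) => h.
by rewrite ceE -2!cexpD [RHS]ceE; congr cexp; ring.
Qed.

Lemma smooth_FS f t (a b c d : C) : FS f -> smooth (fun z => f t (a * z + b) (c * z + d)).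
Proof.
move=> [k hk] z; have [_ j] := @fam_jet R k (val t) (a * z + b) (c * z + d) a c 2 (isFS_asum hk) (valP t).
eexists; apply: jet_ext j => h; have [_ ->] := hk t (a * (z + h) + b) (c * (z + h) + d) I.
have -> : a * (z + h) + b = a * z + b + h * a by ring.
by have -> : c * (z + h) + d = c * z + d + h * c by ring.
Qed.

(** Carries the transformation laws of a quotient across the zeros of its denominator. *)
Lemma smooth_cancel F G (X : C -> C) : smooth F -> smooth G ->
  (forall z, exists2 d : R, 0 < d & forall h, 0 < cabs h < d -> X (z + h) != 0) ->
  (forall z, X z != 0 -> F z = G z) -> forall z, F z = G z.
Proof.
move=> hF hG hX e z; have [p hp] := hF z; have [q hq] := hG z.
have [d d0 hd] := hX z.
have j := jetD hp (jetZ (-1) hq).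
have := jet_continuous j; rewrite coefD coefCM (jet_value hp) (jet_value hq) addr0.
rewrite mulN1r => /(_ _)/eqP; rewrite subr_eq0 => e0; apply/eqP; apply: e0.
by exists d => // h hh; rewrite e ?hd // mulN1r subrr.
Qed.

Lemma theta_isolated t : 0 < complex.Im t ->
  forall z : C, exists2 d : R, 0 < d & forall h, 0 < cabs h < d -> theta t (z + h) != 0.
Proof.
move=> t0 z; have hb := pser_theta z t0.
have low k b : pser (theta t) z b -> b k != 0 -> (forall j, (j < k)%N -> b j = 0) ->
    exists2 d : R, 0 < d & forall h, 0 < cabs h < d -> theta t (z + h) != 0.
  move=> pb bk bz; have [d [d0 _ hd]] := pser_lower pb bk bz; exists d => // h /andP[h0 hh].
  rewrite -cabs_eq0 gt_eqF //; apply: lt_le_trans (hd h hh).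
  by rewrite mulr_gt0 ?exprn_gt0 // divr_gt0 // lt_neqAle eq_sym cabs_eq0 bk cabs_ge0.
have [tz|tz] := eqVneq (theta t z) 0.
  apply: (low 1%N _ hb (theta_simple t0 hb tz)) => -[|//] _.
  by rewrite -(pser0 hb).
by apply: (low 0%N _ hb) => //; rewrite -(pser0 hb).
Qed.

Definition Dz f t w : C := derive1 (fun z => f t z w) 0.

Lemma Dz_jet_eq f t w p : jet 2 (fun h => f t h w) p -> Dz f t w = p`_1.
Proof. by move=> j; apply: jet_derive1; apply: jet_ext j => h; rewrite add0r. Qed.

Lemma Dz_jet f t w : FS f -> exists p, [/\ jet 2 (fun h => f t h w) p, p`_0 = f t 0 w & p`_1 = Dz f t w].
Proof.
move=> hf; have [p] := @smooth_FS f t 1 0 0 w hf 0 => j.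
have j' : jet 2 (fun h => f t h w) p.
  by apply: jet_ext j => h; congr (f t _ _); ring.
by exists p; rewrite (Dz_jet_eq j') (jet_value j').
Qed.

Lemma coefM1 (p q : {poly C}) : (p * q)`_1 = p`_0 * q`_1 + p`_1 * q`_0.
Proof. by rewrite coefM big_ord_recl big_ord1 /= subn0. Qed.

Lemma DzM f g t w : FS f -> FS g ->
  Dz (fun t z w => f t z w * g t z w) t w = f t 0 w * Dz g t w + Dz f t w * g t 0 w.
Proof.
move=> /(Dz_jet t w)[p [jp p0 p1]] /(Dz_jet t w)[q [jq q0 q1]].
by rewrite (Dz_jet_eq (jetM jp jq)) coefM1 p0 p1 q0 q1.
Qed.

Lemma DzD f g t w : FS f -> FS g ->
  Dz (fun t z w => f t z w + g t z w) t w = Dz f t w + Dz g t w.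
Proof.
move=> /(Dz_jet t w)[p [jp p0 p1]] /(Dz_jet t w)[q [jq q0 q1]].
by rewrite (Dz_jet_eq (jetD jp jq)) coefD p1 q1.
Qed.

Lemma DzZ k f t w : FS f -> Dz (fun t z w => k * f t z w) t w = k * Dz f t w.
Proof.
by move=> /(Dz_jet t w)[p [jp p0 p1]]; rewrite (Dz_jet_eq (jetZ k jp)) coefCM p1.
Qed.

(** Termwise differentiation multiplies by 2 pi i r1, and z = 0 merges the exponents that differ
    only in r1. *)
Lemma FS_Dz f : FS f -> FS (fun t _ w => Dz f t w).
Proof.
move=> [c hc].
exists (push (fun m : fexp => (m.1, (0, m.2.2)) : fexp) (fun m => c m * (tpi * m.2.1%:~R))).
apply: isFSon_push => t z w _.
have [ha j] := @fam_jet R c (val t) 0 w 1 0 2 (isFS_asum hc) (valP t).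
have e m : c m * (tpi * m.2.1%:~R) * qmon (m.1, (0, m.2.2)) (val t) z w =
    fam c (val t) 0 w m * lin_exp m 0 1 0 ^+ 1.
  have -> : qmon (m.1, (0, m.2.2)) (val t) z w = qmon m (val t) 0 w.
    by rewrite /qmon /=; congr ce; ring.
  by rewrite /fam /lin_exp expr1; move: (qmon _ _ _ _) => q; ring.
split; first by apply: eq_asum (ha 1%N) => m; rewrite e.
rewrite (eq_csum e); have rel h : csum (fam c (val t) (0 + h * 1) (w + h * 0)) = f t h w.
  by have [_ ->] := hc t h w I; rewrite mulr1 mulr0 add0r addr0.
have j' : jet 2 (fun h => f t h w) _ := jet_ext rel j.
rewrite (Dz_jet_eq j') (taylor1 (fun k => csum (fun m => fam c (val t) 0 w m * lin_exp m 0 1 0 ^+ k))).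
by [].
Qed.

End Smooth.

(** * Closure properties of weak Jacobi forms *)

Section Toolbox.
Variable R : realType.
Local Notation C := R[i].
Local Notation tpi := ((2 * pi : R)%:C * 'i%C).
Implicit Types (f g : jform R) (k p s r : int).

Lemma mulV_eq (j x y : C) : j != 0 -> j^-1 * x = y -> x = j * y.
Proof. by move=> j0 <-; rewrite mulVKf. Qed.

Lemma jmulz (j : C) k l : j != 0 -> j ^ k * j ^ l = j ^ (k + l).
Proof. by move=> j0; rewrite expfzDr. Qed.

Lemma WJ_ext k p s r f g : (forall t z w, f t z w = g t z w) -> WJ k p s r f -> WJ k p s r g.
Proof.
by move=> e; have -> : g = f by apply/funext => t; apply/funext => z; apply/funext => w.
Qed.

Lemma WJ_cast k p s r k' p' s' r' f g : WJ k p s r f -> k = k' -> p = p' -> s = s' -> r = r' ->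
  (forall t z w, f t z w = g t z w) -> WJ k' p' s' r' g.
Proof. by move=> hf <- <- <- <- e; exact: WJ_ext hf. Qed.

Lemma WJ_mul k p s r k' p' s' r' f g : WJ k p s r f -> WJ k' p' s' r' g ->
  WJ (k + k') (p + p') (s + s') (r + r') (fun t z w => f t z w * g t z w).
Proof.
move=> hf hg; split; last exact: (FSM (WJ_FS hf) (WJ_FS hg)).
- move=> a b c d t t' z w det j t'E; have j0 := automorphy_neq0 t'E.
  rewrite (WJ_mod hf z w det t'E) (WJ_mod hg z w det t'E) -/j -jmulz //.
  have -> : c%:~R * (((p + p')%:~R * z ^+ 2 + 2 * (s + s')%:~R * z * w + (r + r')%:~R * w ^+ 2) / 2) / j =
    c%:~R * ((p%:~R * z ^+ 2 + 2 * s%:~R * z * w + r%:~R * w ^+ 2) / 2) / j +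
    c%:~R * ((p'%:~R * z ^+ 2 + 2 * s'%:~R * z * w + r'%:~R * w ^+ 2) / 2) / j :> C.
    by rewrite !intrD; ring.
  by rewrite ceD; move: (ce _) (ce _) (j ^ k) (j ^ k') (f _ _ _) (g _ _ _) => *; ring.
- move=> t z w l1 l2 m1 m2; rewrite (WJ_ell hf) (WJ_ell hg).
  set A := - _; set B := - _; set D := - _.
  have -> : D = A + B by rewrite /A /B /D !intrD; ring.
  by rewrite ceD; move: (ce _) (ce _) (f _ _ _) (g _ _ _) => *; ring.
Qed.

Lemma WJ_add k p s r f g : WJ k p s r f -> WJ k p s r g ->
  WJ k p s r (fun t z w => f t z w + g t z w).
Proof.
move=> hf hg; split; last exact: (FSD (WJ_FS hf) (WJ_FS hg)).
- by move=> a b c d t t' z w det j t'E; rewrite (WJ_mod hf z w det t'E) (WJ_mod hg z w det t'E) -mulrDr.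
- by move=> t z w l1 l2 m1 m2; rewrite (WJ_ell hf) (WJ_ell hg) -mulrDr.
Qed.

Lemma WJ_scale k p s r (x : C) f : WJ k p s r f -> WJ k p s r (fun t z w => x * f t z w).
Proof.
move=> hf; split; last by apply: FSZ; exact: WJ_FS hf.
- by move=> a b c d t t' z w det j t'E; rewrite (WJ_mod hf z w det t'E) mulrCA.
- by move=> t z w l1 l2 m1 m2; rewrite (WJ_ell hf) mulrCA.
Qed.

Lemma WJ_sub k p s r f g : WJ k p s r f -> WJ k p s r g ->
  WJ k p s r (fun t z w => f t z w - g t z w).
Proof.
move=> hf hg; apply: WJ_ext (WJ_add hf (WJ_scale (-1) hg)) => t z w.
by rewrite mulN1r.
Qed.

Lemma WJ_cst (x : C) : WJ 0 0 0 0 (fun _ _ _ => x : C).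
Proof.
split; last exact: FS1.
- move=> a b c d t t' z w _ j _; rewrite expr0z mul1r.
  by rewrite (_ : _ * _ / j = 0) ?ce0 ?mul1r //; ring.
- by move=> t z w l1 l2 m1 m2; rewrite (_ : - _ = 0) ?ce0 ?mul1r //; ring.
Qed.

Lemma WJ_exp k p s r f n : WJ k p s r f ->
  WJ (n%:Z * k) (n%:Z * p) (n%:Z * s) (n%:Z * r) (fun t z w => f t z w ^+ n).
Proof.
move=> hf; elim: n => [|n IH].
  by rewrite !mul0r; apply: WJ_ext (WJ_cst 1) => t z w; rewrite expr0.
have e (x : int) : n.+1%:Z * x = x + n%:Z * x by rewrite -addn1 PoszD; ring.
by rewrite !e; apply: WJ_ext (WJ_mul hf IH) => t z w; rewrite exprS.
Qed.

(** The matrix may be singular: restrictions to z = 0 or to the origin, and one-variable forms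
    evaluated at z, w or z + w, are all of this kind. *)
Lemma WJ_pull k p s r f (u11 u12 u21 u22 : int) : WJ k p s r f ->
  WJ k (p * u11 ^+ 2 + 2 * s * u11 * u21 + r * u21 ^+ 2)
       (p * u11 * u12 + s * (u11 * u22 + u12 * u21) + r * u21 * u22)
       (p * u12 ^+ 2 + 2 * s * u12 * u22 + r * u22 ^+ 2)
    (fun t z w => f t (u11%:~R * z + u12%:~R * w) (u21%:~R * z + u22%:~R * w)).
Proof.
move=> hf; split.
- move=> a b c d t t' z w det j t'E.
  have e (x y : C) : x * (z / j) + y * (w / j) = (x * z + y * w) / j by ring.
  rewrite !e (WJ_mod hf _ _ det t'E); congr (_ * ce _ * _).
  by ring.
- move=> t z w l1 l2 m1 m2.
  have e (x y : int) : x%:~R * (z + l1%:~R * val t + m1%:~R) + y%:~R * (w + l2%:~R * val t + m2%:~R) =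
     (x%:~R * z + y%:~R * w) + (x * l1 + y * l2)%:~R * val t + (x * m1 + y * m2)%:~R :> C.
    by rewrite !intrD !intrM; ring.
  rewrite !e (WJ_ell hf); congr (ce _ * _).
  by ring.
- by have [c hc] := WJ_FS hf; eexists; exact: isFS_subst hc.
Qed.

(** As f vanishes at z = 0, the derivative of the multiplier drops out; the factor 1 / j in the
    argument z / j raises the weight by one. *)
Lemma WJ_Dz k p s r f : WJ k p s r f -> (forall t w, f t 0 w = 0) ->
  WJ (k + 1) 0 0 r (fun t _ w => Dz f t w).
Proof.
move=> hf f0; have Ff := WJ_FS hf; split; last exact: FS_Dz.
- move=> a b c d t t' z w det j t'E; have j0 := automorphy_neq0 t'E.
  have [P [jP P0 P1]] := Dz_jet t' (w / j) Ff; have [Q [jQ Q0 Q1]] := Dz_jet t w Ff.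
  pose E h : C := j ^ k * ce (c%:~R * ((p%:~R * h ^+ 2 + 2 * s%:~R * h * w + r%:~R * w ^+ 2) / 2) / j).
  have [e je] : exists e, jet 2 E e.
    have [e je] := smoothZ (j ^ k) (smooth_ce (c%:~R * p%:~R / 2 / j) (c%:~R * s%:~R * w / j) (c%:~R * r%:~R * w ^+ 2 / 2 / j)) 0.
    exists e; apply: jet_ext je => h; rewrite add0r /E; congr (_ * ce _); field.
    by rewrite j0.
  have rel h : f t' (j^-1 * h) (w / j) = E h * f t h w.
    by rewrite mulrC (WJ_mod hf _ _ det t'E) -/j.
  have := jet_unique (jet_ext rel (jet_scale j^-1 jP)) (jetM je jQ) (ltnSn 1).
  rewrite coef_scale coefM1 Q0 f0 mulr0 addr0 P1 Q1 (jet_value je) expr1 => h1.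
  have h2 : Dz f t' (w / j) = j * (E 0 * Dz f t w) by exact: mulV_eq j0 h1.
  have jE : j ^ (k + 1) = j ^ k * j by rewrite expfzDr // expr1z.
  rewrite [LHS]h2 jE.
  have -> : E 0 = j ^ k * ce (c%:~R * ((0%:~R * z ^+ 2 + 2 * 0%:~R * z * w + r%:~R * w ^+ 2) / 2) / j).
    by rewrite /E; congr (_ * ce _); ring.
  by move: (ce _) (j ^ k) (Dz _ _ _) => u v x; ring.
- move=> t z w l1 l2 m1 m2.
  have [P [jP P0 P1]] := Dz_jet t (w + l2%:~R * val t + m2%:~R) Ff; have [Q [jQ Q0 Q1]] := Dz_jet t w Ff.
  pose E h : C := ce (- (r%:~R * l2%:~R ^+ 2 / 2 * val t + (s%:~R * l2%:~R * h + r%:~R * l2%:~R * w))).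
  have [e je] : exists e, jet 2 E e.
    have [e je] := smooth_ce 0 (- (s%:~R * l2%:~R)) (- (r%:~R * l2%:~R ^+ 2 / 2 * val t + r%:~R * l2%:~R * w)) 0.
    by exists e; apply: jet_ext je => h; rewrite add0r /E; congr ce; ring.
  have rel h : f t h (w + l2%:~R * val t + m2%:~R) = E h * f t h w.
    have := WJ_ell hf t h w 0 l2 0 m2; rewrite mul0r !addr0 => ->; congr (ce _ * _).
    by rewrite /E; ring.
  have := jet_unique (jet_ext rel jP) (jetM je jQ) (ltnSn 1).
  rewrite coefM1 Q0 f0 mulr0 addr0 P1 Q1 (jet_value je) => ->; congr (ce _ * _).
  by rewrite /E; ring.
Qed.

(** The matrix - 1 fixes t and has j = - 1. *)
Lemma WJ_neg k p s r f t z w : WJ k p s r f -> f t (- z) (- w) = (-1) ^ k * f t z w.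
Proof.
move=> hf; have := @WJ_mod R k p s r f hf (-1) 0 0 (-1) t t z w.
rewrite /= mulrNN mulr1 mul0r subr0 => /(_ erefl).
rewrite !mul0r !add0r addr0 -[(-1)%:~R]/(-1 : C) mulN1r.
rewrite invrN invr1 !mulrN1 opprK => /(_ erefl) ->.
by rewrite ce0 mulr1.
Qed.

End Toolbox.

(** * Ellipticity as a relation between Fourier coefficients *)

Section IntSeries.
Variable R : realType.
Local Notation C := R[i].
Local Notation Im := complex.Im.
Local Notation I3 := (int * (int * int))%type.

Definition imon (i : I3) (T z w : C) : C := ce (i.1%:~R * T + i.2.1%:~R * z + i.2.2%:~R * w).
Definition ifam (a : I3 -> C) (T z w : C) : I3 -> C := fun i => a i * imon i T z w.
(** Extension by 0 to negative n, so that lattice translations act on all exponents. *)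
Definition zext (c : fexp -> C) (i : I3) : C := if i.1 is Posz n then c (n, i.2) else 0.

Lemma zext_fam (c : fexp -> C) T z w :
  (asum (fam c T z w) <-> asum (ifam (zext c) T z w)) /\
  (asum (fam c T z w) -> csum (ifam (zext c) T z w) = csum (fam c T z w)).
Proof.
pose h (m : fexp) : I3 := (Posz m.1, m.2).
have hi : injective h by move=> [n r] [n' r'] [-> ->].
have e : ifam (zext c) T z w \o h = fam c T z w by apply/funext => -[n r].
have z0 i : (forall m, h m <> i) -> ifam (zext c) T z w i = 0.
  by case: i => -[n|n] r hn; rewrite /ifam /zext /= ?mul0r //; case: (hn (n, r)).
have pe : push h (fam c T z w) = ifam (zext c) T z w.
  apply/funext => i; have [[m mi]|no] := pselect (exists m, h m = i).
    rewrite /push (@csum1 _ _ _ m) => [|m' mm]; first by rewrite mi eqxx -mi -[RHS]/((_ \o h) m) e.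
    by case: eqP => // hm; case/eqP: mm; apply: hi; rewrite hm.
  have no' m : h m <> i by move=> hm; apply: no; exists m.
  rewrite z0 // /push -[RHS](csum0 R fexp); apply: eq_csum => m.
  by case: eqP => // hm; case: (no' m).
split; last by move=> a; rewrite -pe csum_push.
split=> [a|a]; first by rewrite -pe; exact: asum_push.
by rewrite -e; exact: asum_inj.
Qed.

Lemma ifam_unique (a b : I3 -> C) (T z w : C) : asum (ifam a T z w) -> asum (ifam b T z w) ->
  (forall x1 x2 x3 : R, csum (ifam a (T + x1%:C) (z + x2%:C) (w + x3%:C)) =
                        csum (ifam b (T + x1%:C) (z + x2%:C) (w + x3%:C))) -> a =1 b.
Proof.
move=> ha hb e [n1 [n2 n3]].
have sh d x1 x2 x3 i : ifam d (T + x1%:C) (z + x2%:C) (w + x3%:C) i =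
    ifam d T z w i * ce (i.1%:~R * x1%:C + i.2.1%:~R * x2%:C + i.2.2%:~R * x3%:C).
  by rewrite /ifam -mulrA; congr (_ * _); rewrite -ceD; congr ce; ring.
have cs d x1 x2 x3 : asum (ifam d T z w) ->
    asum (fun i => ifam d T z w i * ce (i.1%:~R * x1%:C + i.2.1%:~R * x2%:C + i.2.2%:~R * x3%:C)).
  apply: asum_le => i; rewrite (cabsM (ifam d T z w i)) cabs_ce !ImD !ImMz /= !mulr0 !addr0 mulr0 oppr0 expR0.
  by rewrite mulr1.
have := @torus_unique R _ (fun i : I3 => i.1) (fun i => i.2.1) (fun i => i.2.2)
  (fun i => ifam a T z w i - ifam b T z w i).
have hab : asum (fun i => ifam a T z w i - ifam b T z w i).
  by apply: asumD ha _; exact: asumN.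
move=> /(_ hab) tu.
have {tu} := tu _ n1 n2 n3; rewrite (@csum1 _ _ _ (n1, (n2, n3))); last first.
  move=> [m1 [m2 m3]] /= ne; case: ifP => // /and3P[/eqP e1 /eqP e2 /eqP e3].
  by case/eqP: ne; rewrite e1 e2 e3.
rewrite /= !eqxx /= => H; have {H} : ifam a T z w (n1, (n2, n3)) - ifam b T z w (n1, (n2, n3)) = 0.
  apply: H => x1 x2 x3; under eq_csum do rewrite mulrBl.
  rewrite csumB; [|exact: cs|exact: cs].
  rewrite -(eq_csum (sh a x1 x2 x3)) -(eq_csum (sh b x1 x2 x3)).
  by rewrite e subrr.
rewrite /ifam -mulrBl => /eqP; rewrite mulf_eq0 (negbTE (ce_neq0 _)) orbF subr_eq0.
by move/eqP.
Qed.

Lemma ifam_shift (a : I3 -> C) T z w :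
  (asum (ifam a T (z + T) w) <-> asum (ifam (fun i => a (i.1 - i.2.1, i.2)) T z w)) /\
  (asum (ifam a T (z + T) w) ->
   csum (ifam (fun i => a (i.1 - i.2.1, i.2)) T z w) = csum (ifam a T (z + T) w)).
Proof.
pose h (i : I3) : I3 := (i.1 - i.2.1, i.2).
pose g (i : I3) : I3 := (i.1 + i.2.1, i.2).
have hg : cancel h g by move=> [n [r1 r2]]; rewrite /h /g /= subrK.
have gh : cancel g h by move=> [n [r1 r2]]; rewrite /h /g /= addrK.
have e : ifam a T (z + T) w \o h = ifam (fun i => a (i.1 - i.2.1, i.2)) T z w.
  apply/funext => i; rewrite /ifam /= /imon /h /=; congr (_ * ce _).
  by rewrite intrB; ring.
split; last by move=> ha; rewrite -e; apply: csum_bij => //; exists g.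
split=> ha; first by rewrite -e; apply: asum_inj => //; exact: can_inj hg.
by apply: (asum_can gh); rewrite e.
Qed.

Lemma ifam_trans (a : I3 -> C) (u1 u2 u3 : int) T z w : asum (ifam a T z w) ->
  asum (ifam (fun i => a (i.1 + u1, (i.2.1 + u2, i.2.2 + u3))) T z w) /\
  csum (ifam (fun i => a (i.1 + u1, (i.2.1 + u2, i.2.2 + u3))) T z w) =
  ce (- (u1%:~R * T + u2%:~R * z + u3%:~R * w)) * csum (ifam a T z w).
Proof.
move=> ha; pose h (i : I3) : I3 := (i.1 + u1, (i.2.1 + u2, i.2.2 + u3)).
pose g (i : I3) : I3 := (i.1 - u1, (i.2.1 - u2, i.2.2 - u3)).
have hg : cancel h g by move=> [n [r1 r2]]; rewrite /h /g /= !addrK.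
have gh : cancel g h by move=> [n [r1 r2]]; rewrite /h /g /= !subrK.
have e : ifam (fun i => a (i.1 + u1, (i.2.1 + u2, i.2.2 + u3))) T z w =
  (fun i => ce (- (u1%:~R * T + u2%:~R * z + u3%:~R * w)) * (ifam a T z w \o h) i).
  apply/funext => i; rewrite /ifam /= [RHS]mulrCA; congr (_ * _).
  by rewrite /imon -ceD /=; congr ce; rewrite !intrD; ring.
have ah : asum (ifam a T z w \o h) by apply: asum_inj => //; exact: can_inj hg.
rewrite e; split; first exact: asumZ.
by rewrite csumZ //; congr (_ * _); apply: csum_bij => //; exists g.
Qed.

Definition strip (t : uhp R) (z w : C) : Prop := - Im (val t) < Im z < Im (val t).

(* Ellipticity z -> z + t, read off on the Fourier coefficients. *)
Lemma coef_shift (c : fexp -> C) (G : jform R) (p s : int) :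
  isFSon strip c G ->
  (forall (t : uhp R) z w, - Im (val t) < Im z < 0 ->
     G t (z + val t) w = ce (- (p%:~R * val t + (2 * p)%:~R * z + s%:~R * w)) * G t z w) ->
  forall i, zext c (i.1 - i.2.1, i.2) = zext c (i.1 + p, (i.2.1 + 2 * p, i.2.2 + s)).
Proof.
(* For t = i and Im z = - 1/2 both z and z + t lie in the strip, together with their real
   translates. *)
move=> hc ell; pose t := uhpi R; pose z : C := (- 2^-1)%:C * 'i%C.
have imz : Im z = - 2^-1.
  by rewrite /z ImMr mulr1.
have key (x1 x2 x3 : R) : let T := val (uhp_shift t x1) in
   [/\ asum (ifam (zext c) T (z + x2%:C + T) x3%:C), asum (ifam (zext c) T (z + x2%:C) x3%:C) &
     csum (ifam (zext c) T (z + x2%:C + T) x3%:C) =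
     ce (- (p%:~R * T + (2 * p)%:~R * (z + x2%:C) + s%:~R * x3%:C)) * csum (ifam (zext c) T (z + x2%:C) x3%:C)].
  move=> T; have iT : Im T = 1 by exact: Im_real.
  have iz : Im (z + x2%:C) = - 2^-1 by rewrite Im_real.
  have d1 : strip (uhp_shift t x1) (z + x2%:C) x3%:C.
    by rewrite /strip -/T iT iz; apply/andP; split; lra.
  have d2 : strip (uhp_shift t x1) (z + x2%:C + T) x3%:C.
    by rewrite /strip -/T (ImD (z + x2%:C) T) iT iz; apply/andP; split; lra.
  have [a1 e1] := hc _ _ _ d1; have [a2 e2] := hc _ _ _ d2.
  have [z1 z1'] := zext_fam c T (z + x2%:C) x3%:C; have [z2 z2'] := zext_fam c T (z + x2%:C + T) x3%:C.
  split; [exact/z2|exact/z1|]; rewrite z1' // z2' // -e1 -e2; apply: ell.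
  by rewrite -/T iT iz; apply/andP; split; lra.
apply: (@ifam_unique (fun i => zext c (i.1 - i.2.1, i.2))
  (fun i => zext c (i.1 + p, (i.2.1 + 2 * p, i.2.2 + s))) (val t) z 0).
- have [a1 _ _] := key 0 0 0; apply/(ifam_shift (zext c) (val t) z 0).1.
  by move: a1; rewrite /= !addr0.
- have [_ a1 _] := key 0 0 0; apply: (ifam_trans p (2 * p) s _).1.
  by move: a1; rewrite /= !addr0.
- move=> x1 x2 x3; have [a1 a2 e] := key x1 x2 x3; rewrite add0r.
  by rewrite ((ifam_shift (zext c) _ _ _).2 a1) ((ifam_trans p (2 * p) s a2).2) e.
Qed.

Lemma strip_ind (t : uhp R) (P : C -> Prop) :
  (forall z, strip t z 0 -> P z) -> (forall z, P z -> P (z + val t)) ->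
  (forall z, P (z + val t) -> P z) -> forall z, P z.
Proof.
move=> hs up down z; have t0 := valP t; rewrite /= in t0.
pose k := Num.floor (Im z / Im (val t)).
have base : P (z - k%:~R * val t).
  apply: hs; have /andP[f1 f2] := floor_itv (Im z / Im (val t)); rewrite -/k in f1 f2.
  rewrite /strip ImD ImN ImMz; rewrite ler_pdivlMr // in f1; rewrite ltr_pdivrMr // intrD in f2.
  apply/andP; split.
    by apply: (lt_le_trans (y := 0)); rewrite ?oppr_lt0 ?subr_ge0.
  by rewrite ltrBlDr addrC; move: f2; rewrite mulrDl mul1r.
have -> : z = (z - k%:~R * val t) + k%:~R * val t by rewrite subrK.
move: (z - k%:~R * val t) base => z0; move: k => k; elim/int_rec: k => [|n IH|n IH] b.
- by rewrite mul0r addr0.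
- by rewrite -addn1 PoszD intrD mulrDl mul1r addrA; apply: up; exact: IH.
- apply: down; have -> : z0 + (- n.+1%:Z)%:~R * val t + val t = z0 + (- n%:Z)%:~R * val t.
    by rewrite -addn1 PoszD opprD intrD mulrDl -[(-1)%:~R]/(-1 : C) mulN1r addrA subrK.
  exact: IH.
Qed.

(* Conversely, the shift relation propagates convergence from the strip. *)
Lemma shift_extend (c : fexp -> C) (p s : int) :
  (forall i, zext c (i.1 - i.2.1, i.2) = zext c (i.1 + p, (i.2.1 + 2 * p, i.2.2 + s))) ->
  (forall (t : uhp R) z w, strip t z w -> asum (fam c (val t) z w)) ->
  forall (t : uhp R) z w, asum (fam c (val t) z w) /\
    csum (fam c (val t) (z + val t) w) =
    ce (- (p%:~R * val t + (2 * p)%:~R * z + s%:~R * w)) * csum (fam c (val t) z w).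
Proof.
move=> rel hs t.
have relf : (fun i : I3 => zext c (i.1 - i.2.1, i.2)) = (fun i => zext c (i.1 + p, (i.2.1 + 2 * p, i.2.2 + s))).
  exact/funext.
have up z w : asum (ifam (zext c) (val t) z w) -> asum (ifam (zext c) (val t) (z + val t) w).
  move=> a; apply/(ifam_shift (zext c) (val t) z w).1; rewrite relf.
  exact: (ifam_trans p (2 * p) s a).1.
have down z w : asum (ifam (zext c) (val t) (z + val t) w) -> asum (ifam (zext c) (val t) z w).
  move=> /(ifam_shift (zext c) (val t) z w).1; rewrite relf => a.
  have := (ifam_trans (- p) (- (2 * p)) (- s) a).1.
  by congr (asum (ifam _ _ _ _)); apply/funext => -[n [r1 r2]] /=; rewrite !subrK.
have all z w : asum (ifam (zext c) (val t) z w).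
  move: z; apply: (strip_ind (t := t)) => [z hz|z|z]; [|exact: up|exact: down].
  by apply/(zext_fam c (val t) z w).1; exact: hs.
move=> z w; have [z1 z1'] := zext_fam c (val t) z w; have [z2 z2'] := zext_fam c (val t) (z + val t) w.
split; first exact/z1.
rewrite -z1'; last exact/z1.
rewrite -z2'; last exact/z2.
by rewrite -((ifam_shift (zext c) _ _ _).2 (all _ _)) relf ((ifam_trans p (2 * p) s (all _ _)).2).
Qed.

End IntSeries.

(** * Division by a form with a double zero at z = 0 *)

Section Division.
Variable R : realType.
Local Notation C := R[i].
Local Notation Im := complex.Im.
Local Notation tpi := ((2 * pi : R)%:C * 'i%C).
Implicit Types (f g : jform R).

Lemma sum_ltn (N n : nat) : \sum_(k < n) (k < N)%N%:R = (minn n N)%:R :> R.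
Proof.
elim: n => [|n IH]; first by rewrite big_ord0 min0n.
by rewrite big_ord_recr /= IH -natrD; congr (_%:R); case: ltnP => h; rewrite /minn; case: ltnP; lia.
Qed.

Lemma sumbnd_trunc (f : nat -> C) (N : nat) (M : R) : 0 <= M ->
  (forall i, cabs (f i) <= (i < N)%N%:R * M) -> sumbnd f (N%:R * M).
Proof.
move=> M0 hf; apply: sumbnd_nat => n.
apply: (@le_trans _ _ (\sum_(k < n) (k < N)%N%:R * M)); first by apply: ler_sum => i _.
by rewrite -mulr_suml sum_ltn ler_wpM2r // ler_nat geq_minr.
Qed.

(** Exponents and sign in the finite sum (x^r - 1) / (1 - x): 0, ..., r - 1 with sign -1 for r >= 0,
    and -1, ..., r with sign 1 for r < 0. *)
Definition gexp (r : int) (i : nat) : int := if r is Posz _ then Posz i else - (Posz i.+1).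
Definition gsign (r : int) : C := if r is Posz _ then -1 else 1.

Lemma sum_gexp (x : C) (r : int) : x != 0 ->
  (1 - x) * (\sum_(i < `|r|%N) gsign r * x ^ gexp r i) = x ^ r - 1.
Proof.
move=> x0; case: r => n; rewrite /gexp /gsign.
  rewrite -mulr_sumr mulrCA mulN1r -mulNr opprB subrX1 /=.
  by congr (_ * _); apply: eq_bigr => i _.
have -> : `|Negz n|%N = n.+1 by [].
have -> : x ^ Negz n = x^-1 ^+ n.+1 by rewrite NegzE -exprz_inv.
rewrite subrX1 (_ : x^-1 - 1 = (1 - x) * x^-1); last by rewrite mulrBl mul1r divff.
rewrite -[RHS]mulrA; congr (_ * _); rewrite mulr_sumr; apply: eq_bigr => i _.
by rewrite mul1r -exprS -[Posz i.+1]/(i.+1 : int) -exprz_inv -exprnP.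
Qed.

(** An exponential on a segment is below the sum of its end values. For exponents between 0 and r1
    the ends are terms of the series at z = 0 and at z. *)
Lemma exp_between (A Y : R) (e r : R) : (0 <= e <= r) \/ (r <= e <= 0) ->
  expR (- (2 * pi * (A + e * Y))) <= expR (- (2 * pi * A)) + expR (- (2 * pi * (A + r * Y))).
Proof.
move=> h; have p0 := pi_gt0 R.
have [l|l] : (0 <= e * Y) \/ (r * Y <= e * Y).
  by have [y|y] := leP 0 Y; case: h => /andP[h1 h2]; [left|right|right|left]; nra.
  apply: (le_trans (y := expR (- (2 * pi * A)))); last by rewrite lerDl expR_ge0.
  by rewrite ler_expR lerN2 ler_wpM2l ?lerDl // mulr_ge0 // ltW.
apply: (le_trans (y := expR (- (2 * pi * (A + r * Y))))); last by rewrite lerDr expR_ge0.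
by rewrite ler_expR lerN2 ler_wpM2l ?lerD2l // mulr_ge0 // ltW.
Qed.

Lemma lin_abs (m : fexp) : cabs (lin_exp m 0 1 0 : C) = 2 * pi * `|m.2.1|%:R.
Proof.
have p0 := pi_gt0 R.
have -> : lin_exp m 0 1 0 = (2 * pi)%:C * 'i%C * m.2.1%:~R :> C by rewrite /lin_exp; ring.
rewrite !cabsM cabsR gtr0_norm ?mulr_gt0 //.
have -> : cabs ('i%C : C) = 1 by rewrite /cabs /= expr0n expr1n add0r sqrtr1.
rewrite mulr1; congr (_ * _).
have -> : m.2.1%:~R = (m.2.1%:~R : R)%:C :> C by rewrite rmorph_int.
by rewrite cabsR -intr_norm -abszE.
Qed.

(* If f vanishes at z = 0, each term of f(z) - f(0) is divisible by 1 - zeta. *)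
Lemma FS_div1 f : FS f -> (forall t w, f t 0 w = 0) ->
  exists2 g, FS g & forall t z w, f t z w = (1 - ce z) * g t z w.
Proof.
move=> [c hc] f0.
pose b (p : fexp * nat) : C := if (p.2 < `|p.1.2.1|)%N then gsign p.1.2.1 * c p.1 else 0.
pose h (p : fexp * nat) : fexp := (p.1.1, (gexp p.1.2.1 p.2, p.1.2.2)).
have gx r i : (i < `|r|)%N -> ((0 <= (gexp r i)%:~R :> R) && ((gexp r i)%:~R <= r%:~R :> R)) \/ ((r%:~R <= (gexp r i)%:~R :> R) && ((gexp r i)%:~R <= 0 :> R)).
  case: r => n /= ni; [left|right]; rewrite ?ler0z ?lerz0 ?ler_int /gexp; first by apply/andP; split=> //; lia.
  by apply/andP; split; lia.
have bnd (t : uhp R) z w m i : cabs (b (m, i) * qmon (h (m, i)) (val t) z w) <=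
    (i < `|m.2.1|)%N%:R * (cabs (c m) * (cabs (qmon m (val t) 0 w) + cabs (qmon m (val t) z w))).
  rewrite /b /=; case: ifP => li; last by rewrite mul0r cabs0 mul0r.
  rewrite mul1r (cabsM (_ * _)) (cabsM (gsign _)).
  have -> : cabs (gsign m.2.1) = 1 by case: (m.2.1) => n; rewrite /gsign ?cabsN cabs1.
  rewrite mul1r ler_wpM2l ?cabs_ge0 // !cabs_qmon /h /= mulr0 addr0.
  have := exp_between (m.1%:R * Im (val t) + m.2.2%:~R * Im w) (Im z) (gx _ _ li).
  by rewrite 2![m.1%:R * _ + m.2.2%:~R * _ + _]addrAC.
have mB (t : uhp R) z w m : sumbnd (fun i => b (m, i) * qmon (h (m, i)) (val t) z w)
    (`|m.2.1|%:R * (cabs (c m) * (cabs (qmon m (val t) 0 w) + cabs (qmon m (val t) z w)))).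
  by apply: sumbnd_trunc; [rewrite mulr_ge0 ?addr_ge0 ?cabs_ge0|move=> i; exact: bnd].
have p0 := pi_gt0 R.
have ab (t : uhp R) z w : asum (fun p => b p * qmon (h p) (val t) z w).
  apply: (asum_pairI (mB t z w)).
  (* A term with exponent r1 produces |r1| terms of the quotient; this factor is the one of the
     differentiated series. *)
  have lin z' : asum (fun m => (cabs (fam c (val t) z' w m * lin_exp m 0 1 0 ^+ 1))%:C).
    have [_ [S [_ hS _]]] := fam_taylor z' w (isFS_asum hc) (valP t).
    by apply: asum_le (hS 1%N 0 1 0) => m; rewrite cabsR ger0_norm ?cabs_ge0.
  apply: eq_asum (asumZ ((2 * pi)^-1 : R)%:C (asumD (lin 0) (lin z))) => m.
  rewrite -rmorphD -rmorphM /=; congr (_%:C).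
  have cl (y : C) : cabs (y * lin_exp m 0 1 0 ^+ 1) = cabs y * (2 * pi * `|m.2.1|%:R).
    by rewrite expr1 cabsM lin_abs.
  rewrite !cl /fam !(cabsM (c m)).
  move: (cabs (c m)) (cabs (qmon _ _ 0 _)) (cabs (qmon _ _ z _)) => u v x.
  have pn : 2 * pi != 0 :> R by rewrite gt_eqF ?mulr_gt0.
  by move: (2 * pi) pn => P pn; field.
exists (fun t z w => csum (fun p => b p * qmon (h p) (val t) z w)).
  by eexists; apply: isFSon_push => t z w _; split; [exact: ab|].
move=> t z w; rewrite (csum_pair (ab t z w)) -csumZ; last exact: (asum_pair_sum (ab t z w)).
have [a1 ->] := hc t z w I; have [a0 e0] := hc t 0 w I.
rewrite -[LHS]subr0 -[X in _ - X](f0 t w) e0 -csumB //; apply: eq_csum => m.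
rewrite (@csum_finsupp _ _ _ (iota 0 `|m.2.1|)) ?iota_uniq => [|//|i]; last first.
  by rewrite mem_iota add0n /b /= => /negbTE ->; rewrite mul0r.
have qE e : qmon (m.1, (e, m.2.2)) (val t) z w = qmon m (val t) 0 w * ce z ^ e.
  by rewrite -ceMz -ceD /qmon /=; congr ce; ring.
have qz : qmon m (val t) z w = qmon m (val t) 0 w * ce z ^ m.2.1.
  by rewrite -qE; case: (m) => ? [? ?].
rewrite /fam qz -[X in iota 0 X]subn0 -/(index_iota 0 `|m.2.1|) big_mkord.
rewrite (eq_bigr (fun i : 'I_ _ => c m * qmon m (val t) 0 w * (gsign m.2.1 * ce z ^ gexp m.2.1 i))); last first.
  by move=> i _; rewrite /b /h /= ltn_ord qE; move: (qmon _ _ _ _) (ce z ^ _) => *; ring.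
rewrite -mulr_sumr [RHS]mulrCA sum_gexp ?ce_neq0 //.
by move: (qmon _ _ _ _) (ce z ^ _) => *; ring.
Qed.

(** The form x in the variable z: up to a constant theta(z)^2 / eta^6. *)
Definition X1 : jform R := fun t z _ => Phi_m2 R t 0 z.

Lemma WJ_X1 : WJ (- 2) 2 0 0 X1.
Proof.
apply: WJ_cast (WJ_pull 0 0 1 0 (WJ_Phi_m2 R)) _ _ _ _ _; try lia.
by move=> t z w; rewrite /X1 !mul0r addr0 mul1r addr0.
Qed.

Lemma X1E t z w : X1 t z w = tpi ^+ 3 * theta (val t) z ^+ 2 / Dtheta (val t) 1 0 ^+ 2.
Proof. exact: Phi_m2_z0. Qed.

Lemma X1_neq0 t z w : theta (val t) z != 0 -> X1 t z w != 0.
Proof.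
move=> tz; rewrite X1E; apply: mulf_neq0.
  by apply: mulf_neq0; apply: expf_neq0 => //; exact: tpi_neq0.
by rewrite invr_eq0; apply: expf_neq0; exact: Dtheta1_neq0 (valP t).
Qed.

(** (1 - zeta)^2 g / X1 in the strip, where [eulerE] inverts the infinite products of theta. The
    factor [ce z] offsets the one in (e(z/2) - e(-z/2))^2 = ce (- z) (1 - ce z)^2. *)
Definition Gdiv (g : jform R) : jform R := fun t z w =>
  tpi^-1 * (ce z * g t z w * (eulerE (val t) z * eulerE (val t) (- z)) ^+ 2 *
   ((ce (- (val t / 8)) * Dtheta (val t) 1 0 / tpi) ^+ 2 * eulerE (val t) 0 ^+ 2)).

Lemma FS_Gdiv g : FS g -> exists c, isFSon (@strip R) c (Gdiv g).
Proof.
move=> [cg hg].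
have sub c f : isFS c f -> isFSon (@strip R) c f by apply: isFSon_sub.
have [c1 [h1 _]] := @isFS_eulerE R 1; have [c2 [h2 _]] := @isFS_eulerE R (-1).
have H1 : isFSon (@strip R) c1 (fun t z _ => eulerE (val t) z).
  move=> t z w /andP[s1 s2]; have [] := h1 t z w; last by rewrite mul1r.
  by rewrite mul1r ImD -ltrBlDl sub0r.
have H2 : isFSon (@strip R) c2 (fun t z _ => eulerE (val t) (- z)).
  move=> t z w /andP[s1 s2]; have [] := h2 t z w; last by rewrite mulN1r.
  by rewrite mulN1r ImD ImN subr_gt0.
have H12 := isFSonM H1 H2.
have [ce0 he0] := FS_eulerE0 R.
have hq := sub _ _ (@isFSon_monom R (@everywhere R) (0%N, (1, 0))).
have hP := sub _ _ (isFSonZ tpi^-1 (@isFS_Dtheta R 1)).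
have hE := sub _ _ he0.
have H := isFSonZ tpi^-1 (isFSonM (isFSonM (isFSonM hq (sub _ _ hg)) (isFSonM H12 H12))
  (isFSonM (isFSonM hP hP) (isFSonM hE hE))).
eexists; apply: isFSon_ext H => t z w _; rewrite /Gdiv.
have -> : qmon (0%N, (1, 0)) (val t) z w = ce z by rewrite /qmon /=; congr ce; ring.
by move: (ce _) (ce _) (eulerE _ _) (eulerE _ _) (eulerE _ _) (Dtheta _ _ _) (tpi^-1) (g _ _ _) => *; ring.
Qed.

Lemma X1_Gdiv g t z w : strip t z w -> X1 t z w * Gdiv g t z w = (1 - ce z) ^+ 2 * g t z w.
Proof.
move=> hs; have t0 := valP t; have /andP[s1 s2] := hs; rewrite /= in t0.
have EF u : 0 < Im (val t + u) -> eulerE (val t) u = (eulerF (val t) u)^-1 /\ eulerF (val t) u != 0.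
  move=> hu; have e := eulerEF t0 hu.
  have F0 : eulerF (val t) u != 0.
    by apply/eqP => F0; move/eqP: e; rewrite F0 mulr0 eq_sym oner_eq0.
  by split=> //; rewrite -[RHS]mul1r -e mulfK.
have [e1 n1] : eulerE (val t) z = (eulerF (val t) z)^-1 /\ eulerF (val t) z != 0.
  by apply: EF; rewrite ImD -ltrBlDl sub0r.
have [e2 n2] : eulerE (val t) (- z) = (eulerF (val t) (- z))^-1 /\ eulerF (val t) (- z) != 0.
  by apply: EF; rewrite ImD ImN subr_gt0.
have [e0 n0] : eulerE (val t) 0 = (eulerF (val t) 0)^-1 /\ eulerF (val t) 0 != 0.
  by apply: EF; rewrite addr0.
rewrite X1E /Gdiv e1 e2 e0 Dtheta1_0 // eta3 // theta_prod //.
have sq : (ce (z / 2) - ce (- (z / 2))) ^+ 2 = ce (- z) * (1 - ce z) ^+ 2.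
  have -> : ce z = ce (z / 2) ^+ 2 by rewrite -ceMn; congr ce; field.
  have -> : ce (- z) = ce (- (z / 2)) ^+ 2 by rewrite -ceMn; congr ce; field.
  have := ceNr (z / 2); move: (ce (z / 2)) (ce (- (z / 2))) => x y xy.
  have -> : y ^+ 2 * (1 - x ^+ 2) ^+ 2 = (y - x * (x * y)) ^+ 2 by ring.
  by rewrite xy mulr1 -sqrrN opprB.
have tn := tpi_neq0 R; have q8 := ce_neq0 (val t / 8); have qz := ce_neq0 z.
move: sq; set s := ce (z / 2) - _; clearbody s; rewrite !ceN.
move: (eulerF _ z) (eulerF _ (- z)) (eulerF _ 0) (ce (_ / 8)) (ce z) (g t z w) n1 n2 n0 q8 qz.
set T := tpi in tn *; clearbody T => F1 F2 F0 q x G ? ? ? ? ? sq.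
transitivity (s ^+ 2 * (x * G)); first by field; do ?[apply/andP; split].
by rewrite sq; field.
Qed.

Lemma cancel_mul (f f' X X' g g' mu nu : C) : f = X * g -> f' = X' * g' -> f' = mu * f ->
  X' = nu * X -> nu != 0 -> X != 0 -> g' = mu / nu * g.
Proof.
move=> e1 e2 e3 e4 nu0 X0; apply: (mulfI (mulf_neq0 nu0 X0)).
have -> : nu * X * (mu / nu * g) = mu * (X * g) by field.
by rewrite -e4 -e2 e3 e1.
Qed.

(** The double zero yields two factors 1 - zeta, and the rest of X1 is inverted in the strip.
    Ellipticity of this quotient becomes a relation between coefficients by [coef_shift], and
    [shift_extend] then gives convergence for all z. *)
Lemma WJ_div k (p : int) s r f : WJ k (2 * p) s r f ->
  (forall t w, f t 0 w = 0) -> (forall t w, Dz f t w = 0) ->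
  exists2 g, WJ (k + 2) (2 * (p - 1)) s r g & forall t z w, f t z w = X1 t z w * g t z w.
Proof.
move=> hf f0 f1; have Ff := WJ_FS hf.
have [g1 Fg1 e1] := FS_div1 Ff f0.
(* The derivative of f at z = 0 is g1 times that of 1 - zeta, which is - 2 pi i. *)
have g10 t w : g1 t 0 w = 0.
  have Fc : FS (fun (_ : uhp R) (z _ : C) => 1 - ce z).
    have h := @isFSon_monom R (@everywhere R) (0%N, (1, 0)).
    apply: FS_ext (FSD (FS1 (1 : C)) (FSZ (-1) (isFS_FS h))) => t' z w'.
    by rewrite mulN1r /qmon /=; congr (1 - ce _); ring.
  have := f1 t w; have -> : f = (fun t z w => (1 - ce z) * g1 t z w).
    by apply/funext => ?; apply/funext => ?; apply/funext => ?; exact: e1.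
  rewrite (DzM t w Fc Fg1) ce0 subrr mul0r add0r => /eqP.
  rewrite mulf_eq0 => /orP[|/eqP //].
  have j := jet_cexp tpi 2; have j1 := jetD (jet_horner 2 1) (jetZ (-1) j).
  have rel h : (1 : {poly C}).[h] + -1 * cexp (tpi * h) = 1 - ce h.
    by rewrite hornerC mulN1r -ceE.
  rewrite (@Dz_jet_eq R (fun _ z _ => 1 - ce z) t w _ (jet_ext rel j1)) coefD coefC add0r coefCM.
  rewrite (taylor1 (fun k => tpi ^+ k)) expr1 mulN1r oppr_eq0.
  by rewrite (negbTE (tpi_neq0 R)).
have [g2 Fg2 e2] := FS_div1 Fg1 g10.
have [c hc] := FS_Gdiv Fg2.
have XG t z w : strip t z w -> f t z w = X1 t z w * Gdiv g2 t z w.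
  by move=> hs; rewrite X1_Gdiv // e1 e2 mulrA.
have fsh t z w : f t (z + val t) w = ce (- (p%:~R * val t + (2 * p)%:~R * z + s%:~R * w)) * f t z w.
  have := WJ_ell hf t z w 1 0 0 0; rewrite mul1r mul0r !addr0 => ->; congr (ce _ * _).
  by rewrite !intrM -[(2 : int)%:~R]/(2 : C); field.
have Xsh t z w : X1 t (z + val t) w = ce (- (val t + 2 * z)) * X1 t z w.
  have := WJ_ell WJ_X1 t z w 1 0 0 0; rewrite mul1r mul0r !addr0 => ->; congr (ce _ * _).
  by rewrite -[(2 : int)%:~R]/(2 : C); field.
have muE t z w : ce (- (p%:~R * val t + (2 * p)%:~R * z + s%:~R * w)) / ce (- (val t + 2 * z)) =
     ce (- ((p - 1)%:~R * val t + (2 * (p - 1))%:~R * z + s%:~R * w)) :> C.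
  by rewrite -ceN -ceD; congr ce; rewrite !intrM !intrB -[(2 : int)%:~R]/(2 : C); ring.
(* For - Im t < Im z < 0 both z and z + t lie in the strip, and theta has no zero at z. *)
have Gsh (t : uhp R) z w : - Im (val t) < Im z < 0 -> Gdiv g2 t (z + val t) w =
    ce (- ((p - 1)%:~R * val t + (2 * (p - 1))%:~R * z + s%:~R * w)) * Gdiv g2 t z w.
  move=> /andP[z1 z2]; have t0 := valP t; rewrite /= in t0.
  have d1 : strip t z w by rewrite /strip z1 (lt_trans z2).
  have d2 : strip t (z + val t) w.
    by rewrite /strip ImD; apply/andP; split; move: z1 z2 t0; move: (Im _) (Im _) => x y ? ? ?; lra.
  rewrite -muE; apply: (cancel_mul (XG _ _ _ d1) (XG _ _ _ d2) (fsh t z w) (Xsh t z w)).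
    exact: ce_neq0.
  apply: X1_neq0; apply/eqP => /(theta_eq0_strip t0)[]; first by [].
  move=> m zm; move: z2; rewrite zm -[m%:~R]mulr1 ImMz /= mulr0.
  by rewrite ltxx.
have rel := coef_shift hc Gsh.
have ext := shift_extend rel (fun t z w hs => (hc t z w hs).1).
pose g : jform R := fun t z w => csum (fam c (val t) z w).
have hg : isFS c g by move=> t z w _; split; [exact: (ext t z w).1|].
have Fg : FS g by exists c.
(* The factorisation spreads from the strip because both sides have the same multiplier under z +
   t. *)
have fg t z w : f t z w = X1 t z w * g t z w.
  move: z; apply: (strip_ind (t := t)) => [z hs|z IH|z IH].
  - by rewrite XG // /g -(hc t z w hs).2.
  - rewrite fsh Xsh IH /g (ext t z w).2 -muE; move: (csum _) (X1 _ _ _) => *.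
    by field; exact: ce_neq0.
  - move: IH; rewrite fsh Xsh /g (ext t z w).2 -muE => IH.
    apply: (mulfI (ce_neq0 (- (p%:~R * val t + (2 * p)%:~R * z + s%:~R * w)))).
    by rewrite IH; move: (csum _) (X1 _ _ _) => *; field; exact: ce_neq0.
clearbody g; exists g => //; split=> //.
- move=> a b c0 d t t' z w det j t'E; have j0 := automorphy_neq0 t'E; rewrite -/j in j0.
  (* Where theta(z) is nonzero the law of [g] is the quotient of those of [f] and [X1]; the zeros of
     theta are isolated. *)
  move: z; apply: (@smooth_cancel R (fun z => g t' (z / j) (w / j)) _ (theta (val t))).
  + move=> z; have [q hq] := @smooth_FS R g t' j^-1 0 0 (w / j) Fg z; exists q; apply: jet_ext hq => h.
    by congr (g t' _ _); ring.
  + have S1 := smoothZ (j ^ (k + 2)) (smooth_ce (c0%:~R * (2 * (p - 1))%:~R / 2 / j) (c0%:~R * s%:~R * w / j) (c0%:~R * r%:~R * w ^+ 2 / 2 / j)).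
    have S := smoothM S1 (@smooth_FS R g t 1 0 0 w Fg).
    move=> z; have [q hq] := S z; exists q; apply: jet_ext hq => h.
    congr (_ * ce _ * g t _ _); first by field.
      by ring.
    by ring.
  + exact: theta_isolated (valP t).
  + move=> z tz.
    have := cancel_mul (fg t z w) (fg t' (z / j) (w / j)) (WJ_mod hf z w det t'E) (WJ_mod WJ_X1 z w det t'E) _ (X1_neq0 w tz).
    rewrite -/j => ->; last by rewrite mulf_neq0 ?ce_neq0 ?expfz_neq0.
    congr (_ * _); rewrite invfM invr_expz opprK mulrACA -ceN -ceD -expfzDr //; congr (_ * ce _).
    by rewrite !intrM !intrB -[(2 : int)%:~R]/(2 : C); field.
- move=> t z w l1 l2 m1 m2; move: z.
  apply: (@smooth_cancel R (fun z => g t (z + l1%:~R * val t + m1%:~R) (w + l2%:~R * val t + m2%:~R)) _ (theta (val t))).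
  + move=> z; have [q hq] := @smooth_FS R g t 1 (l1%:~R * val t + m1%:~R) 0 (w + l2%:~R * val t + m2%:~R) Fg z.
    by exists q; apply: jet_ext hq => h; congr (g t _ _); ring.
  + have S1 := smooth_ce 0 (- ((2 * (p - 1))%:~R * l1%:~R + s%:~R * l2%:~R)) (- (((2 * (p - 1))%:~R * l1%:~R ^+ 2 + 2 * s%:~R * l1%:~R * l2%:~R + r%:~R * l2%:~R ^+ 2) / 2 * val t + (s%:~R * l1%:~R + r%:~R * l2%:~R) * w)).
    have S := smoothM S1 (@smooth_FS R g t 1 0 0 w Fg).
    move=> z; have [q hq] := S z; exists q; apply: jet_ext hq => h.
    by congr (ce _ * g t _ _); ring.
  + exact: theta_isolated (valP t).
  + move=> z tz.
    have := cancel_mul (fg t z w) (fg t _ _) (WJ_ell hf t z w l1 l2 m1 m2) (WJ_ell WJ_X1 t z w l1 l2 m1 m2) (ce_neq0 _) (X1_neq0 w tz).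
    move=> ->; congr (_ * _); rewrite -ceN -ceD; congr ce.
    by rewrite !intrM !intrB -[(2 : int)%:~R]/(2 : C); field.
Qed.

End Division.

(** * Vanishing of forms of small index *)

Section Vanishing.
Variable R : realType.
Local Notation C := R[i].
Local Notation Im := complex.Im.
Implicit Types (f g : jform R) (k p s r : int).

Lemma WJ_swap k p s r f : WJ k p s r f -> WJ k r s p (fun t z w => f t w z).
Proof.
move=> hf; apply: WJ_cast (WJ_pull 0 1 1 0 hf) _ _ _ _ _; try lia.
by move=> t z w; rewrite !mul0r !mul1r add0r addr0.
Qed.

Lemma isFS_perm (h : fexp -> fexp) c f (g : uhp R -> C -> C -> C * C) : involutive h ->
  (forall m t z w, qmon (h m) (val t) z w = qmon m (val t) (g t z w).1 (g t z w).2) ->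
  isFS c f -> isFS (c \o h) (fun t z w => f t (g t z w).1 (g t z w).2 : C).
Proof.
move=> hh hq hc t z w _; have [a e] := hc t (g t z w).1 (g t z w).2 I.
have eF : fam (c \o h) (val t) z w = fam c (val t) (g t z w).1 (g t z w).2 \o h.
  by apply/funext => m; rewrite /fam /= -hq hh.
rewrite eF e; split; first by apply: asum_inj => //; exact: can_inj hh.
by rewrite csum_bij //; exists h.
Qed.

Lemma isFS_swap c f : isFS c f ->
  isFS (fun m => c (m.1, (m.2.2, m.2.1))) (fun t z w => f t w z).
Proof.
apply: (@isFS_perm (fun m => (m.1, (m.2.2, m.2.1))) c f (fun _ z w => (w, z))).
  by move=> [n [a b]].
by move=> m t z w; rewrite /qmon /=; congr ce; ring.
Qed.

Lemma isFS_neg c f : isFS c f ->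
  isFS (fun m => c (m.1, (- m.2.1, - m.2.2))) (fun t z w => f t (- z) (- w)).
Proof.
apply: (@isFS_perm (fun m => (m.1, (- m.2.1, - m.2.2))) c f (fun _ z w => (- z, - w))).
  by move=> [n [a b]] /=; rewrite !opprK.
by move=> m t z w; rewrite /qmon /= !rmorphN; congr ce; ring.
Qed.

Lemma zext_neg (c : fexp -> C) (n : int) (r : int * int) : n < 0 -> zext c (n, r) = 0.
Proof. by case: n. Qed.

Lemma WJ_coef k p s r f c : WJ k (2 * p) s r f -> isFS c f ->
  forall n a b, zext c (n - a, (a, b)) = zext c (n + p, (a + 2 * p, b + s)).
Proof.
move=> hf hc n a b; have hs : isFSon (@strip R) c f by apply: isFSon_sub hc.
apply: (coef_shift hs _ (n, (a, b))) => t z w _.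
have := WJ_ell hf t z w 1 0 0 0; rewrite mul1r mul0r !addr0 => ->; congr (ce _ * _).
by rewrite !intrM -[(2 : int)%:~R]/(2 : C); field.
Qed.

(** Translation by t in z moves n by multiples of a and keeps the coefficient; for nonzero a this
    reaches negative n. *)
Lemma WJ0_coef k r f c : WJ k 0 0 r f -> isFS c f ->
  forall n a b, a != 0 -> zext c (n, (a, b)) = 0.
Proof.
move=> hf hc; have hf' : WJ k (2 * 0) 0 r f by rewrite mulr0.
have rel n a b : zext c (n - a, (a, b)) = zext c (n, (a, b)).
  by have := WJ_coef hf' hc n a b; rewrite mulr0 !addr0.
have it (m : nat) n a b : zext c (n - m%:Z * a, (a, b)) = zext c (n, (a, b)).
  elim: m n => [|m IH] n; first by rewrite mul0r subr0.
  by rewrite -[RHS]IH -[RHS]rel; congr (zext c (_, _)); rewrite -addn1 PoszD; ring.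
move=> n a b a0; have [ap|an] := ltP 0 a.
  by rewrite -(it `|n|.+1) zext_neg //; nia.
have -> : n = (n + `|n|.+1%:Z * a) - `|n|.+1%:Z * a by ring.
by rewrite it zext_neg //; nia.
Qed.

Lemma WJ0_indep k r f t z w : WJ k 0 0 r f -> f t z w = f t 0 w.
Proof.
move=> hf; have [c hc] := WJ_FS hf; have [_ ->] := hc t z w I; have [_ ->] := hc t 0 w I.
apply: eq_csum => -[n [a b]]; rewrite /fam.
have [->|a0] := eqVneq a 0; first by rewrite /qmon /= !mul0r.
by have := WJ0_coef hf hc n b a0; rewrite /zext /= => ->; rewrite !mul0r.
Qed.

Lemma isFS0 c f t z w : isFS c f -> (forall m, c m = 0) -> f t z w = 0.
Proof.
move=> hc c0; have [_ ->] := hc t z w I; rewrite -[RHS](csum0 R fexp).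
by apply: eq_csum => m; rewrite /fam c0 mul0r.
Qed.

(** Translation in z gives c(n, a, b) = c(n - m a, a, b - m), hence 0 for nonzero a; translation in
    w moves a = 0 to a = 1. *)
Lemma WJ_012_eq0 k f t z w : WJ k 0 1 2 f -> f t z w = 0.
Proof.
move=> hf; have [c hc] := WJ_FS hf; apply: (isFS0 t z w hc) => -[n0 [a0 b0]].
have hf' : WJ k (2 * 0) 1 2 f by rewrite mulr0.
have rel n a b : zext c (n - a, (a, b)) = zext c (n, (a, b + 1)).
  by have := WJ_coef hf' hc n a b; rewrite mulr0 !addr0.
have hs : WJ k (2 * 1) 1 0 (fun t z w => f t w z) by rewrite mulr1; exact: WJ_swap.
have rel' n a b : zext c (n - b, (a, b)) = zext c (n + 1, (a + 1, b + 2)).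
  have := WJ_coef hs (isFS_swap hc) n b a; rewrite mulr1 /zext /=.
  by case: (n - b) => ?; case: (n + 1).
have it (m : nat) n a b : zext c (n - m%:Z * a, (a, b - m%:Z)) = zext c (n, (a, b)).
  elim: m n b => [|m IH] n b; first by rewrite mul0r !subr0.
  rewrite -[RHS]IH; have := rel (n - m%:Z * a) a (b - m.+1%:Z).
  have -> : b - m.+1%:Z + 1 = b - m%:Z by lia.
  by move=> <-; congr (zext c (_, _)); rewrite -addn1 PoszD; ring.
have nz n a b : a != 0 -> zext c (n, (a, b)) = 0.
  move=> a1; have [ap|an] := ltP 0 a.
    by rewrite -(it `|n|.+1) zext_neg //; nia.
  have -> : n = (n + `|n|.+1%:Z * a) - `|n|.+1%:Z * a by ring.
  have -> : b = (b + `|n|.+1%:Z) - `|n|.+1%:Z by ring.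
  by rewrite it zext_neg //; nia.
rewrite -[c _]/(zext c (Posz n0, (a0, b0))).
have [->|a1] := eqVneq a0 0; last exact: nz.
have -> : Posz n0 = (Posz n0 + b0) - b0 by ring.
by rewrite rel' nz.
Qed.

Lemma sign_odd (k : int) : (-1) ^ (2 * k + 1) = -1 :> C.
Proof. by rewrite expfzDr ?oppr_eq0 ?oner_eq0 // sign2z mul1r expr1z. Qed.

Lemma opp_eq_self (x : C) : x = - x -> x = 0.
Proof.
move=> e; apply/eqP; have : x *+ 2 = 0 by rewrite mulr2n {1}e addNr.
by move/eqP; rewrite mulrn_eq0.
Qed.

(** Coefficients are odd in a, and translation ties a to a + 2. Those with a = 0 vanish by oddness,
    those with a = 1 because they equal the ones with a = -1 at the same n, and the others follow in
    steps of 2. *)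
Lemma WJ_odd1_eq0 k f t z w : WJ (2 * k + 1) 2 0 0 f -> f t z w = 0.
Proof.
move=> hf; have [c hc] := WJ_FS hf; apply: (isFS0 t z w hc) => -[n0 [a0 b0]].
have hf' : WJ (2 * k + 1) (2 * 1) 0 0 f by rewrite mulr1.
have rel n a b : zext c (n - a, (a, b)) = zext c (n + 1, (a + 2, b)).
  by have := WJ_coef hf' hc n a b; rewrite mulr1 !addr0.
have cN : (fun m => c (m.1, (- m.2.1, - m.2.2))) = (fun m => -1 * c m).
  apply: isFS_unique (isFS_neg hc) _; apply: isFSon_ext (isFSonZ (-1) hc) => t' z' w' _.
  by rewrite (WJ_neg _ _ _ hf) sign_odd.
have neg n a b : zext c (n, (- a, - b)) = - zext c (n, (a, b)).
  case: n => n; rewrite /zext /= ?oppr0 //.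
  by have := congr1 (fun F => F (n, (a, b))) cN; rewrite /= mulN1r.
have pos (m : nat) n : zext c (n, (Posz m, 0)) = 0 /\ zext c (n, (Posz m.+1, 0)) = 0.
  elim: m n => [|m IH] n.
    split; apply: opp_eq_self; first by rewrite -neg !oppr0.
    rewrite -neg oppr0; have := rel (n - 1) (-1) 0.
    by rewrite opprK subrK => ->.
  split; first exact: (IH n).2.
  have := rel (n - 1) (Posz m) 0; rewrite subrK.
  have -> : Posz m + 2 = Posz m.+2 by lia.
  by move=> <-; exact: (IH _).1.
have := WJ0_coef (WJ_swap hf) (isFS_swap hc) (Posz n0) a0; rewrite /zext /= => bz.
have [b1|b1] := eqVneq b0 0; last exact: bz.
rewrite b1 -[c _]/(zext c (Posz n0, (a0, 0))); case: a0 {bz} => m; first exact: (pos m _).1.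
by rewrite NegzE -{1}oppr0 neg (pos m _).2 oppr0.
Qed.

Lemma Dz_even f t w : FS f -> (forall z, f t (- z) w = f t z w) -> Dz f t w = 0.
Proof.
move=> /(Dz_jet t w)[p [jp _ p1]] ev.
have rel h : f t (-1 * h) w = f t h w by rewrite mulN1r.
have := jet_unique (jet_ext rel (jet_scale (-1) jp)) jp (ltnSn 1).
by rewrite coef_scale expr1 mulN1r p1 => /esym/opp_eq_self.
Qed.

End Vanishing.

(** * One-variable forms, their lifts, and [psi] *)

Section OneVariable.
Variable R : realType.
Local Notation C := R[i].
Local Notation tpi := ((2 * pi : R)%:C * 'i%C).
Local Notation X1 := (@X1 R).
Implicit Types (f g : jform R) (k p s r : int).

Definition Y1 : jform R := fun t z _ => Phi_0 R t 0 z.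
Definition X2 : jform R := fun t _ w => Phi_m2 R t 0 w.
Definition Y2 : jform R := fun t _ w => Phi_0 R t 0 w.
Definition X3 : jform R := fun t z w => Phi_m2 R t 0 (z + w).
Definition Y3 : jform R := fun t z w => Phi_0 R t 0 (z + w).

Lemma WJ_Y1 : WJ 0 2 0 0 Y1.
Proof.
apply: WJ_cast (WJ_pull 0 0 1 0 (WJ_Phi_0 R)) _ _ _ _ _; try lia.
by move=> t z w; rewrite /Y1 !mul0r addr0 mul1r addr0.
Qed.

Lemma WJ_X2 : WJ (- 2) 0 0 2 X2. Proof. exact: WJ_swap (WJ_X1 R). Qed.
Lemma WJ_Y2 : WJ 0 0 0 2 Y2. Proof. exact: WJ_swap WJ_Y1. Qed.

Lemma WJ_X3 : WJ (- 2) 2 2 2 X3.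
Proof.
apply: WJ_cast (WJ_pull 0 0 1 1 (WJ_Phi_m2 R)) _ _ _ _ _; try lia.
by move=> t z w; rewrite /X3 !mul0r addr0 !mul1r.
Qed.

Lemma WJ_Y3 : WJ 0 2 2 2 Y3.
Proof.
apply: WJ_cast (WJ_pull 0 0 1 1 (WJ_Phi_0 R)) _ _ _ _ _; try lia.
by move=> t z w; rewrite /Y3 !mul0r addr0 !mul1r.
Qed.

Lemma y0_neq0 : 12 * tpi != 0 :> C.
Proof. by rewrite mulf_neq0 ?tpi_neq0 // pnatr_eq0. Qed.

Lemma X1_0 t w : X1 t 0 w = 0.
Proof. by rewrite X1E theta0 ?(valP t) // expr0n mulr0 mul0r. Qed.

(** Powers of Y1 scaled to take the value 1 at z = 0; they interpolate a prescribed value without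
    changing the weight. *)
Definition YN (n : nat) : jform R := fun t z w => ((12 * tpi)^-1 * Y1 t z w) ^+ n.

Lemma WJ_YN n : WJ 0 (2 * n%:Z) 0 0 (YN n).
Proof.
by apply: WJ_cast (WJ_exp n (WJ_scale (12 * tpi)^-1 WJ_Y1)) _ _ _ _ _ => //; lia.
Qed.

Lemma YN0 n t w : YN n t 0 w = 1.
Proof. by rewrite /YN /Y1 Phi_0_00 mulVf ?y0_neq0 // expr1n. Qed.

Lemma WJ1_indep k p f t z w : WJ k p 0 0 f -> f t z w = f t z 0.
Proof. by move=> /WJ_swap hf; exact: (WJ0_indep t w z hf). Qed.

Lemma WJ1_even k p f t z w : WJ (2 * k) p 0 0 f -> f t (- z) w = f t z w.
Proof.
move=> hf; rewrite (WJ1_indep t z w hf) (WJ1_indep t (- z) w hf).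
by rewrite -{1}[0 : C]oppr0 (WJ_neg _ _ _ hf) sign2z mul1r.
Qed.

Lemma WJ_at0 k p s r f : WJ k p s r f -> WJ k 0 0 0 (fun t _ _ => f t 0 0).
Proof.
move=> hf; apply: WJ_cast (WJ_pull 0 0 0 0 hf) _ _ _ _ _; try lia.
by move=> t z w; rewrite !mul0r addr0.
Qed.

(** In even weight a form in z alone is even in z, so matching the value at 0 already produces a
    double zero. *)
Lemma even_decomp k (m : nat) f : WJ (2 * k) (2 * m.+1%:Z) 0 0 f ->
  exists a g, [/\ WJ (2 * k) 0 0 0 a, WJ (2 * k + 2) (2 * m%:Z) 0 0 g &
    forall t z w, f t z w = a t z w * YN m.+1 t z w + X1 t z w * g t z w].
Proof.
move=> hf; have ha := WJ_at0 hf; have hY := WJ_mul ha (WJ_YN m.+1).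
have h1 : WJ (2 * k) (2 * m.+1%:Z) 0 0 (fun t z w => f t z w - f t 0 0 * YN m.+1 t z w).
  by apply: WJ_sub hf _; apply: WJ_cast hY _ _ _ _ _ => //; lia.
have [||g hg e] := WJ_div h1.
- by move=> t w; rewrite YN0 mulr1 (WJ1_indep t 0 w hf) subrr.
- by move=> t w; apply: Dz_even (WJ_FS h1) _ => z; exact: (WJ1_even t z w h1).
exists (fun t _ _ => f t 0 0), g; split=> //.
  by apply: WJ_cast hg _ _ _ _ _ => //; lia.
by move=> t z w; rewrite -e addrC subrK.
Qed.

(* The Gram matrix of the conclusion is that of al z^2 + ga w^2 + be (z + w)^2. *)
Lemma lift_form (al ga be : nat) k f : WJ (2 * k) (2 * (ga%:Z + be%:Z)) 0 0 f ->
  exists2 F, WJ (2 * k) (2 * (al%:Z + be%:Z)) (2 * be%:Z) (2 * (ga%:Z + be%:Z)) F &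
    forall t w, F t 0 w = f t w 0.
Proof.
have [m] : exists m, m = (ga + be)%N by eexists.
elim: m k ga be f => [|m IH] k ga be f em hf.
  have [g0 b0] : ga = 0%N /\ be = 0%N by lia.
  rewrite g0 b0 in hf *; have hf0 : WJ (2 * k) 0 0 0 f by apply: WJ_cast hf _ _ _ _ _ => //; lia.
  exists (fun t z w => f t 0 0 * YN al t z w).
    by apply: WJ_cast (WJ_mul (WJ_at0 hf) (WJ_YN al)) _ _ _ _ _ => //; lia.
  by move=> t w; rewrite YN0 mulr1 -(WJ0_indep t w 0 hf0).
have hf1 : WJ (2 * k) (2 * m.+1%:Z) 0 0 f by apply: WJ_cast hf _ _ _ _ _ => //; lia.
have [a [g [ha hg e]]] := even_decomp hf1.
pose n2 := WJ_exp ga (WJ_scale (12 * tpi)^-1 WJ_Y2).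
pose n3 := WJ_exp be (WJ_scale (12 * tpi)^-1 WJ_Y3).
have hA := WJ_mul (WJ_mul ha (WJ_YN al)) (WJ_mul n2 n3).
have a0 t w : a t 0 w = a t w 0 by rewrite (WJ1_indep t 0 w ha) -(WJ0_indep t w 0 ha).
have val0 t w : a t 0 w * YN al t 0 w * (((12 * tpi)^-1 * Y2 t 0 w) ^+ ga * ((12 * tpi)^-1 * Y3 t 0 w) ^+ be) =
    a t w 0 * YN m.+1 t w 0.
  by rewrite YN0 mulr1 a0 /Y3 add0r /Y2 -exprD -em.
have hg1 : WJ (2 * (k + 1)) (2 * m%:Z) 0 0 g by apply: WJ_cast hg _ _ _ _ _ => //; lia.
(* The induction spends a factor X2 as long as the index contains w^2, and X3 otherwise; both
   restrict to x(w) at z = 0. *)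
case: ga em hf hA val0 n2 => [|ga] em hf hA val0 n2.
  case: be em hf n3 hA val0 => [|be] em hf n3 hA val0; first by lia.
  have [||G hG eG] := IH (k + 1) 0%N be g; first by lia.
    by apply: WJ_cast hg1 _ _ _ _ _ => //; lia.
  exists (fun t z w => a t z w * YN al t z w * (((12 * tpi)^-1 * Y2 t z w) ^+ 0 * ((12 * tpi)^-1 * Y3 t z w) ^+ be.+1)
     + X3 t z w * G t z w).
    apply: WJ_add; first by apply: WJ_cast hA _ _ _ _ _ => //; lia.
    by apply: WJ_cast (WJ_mul WJ_X3 hG) _ _ _ _ _ => //; lia.
  by move=> t w; rewrite val0 e eG /X3 add0r.
have [||G hG eG] := IH (k + 1) ga be g; first by lia.
  by apply: WJ_cast hg1 _ _ _ _ _ => //; lia.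
exists (fun t z w => a t z w * YN al t z w * (((12 * tpi)^-1 * Y2 t z w) ^+ ga.+1 * ((12 * tpi)^-1 * Y3 t z w) ^+ be)
   + X2 t z w * G t z w).
  apply: WJ_add; first by apply: WJ_cast hA _ _ _ _ _ => //; lia.
  by apply: WJ_cast (WJ_mul WJ_X2 hG) _ _ _ _ _ => //; lia.
by move=> t w; rewrite val0 e eG.
Qed.

(** The combination of Phi_{-2} and Phi_0 that vanishes at z = 0. Its derivative there, [psi], has
    weight -1 and is a multiple of theta(2z) / eta^3. *)
Definition B2 : jform R := fun t z w => Y2 t z w * Phi_m2 R t z w - X2 t z w * Phi_0 R t z w.
Definition psi : jform R := fun t z _ => Dz B2 t z.

Lemma WJ_B2 : WJ (- 2) 2 1 4 B2.
Proof.
apply: WJ_sub.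
  by apply: WJ_cast (WJ_mul WJ_Y2 (WJ_Phi_m2 R)) _ _ _ _ _ => //; lia.
by apply: WJ_cast (WJ_mul WJ_X2 (WJ_Phi_0 R)) _ _ _ _ _ => //; lia.
Qed.

Lemma B2_0 t w : B2 t 0 w = 0.
Proof. by rewrite /B2 /Y2 /X2 mulrC subrr. Qed.

Lemma WJ_psi : WJ (- 1) 4 0 0 psi.
Proof. by apply: WJ_cast (WJ_swap (WJ_Dz WJ_B2 B2_0)) _ _ _ _ _ => //; lia. Qed.

Lemma Dtheta1_jet (t z : C) : 0 < complex.Im t -> exists p : {poly C}, jet 2 (fun h => Dtheta t 1 (z + h)) p /\ p`_1 = Dtheta t 2 z.
Proof.
move=> t0.
have A : asum (fun n => theta_term t z n * (tpi * half R n) * (expR (1 * cabs (tpi * half R n)))%:C).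
  apply: asum_le (asum_theta_exp t0 z (ler0n R 2)) => n.
  rewrite -mulrA 2!(cabsM (theta_term t z n)) ler_wpM2l ?cabs_ge0 // (cabsM (tpi * half R n)) !cabsR.
  move: (cabs (tpi * half R n)) (cabs_ge0 (tpi * half R n)) => y y0.
  rewrite !ger0_norm ?expR_ge0 // mul1r; have -> : 2 * y = y + y by ring.
  rewrite expRD ler_wpM2r ?expR_ge0 //.
  by have := pow_le_exp 1 y0; rewrite expr1 mul1r.
have j := expsum_jet 2 ltr01 A; eexists; split.
  apply: jet_ext j => h; apply: eq_csum => n; rewrite theta_term_shift expr1.
  by move: (theta_term _ _ _) (cexp _) => *; ring.
rewrite (taylor1 (fun k : nat => csum (fun n => theta_term t z n * (tpi * half R n) * (tpi * half R n) ^+ k))).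
by apply: eq_csum => n; rewrite expr1 -mulrA.
Qed.

Lemma Dz_Phi_m2 t w : Dz (Phi_m2 R) t w =
  Dtheta (val t) 1 0 * theta (val t) w * Dtheta (val t) 1 w / eta (val t) ^+ 9.
Proof.
have t0 := valP t.
have [p0 [j0 e0]] := Dtheta1_jet 0 t0; have [pw [jw ew]] := Dtheta1_jet w t0.
have k0 := theta_jet t0 2 0; have kw := theta_jet t0 2 w.
have jc (c : C) : jet 2 (fun=> c) c%:P.
  by apply: jet_ext (jet_horner 2 c%:P) => h; rewrite hornerC.
have J1 := jetM (jetM j0 (jc (theta (val t) w))) kw.
have J2 := jetM (jetM k0 (jc (Dtheta (val t) 1 w))) kw.
have J3 := jetM (jetM k0 (jc (theta (val t) w))) jw.
have J := jetZ (eta (val t) ^+ 9)^-1 (jetD (jetD J1 J2) (jetZ (-1) J3)).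
have rel h : (eta (val t) ^+ 9)^-1 *
  (Dtheta (val t) 1 (0 + h) * theta (val t) w * theta (val t) (w + h) +
   theta (val t) (0 + h) * Dtheta (val t) 1 w * theta (val t) (w + h) +
   -1 * (theta (val t) (0 + h) * theta (val t) w * Dtheta (val t) 1 (w + h))) = Phi_m2 R t h w.
  rewrite Phi_m2_Gd Gd1E // add0r [h + w]addrC.
  by move: (theta _ _) (theta _ _) (theta _ _) (Dtheta _ _ _) (Dtheta _ _ _) (Dtheta _ _ _) (eta _ ^+ 9)^-1 => *; ring.
have v0 := jet_value j0; have vw := jet_value jw; rewrite !addr0 in v0 vw.
have c1 (c : C) : c%:P`_1 = 0 by rewrite coefC.
have c0 (c : C) : c%:P`_0 = c by rewrite coefC.
rewrite (Dz_jet_eq (jet_ext rel J)) !(coefCM, coefD, coefM1, coef0M, c0, c1) e0 v0 vw.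
rewrite (taylor0 (fun k : nat => Dtheta (val t) k 0)) (taylor1 (fun k : nat => Dtheta (val t) k 0)).
rewrite (taylor0 (fun k : nat => Dtheta (val t) k w)) (taylor1 (fun k : nat => Dtheta (val t) k w)).
rewrite !Dtheta0 // theta0 // Dtheta_even0 //.
by move: (theta _ _) (Dtheta _ _ _) (Dtheta _ _ _) (eta _ ^+ 9)^-1 => *; ring.
Qed.

Lemma DzM_even f g t w : FS f -> FS g -> Dz f t w = 0 ->
  Dz (fun t z w => f t z w * g t z w) t w = f t 0 w * Dz g t w.
Proof. by move=> hf hg f0; rewrite DzM // f0 mul0r addr0. Qed.

(** X1 vanishes to second order, so only the term with Y1 contributes, and it gives Y1(0)
    theta'(0)^3 / eta^9. As this is a nonzero constant, [psi] can match any z-derivative at 0. *)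
Lemma Dz_psi t w : Dz psi t w = 12 * tpi * tpi ^+ 3.
Proof.
have FP := WJ_FS (WJ_Phi_m2 R); have FQ := WJ_FS (WJ_Phi_0 R).
have FX2 := WJ_FS WJ_X2; have FY2 := WJ_FS WJ_Y2.
have swF f : FS f -> FS (fun t z w => f t w z) by move=> [c hc]; eexists; exact: isFS_swap hc.
have FDP := swF _ (FS_Dz FP); have FDQ := swF _ (FS_Dz FQ).
have FX1 := WJ_FS (WJ_X1 R); have FY1 := WJ_FS WJ_Y1.
have DY2 u v : Dz Y2 u v = 0 by apply: (Dz_even FY2).
have DX2 u v : Dz X2 u v = 0 by apply: (Dz_even FX2).
have e u v : Dz B2 u v = Y1 u v 0 * Dz (Phi_m2 R) u v + -1 * (X1 u v 0 * Dz (Phi_0 R) u v).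
  have h1 := DzM_even FY2 FP (DY2 u v); have h2 := DzM_even FX2 FQ (DX2 u v).
  have h3 := DzD u v (FSM FY2 FP) (FSZ (-1) (FSM FX2 FQ)).
  have h4 := DzZ (-1) u v (FSM FX2 FQ); rewrite h1 h4 h2 in h3.
  rewrite -[RHS]h3; congr (Dz _ u v).
  by apply/funext => ?; apply/funext => ?; apply/funext => ?; rewrite mulN1r.
pose DP : jform R := fun t z _ => Dz (Phi_m2 R) t z.
pose DQ : jform R := fun t z _ => Dz (Phi_0 R) t z.
have -> : psi = (fun t z w => Y1 t z w * DP t z w + -1 * (X1 t z w * DQ t z w)).
  by apply/funext => ?; apply/funext => ?; apply/funext => ?; exact: e.
have h3 := DzD t w (FSM FY1 FDP) (FSZ (-1) (FSM FX1 FDQ)).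
have DX1 : Dz X1 t w = 0.
  by apply: (Dz_even FX1) => z; apply: (@WJ1_even (-1) 2); exact: WJ_X1.
have DY1 : Dz Y1 t w = 0.
  by apply: (Dz_even FY1) => z; apply: (@WJ1_even 0 2); exact: WJ_Y1.
have h1 := DzM_even FY1 FDP DY1; have h2 := DzM_even FX1 FDQ DX1.
have h4 := DzZ (-1) t w (FSM FX1 FDQ).
rewrite [LHS]h3 [X in X + _]h1 [X in _ + X]h4 [X in _ + _ * X]h2 X1_0 mul0r mulr0 addr0.
rewrite [Y1 t 0 w]Phi_0_00; congr (_ * _).
have t0 := valP t; have k0 := theta_jet t0 2 0; have [p0 [j0 e0]] := Dtheta1_jet 0 t0.
have J := jetZ (Dtheta (val t) 1 0 / eta (val t) ^+ 9) (jetM k0 j0).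
have rel h : Dtheta (val t) 1 0 / eta (val t) ^+ 9 * (theta (val t) (0 + h) * Dtheta (val t) 1 (0 + h)) = Dz (Phi_m2 R) t h.
  by rewrite Dz_Phi_m2 !add0r; move: (theta _ _) (Dtheta _ _ _) (Dtheta _ _ _) (eta _ ^+ 9)^-1 => *; ring.
have v0 := jet_value j0; rewrite addr0 in v0.
rewrite [LHS](@Dz_jet_eq R (fun t z _ => Dz (Phi_m2 R) t z) t w _ (jet_ext rel J)) coefCM coefM1 v0.
rewrite (taylor0 (fun k : nat => Dtheta (val t) k 0)) (taylor1 (fun k : nat => Dtheta (val t) k 0)) Dtheta0 // theta0 //.
rewrite mul0r add0r eta9E; have e1 := Dtheta1_neq0 t0; have tn := tpi_neq0 R.
by set T := tpi in tn *; clearbody T; field; apply/andP.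
Qed.

End OneVariable.

(** * Spanning in a fixed weight and index *)

Section Spanning.
Variable R : realType.
Local Notation C := R[i].
Local Notation tpi := ((2 * pi : R)%:C * 'i%C).
Local Notation X1 := (@X1 R).
Local Notation Y1 := (@Y1 R).
Local Notation psi := (@psi R).
Local Notation YN := (@YN R).
Local Notation Y2 := (@Y2 R).
Local Notation X2 := (@X2 R).
Local Notation B2 := (@B2 R).
Implicit Types (f g : jform R) (k p s r : int).

Lemma WJ1_odd_0 k p f t w : WJ (2 * k + 1) p 0 0 f -> f t 0 w = 0.
Proof.
move=> hf; rewrite (WJ1_indep t 0 w hf); apply: opp_eq_self.
by have := WJ_neg t 0 0 hf; rewrite !oppr0 sign_odd mulN1r.
Qed.

Lemma Dz_kill (f u y b : jform R) (x : C) t w : x != 0 -> FS f -> FS u -> FS y -> FS b ->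
  u t 0 w = 0 -> Dz u t w = x -> y t 0 w = 1 -> b t 0 w = Dz f t w ->
  Dz (fun t z w => f t z w + -1 * ((x^-1 * b t z w) * (u t z w * y t z w))) t w = 0.
Proof.
move=> x0 Ff Fu Fy Fb u0 ux y1 bE.
have F1 := FSM Fu Fy; have F2 := FSZ x^-1 Fb; have F3 := FSM F2 F1.
rewrite (DzD t w Ff (FSZ (-1) F3)) (DzZ (-1) t w F3) (DzM t w F2 F1) (DzM t w Fu Fy).
by rewrite u0 ux y1 bE !mul0r add0r mulr0 addr0 mulr1 mulrAC mulVf // mul1r mulN1r subrr.
Qed.

(** An odd form vanishes at 0. Subtracting a multiple of [psi] times a power of Y1 removes its
    derivative, and division by X1 then lowers the index by one and keeps the weight odd. The
    descent ends at the indices 0 and 1, where odd forms vanish. *)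
Lemma odd_decomp (m : nat) k f : WJ (2 * k + 1) (2 * m%:Z) 0 0 f ->
  ((m <= 1)%N -> forall t z w, f t z w = 0) /\
  (forall m', m = m'.+2 -> exists2 h, WJ (2 * k + 2) (2 * m'%:Z) 0 0 h &
     forall t z w, f t z w = psi t z w * h t z w).
Proof.
elim: m k f => [|m IH] k f hf.
  split=> // _ t z w; have hf0 : WJ (2 * k + 1) 0 0 0 f by apply: WJ_cast hf _ _ _ _ _.
  by rewrite (WJ0_indep t z w hf0); exact: (WJ1_odd_0 t w hf).
split=> [m1 t z w|m' [em]].
  have m0 : m = 0%N by case: (m) m1.
  by rewrite m0 mulr1 in hf; exact: (WJ_odd1_eq0 t z w hf).
have f0 t w : f t 0 w = 0 by exact: (WJ1_odd_0 t w hf).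
have hb : WJ (2 * k + 2) 0 0 0 (fun t _ w => Dz f t w).
  by apply: WJ_cast (WJ_Dz hf f0) _ _ _ _ _ => //; lia.
pose x : C := 12 * tpi * tpi ^+ 3.
have x0 : x != 0.
  by rewrite /x; apply: mulf_neq0; [exact: y0_neq0|apply: expf_neq0; exact: tpi_neq0].
have hpsi : WJ (2 * (- 1) + 1) 4 0 0 psi by apply: WJ_cast (WJ_psi R) _ _ _ _ _.
have hT := WJ_mul (WJ_scale x^-1 hb) (WJ_mul (WJ_psi R) (@WJ_YN R m')).
have h1 : WJ (2 * k + 1) (2 * m'.+2%:Z) 0 0 (fun t z w => f t z w +
    -1 * ((x^-1 * Dz f t w) * (psi t z w * YN m' t z w))).
  apply: WJ_add; first by rewrite em in hf.
  by apply: WJ_scale; apply: WJ_cast hT _ _ _ _ _ => //; lia.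
have [||g hg eg] := WJ_div h1.
- by move=> t w; rewrite f0 (WJ1_odd_0 t w hpsi) mul0r !mulr0 addr0.
- move=> t w; apply: (Dz_kill (u := psi) (y := YN m') (b := fun t _ w => Dz f t w) x0).
  + exact: WJ_FS hf.
  + exact: WJ_FS hpsi.
  + exact: WJ_FS (@WJ_YN R m').
  + exact: WJ_FS hb.
  + exact: (WJ1_odd_0 t w hpsi).
  + exact: Dz_psi.
  + exact: YN0.
  + by [].
have hg1 : WJ (2 * (k + 1) + 1) (2 * m%:Z) 0 0 g.
  by apply: WJ_cast hg _ _ _ _ _ => //; lia.
have [IH0 IH2] := IH _ _ hg1.
have hbY := WJ_mul (WJ_scale x^-1 hb) (@WJ_YN R m').
have fE t z w : f t z w = (x^-1 * Dz f t w) * (psi t z w * YN m' t z w) + X1 t z w * g t z w.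
  by rewrite -eg; move: (psi _ _ _) (Dz _ _ _) (YN _ _ _ _) => *; ring.
case: m' em h1 {hT eg} hg hbY fE => [|m'] em h1 hg hbY fE.
  exists (fun t z w => x^-1 * Dz f t w * YN 0 t z w).
    by apply: WJ_cast hbY _ _ _ _ _ => //; lia.
  move=> t z w; rewrite [LHS]fE IH0 ?em // mulr0 addr0.
  by move: (psi _ _ _) (Dz _ _ _) (YN _ _ _ _) => *; ring.
have [h hh eh] := IH2 m' em.
exists (fun t z w => x^-1 * Dz f t w * YN m'.+1 t z w + X1 t z w * h t z w).
  apply: WJ_add; first by apply: WJ_cast hbY _ _ _ _ _ => //; lia.
  by apply: WJ_cast (WJ_mul (WJ_X1 R) hh) _ _ _ _ _ => //; lia.
move=> t z w; rewrite [LHS]fE eh.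
by move: (psi _ _ _) (Dz _ _ _) (YN _ _ _ _) (X1 _ _ _) (h _ _ _) => *; ring.
Qed.

(** The index of [A] and [B] is al z^2 + ga w^2 + be (z + w)^2; that of [f] will exceed it by the A2
    form. *)
Definition spanned (al ga be : nat) k f := exists A B,
  [/\ WJ (2 * k + 2) (2 * (al%:Z + be%:Z)) (2 * be%:Z) (2 * (ga%:Z + be%:Z)) A,
      WJ (2 * k) (2 * (al%:Z + be%:Z)) (2 * be%:Z) (2 * (ga%:Z + be%:Z)) B &
      forall t z w, f t z w = A t z w * Phi_m2 R t z w + B t z w * Phi_0 R t z w].

Definition all_spanned (al ga be : nat) := forall k f,
  WJ (2 * k) (2 * (al%:Z + be%:Z + 1)) (2 * be%:Z + 1) (2 * (ga%:Z + be%:Z + 1)) f ->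
  spanned al ga be k f.

Lemma all_spanned_swap al ga be : all_spanned ga al be -> all_spanned al ga be.
Proof.
move=> H k f hf; have [A [B [hA hB e]]] := H k _ (WJ_swap hf).
exists (fun t z w => A t w z), (fun t z w => B t w z); split; try exact: WJ_swap.
by move=> t z w; rewrite e Phi_m2_swap Phi_0_swap.
Qed.

Lemma WJ_reflect k p s r f : WJ k p s r f ->
  WJ k p (p - s) (p - 2 * s + r) (fun t z w => f t (- z - w) w).
Proof.
move=> hf; apply: WJ_cast (WJ_pull (-1) (-1) 0 1 hf) _ _ _ _ _; try ring.
by move=> t z w; congr (f t _ _); ring.
Qed.

(** The substitution z -> - z - w exchanges z^2 with (z + w)^2 and fixes w^2 and the A2 form. *)
Lemma all_spanned_reflect al ga be : all_spanned be ga al -> all_spanned al ga be.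
Proof.
move=> H k f hf; have [|A [B [hA hB e]]] := H k (fun t z w => f t (- z - w) w).
  by apply: WJ_cast (WJ_reflect hf) _ _ _ _ _ => //; lia.
exists (fun t z w => A t (- z - w) w), (fun t z w => B t (- z - w) w); split.
- by apply: WJ_cast (WJ_reflect hA) _ _ _ _ _ => //; lia.
- by apply: WJ_cast (WJ_reflect hB) _ _ _ _ _ => //; lia.
move=> t z w; have := e t (- z - w) w; rewrite Phi_m2_reflect Phi_0_reflect.
by have -> : - (- z - w) - w = z by ring.
Qed.

Lemma Dz_diff (f a b : jform R) t w : FS f -> FS a -> FS b -> b t 0 w = 0 ->
  Dz f t w = a t 0 w * Dz b t w -> Dz (fun t z w => f t z w - a t z w * b t z w) t w = 0.
Proof.
move=> Ff Fa Fb b0 e; have F1 := FSM Fa Fb.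
have -> : (fun t z w => f t z w - a t z w * b t z w) = (fun t z w => f t z w + -1 * (a t z w * b t z w)).
  by apply/funext => ?; apply/funext => ?; apply/funext => ?; rewrite mulN1r.
by rewrite (DzD t w Ff (FSZ (-1) F1)) (DzZ (-1) t w F1) (DzM t w Fa Fb) b0 e mulr0 addr0 mulN1r subrr.
Qed.

(* Matching f and then its z-derivative along z = 0 leaves a multiple of X1. *)
Lemma span_step (al ga be : nat) k f : (be <= ga)%N ->
  WJ (2 * k) (2 * (al%:Z + be%:Z + 1)) (2 * be%:Z + 1) (2 * (ga%:Z + be%:Z + 1)) f ->
  exists f', spanned al ga be k f' /\ exists2 g,
   WJ (2 * k + 2) (2 * (al%:Z + be%:Z)) (2 * be%:Z + 1) (2 * (ga%:Z + be%:Z + 1)) g &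
   forall t z w, f t z w = f' t z w + X1 t z w * g t z w.
Proof.
move=> bg hf.
have hF : WJ (2 * k) (2 * (ga + be).+1%:Z) 0 0 (fun t z _ => f t 0 z).
  apply: WJ_cast (WJ_pull 0 0 1 0 hf) _ _ _ _ _; try lia.
  by move=> t z w; rewrite !mul0r addr0 mul1r addr0.
have [a [g0 [ha hg0 eF]]] := even_decomp hF.
(* One factor of the normalised power of Y1 is split off, since it is the restriction of Phi_0; what
   remains is lifted to the coefficient [B1]. *)
have hb : WJ (2 * k) (2 * (ga%:Z + be%:Z)) 0 0 (fun t z w => (12 * tpi)^-1 * (a t z w * YN (ga + be) t z w)).
  by apply: WJ_scale; apply: WJ_cast (WJ_mul ha (@WJ_YN R (ga + be))) _ _ _ _ _ => //; lia.
have hg1 : WJ (2 * (k + 1)) (2 * (ga%:Z + be%:Z)) 0 0 g0.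
  by apply: WJ_cast hg0 _ _ _ _ _ => //; lia.
have [A1 hA1 eA1] := lift_form al hg1; have [B1 hB1 eB1] := lift_form al hb.
have hP := WJ_Phi_m2 R; have hQ := WJ_Phi_0 R.
pose f1 : jform R := fun t z w => f t z w + -1 * (A1 t z w * Phi_m2 R t z w + B1 t z w * Phi_0 R t z w).
have hAP : WJ (2 * k) (2 * (al%:Z + be%:Z + 1)) (2 * be%:Z + 1) (2 * (ga%:Z + be%:Z + 1)) (fun t z w => A1 t z w * Phi_m2 R t z w).
  by apply: WJ_cast (WJ_mul hA1 hP) _ _ _ _ _ => //; lia.
have hBQ : WJ (2 * k) (2 * (al%:Z + be%:Z + 1)) (2 * be%:Z + 1) (2 * (ga%:Z + be%:Z + 1)) (fun t z w => B1 t z w * Phi_0 R t z w).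
  by apply: WJ_cast (WJ_mul hB1 hQ) _ _ _ _ _ => //; lia.
have hf1 : WJ (2 * k) (2 * (al%:Z + be%:Z + 1)) (2 * be%:Z + 1) (2 * (ga%:Z + be%:Z + 1)) f1.
  by apply: WJ_add hf _; apply: WJ_scale; exact: WJ_add.
have f10 t w : f1 t 0 w = 0.
  rewrite /f1 eA1 eB1; have := eF t w 0; rewrite /YN exprS => ->.
  rewrite -[X1 t w 0]/(Phi_m2 R t 0 w) -[Y1 t w 0]/(Phi_0 R t 0 w).
  by move: (Phi_m2 _ _ _ _) (Phi_0 _ _ _ _) (_ ^+ (ga + be)) (a _ _ _) (g0 _ _ _) => *; ring.
have hA1' : WJ (2 * k + 2) (2 * (al%:Z + be%:Z)) (2 * be%:Z) (2 * (ga%:Z + be%:Z)) A1.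
  by apply: WJ_cast hA1 _ _ _ _ _ => //; lia.
have hD : WJ (2 * k + 1) (2 * (ga + be).+1%:Z) 0 0 (fun t z _ => Dz f1 t z).
  by apply: WJ_cast (WJ_swap (WJ_Dz hf1 f10)) _ _ _ _ _ => //; lia.
have [D0 D2] := odd_decomp hD.
(* If ga = 0, then be = 0, and the derivative at z = 0 is an odd form of index 1, hence 0: there is
   no correction by [psi] in this case. *)
case: ga bg hf hF hg0 hb hg1 hA1 hB1 eA1 eB1 hAP hBQ hf1 hA1' hD D0 D2 eF => [|ga] bg hf hF hg0 hb hg1 hA1 hB1 eA1 eB1 hAP hBQ hf1 hA1' hD D0 D2 eF.
  have be0 : be = 0%N by lia.
  exists (fun t z w => A1 t z w * Phi_m2 R t z w + B1 t z w * Phi_0 R t z w); split.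
    by exists A1, B1.
  have [||g hg eg] := WJ_div hf1; first exact: f10.
    by move=> t w; apply: (D0 _ t w 0); rewrite be0.
  exists g; first by apply: WJ_cast hg _ _ _ _ _ => //; lia.
  by move=> t z w; rewrite -eg /f1; ring.
have [h hh eh] := D2 (ga + be)%N erefl.
have hh1 : WJ (2 * (k + 1)) (2 * (ga%:Z + be%:Z)) 0 0 h.
  by apply: WJ_cast hh _ _ _ _ _ => //; lia.
have [H hH eH] := lift_form al hh1.
have hHY : WJ (2 * k + 2) (2 * (al%:Z + be%:Z)) (2 * be%:Z) (2 * (ga.+1%:Z + be%:Z)) (fun t z w => H t z w * Y2 t z w).
  by apply: WJ_cast (WJ_mul hH (WJ_Y2 R)) _ _ _ _ _ => //; lia.
have hHX : WJ (2 * k) (2 * (al%:Z + be%:Z)) (2 * be%:Z) (2 * (ga.+1%:Z + be%:Z)) (fun t z w => H t z w * X2 t z w).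
  by apply: WJ_cast (WJ_mul hH (WJ_X2 R)) _ _ _ _ _ => //; lia.
have hHB : WJ (2 * k) (2 * (al%:Z + be%:Z + 1)) (2 * be%:Z + 1) (2 * (ga.+1%:Z + be%:Z + 1)) (fun t z w => H t z w * B2 t z w).
  by apply: WJ_cast (WJ_mul hH (WJ_B2 R)) _ _ _ _ _ => //; lia.
have hf2 := WJ_sub hf1 hHB.
have [||g hg eg] := WJ_div hf2.
- by move=> t w; rewrite f10 B2_0 mulr0 subrr.
- move=> t w; apply: (Dz_diff (WJ_FS hf1) (WJ_FS hH) (WJ_FS (WJ_B2 R)) (@B2_0 R t w)).
  have := eh t w 0; rewrite /psi => ->; rewrite eH.
  by rewrite mulrC.
exists (fun t z w => (A1 t z w + H t z w * Y2 t z w) * Phi_m2 R t z w + (B1 t z w - H t z w * X2 t z w) * Phi_0 R t z w); split.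
  exists (fun t z w => A1 t z w + H t z w * Y2 t z w), (fun t z w => B1 t z w - H t z w * X2 t z w); split=> //.
    exact: WJ_add.
  exact: WJ_sub.
exists g; first by apply: WJ_cast hg _ _ _ _ _ => //; lia.
move=> t z w; rewrite -eg /f1 /B2.
by move: (Y2 _ _ _) (X2 _ _ _) (Phi_m2 _ _ _ _) (Phi_0 _ _ _ _) (f _ _ _) => *; ring.
Qed.

(* The symmetric group of {z, w, - z - w} permutes al, ga and be and fixes both
   Phi's, so that one may assume be <= ga <= al. *)
Lemma spanned_all al ga be : all_spanned al ga be.
Proof.
have [n] : exists n, (al + ga + be)%N = n by eexists.
elim: n al ga be => [|n IH] al ga be en.
  have [a0 [g0 b0]] : al = 0%N /\ ga = 0%N /\ be = 0%N by lia.
  rewrite a0 g0 b0 => k f hf; have [f' [[A [B [hA hB e']]] [g hg eg]]] := span_step (leqnn 0) hf.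
  exists A, B; split=> // t z w; rewrite eg e' (@WJ_012_eq0 R (2 * k + 2) g t z w) ?mulr0 ?addr0 //.
have S (a g b : nat) : (b <= g)%N -> (g <= a)%N -> (a + g + b)%N = n.+1 -> all_spanned a g b.
  move=> bg le_ga sn k f hf; have [f' [[A [B [hA hB e']]] [h hh eh]]] := span_step bg hf.
  case: a le_ga sn hf hA hB hh => [|a] le_ga sn hf hA hB hh; first by lia.
  have [||A' [B' [hA' hB' e'']]] := IH a g b _ (k + 1) h; first by lia.
    by apply: WJ_cast hh _ _ _ _ _ => //; lia.
  have hX := WJ_X1 R.
  exists (fun t z w => A t z w + X1 t z w * A' t z w), (fun t z w => B t z w + X1 t z w * B' t z w); split.
  - by apply: WJ_add hA _; apply: WJ_cast (WJ_mul hX hA') _ _ _ _ _ => //; lia.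
  - by apply: WJ_add hB _; apply: WJ_cast (WJ_mul hX hB') _ _ _ _ _ => //; lia.
  move=> t z w; rewrite eh e' e''.
  by move: (X1 _ _ _) (Phi_m2 _ _ _ _) (Phi_0 _ _ _ _) => *; ring.
(* Two of the eight patterns are cyclic and contradictory; in the others swaps and reflections sort
   the triple. *)
have [h1|h1] := leqP ga al; have [h2|h2] := leqP be ga; have [h3|h3] := leqP be al.
- by apply: S.
- by lia.
- by apply/all_spanned_swap/all_spanned_reflect/all_spanned_swap/S; lia.
- by apply/all_spanned_swap/all_spanned_reflect/S; lia.
- by apply/all_spanned_swap/S; lia.
- by apply/all_spanned_reflect/all_spanned_swap/S; lia.
- by lia.
- by apply/all_spanned_reflect/S; lia.
Qed.

End Spanning.

(** * Graded sums and the module structure *)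

Section Graded.
Variable R : realType.
Local Notation C := R[i].
Implicit Types (f g : jform R) (F G : gform R) (D : set degree) (d e : degree).

Definition even_deg : set degree := [set d | exists (k : int) (a b c : nat),
  (b <= minn a c)%N /\ d = (2 * k, gram (2 * a%:Z) (2 * b%:Z) (2 * c%:Z))].

Definition odd_deg : set degree := [set d | exists (k : int) (a b c : nat),
  (b < minn a c)%N /\ d = (2 * k, gram (2 * a%:Z) (2 * b%:Z + 1) (2 * c%:Z))].

Lemma gramD p s r p' s' r' : gram p s r + gram p' s' r' = gram (p + p') (s + s') (r + r').
Proof. by apply/matrixP => i j; rewrite !mxE; case: ifP => // _; case: ifP. Qed.

Lemma gramB p s r p' s' r' : gram p s r - gram p' s' r' = gram (p - p') (s - s') (r - r').
Proof. by apply/matrixP => i j; rewrite !mxE; case: ifP => // _; case: ifP. Qed.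

Lemma odd_deg_sub d (x : int) : odd_deg d -> even_deg (d - (2 * x, gramA2)).
Proof.
move=> [k [a [b [c [bac ->]]]]].
exists (k - x), a.-1, b, c.-1; split; first by lia.
congr (_, _); first by rewrite /=; lia.
by rewrite /= /gramA2 gramB; congr gram; lia.
Qed.

Lemma even_deg_add d (x : int) : even_deg d -> odd_deg (d + (2 * x, gramA2)).
Proof.
move=> [k [a [b [c [bac ->]]]]].
exists (k + x), a.+1, b, c.+1; split; first by lia.
congr (_, _); first by rewrite /=; lia.
by rewrite /= /gramA2 gramD; congr gram; lia.
Qed.

(** The condition b < min(a, c) makes the truncated subtractions in al = a - 1 - b and ga = c - 1 -
    b exact. *)
Lemma odd_split d f : odd_deg d -> weak_jacobi_form d.1 d.2 f ->
  exists A B, [/\ weak_jacobi_form (d - (- 2, gramA2)).1 (d - (- 2, gramA2)).2 A,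
    weak_jacobi_form (d - (0, gramA2)).1 (d - (0, gramA2)).2 B &
    f = A * Phi_m2 R + B * Phi_0 R].
Proof.
move=> [k [a [b [c [bac ->]]]]] /= /WJP hf.
pose al := (a.-1 - b)%N; pose ga := (c.-1 - b)%N.
have [|A [B [hA hB e]]] := @spanned_all R al ga b k f.
  by apply: WJ_cast hf _ _ _ _ _ => //; rewrite /al /ga; lia.
exists A, B; split.
- rewrite /gramA2 gramB; apply/WJP; apply: WJ_cast hA _ _ _ _ _ => //; rewrite /al /ga; lia.
- rewrite /gramA2 gramB; apply/WJP; apply: WJ_cast hB _ _ _ _ _ => //; rewrite /al /ga; lia.
- by apply/funext => t; apply/funext => z; apply/funext => w; exact: e.
Qed.

Lemma even_mul d k f g : even_deg d -> weak_jacobi_form d.1 d.2 f -> WJ k 2 1 2 g ->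
  weak_jacobi_form (d + (k, gramA2)).1 (d + (k, gramA2)).2 (f * g).
Proof.
move=> [l [a [b [c [bac ->]]]]] /= /WJP hf hg; rewrite /gramA2 gramD; apply/WJP.
exact: (WJ_mul hf hg).
Qed.

(** The convolution has a single term, so multiplication by a generator is a shift of degrees. *)
Lemma gmul_homog F d f e : gmul F (homog d f) e = F (e - d) * f.
Proof.
rewrite /gmul (@fsbigTE _ _ _ _ [fset (e - d)]%fset) => [|i].
  by rewrite big_seq_fset1 /homog subKr eqxx.
rewrite inE => ie; rewrite /homog; case: eqP => [E|_]; last by rewrite mulr0.
by case/eqP: ie; rewrite -E subKr.
Qed.

Lemma weak_jacobi_form0 k p s r : weak_jacobi_form k (gram p s r) (0 : jform R).
Proof.
apply/WJP; split; last exact: (FS1 (0 : C)).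
- by move=> *; rewrite [RHS]mulr0.
- by move=> *; rewrite [RHS]mulr0.
Qed.

(** Sums and the zero form are handled through [WJP], which speaks of matrices written with
    [gram]. *)
Definition gram_degrees D := forall d, D d -> exists p s r, d.2 = gram p s r.

Lemma graded_sum0 D : gram_degrees D -> graded_sum D (0 : gform R).
Proof.
move=> hD; split=> [|d /hD[p [s [r ->]]]|d _]; last by [].
  by rewrite (_ : [set d | _] = set0); [exact: finite_set0|apply/seteqP; split=> d //= []].
exact: weak_jacobi_form0.
Qed.

Lemma graded_sumD D F G : gram_degrees D -> graded_sum D F -> graded_sum D G ->
  graded_sum D (F + G).
Proof.
move=> hD [fF wF zF] [fG wG zG]; split.
- have fU : finite_set ([set d | F d <> 0] `|` [set d | G d <> 0]) by rewrite finite_setU.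
  apply: sub_finite_set fU => d /= h; have [h1|h1] := pselect (F d <> 0); first by left.
  right=> h2; apply: h; have -> : (F + G) d = F d + G d by [].
  by rewrite (contrapT h1) h2 addr0.
- move=> d Dd; have [p [s [r e]]] := hD d Dd; have := wF d Dd; have := wG d Dd.
  rewrite e => /WJP hG /WJP hF; apply/WJP; exact: (WJ_add hF hG).
- by move=> d nD; have -> : (F + G) d = F d + G d by []; rewrite zF // zG // addr0.
Qed.

Lemma finite_shift F d : finite_set [set e | F e <> 0] -> finite_set [set e | F (e - d) <> 0].
Proof.
move=> fF; have := finite_image (fun e => e + d) fF.
by apply: sub_finite_set => e /= he; exists (e - d) => //; rewrite subrK.
Qed.

Lemma graded_sum_gmul F (x : int) g : graded_sum even_deg F -> WJ (2 * x) 2 1 2 g ->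
  graded_sum odd_deg (gmul F (homog (2 * x, gramA2) g)).
Proof.
move=> [fF wF zF] hg; split.
- apply: sub_finite_set (finite_shift (2 * x, gramA2) fF) => e /=; rewrite gmul_homog => h E.
  by apply: h; rewrite E mul0r.
- move=> e oe; rewrite gmul_homog; have ev := odd_deg_sub x oe.
  by have := even_mul ev (wF _ ev) hg; rewrite subrK.
- move=> e ne; rewrite gmul_homog zF ?mul0r // => ev; apply: ne.
  by have := even_deg_add x ev; rewrite subrK.
Qed.

Lemma odd_gram : gram_degrees odd_deg.
Proof. by move=> d [k [a [b [c [_ ->]]]]]; do 3!eexists. Qed.

Lemma even_gram : gram_degrees even_deg.
Proof. by move=> d [k [a [b [c [_ ->]]]]]; do 3!eexists. Qed.

(** The coefficient is set to 0 where [F] vanishes: there the chosen [A] is arbitrary and could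
    spoil the finite support. *)
Lemma graded_sum_coef F (x : int) (A : degree -> jform R) : graded_sum odd_deg F ->
  (forall d, F d <> 0 -> weak_jacobi_form (d - (2 * x, gramA2)).1 (d - (2 * x, gramA2)).2 (A d)) ->
  graded_sum even_deg (fun e => if pselect (F (e + (2 * x, gramA2)) <> 0) then A (e + (2 * x, gramA2)) else 0).
Proof.
move=> [fF wF zF] hA; have oF d : F d <> 0 -> odd_deg d.
  by move=> h; apply: contrapT => /zF.
split.
- have := finite_shift (- (2 * x, gramA2)) fF; apply: sub_finite_set => e /=.
  by rewrite opprK; case: pselect.
- move=> e ev; case: pselect => h.
    by have := hA _ h; rewrite addrK.
  by have [p [s [r ->]]] := even_gram ev; exact: weak_jacobi_form0.
- move=> e ne; case: pselect => // h; case: ne.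
  by have := odd_deg_sub x (oF _ h); rewrite addrK.
Qed.

End Graded.

Theorem theorem5p2 (R : realType) :
  Jodd R =
    gspan (J0 R)
      [set homog (- 2, gramA2) (Phi_m2 R); homog (0, gramA2) (Phi_0 R)].
Proof.
apply/seteqP; split=> [F hF|F [n [a [s [ha hs ->]]]]]; last first.
  apply: (big_ind (graded_sum odd_deg)) => [|G H|i _].
  - exact: graded_sum0 odd_gram.
  - exact: graded_sumD odd_gram.
  - have [->|->] := hs i.
      exact: (graded_sum_gmul (x := -1) (ha i) (WJ_Phi_m2 R)).
    exact: (graded_sum_gmul (x := 0) (ha i) (WJ_Phi_0 R)).
have [fF wF zF] := hF.
(* Stated for every degree so that [choice] applies; outside the support of [F] any pair will do. *)
have ex d : exists AB : jform R * jform R, F d <> 0 ->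
    [/\ weak_jacobi_form (d - (2 * -1, gramA2)).1 (d - (2 * -1, gramA2)).2 AB.1,
        weak_jacobi_form (d - (2 * 0, gramA2)).1 (d - (2 * 0, gramA2)).2 AB.2 &
        F d = AB.1 * Phi_m2 R + AB.2 * Phi_0 R].
  have [h|h] := pselect (F d <> 0); last by exists (0, 0).
  have od : odd_deg d by apply: contrapT => /zF.
  by have [A [B [hA hB e]]] := odd_split od (wF d od); exists (A, B).
have [AB hAB] := choice ex.
have hA d : F d <> 0 -> weak_jacobi_form (d - (2 * -1, gramA2)).1 (d - (2 * -1, gramA2)).2 (AB d).1.
  by move=> /hAB[].
have hB d : F d <> 0 -> weak_jacobi_form (d - (2 * 0, gramA2)).1 (d - (2 * 0, gramA2)).2 (AB d).2.
  by move=> /hAB[].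
(* The part of degree e is read off from [F] in degree e + (-2, A2), to which multiplication by
   Phi_{-2} returns; [a2] does the same for Phi_0. *)
pose a1 : gform R := fun e => if pselect (F (e + (2 * -1, gramA2)) <> 0) then (AB (e + (2 * -1, gramA2))).1 else 0.
pose a2 : gform R := fun e => if pselect (F (e + (2 * 0, gramA2)) <> 0) then (AB (e + (2 * 0, gramA2))).2 else 0.
exists 2%N, (fun i => if i == 0 then a1 else a2),
  (fun i => if i == 0 then homog (- 2, gramA2) (Phi_m2 R) else homog (0, gramA2) (Phi_0 R)); split.
- move=> i; case: ifP => _.
    exact: (graded_sum_coef (x := -1) hF hA).
  exact: (graded_sum_coef (x := 0) hF hB).
- by move=> i; case: ifP => _; [left|right].
rewrite !big_ord_recl big_ord0 addr0 /=; apply/funext => e.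
have -> : (gmul a1 (homog (- 2, gramA2) (Phi_m2 R)) + gmul a2 (homog (0, gramA2) (Phi_0 R))) e =
  a1 (e - (- 2, gramA2)) * Phi_m2 R + a2 (e - (0, gramA2)) * Phi_0 R.
  by rewrite -!gmul_homog.
rewrite /a1 /a2 !subrK; case: pselect => [h|h]; first by have [_ _] := hAB _ h.
by rewrite !mul0r addr0 (contrapT h).
Qed.
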